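(* Let $\kappa\in\{-1,0,1\}$ and fix $A>0$ (with $A\le 2\pi$ if $\kappa=1$). Consider all $\mathcal{C}=\mathcal{C}_1\sqcup\dots\sqcup\mathcal{C}_m$, with $m\ge 1$ an arbitrary integer, that are disjoint unions of $m$ piecewise smooth simple closed curves $\mathcal{C}_i$ in $M^2_\kappa$ (the components of $\mathcal{C}$), where $\mathcal{C}_i$ encloses area $A_i>0$ and $\sum_{i=1}^m A_i=A$. Among all such $\mathcal{C}$ there exists a unique (up to isometry of $M^2_\kappa$) minimizer of the perimeter, and it is a single circle in $M^2_\kappa$ of radius $AS_\kappa\!\left(\frac{\sqrt{A(4\pi-\kappa A)}}{2\pi}\right)$.
   Context: $M^2_\kappa$ denotes the complete simply connected surface of constant curvature $\kappa$: the Euclidean plane for $\kappa=0$, the unit sphere $S^2\subset\mathbb{R}^3$ for $\kappa=1$, the hyperbolic plane for $\kappa=-1$; $d_\kappa$ is its Riemannian distance. A circle in $M^2_\kappa$ of radius $r>0$ ($r<\pi$ if $\kappa=1$) is a set $\{x\in M^2_\kappa : d_\kappa(p,x)=r\}$ with $p\in M^2_\kappa$. The perimeter of $\mathcal{C}$ is its total arc-length, i.e. the sum of the arc-lengths of its components. For $\kappa\ne 1$ the area enclosed by a simple closed curve is the area of the unique relatively compact component of its complement; for $\kappa=1$, a simple closed curve encloses area $B$ if one of the two components of its complement has area $B$. The function $AS_\kappa$ is $AS_0(t)=t$, $AS_1(t)=\arcsin t$, $AS_{-1}(t)=\sinh^{-1}t$. *)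

(* Defs.v *)
From HB Require Import structures.
From mathcomp Require Import all_boot all_order all_algebra.
From mathcomp Require Import all_classical all_reals all_analysis.
From mathcomp Require Import ring lra.

Set Implicit Arguments.
Unset Strict Implicit.
Unset Printing Implicit Defensive.

Import Order.TTheory GRing.Theory Num.Theory.
Import numFieldNormedType.Exports.

Local Open Scope classical_set_scope.
Local Open Scope ring_scope.

(* A point ((x, y), z) of R^3. *)
Notation point R := ((R * R) * R)%type.

(* The surface M^2_k for k = -1, 0, 1, embedded in R^3 and carrying the
   Riemannian metric induced by dx^2 + dy^2 + k dz^2:
   - k = 1: the unit sphere of Euclidean R^3 (see [surface1E]);
   - k = 0: the plane z = 1 with dx^2 + dy^2 (see [surface0E]);
   - k = -1: the hyperboloid model of the hyperbolic plane, that is, the upper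
     sheet of z^2 = 1 + x^2 + y^2 in Minkowski space (see [surfaceN1E]). *)
Definition surface (R : realType) (k : R) : set (point R) :=
  [set p | p.2 ^+ 2 + k * (p.1.1 ^+ 2 + p.1.2 ^+ 2) = 1 /\
           (k <> 1 -> 0 < p.2)].

Lemma surface1E (R : realType) :
  surface (1 : R) = [set p | p.1.1 ^+ 2 + p.1.2 ^+ 2 + p.2 ^+ 2 = 1].
Proof.
rewrite /surface; apply/seteqP; split=> p /=; first by case=> p1 _; lra.
by move=> p1; split=> //; lra.
Qed.

Lemma surface0E (R : realType) : surface (0 : R) = [set p | p.2 = 1].
Proof.
rewrite /surface; apply/seteqP; split=> p /=; last first.
  by move=> ->; split=> [|_]; [ring | exact: ltr01].
case=> p1 p0; have {}p0 : 0 < p.2.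
  by apply: p0 => h; have := @ltr01 R; rewrite -h ltxx.
by nra.
Qed.

Lemma surfaceN1E (R : realType) :
  surface (- 1 : R) =
  [set p | p.2 ^+ 2 = 1 + p.1.1 ^+ 2 + p.1.2 ^+ 2 /\ 0 < p.2].
Proof.
rewrite /surface; apply/seteqP; split=> p /= -[p1 p0]; split=> //; [lra | | lra].
by apply: p0 => h; have := @ltr01 R; lra.
Qed.

Definition smooth (R : realType) (f : R -> R) : Prop :=
  forall (n : nat) (t : R), derivable (derive1n n f) t 1.

(* [g] is the restriction to [[u, v]] of a smooth map R -> R^3, which is what
   smoothness up to the end points amounts to. *)
Definition smooth_on (R : realType) (u v : R) (g : R -> point R) : Prop :=
  exists h : R -> point R,
    [/\ smooth (fun t => (h t).1.1), smooth (fun t => (h t).1.2),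
        smooth (fun t => (h t).2) & {in `[u, v], g =1 h}].

(* Piecewise smooth maps [0, 1] -> M^2_k; consecutive pieces share the value of
   [g] at the break point, so that continuity on [0, 1] is automatic. The
   values of [g] outside [0, 1] are irrelevant. *)
Definition piecewise_smooth (R : realType) (k : R) (g : R -> point R) : Prop :=
  (forall t, t \in `[0, 1] -> surface k (g t)) /\
  exists2 s : seq R, itv_partition 0 1 s &
    forall i, (i < size s)%N -> smooth_on (nth 1 (0 :: s) i) (nth 1 s i) g.

Definition speed (R : realType) (k : R) (g : R -> point R) (t : R) : R :=
  Num.sqrt (derive1 (fun u => (g u).1.1) t ^+ 2 +
            derive1 (fun u => (g u).1.2) t ^+ 2 +
            k * derive1 (fun u => (g u).2) t ^+ 2).

(* The finitely many break points of a piecewise smooth curve, where the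
   derivative may be meaningless, do not contribute to the integral. *)
Definition arc_length (R : realType) (k : R) (g : R -> point R) : \bar R :=
  (\int[lebesgue_measure]_(t in `[0%R, 1%R]) (speed k g t)%:E)%E.

Definition dist (R : realType) (k : R) (p q : point R) : \bar R :=
  ereal_inf [set arc_length k g | g in
    [set g | [/\ piecewise_smooth k g, g 0 = p & g 1 = q]]].

Definition is_isometry (R : realType) (k : R) (f : point R -> point R) : Prop :=
  set_bij (surface k) (surface k) f /\
  forall p q, surface k p -> surface k q -> dist k (f p) (f q) = dist k p q.

Definition congruent (R : realType) (k : R) (C D : set (point R)) : Prop :=
  exists2 f, is_isometry k f & f @` C = D.

Definition is_circle (R : realType) (k r : R) (C : set (point R)) : Prop :=
  [/\ 0 < r, k = 1 -> r < pi &
      exists2 p, surface k p &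
        C = [set x | surface k x /\ dist k p x = r%:E]].

(* Riemannian area of a subset of M^2_k in the coordinates (x, y): above (x, y)
   lie the points z = h and z = - h with h = sqrt (1 - k (x^2 + y^2)), and the
   area element of dx^2 + dy^2 + k dz^2 is dx dy / h there. For k <> 1 no point
   of the surface has z = - h; for k = 1 the omitted equator has area zero. *)
Definition area (R : realType) (k : R) (E : set (point R)) : \bar R :=
  (\int[lebesgue_measure \x lebesgue_measure]_(q in
      [set q : R * R | (k * (q.1 ^+ 2 + q.2 ^+ 2) < 1)%R])
    (let h := Num.sqrt (1 - k * (q.1 ^+ 2 + q.2 ^+ 2)) in
     ((\1_E (q, h) + \1_E (q, - h)) / h)%R)%:E)%E.

Definition simple_closed_curve (R : realType) (k : R) (g : R -> point R) :
    Prop :=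
  [/\ piecewise_smooth k g, g 0 = g 1 & {in `[0, 1[ &, injective g}].

Definition trace (R : realType) (g : R -> point R) : set (point R) :=
  g @` `[0, 1].

(* Some component of the complement, relatively compact if k <> 1, has area B;
   for k <> 1 and a Jordan curve C there is exactly one such component. *)
Definition encloses (R : realType) (k : R) (C : set (point R)) (B : R) : Prop :=
  exists2 p, (surface k `\` C) p &
    let D := connected_component (surface k `\` C) p in
    (k <> 1 -> precompact D) /\ area k D = B%:E.

(* A disjoint union of piecewise smooth simple closed curves, given by
   parametrizations of its components. *)
Record multicurve (R : realType) (k : R) := Multicurve {
  ncomp : nat;
  ncomp_gt0 : (0 < ncomp)%N;
  component : 'I_ncomp -> R -> point R;
  componentP : forall i, simple_closed_curve k (component i);
  component_disjoint : forall i j, i != j ->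
    trace (component i) `&` trace (component j) = set0 }.

Arguments component {R k} m i.

Definition carrier (R : realType) (k : R) (C : multicurve k) : set (point R) :=
  \bigcup_(i in [set: 'I_(ncomp C)]) trace (component C i).

Definition perimeter (R : realType) (k : R) (C : multicurve k) : \bar R :=
  (\sum_(i < ncomp C) arc_length k (component C i))%E.

Definition encloses_total (R : realType) (k A : R) (C : multicurve k) : Prop :=
  exists a : 'I_(ncomp C) -> R,
    (forall i, 0 < a i /\ encloses k (trace (component C i)) (a i)) /\
    \sum_(i < ncomp C) a i = A.

Definition is_minimizer (R : realType) (k A : R) (C : multicurve k) : Prop :=
  encloses_total A C /\
  forall D : multicurve k, encloses_total A D ->
    (perimeter C <= perimeter D)%E.

Definition sinh (R : realType) (t : R) : R := (expR t - expR (- t)) / 2.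

Definition asinh (R : realType) (t : R) : R := ln (t + Num.sqrt (t ^+ 2 + 1)).

Lemma asinhK (R : realType) : cancel (@asinh R) (@sinh R).
Proof.
move=> t; rewrite /sinh /asinh; set s := Num.sqrt _.
have s2 : s ^+ 2 = t ^+ 2 + 1 by rewrite sqr_sqrtr// addr_ge0// sqr_ge0.
have st : `|t| < s.
  by rewrite -sqrtr_sqr ltr_sqrt ?ltrDl// ltr_wpDl// sqr_ge0.
have ts0 : 0 < t + s by move: st; rewrite ltr_norml => /andP[]; lra.
rewrite expRN lnK//.
suff -> : (t + s)^-1 = s - t by field.
apply: (mulfI (lt0r_neq0 ts0)); rewrite mulfV ?lt0r_neq0//.
by rewrite [RHS](_ : _ = s ^+ 2 - t ^+ 2); [rewrite s2; ring | ring].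
Qed.

Definition AS (R : realType) (k t : R) : R :=
  if k == 1 then asin t else if k == 0 then t else asinh t.

(* Main.v *)
(* For distinct points x, y of the surface let n = x - y, N = <n, n> be taken in
   the ambient quadratic form dx^2 + dy^2 + k dz^2. The reflection in n exchanges
   x and y, so the kernel <v, u> - 2 <v, n> <u, n> / N is at most |v| |u| for v, u
   tangent at x, y. Replace N by N + d and integrate the kernel over pairs of
   points of a curve of length L bounding a region of area B: the divergence
   theorem, used in both variables, gives an integral over pairs of points of the
   region which tends to B (4 pi - k B) as d -> 0. Hence
   B (4 pi - k B) <= L^2. In case of equality the kernel has modulus |v| |u| for
   all pairs, which puts the curve on a plane section, that is, on a circle.
   The divergence theorem is only used for sums over samples of the curve, and of
   the region it only needs that its indicator is constant along segments avoiding
   the curve; no Jordan curve theorem enters. As B |-> sqrt (B (4 pi - k B)) is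
   strictly subadditive, a single component is best. *)
Require Import Defs.
From HB Require Import structures.
From mathcomp Require Import all_boot all_order all_algebra.
From mathcomp Require Import all_classical all_reals all_analysis.
From mathcomp Require Import measurable_realfun.
From mathcomp Require Import ring lra zify.

Set Implicit Arguments.
Unset Strict Implicit.
Unset Printing Implicit Defensive.

Import Order.TTheory GRing.Theory Num.Theory.
Import numFieldNormedType.Exports.

Local Open Scope classical_set_scope.
Local Open Scope ring_scope.

(** * Integration along slices of the plane *)

(** The obstacle is sharpness. The kernel bound is an equality on circles, so the divergence
    inequality may lose nothing in the limit, although the region is known only through segments
    that miss the curve. Slicing along lines of one slope gives the exact flux of a constant field.
    An arbitrary field is therefore frozen on the small cells of a partition of unity, and each cell
    is sliced in the direction of its frozen field. The price is an absolute value inside the sums,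
    which is harmless because the kernel is bounded in modulus. The number 4 pi is a mass on the
    diagonal: away from it, the curl taken in both variables is k times the two area densities, and
    [d] spreads the mass over a scale sqrt d; a lower bound for it is enough. On the sphere a region
    and its complement are interchangeable, as B (4 pi - B) is symmetric; a reflection first takes
    the curve off the centre of the stereographic projection. The radius of an extremal circle is
    pinned down by two inequalities between lengths of curves with the same trace, not by inverting
    an area formula. *)

Notation lam := (@lebesgue_measure _) (only parsing).
Notation lam2 := (lam \x lam)%E (only parsing).
Notation curvature k := (k \in [:: -1; 0; 1]) (only parsing).

Section plane_measure.
Context {R : realType}.
Notation TR := (measurableTypeR R).
Implicit Types (r : R) (E : set (TR * TR)) (f g : TR * TR -> R).

(** The product sigma-algebra is generated by rectangles, so an open set has to be written as a
    countable union: the squares with rational centre and rational radius form a countable base. *)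
Lemma open_measurable2 (U : set (TR * TR)) : open (U : set (R * R)) -> measurable U.
Proof.
move=> oU.
pose box (q : rat * rat * rat) : set (TR * TR) :=
  ball (ratr q.1.1 : R) (ratr q.2 : R) `*` ball (ratr q.1.2 : R) (ratr q.2 : R).
have mbox q : measurable (box q).
  by apply: measurableX; apply: open_measurable; exact: ball_open.
have -> : U = \bigcup_(q in [set q | box q `<=` U]) box q.
  apply/seteqP; split=> [[x y] Uxy|z [q /= qU]]; last exact: qU.
  have /nbhs_ballP[e /= e0 eU] : nbhs (x, y) U by exact: open_nbhs_nbhs.
  have [q q1 q2] : exists2 q : rat, (0 < ratr q :> R) & (ratr q < e / 2).
    by have [|q /itvP qe] := @rat_in_itvoo R 0 (e / 2); [rewrite divr_gt0|exists q; rewrite qe].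
  have ap (t : R) : exists p : rat, `|ratr p - t| < ratr q.
    have [|p /itvP pe] := @rat_in_itvoo R (t - ratr q) (t + ratr q); first lra.
    by exists p; rewrite ltr_distl !pe.
  have [a ax] := ap x; have [b bY] := ap y.
  exists (a, b, q) => /=; last by split; rewrite /ball /=.
  move=> [u v] /= [/=]; rewrite /ball/= => au bv; apply: eU; split; rewrite /ball /=.
    move: ax au; rewrite !ltr_distlC => /andP[? ?] /andP[? ?]; lra.
  move: bY bv; rewrite !ltr_distlC => /andP[? ?] /andP[? ?]; lra.
rewrite bigcup_mkcond; apply: (@countable_bigcupT_measurable _ _ _ _ ) => [|q]; first exact: countableP.
by case: ifP.
Qed.

Lemma continuous_measurable2 f : continuous (f : R * R -> R) -> measurable_fun setT f.
Proof.
move=> /continuousP cf; apply: (measurability _ (RGenOpens.measurableE R)).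
move=> _ [_ [a [b ->] <-]]; rewrite setTI; apply: open_measurable2.
exact/cf/interval_open.
Qed.

Definition square r : set (TR * TR) := [set z | `|z.1| <= r /\ `|z.2| <= r].

Lemma squareE r : square r = `[- r, r] `*` `[- r, r].
Proof.
by apply/seteqP; split=> -[x y]; rewrite /square /= !in_itv/= !ler_norml.
Qed.

Lemma measurable_square r : measurable (square r).
Proof. by rewrite squareE; apply: measurableX; exact: measurable_itv. Qed.

Lemma lam2_square r : (lam2 (square r) < +oo)%E.
Proof.
rewrite squareE product_measure1E//= !lebesgue_measure_itv/=.
by case: ifP => _; rewrite ?mule0 ?ltry// -EFinD -EFinM ltry.
Qed.

Lemma bounded_integrable2 r (C : R) E f : measurable E -> E `<=` square r ->
  measurable_fun E f -> (forall z, E z -> `|f z| <= C) ->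
  lam2.-integrable E (EFin \o f).
Proof.
move=> mE Er mf fC; apply: measurable_bounded_integrable => //.
  apply: le_lt_trans (lam2_square r); apply: le_measure; rewrite ?inE//.
  exact: measurable_square.
by exists C; split; [exact: num_real|move=> M CM z /= Ez; rewrite (le_trans (fC _ Ez))// ltW].
Qed.

Lemma bounded_integrable2T r (C : R) f : measurable_fun setT f ->
  (forall z, `|f z| <= C) -> (forall z, ~ square r z -> f z = 0) ->
  lam2.-integrable setT (EFin \o f).
Proof.
move=> mf fC f0.
have -> : EFin \o f = (EFin \o f) \_ (square r).
  apply/funext => z; rewrite /patch; case: ifPn => //; rewrite notin_setE => /f0 /= ->//.
apply/(integrable_mkcond _ _).1; first exact: measurable_square.
apply: (@bounded_integrable2 r C) => //; [exact: measurable_square|exact: measurable_funS mf].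
Qed.

Lemma pushforward_Rintegral2 (phi : TR * TR -> TR * TR) f :
  measurable_fun setT phi ->
  (forall A, measurable A -> lam2 (phi @^-1` A) = lam2 A) ->
  measurable_fun setT f -> lam2.-integrable setT (EFin \o (f \o phi)) ->
  \int[lam2]_z f z = \int[lam2]_z f (phi z).
Proof.
move=> mphi phiE mf intf; rewrite /Rintegral; congr fine.
have mf' : measurable_fun setT (EFin \o f) by exact/measurable_EFinP.
have H := integral_pushforward mphi mf' intf measurableT.
rewrite preimage_setT in H; apply: etrans H.
by apply: eq_measure_integral => A mA _; exact/esym/phiE.
Qed.

Lemma lebesgue_measureD (c : R) (A : set TR) : measurable A ->
  lam ((fun x : TR => (x + c : TR)) @^-1` A) = lam A.
Proof.
move=> mA; rewrite -[LHS]/(pushforward lam (fun x : TR => (x + c : TR)) A).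
have mc : measurable_fun setT (fun x : TR => (x + c : TR)) by exact: measurable_funD.
apply/esym; apply: (@lebesgue_measure_unique R (measure_function_pushforward__canonical__measure_function_Measure lam mc)) => //= _ [[a b]] _ <-.
rewrite /pushforward.
rewrite (_ : _ @^-1` _ = `](a - c)%R, (b - c)%R])%classic; last first.
  by apply/seteqP; split=> x /=; rewrite !in_itv/= ltrBlDr lerBrDr.
by rewrite !lebesgue_measure_itv/= !lte_fin ltrD2r -!EFinD; case: ifP => // _; congr _%:E; ring.
Qed.

(** Carries the horizontal line at height y to the line of slope [m] through (0, y). Vertical
    sections are merely translated, which is why area is preserved. *)
Definition shear (m : R) (z : TR * TR) : TR * TR := (z.1, z.2 + m * z.1).

Lemma measurable_shear m : measurable_fun setT (shear m).
Proof.
apply/measurable_fun_pairP; split => /=; first exact: measurable_fst.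
by apply: measurable_funD => //; apply: measurable_funM.
Qed.

Lemma lam2_shear m A : measurable A -> lam2 (shear m @^-1` A) = lam2 A.
Proof.
move=> mA; rewrite /product_measure1/=; apply: eq_integral => x _ /=.
rewrite -[in RHS](lebesgue_measureD (m * x)); last exact: measurable_xsection.
congr (lam _); apply/seteqP; split=> y; rewrite /xsection/= !inE//.
Qed.

Lemma bounded_integrable_itv (a b C : R) (g : TR -> R) :
  measurable_fun `[a, b] g -> (forall x, x \in `[a, b] -> `|g x| <= C) ->
  lam.-integrable `[a, b] (EFin \o g).
Proof.
move=> mg gC; apply: measurable_bounded_integrable => //.
  by rewrite [ltLHS](@lebesgue_measure_itv R `[a, b])/=; case: ifP => _; rewrite ?ltry// -EFinD ltry.
by exists C; split; [exact: num_real|move=> M CM z /= Ez; rewrite (le_trans (gC _ Ez))// ltW].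
Qed.

Lemma bounded_integrableT (a b C : R) (g : TR -> R) :
  measurable_fun setT g -> (forall x, `|g x| <= C) ->
  (forall x, x \notin `[a, b] -> g x = 0) ->
  lam.-integrable setT (EFin \o g).
Proof.
move=> mg gC g0.
have -> : EFin \o g = (EFin \o g) \_ `[a, b].
  apply/funext => z; rewrite /patch; case: ifPn => // zab /=; rewrite g0//.
  by apply: contra zab => zab; rewrite inE.
apply/(integrable_mkcond _ _).1; first exact: measurable_itv.
by apply: (@bounded_integrable_itv _ _ C) => [|x _]; [exact: measurable_funS mg|exact: gC].
Qed.

Lemma fubini_le r (C : R) (G : TR * TR -> R) (H : TR -> R) :
  measurable_fun setT G -> (forall z, `|G z| <= C) ->
  (forall z, ~ square r z -> G z = 0) ->
  lam.-integrable setT (EFin \o H) ->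
  (forall y, `| \int[lam]_x G (x, y)| <= H y) ->
  `| \int[lam2]_z G z | <= \int[lam]_y H y.
Proof.
move=> mG GC G0 iH GH.
have iG := bounded_integrable2T mG GC G0.
have iGy y : lam.-integrable setT (fun x => (G (x, y))%:E).
  apply: (@bounded_integrableT (- r) r C) => [|x|x xr]; [exact: measurable_fun_pair1|exact: GC|].
  by apply: G0 => -[/= + _]; rewrite ler_norml; apply/negP; move: xr; rewrite in_itv.
have GE y : (\int[lam]_x (G (x, y))%:E)%E = (\int[lam]_x G (x, y))%:E.
  rewrite /Rintegral fineK//; exact: integrable_fin_num.
rewrite {1}/Rintegral -integral21_prod_meas1//=.
have mGy : measurable_fun setT (fun y : TR => \int[lam]_x G (x, y)).
  apply/measurable_EFinP; rewrite (_ : _ \o _ = fubini_G lam (EFin \o G)).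
    exact: (measurable_fubini_G (m1 := lam) (m2 := lam) (f := EFin \o G)).
  by apply/funext => y; rewrite /fubini_G/= GE.
rewrite (_ : integral _ _ _ = (\int[lam]_y (\int[lam]_x G (x, y))%:E))%E; last first.
  by apply: eq_integral => y _; rewrite /fubini_G /= GE.
have iI : lam.-integrable setT (fun y => (\int[lam]_x G (x, y))%:E).
  apply: le_integrable iH => //; first exact/measurable_EFinP.
  by move=> y _; rewrite lee_fin (le_trans (GH y))// ler_norm.
rewrite -/(Rintegral lam setT (fun y => \int[lam]_x G (x, y))).
apply: (le_trans (le_normr_Rintegral _ iI)) => //.
apply: le_Rintegral => //.
exact: integrable_norm.
Qed.

End plane_measure.

(** * One line: integrating a derivative against a function with few jumps *)

Section slice.
Context {R : realType}.
Notation TR := (measurableTypeR R).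
Implicit Types (f df : R -> R) (chi : TR -> R) (s : seq R).

Lemma FTC_Rintegral f df (a b : R) : a <= b ->
  (forall x : R, is_derive x (1 : R) f (df x)) ->
  continuous df -> \int[lam]_(x in `[a, b]) df x = f b - f a.
Proof.
rewrite le_eqVlt => /predU1P[->|ab] fdf cdf.
  by rewrite set_itv1 Rintegral_set1 subrr.
have cf : continuous f.
  by move=> x; apply/differentiable_continuous/derivable1_diffP; have [] := fdf x.
rewrite /Rintegral (@continuous_FTC2 _ _ f)//.
- exact: continuous_subspaceT.
- split; first by move=> x _; have [] := fdf x.
  + exact/cvg_at_right_filter/cf.
  + exact/cvg_at_left_filter/cf.
- by move=> x _; rewrite derive1E; exact: derive_val.
Qed.

(* Cutting at a pivot interval of length [delta]: every other interval starts
   before or after it, hence meets only one of the two sides. Shifting the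
   indicator to the values [-1/2, 1/2] makes each jump cost [A l] once. *)
Lemma slice_bound (J : eqType) (lft A : J -> R) (s : seq J) f df chi (delta B a b : R) :
  a <= b -> 0 <= delta -> 0 <= B ->
  (forall x : R, is_derive x (1 : R) f (df x)) -> continuous df ->
  (forall x, `|df x| <= B) ->
  measurable_fun setT chi -> (forall x, `|chi x| <= 2^-1) ->
  (forall l x, l \in s -> lft l <= x <= lft l + delta -> `|f x| <= A l) ->
  (forall x y, a < x -> x <= y -> y < b ->
     (forall l t, l \in s -> lft l <= t <= lft l + delta -> x <= t <= y -> False) ->
     chi x = chi y) ->
  `|\int[lam]_(x in `[a, b]) (chi x * df x)| <=
    2^-1 * `|f a| + 2^-1 * `|f b| + \sum_(l <- s) (A l + B * delta).
Proof.
move=> ab d0 B0 fdf cdf dfB mchi chi2 fA.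
have mdf : measurable_fun setT (df : TR -> R) by exact: continuous_measurable_fun.
have mcf : measurable_fun setT (fun x : TR => chi x * df x) by exact: measurable_funM.
have cfB x : `|chi x * df x| <= 2^-1 * B by rewrite normrM ler_pM.
have icf u v : lam.-integrable `[u, v] (EFin \o (fun x : TR => chi x * df x)).
  by apply: (@bounded_integrable_itv _ u v (2^-1 * B)) => [|x _]; [exact: measurable_funS mcf|].
have split_itv u v w : u <= v -> v <= w -> \int[lam]_(x in `[u, w]) (chi x * df x) =
    \int[lam]_(x in `[u, v]) (chi x * df x) + \int[lam]_(x in `[v, w]) (chi x * df x).
  move=> uv vw.
  have := @Rintegral_itvB R (fun x : TR => chi x * df x) (BLeft u) (BRight w) v (icf u w).
  rewrite !bnd_simp uv vw => /(_ isT isT) /(canRL (subrK _)) ->.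
  rewrite addrC; congr (_ + _); rewrite Rintegral_itv_obnd_cbnd//.
  by apply: integrableS (icf v w) => //; apply: subset_itvr; rewrite bnd_simp.
have [n] := ubnP (size s); elim: n s a b ab fA => // n IHn s a b ab fA sn cst.
have A0 l : l \in s -> 0 <= A l.
  by move=> ls; rewrite (le_trans _ (fA l (lft l) ls _))// lexx lerDl.
have [s0|] := eqVneq s [::].
  rewrite s0 big_nil addr0.
  move: ab; rewrite le_eqVlt => /predU1P[->|ab].
    by rewrite set_itv1 Rintegral_set1 normr0 addr_ge0// mulr_ge0.
  pose m := (a + b) / 2.
  have mab : a < m < b by rewrite !midf_lt.
  have -> : \int[lam]_(x in `[a, b]) (chi x * df x) = chi m * (f b - f a).
    rewrite -(FTC_Rintegral (ltW ab) fdf cdf).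
    rewrite -RintegralZl//; last first.
      by apply: (@bounded_integrable_itv _ a b B) => [|x _]; [exact: measurable_funS mdf|].
    have icm : lam.-integrable `[a, b] (EFin \o (fun x : TR => chi m * df x)).
      apply: (@bounded_integrable_itv _ a b (2^-1 * B)) => [|x _]; last by rewrite normrM ler_pM.
      by apply: measurable_funS (measurable_funM (measurable_cst (chi m)) mdf).
    have oc : `]a, b] `<=` `[a, b]%classic by apply: subset_itvr; rewrite bnd_simp.
    have oo : `]a, b[ `<=` `[a, b]%classic by apply: subset_itv; rewrite bnd_simp.
    (* [cst] controls [chi] only strictly between [a] and [b]; the two end points are removed as a
       null set. *)
    rewrite -[LHS]Rintegral_itv_obnd_cbnd; last by apply: integrableS (icf a b).
    rewrite -[RHS]Rintegral_itv_obnd_cbnd; last by apply: integrableS icm.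
    rewrite -[LHS]Rintegral_itv_bndo_bndc; last by apply: integrableS (icf a b).
    rewrite -[RHS]Rintegral_itv_bndo_bndc; last by apply: integrableS icm.
    apply: eq_Rintegral => x; rewrite inE/= in_itv/= => /andP[ax xb]; congr (_ * _).
    case/andP: mab => am mb.
    by case: (leP x m) => [xm|/ltW mx]; [|apply/esym]; apply: cst => //; rewrite s0.
  rewrite normrM -mulrDr ler_pM//.
  by rewrite (le_trans (ler_normB _ _))// addrC.
case: s => // l s in sn fA cst A0 * => _.
have lls : l \in l :: s by rewrite mem_head.
have Al0 := A0 _ lls.
have fA' u (P : pred J) x : u \in [seq y <- s | P y] -> lft u <= x <= lft u + delta -> `|f x| <= A u.
  by rewrite mem_filter => /andP[_ us]; apply: fA; rewrite inE us orbT.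
have Bd0 : 0 <= B * delta by rewrite mulr_ge0.
have [out|] := boolP ((lft l + delta < a) || (b < lft l)).
  rewrite big_cons; apply: (@le_trans _ _ (2^-1 * `|f a| + 2^-1 * `|f b| + \sum_(l <- s) (A l + B * delta))).
    apply: IHn => //; first by move=> u x us; apply: fA; rewrite inE us orbT.
    move=> x y ax xy yb noS; apply: cst => // u t.
    rewrite inE => /predU1P[->|]; last exact: noS.
    by case/orP: out => ? /andP[? ?] /andP[? ?]; lra.
  by rewrite lerD2l lerDr addr_ge0.
rewrite negb_or -!leNgt => /andP[al lb].
pose c := Num.max a (lft l); pose d := Num.min b (lft l + delta).
have ac : a <= c by rewrite /c le_max lexx.
have lc : lft l <= c by rewrite /c le_max lexx orbT.
have db : d <= b by rewrite /d ge_min lexx.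
have dl : d <= lft l + delta by rewrite /d ge_min lexx orbT.
have cd : c <= d by rewrite /c /d ge_max !le_min; apply/andP; split; apply/andP; split => //; lra.
rewrite (split_itv a c b)//; last exact: le_trans db.
rewrite (split_itv c d b)//.
have I1 : `|\int[lam]_(x in `[a, c]) (chi x * df x)| <= 2^-1 * `|f a| + 2^-1 * `|f c| +
    \sum_(u <- [seq u <- s | lft u < lft l]) (A u + B * delta).
  apply: IHn => //; first by move=> u x; exact: fA'.
    by rewrite size_filter (leq_ltn_trans (count_size _ _)).
  move=> x y ax xy yc noS; apply: cst => //; first by lra.
  have yl : y < lft l by move: yc; rewrite /c lt_max => /orP[|//]; lra.
  move=> u t; rewrite inE => /predU1P[->|us] ut xty; first by case/andP: ut; case/andP: xty; lra.
  have [ul|lu] := ltP (lft u) (lft l); first by apply: (noS u t) => //; rewrite mem_filter ul.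
  by case/andP: ut; case/andP: xty; lra.
have I3 : `|\int[lam]_(x in `[d, b]) (chi x * df x)| <= 2^-1 * `|f d| + 2^-1 * `|f b| +
    \sum_(u <- [seq u <- s | ~~ (lft u < lft l)]) (A u + B * delta).
  apply: IHn => //; first by move=> u x; exact: fA'.
    by rewrite size_filter (leq_ltn_trans (count_size _ _)).
  move=> x y dx xy yb noS; apply: cst => //; first by lra.
  have lx : lft l + delta < x by move: dx; rewrite /d gt_min => /orP[|//]; lra.
  move=> u t; rewrite inE => /predU1P[->|us] ut xty; first by case/andP: ut; case/andP: xty; lra.
  (* The common length [delta] matters here: an interval that starts before the pivot also ends
     before the pivot does, so it cannot reach [x]. *)
  have [ul|lu] := ltP (lft u) (lft l); last by apply: (noS u t) => //; rewrite mem_filter -leNgt lu.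
  by case/andP: ut; case/andP: xty; lra.
have I2 : `|\int[lam]_(x in `[c, d]) (chi x * df x)| <= B * delta.
  have i2 := icf c d.
  apply: (le_trans (le_normr_Rintegral _ i2)) => //.
  have /le_trans : \int[lam]_(x in `[c, d]) `|chi x * df x| <= \int[lam]_(x in `[c, d]) (2^-1 * B).
    apply: le_Rintegral => //; first exact: integrable_norm.
    by apply: (@bounded_integrable_itv _ c d (2^-1 * B)) => // x _; rewrite ger0_norm// mulr_ge0.
  apply; rewrite Rintegral_cst//= lebesgue_measure_itv/= lte_fin.
  case: ifPn => _ /=; last by rewrite mulr0.
  by nra.
have fc : `|f c| <= A l by apply: fA => //; rewrite lc/= (le_trans cd).
have fd : `|f d| <= A l by apply: fA => //; rewrite dl andbT (le_trans _ cd).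
have -> : \sum_(u <- l :: s) (A u + B * delta) = A l + B * delta +
    (\sum_(u <- [seq u <- s | lft u < lft l]) (A u + B * delta) +
     \sum_(u <- [seq u <- s | ~~ (lft u < lft l)]) (A u + B * delta)).
  by rewrite big_cons !big_filter; congr (_ + _); exact: bigID.
move: I1 I2 I3; move: (\int[lam]_(x in `[a, c]) _) (\int[lam]_(x in `[c, d]) _) (\int[lam]_(x in `[d, b]) _) => i1 i2 i3.
move: (\sum_(u <- [seq u <- s | lft u < lft l]) _) (\sum_(u <- [seq u <- s | ~~ (lft u < lft l)]) _) => S1 S2.
move: (B * delta) => Bd I1 I2 I3.
have := ler_normD i1 (i2 + i3); have := ler_normD i2 i3.
by move: fc fd I1 I2 I3; clear; lra.
Qed.
End slice.

Lemma continuous_pair (T U V : topologicalType) (u : T -> U) (v : T -> V) :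
  continuous u -> continuous v -> continuous (fun x => (u x, v x)).
Proof. by move=> cu cv x; apply: (@cvg_pair _ _ _ _ (nbhs (u x)) (nbhs (v x))); [exact: cu|exact: cv]. Qed.

(** * Parallel lines: integrating the slices *)

Section strip.
Context {R : realType}.
Notation TR := (measurableTypeR R).

(** The derivative is demanded at parameter 0 only; [C1_line] moves it along the line. Carrying the
    partial derivatives as data reduces each closure property to an identity for [ring] or
    [field]. *)
Definition C1 (f f1 f2 : R * R -> R) : Prop :=
  [/\ forall z v : R * R, is_derive (0 : R) (1 : R)
        (fun t => f (z.1 + t * v.1, z.2 + t * v.2)) (v.1 * f1 z + v.2 * f2 z),
      continuous f, continuous f1 & continuous f2].

Lemma C1_line f f1 f2 (z v : R * R) (t : R) : C1 f f1 f2 ->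
  is_derive t (1 : R) (fun t => f (z.1 + t * v.1, z.2 + t * v.2))
    (v.1 * f1 (z.1 + t * v.1, z.2 + t * v.2) + v.2 * f2 (z.1 + t * v.1, z.2 + t * v.2)).
Proof.
move=> [df _ _ _].
have := df (z.1 + t * v.1, z.2 + t * v.2) v => /= dt.
pose sh (s : R) := s - t.
have ds : is_derive (t : R) (1 : R) sh 1.
  by apply: is_derive_eq; rewrite subr0.
rewrite -(subrr t) -[t - t]/(sh t) in dt.
have := @is_derive1_comp R _ sh _ _ _ dt ds.
rewrite /sh mulr1; congr (is_derive _ _ _ _); apply/funext => s /=.
by congr (f (_, _)); ring.
Qed.

Lemma sum_indic_integral (J : eqType) (s : seq J) (low wid c : J -> R) :
  (forall j, j \in s -> 0 <= wid j) ->
  lam.-integrable setT (EFin \o (fun y : TR => \sum_(j <- s) \1_(`[low j, low j + wid j]%classic) y * c j)) /\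
  \int[lam]_y (\sum_(j <- s) \1_(`[low j, low j + wid j]%classic : set TR) y * c j) =
    \sum_(j <- s) wid j * c j.
Proof.
elim: s => [|j s IHs] w0.
  under eq_fun do rewrite big_nil.
  split; last by rewrite Rintegral_cst// big_nil mul0r.
  exact: integrable0.
have [|is_ Is_] := IHs; first by move=> k ks; apply: w0; rewrite inE ks orbT.
have mi : measurable (`[low j, low j + wid j]%classic : set TR) by exact: measurable_itv.
have i1 : lam.-integrable setT (EFin \o (fun y : TR => \1_(`[low j, low j + wid j]%classic) y * c j)).
  apply: (@bounded_integrableT _ (low j) (low j + wid j) `|c j|) => [|x|x xj].
  - by apply: measurable_funM => //.
  - by rewrite normrM ler_piMl// indicE; case: (_ \in _); rewrite ?normr1 ?normr0 ?ler01.
  - by rewrite indicE memNset ?mul0r//=; apply/negP.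
split.
  under [X in _.-integrable _ X]eq_fun do rewrite /= big_cons EFinD.
  exact: integrableD.
under eq_Rintegral do rewrite big_cons.
rewrite RintegralD// Is_ big_cons; congr (_ + _).
under eq_Rintegral do rewrite mulrC.
rewrite RintegralZl//; last first.
  apply: (@bounded_integrableT _ (low j) (low j + wid j) 1) => [|x|x xj] //.
  - by rewrite indicE; case: (_ \in _); rewrite ?normr1 ?normr0 ?ler01.
  - by rewrite indicE memNset//=; apply/negP.
rewrite mulrC; congr (_ * _).
rewrite /Rintegral integral_indic// setIT.
rewrite [X in fine X](@lebesgue_measure_itv R `[low j, low j + wid j])/= lte_fin ltrDl.
case: ltP => [_|wj]/=; first by rewrite addrAC subrr add0r.
by apply/eqP; rewrite eq_le wj w0 ?mem_head.
Qed.

(** After the shear, [f1 + m f2] is the derivative of [f] along horizontal lines. [slice_bound]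
    applies on each of them to the intervals of those [j] whose range of heights contains the line,
    and integrating over the height multiplies the cost of [j] by [wid j]. *)
Lemma strip_bound (J : eqType) (s : seq J) (lft low wid A : J -> R)
    f f1 f2 (m delta B r : R) (E : set (TR * TR)) :
  0 <= delta -> 0 <= B -> 0 <= r -> measurable E -> C1 f f1 f2 ->
  (forall z, ~ square r z -> [/\ f z = 0, f1 z = 0 & f2 z = 0]) ->
  (forall z, `|f1 z| <= B /\ `|f2 z| <= B) ->
  (forall j, j \in s -> 0 <= wid j) ->
  (forall j x y, j \in s -> lft j <= x <= lft j + delta ->
     low j <= y <= low j + wid j -> `|f (x, y + m * x)| <= A j) ->
  (forall x1 x2 y, x1 <= x2 ->
     (forall j t, j \in s -> lft j <= t <= lft j + delta ->
        low j <= y <= low j + wid j -> x1 <= t <= x2 -> False) ->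
     E (x1, y + m * x1) <-> E (x2, y + m * x2)) ->
  `|\int[lam2]_(z in E) (f1 z + m * f2 z)| <=
    \sum_(j <- s) wid j * (A j + B * (1 + `|m|) * delta).
Proof.
move=> d0 B0 r0 mE Cf f0 fB w0 fA seg; have [_ cf cf1 cf2] := Cf.
pose g (z : TR * TR) := \1_E z * (f1 z + m * f2 z).
pose B' := B * (1 + `|m|).
have B'0 : 0 <= B' by rewrite mulr_ge0// addr_ge0.
have gB0 z : `|f1 z + m * f2 z| <= B'.
  have [b1 b2] := fB z; rewrite (le_trans (ler_normD _ _))// normrM /B' mulrDr mulr1.
  by rewrite lerD// mulrC ler_wpM2r.
have gB z : `|g z| <= B'.
  rewrite normrM -[leRHS]mul1r ler_pM//.
  by rewrite indicE; case: (_ \in _); rewrite ?normr1 ?normr0 ?ler01.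
have mg : measurable_fun setT g.
  apply: measurable_funM => //.
  apply: measurable_funD; first exact: continuous_measurable2.
  by apply: measurable_funM => //; exact: continuous_measurable2.
have -> : \int[lam2]_(z in E) (f1 z + m * f2 z) = \int[lam2]_z g z.
  rewrite Rintegral_mkcond; apply: eq_Rintegral => z _.
  by rewrite /g patchE indicE; case: (_ \in _); rewrite ?mul1r ?mul0r.
have mgs : measurable_fun setT (g \o shear m) by apply: measurableT_comp => //; exact: measurable_shear.
have gs0 z : ~ square (r + `|m| * r) z -> (g \o shear m) z = 0.
  move=> zr; rewrite /= /g; suff /f0[_ -> ->] : ~ square r (shear m z) by rewrite mulr0 addr0 mulr0.
  apply: contra_not zr => -[/= z1 z2].
  split; first by rewrite (le_trans z1)// lerDl mulr_ge0.
  rewrite (_ : z.2 = z.2 + m * z.1 - m * z.1); last by ring.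
  by rewrite (le_trans (ler_normB _ _))// lerD// normrM ler_wpM2l.
have igs : lam2.-integrable setT (EFin \o (g \o shear m)).
  by apply: (@bounded_integrable2T _ (r + `|m| * r) B') => // z; exact: gB.
rewrite (pushforward_Rintegral2 (measurable_shear m) (lam2_shear m) mg igs).
have [iH IH] := sum_indic_integral low (fun j => A j + B' * delta) w0.
rewrite -IH.
apply: (@fubini_le _ (r + `|m| * r) B' (g \o shear m)) => // [z|y]; first exact: gB.
rewrite /comp /shear/=.
pose df x := f1 (x, y + m * x) + m * f2 (x, y + m * x).
pose F x := f (x, y + m * x).
have dF x : is_derive (x : R) (1 : R) F (df x).
  have := @C1_line f f1 f2 (0, y) (1, m) x Cf.
  rewrite /= mul1r add0r mulr1 (mulrC x m).
  by congr (is_derive _ _ _ _); apply/funext => t; rewrite add0r mulr1 mulrC.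
have cl : continuous (fun x : R => (x, y + m * x) : R * R).
  apply: continuous_pair => x; first exact: cvg_id.
  by apply: cvgD; [exact: cvg_cst|apply: cvgM; [exact: cvg_cst|exact: cvg_id]].
have cdf : continuous df.
  move=> x; apply: cvgD; [|apply: cvgM; first exact: cvg_cst].
  - by apply: (@continuous_comp _ _ _ _ f1) => //; [exact: cl|exact: cf1].
  - by apply: (@continuous_comp _ _ _ _ f2) => //; [exact: cl|exact: cf2].
pose chi (x : TR) := \1_E (x, y + m * x) - 2^-1 : R.
have m1 : measurable_fun setT (fun x : TR => \1_E (x, y + m * x) : R).
  apply: (@measurableT_comp _ _ _ _ _ _ (\1_E : TR * TR -> R)) => //.
  apply/measurable_fun_pairP; split => /=; first exact: measurable_id.
  by apply: measurable_funD => //; apply: measurable_funM.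
have mchi : measurable_fun setT chi by exact: measurable_funB.
have chi2 x : `|chi x| <= 2^-1.
  by rewrite /chi indicE; case: (_ \in _); rewrite /= ler_norml; lra.
pose r1 := r + 1.
have out x : `|x| > r -> [/\ F x = 0, f1 (x, y + m * x) = 0 & f2 (x, y + m * x) = 0].
  by move=> rx; apply: f0 => -[/=]; rewrite leNgt rx.
have F1 : F r1 = 0 by have [] := out r1; rewrite // ger0_norm /r1 ?ltrDl// addr_ge0.
have FN1 : F (- r1) = 0 by have [] := out (- r1); rewrite // normrN ger0_norm /r1 ?ltrDl// addr_ge0.
have r1r1 : - r1 <= r1 by rewrite /r1; lra.
have dfB x : `|df x| <= B' by exact: gB0.
have mdf : measurable_fun setT (df : TR -> R) by exact: continuous_measurable_fun.
have -> : \int[lam]_x (\1_E (x, y + m * x) * (f1 (x, y + m * x) + m * f2 (x, y + m * x))) =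
    \int[lam]_(x in `[- r1, r1]) (chi x * df x).
  transitivity (\int[lam]_(x in `[- r1, r1]) (chi x * df x + 2^-1 * df x)).
    rewrite [RHS]Rintegral_mkcond; apply: eq_Rintegral => x _; rewrite patchE.
    case: ifPn => [_|]; first by rewrite -mulrDl /chi subrK.
    rewrite notin_setE/= in_itv/= -ler_norml => /negP; rewrite -ltNge => xr1.
    have [|_ -> ->] := out x; last by rewrite mulr0 addr0 mulr0.
    by apply: le_lt_trans xr1; rewrite /r1 lerDl.
  rewrite RintegralD//; last 2 first.
  - apply: (@bounded_integrable_itv _ _ _ (2^-1 * B')) => [|x _]; last by rewrite normrM ler_pM.
    by apply: measurable_funS (measurable_funM mchi mdf).
  - apply: (@bounded_integrable_itv _ _ _ (2^-1 * B')) => [|x _]; last first.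
      by rewrite normrM ger0_norm ?ler_pM.
    by apply: measurable_funS (measurable_funM (measurable_cst _) mdf).
  rewrite [X in _ + X]RintegralZl//; last first.
    by apply: (@bounded_integrable_itv _ _ _ B') => [|x _]; [exact: measurable_funS mdf|].
  by rewrite (FTC_Rintegral r1r1 dF)// F1 FN1 subrr mulr0 addr0.
pose sy := [seq j <- s | low j <= y <= low j + wid j].
have := @slice_bound _ J lft A sy F df chi delta B' (- r1) r1 r1r1 d0 B'0 dF cdf dfB mchi chi2.
rewrite F1 FN1 normr0 mulr0 !add0r => H.
have {}H := H _ _.
apply: (le_trans (H _ _)).
- by move=> l x; rewrite mem_filter => /andP[yl ls] xl; apply: (fA l x y).
- move=> u v _ uv _ noS; congr (_ - _); rewrite !indicE; congr ((_ : bool)%:R).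
  have [|EE1 EE2] := seg u v y uv.
    by move=> j t js tj yj tuv; apply: (noS j t) => //; rewrite mem_filter yj.
  by apply/idP/idP; rewrite !inE.
rewrite /sy big_filter big_mkcond/=; apply: ler_sum => j _.
rewrite indicE; case: ifPn => yj.
  by rewrite mem_set ?mul1r.
by rewrite memNset ?mul0r//=; rewrite in_itv/=; exact/negP.
Qed.

End strip.

(** * A sampled divergence inequality *)

Section continuity.
Context {R : realType} {T : topologicalType}.
Implicit Types f g : T -> R.

Lemma contD f g : continuous f -> continuous g -> continuous (fun z => f z + g z).
Proof. by move=> cf cg z; apply: cvgD; [exact: cf|exact: cg]. Qed.

Lemma contM f g : continuous f -> continuous g -> continuous (fun z => f z * g z).
Proof. by move=> cf cg z; apply: cvgM; [exact: cf|exact: cg]. Qed.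

Lemma contN f : continuous f -> continuous (fun z => - f z).
Proof. by move=> cf z; apply: cvgN; exact: cf. Qed.

Lemma contB f g : continuous f -> continuous g -> continuous (fun z => f z - g z).
Proof. by move=> cf cg; apply: contD => //; exact: contN. Qed.

Lemma contX f n : continuous f -> continuous (fun z => f z ^+ n).
Proof.
move=> cf; elim: n => [|n IHn]; first exact: cst_continuous.
by under eq_fun do rewrite exprS; exact: contM.
Qed.

Lemma contV f : continuous f -> (forall z, f z != 0) -> continuous (fun z => (f z)^-1).
Proof. by move=> cf f0 z; apply: cvgV; [exact: f0|exact: cf]. Qed.

Lemma cont_norm f : continuous f -> continuous (fun z => `|f z|).
Proof. by move=> cf z; apply: cvg_norm; exact: cf. Qed.

Lemma cont_comp (phi : R -> R) f : continuous phi -> continuous f -> continuous (fun z => phi (f z)).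
Proof. by move=> cp cf z; apply: (@continuous_comp _ _ _ f phi); [exact: cf|exact: cp]. Qed.

End continuity.

Ltac cont := repeat first
  [ assumption | exact: cst_continuous | exact: cvg_id
  | apply: contD | apply: contM | apply: contN | apply: contX
  | apply: cont_norm | (move=> ?; exact: cvg_fst) | (move=> ?; exact: cvg_snd) ].

Ltac derive_ring := apply: is_derive_eq; rewrite /GRing.scale/=; ring.

Notation has_deriv x := (is_derive (x : Real.sort _) (1 : Real.sort _)) (only parsing).

Section derive_ext.
Context {R : realType}.

Lemma der_ext (f g : R -> R) (x d e : R) : has_deriv x f d ->
  f =1 g -> d = e -> has_deriv x g e.
Proof. by move=> fd /funext <- <-. Qed.

Lemma der_comp (phi l : R -> R) (x dphi dl : R) : is_derive (l x) (1 : R) phi dphi ->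
  has_deriv x l dl -> has_deriv x (fun t => phi (l t)) (dphi * dl).
Proof. by move=> dp dlx; exact: (is_derive1_comp dp dlx). Qed.

End derive_ext.

Section C1_theory.
Context {R : realType}.
Implicit Types (f g : R * R -> R).

Lemma C1_cst (c : R) : C1 (cst c) (cst 0) (cst 0).
Proof.
split; [|exact: cst_continuous..] => z v.
by rewrite !mulr0 addr0; exact: is_derive_cst.
Qed.

Lemma C1_add f f1 f2 g g1 g2 : C1 f f1 f2 -> C1 g g1 g2 ->
  C1 (fun z => f z + g z) (fun z => f1 z + g1 z) (fun z => f2 z + g2 z).
Proof.
move=> [df cf cf1 cf2] [dg cg cg1 cg2]; split => [z v|||]; [|by cont..].
by apply: (der_ext (is_deriveD (df z v) (dg z v))) => //; ring.
Qed.

Lemma C1_mul f f1 f2 g g1 g2 : C1 f f1 f2 -> C1 g g1 g2 ->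
  C1 (fun z => f z * g z) (fun z => f1 z * g z + f z * g1 z) (fun z => f2 z * g z + f z * g2 z).
Proof.
move=> [df cf cf1 cf2] [dg cg cg1 cg2]; split => [z v|||]; [|by cont..].
apply: (der_ext (is_deriveM (df z v) (dg z v))) => //.
by rewrite !mul0r !addr0 -!surjective_pairing /GRing.scale/=; ring.
Qed.

Lemma C1_inv f f1 f2 : C1 f f1 f2 -> (forall z, f z != 0) ->
  C1 (fun z => (f z)^-1) (fun z => - (f z) ^- 2 * f1 z) (fun z => - (f z) ^- 2 * f2 z).
Proof.
move=> [df cf cf1 cf2] f0.
have cV : continuous (fun z => - (f z) ^- 2).
  by apply: contN; apply: contV; [cont|move=> z; rewrite expf_neq0].
split => [z v|||]; [|exact: contV|by cont|by cont].
apply: (der_ext (@is_deriveV R (fun t => f (z.1 + t * v.1, z.2 + t * v.2)) 0 _ 1 (f0 _) (df z v))) => //.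
by rewrite !mul0r !addr0 -!surjective_pairing /GRing.scale/=; ring.
Qed.

Lemma C1_eq f f1 f2 g g1 g2 : C1 f f1 f2 -> f =1 g -> f1 =1 g1 -> f2 =1 g2 -> C1 g g1 g2.
Proof. by move=> C /funext <- /funext <- /funext <-. Qed.

Lemma C1_scale (c : R) f f1 f2 : C1 f f1 f2 ->
  C1 (fun z => c * f z) (fun z => c * f1 z) (fun z => c * f2 z).
Proof.
move=> Cf; apply: (C1_eq (C1_mul (C1_cst c) Cf)) => z //=; by rewrite mul0r add0r.
Qed.

Lemma C1_opp f f1 f2 : C1 f f1 f2 -> C1 (fun z => - f z) (fun z => - f1 z) (fun z => - f2 z).
Proof. by move=> Cf; apply: (C1_eq (C1_scale (-1) Cf)) => z; exact: mulN1r. Qed.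

Lemma C1_sub f f1 f2 g g1 g2 : C1 f f1 f2 -> C1 g g1 g2 ->
  C1 (fun z => f z - g z) (fun z => f1 z - g1 z) (fun z => f2 z - g2 z).
Proof.
move=> Cf Cg; apply: (C1_eq (C1_add Cf (C1_scale (-1) Cg))) => z; by rewrite mulN1r.
Qed.

Lemma C1_fst (phi dphi : R -> R) (a b : R) :
  (forall x : R, is_derive x (1 : R) phi (dphi x)) -> continuous dphi ->
  C1 (fun z => phi (a * z.1 + b)) (fun z => a * dphi (a * z.1 + b)) (cst 0).
Proof.
move=> dp cd.
have cl : continuous (fun z : R * R => a * z.1 + b) by cont.
have cp : continuous phi.
  by move=> x; apply/differentiable_continuous/derivable1_diffP; have [] := dp x.
split => [z v|||]; last exact: cst_continuous.
- pose l (t : R) := a * (z.1 + t * v.1) + b.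
  have dl : has_deriv 0 l (a * v.1).
    by derive_ring.
  by apply: (der_ext (der_comp (dp (l 0)) dl)) => //; rewrite /l mul0r addr0; rewrite /cst; ring.
- exact: cont_comp.
- by apply: contM; [cont|exact: cont_comp].
Qed.

Lemma C1_snd (phi dphi : R -> R) (a b : R) :
  (forall x : R, is_derive x (1 : R) phi (dphi x)) -> continuous dphi ->
  C1 (fun z => phi (a * z.2 + b)) (cst 0) (fun z => a * dphi (a * z.2 + b)).
Proof.
move=> dp cd.
have cl : continuous (fun z : R * R => a * z.2 + b) by cont.
have cp : continuous phi.
  by move=> x; apply/differentiable_continuous/derivable1_diffP; have [] := dp x.
split => [z v|||]; [| |exact: cst_continuous|].
- pose l (t : R) := a * (z.2 + t * v.2) + b.
  have dl : has_deriv 0 l (a * v.2).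
    by derive_ring.
  by apply: (der_ext (der_comp (dp (l 0)) dl)) => //; rewrite /l mul0r addr0; rewrite /cst; ring.
- exact: cont_comp.
- by apply: contM; [cont|exact: cont_comp].
Qed.

Lemma C1_lipschitz f f1 f2 (B r : R) (p q : R * R) : C1 f f1 f2 ->
  square r p -> square r q ->
  (forall z, square r z -> `|f1 z| <= B /\ `|f2 z| <= B) ->
  `|f q - f p| <= B * (`|q.1 - p.1| + `|q.2 - p.2|).
Proof.
move=> Cf [p1 p2] [q1 q2] fB.
pose v := (q.1 - p.1, q.2 - p.2).
pose F t := f (p.1 + t * v.1, p.2 + t * v.2).
pose dF t := v.1 * f1 (p.1 + t * v.1, p.2 + t * v.2) + v.2 * f2 (p.1 + t * v.1, p.2 + t * v.2).
have dFt (t : R) : is_derive t (1 : R) F (dF t) by exact: C1_line.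
have cF : {within `[0, 1], continuous F}.
  apply: derivable_within_continuous => x _; by have [] := dFt x.
have [c c01] := MVT_segment ler01 (fun x _ => dFt x) cF.
rewrite subr0 mulr1 /F/v/= !mul1r !mul0r !addr0 !(addrC p.1) !(addrC p.2) !subrK -!surjective_pairing => ->.
have [|b1 b2] := fB (p.1 + c * v.1, p.2 + c * v.2).
  move: c01; rewrite in_itv/= => /andP[c0 c1].
  move: p1 p2 q1 q2; rewrite /square/= !ler_norml => /andP[? ?] /andP[? ?] /andP[? ?] /andP[? ?].
  by split; rewrite /v/=; apply/andP; split; nra.
rewrite [B * (_ + _)]mulrDr /dF; apply: (le_trans (ler_normD _ _)); rewrite !normrM; apply: lerD.
  by rewrite mulrC ler_wpM2r.
by rewrite mulrC ler_wpM2r.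
Qed.
Lemma C1_lipschitzT f f1 f2 (B : R) (p q : R * R) : C1 f f1 f2 ->
  (forall z, `|f1 z| <= B /\ `|f2 z| <= B) ->
  `|f q - f p| <= B * (`|q.1 - p.1| + `|q.2 - p.2|).
Proof.
move=> Cf fB.
apply: (@C1_lipschitz _ _ _ _ (`|p.1| + `|p.2| + `|q.1| + `|q.2|) _ _ Cf) => // [|].
- by split; rewrite -!addrA ?lerDl ?addr_ge0// addrCA lerDl !addr_ge0.
- by split; rewrite ?lerDr ?addr_ge0// -addrA [`|q.1| + _]addrC addrA lerDr !addr_ge0.
Qed.
End C1_theory.

(** * A quadratic spline partition of unity *)

Section spline.
Context {R : realType}.

Lemma is_derive_quadratic (f : R -> R) (x d C : R) : 0 <= C ->
  (forall h, `|f (x + h) - f x - h * d| <= C * h ^+ 2) -> has_deriv x f d.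
Proof.
move=> C0 H.
have cv : h^-1 *: ((f \o shift x) (h *: (1 : R)) - f x) @[h --> 0^'] --> d.
  apply/cvgrPdist_le => e e0; near=> h.
  have h0 : h != 0 by near: h; exact: nbhs_dnbhs_neq.
  rewrite /= /GRing.scale/= mulr1 (addrC h) distrC.
  rewrite (_ : _ - d = h^-1 * (f (x + h) - f x - h * d)); last by field.
  rewrite normrM normfV ler_pdivrMl ?normr_gt0//.
  apply: (le_trans (H h)); rewrite -real_normK ?num_real// expr2 mulrA mulrC ler_wpM2l//.
  have he : `|h| <= e / (C + 1).
    near: h; apply: dnbhs0_le; by rewrite divr_gt0// ltr_wpDl.
  rewrite (le_trans (ler_wpM2l C0 he))// mulrCA ler_piMr ?(ltW e0)//.
  by rewrite ler_pdivrMr ?ltr_wpDl// mul1r lerDl.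
split; first by apply/cvg_ex; exists d.
exact: cvg_lim cv.
Unshelve. all: by end_near. Qed.

(** The square of the positive part of [t]. Its scaled second difference [sstep] is a step of class
    C^1 that rises from 0 to 1 on [0, 1]. *)
Let pos (t : R) : R := (t * `|t| + t ^+ 2) / 2.
Definition sstep (t : R) : R := 2 * pos t - 4 * pos (t - 2^-1) + 2 * pos (t - 1).
Definition dsstep (t : R) : R := 2 * (`|t| + t) - 4 * (`|t - 2^-1| + (t - 2^-1)) + 2 * (`|t - 1| + (t - 1)).

Let normE (t : R) : t >= 0 /\ `|t| = t \/ t <= 0 /\ `|t| = - t.
Proof.
by case: (leP 0 t) => [t0|/ltW t0]; [left; rewrite ger0_norm|right; rewrite ler0_norm].
Qed.

Let dpos (t h : R) : `|pos (t + h) - pos t - h * (`|t| + t)| <= 2 * h ^+ 2.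
Proof.
rewrite /pos ler_norml; move: (normE t) (normE (t + h)).
move: `|t| `|t + h| => a b [[? ->]|[? ->]] [[? ->]|[? ->]]; apply/andP; split; nra.
Qed.

Lemma is_derive_step (t : R) : has_deriv t sstep (dsstep t).
Proof.
apply: (@is_derive_quadratic _ _ _ 16) => // h.
have := dpos t h; have := dpos (t - 2^-1) h; have := dpos (t - 1) h.
rewrite /sstep /dsstep (addrAC t h (- 2^-1)) (addrAC t h (-1)).
move: (pos (t + h)) (pos t) (pos (t - 1 + h)) (pos (t - 1)) (pos (t - 2^-1 + h)) (pos (t - 2^-1)) => p1 p2 p3 p4 p5 p6.
rewrite !ler_norml => /andP[? ?] /andP[? ?] /andP[? ?].
by lra.
Qed.

Lemma continuous_dstep : continuous dsstep.
Proof. rewrite /dsstep; apply: contD; [apply: contB|]; apply: contM; try exact: cst_continuous;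
  by apply: contD; [apply: cont_norm|]; try (apply: contB); try exact: cst_continuous; move=> ?; exact: cvg_id. Qed.

Let step_cases t :
  [\/ t <= 0 /\ (sstep t = 0 /\ dsstep t = 0),
      0 <= t <= 2^-1 /\ (sstep t = 2 * t ^+ 2 /\ dsstep t = 4 * t),
      2^-1 <= t <= 1 /\ (sstep t = 1 - 2 * (1 - t) ^+ 2 /\ dsstep t = 4 * (1 - t)) |
      1 <= t /\ (sstep t = 1 /\ dsstep t = 0)].
Proof.
rewrite /sstep /dsstep /pos.
case: (leP t 0) => [t0|t0].
  by apply: Or41; split => //; rewrite !ler0_norm; [split; field|lra..].
case: (leP t 2^-1) => [t1|t1].
  apply: Or42; split; first lra.
  by rewrite ger0_norm ?(ltW t0)// !ler0_norm; [split; field|lra..].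
case: (leP t 1) => [t2|t2].
  apply: Or43; split; first lra.
  by rewrite [`|t - 1|]ler0_norm ?subr_le0// !ger0_norm; [split; field|lra..].
by apply: Or44; split; [lra|rewrite !ger0_norm; [split; field|lra..]].
Qed.

Lemma step_le0 t : t <= 0 -> sstep t = 0 /\ dsstep t = 0.
Proof. by move=> t0; case: (step_cases t) => -[? [-> ->]] //; split; nra. Qed.

Lemma step_ge1 t : 1 <= t -> sstep t = 1 /\ dsstep t = 0.
Proof. by move=> t0; case: (step_cases t) => -[? [-> ->]] //; split; nra. Qed.

Lemma step_homo s t : s <= t -> sstep s <= sstep t.
Proof.
move=> st; case: (step_cases s) => -[? [-> _]]; case: (step_cases t) => -[? [-> _]]; nra.
Qed.

Lemma dstep_bound t : 0 <= dsstep t <= 2.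
Proof. by case: (step_cases t) => -[? [_ ->]]; lra. Qed.

(** A bump on [k - 1, k + 1]. As a difference of consecutive translates of one step it makes sums
    over [k] telescope, hence a partition of unity. *)
Definition bspl (k t : R) := sstep (t - k + 1) - sstep (t - k).
Definition dbspl (k t : R) := dsstep (t - k + 1) - dsstep (t - k).

Lemma bspl_ge0 k t : 0 <= bspl k t.
Proof. by rewrite /bspl subr_ge0 step_homo// lerDl. Qed.

Lemma dbspl_bound k t : `|dbspl k t| <= 2.
Proof.
rewrite /dbspl; have := dstep_bound (t - k + 1); have := dstep_bound (t - k).
by rewrite ler_norml => /andP[? ?] /andP[? ?]; lra.
Qed.

Lemma bspl_out k t : 1 <= `|t - k| -> bspl k t = 0 /\ dbspl k t = 0.
Proof.
rewrite /bspl /dbspl; case: (normE (t - k)) => -[_ ->] ?.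
  by have [-> ->] := @step_ge1 (t - k + 1) ltac:(lra); have [-> ->] := @step_ge1 (t - k) ltac:(lra); rewrite !subrr.
by have [-> ->] := @step_le0 (t - k + 1) ltac:(lra); have [-> ->] := @step_le0 (t - k) ltac:(lra); rewrite !subrr.
Qed.

Lemma sum_bspl (n : nat) t : `|t| <= n%:R ->
  \sum_(i < n.*2.+1) bspl (i%:R - n%:R) t = 1 /\
  \sum_(i < n.*2.+1) dbspl (i%:R - n%:R) t = 0.
Proof.
rewrite ler_norml => /andP[tn1 tn2].
have tele (f : R -> R) m : \sum_(i < m.+1) (f (t - (i%:R - n%:R) + 1) - f (t - (i%:R - n%:R))) =
    f (t + n%:R + 1) - f (t + n%:R - m%:R).
  elim: m => [|m IHm]; first by rewrite big_ord1 sub0r opprK subr0.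
  rewrite big_ord_recr/= IHm.
  have -> : t - (m.+1%:R - n%:R) + 1 = t + n%:R - m%:R by rewrite -natr1; ring.
  have -> : t - (m.+1%:R - n%:R) = t + n%:R - m.+1%:R by ring.
  by rewrite addrA subrK.
rewrite !tele -addnn natrD.
have [-> ->] := @step_ge1 (t + n%:R + 1) ltac:(lra).
have [-> ->] := @step_le0 (t + n%:R - (n%:R + n%:R)) ltac:(lra).
by rewrite !subr0.
Qed.

Lemma is_derive_bspl (k t : R) : has_deriv t (bspl k) (dbspl k t).
Proof.
have d1 : has_deriv t (fun t => sstep (t - k + 1)) (dsstep (t - k + 1)).
  have ds : has_deriv t (fun t => t - k + 1) 1.
    by derive_ring.
  by apply: (der_ext (@der_comp _ sstep (fun t => t - k + 1) t _ _ (is_derive_step _) ds)) => //; rewrite mulr1.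
have d2 : has_deriv t (fun t => sstep (t - k)) (dsstep (t - k)).
  have ds : has_deriv t (fun t => t - k) 1.
    by derive_ring.
  by apply: (der_ext (@der_comp _ sstep (fun t => t - k) t _ _ (is_derive_step _) ds)) => //; rewrite mulr1.
exact: is_deriveB.
Qed.

Lemma continuous_dbspl k : continuous (dbspl k).
Proof.
rewrite /dbspl; apply: contB; apply: (@cont_comp _ _ dsstep); try exact: continuous_dstep.
  by apply: contD; [apply: contD; [move=> ?; exact: cvg_id|]|]; cont.
by apply: contD; [move=> ?; exact: cvg_id|cont].
Qed.

End spline.

(** * Sampled curves and the flux in one direction *)

Section star.
Context {R : realType}.
Notation TR := (measurableTypeR R).

(** A discrete stand-in for a curve with trace [T]: [p j] is a point, [v j] a velocity and [len j] a
    time step. The error allowed is [eps * len j], of higher order than the step, so that the errors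
    of all samples still add up to a multiple of [eps]. *)
Definition sampled (J : eqType) (s : seq J) (p v : J -> R * R) (len : J -> R)
    (T : set (R * R)) (eps M rho : R) : Prop :=
  [/\ forall j, j \in s ->
        [/\ 0 <= len j <= eps, `|(v j).1| <= M, `|(v j).2| <= M & square rho (p j)],
      \sum_(j <- s) len j <= 1 &
      forall z, T z -> exists2 j, j \in s & exists tau,
        [/\ 0 <= tau <= len j, `|z.1 - ((p j).1 + tau * (v j).1)| <= eps * len j &
            `|z.2 - ((p j).2 + tau * (v j).2)| <= eps * len j]].

(** One implication is enough, because a segment can be run backwards. *)
Definition constant_off (T E : set (R * R)) : Prop := forall z w : R * R,
  (forall t, 0 <= t <= 1 -> ~ T (z.1 + t * (w.1 - z.1), z.2 + t * (w.2 - z.2))) -> E z -> E w.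

(** In sheared coordinates the segment of sample [j] covers a range of heights of extent [len j]
    times |v2 - m v1|, which is the flux of the direction (1, m) through it. This is the width fed
    to [strip_bound], up to the sampling error. *)
Lemma direction_bound (J : eqType) (s : seq J) (p v : J -> R * R) (len : J -> R)
    (T : set (R * R)) (E : set (TR * TR)) (eps M rho : R) f f1 f2 (m m0 B r : R) :
  0 <= eps <= 1 -> 0 <= M -> 0 <= rho -> sampled s p v len T eps M rho ->
  measurable E -> constant_off T E ->
  `|m| <= m0 -> 0 <= B -> rho + 1 <= r ->
  C1 f f1 f2 ->
  (forall z, ~ square r z -> [/\ f z = 0, f1 z = 0 & f2 z = 0]) ->
  (forall z, `|f1 z| <= B /\ `|f2 z| <= B) ->
  `|\int[lam2]_(z in E) (f1 z + m * f2 z)| <=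
    \sum_(j <- s) len j * (`|(v j).2 - m * (v j).1| + 2 * eps * (1 + m0)) *
      (`|f (p j)| + B * ((1 + m0) * (5 * M + 6) * eps)).
Proof.
move=> eps01 M0 rho0 sam mE sep mm0 B0 rr Cf f0 fB; have [samp _ samT] := sam.
case/andP: eps01 => e0 e1.
have r0 : 0 <= r by apply: le_trans rr; rewrite addr_ge0.
have m00 : 0 <= m0 by apply: le_trans mm0.
(* Bound for the horizontal distance from [p j] to the part of [T] near sample [j]: at most M eps
   along the segment and eps for the sampling error. *)
pose d := (M + 1) * eps.
pose del j := (v j).2 - m * (v j).1.
pose wid j := len j * (`|del j| + 2 * eps * (1 + m0)).
(* The heights start at that of [p j] and move by [len j * del j], which may be negative; the
   minimum picks the lower end. *)
pose low j := (p j).2 - m * (p j).1 - len j * eps * (1 + m0) + Num.min 0 (len j * del j).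
pose lft j := (p j).1 - d.
have d0 : 0 <= d by rewrite mulr_ge0// addr_ge0.
have len01 j : j \in s -> 0 <= len j <= eps by move=> /samp[].
have wid0 j : j \in s -> 0 <= wid j.
  move=> /len01/andP[l0 _]; rewrite mulr_ge0// addr_ge0// mulr_ge0 ?addr_ge0// mulr_ge0//.
have delM j : j \in s -> `|del j| <= M * (1 + m0).
  move=> /samp[_ v1 v2 _]; rewrite (le_trans (ler_normB _ _))// mulrDr mulr1 lerD//.
  by rewrite normrM mulrC ler_pM.
(* The displacement terms cost 3 (1 + m0) d and the width at most (1 + m0) (M + 2) eps, in all (1 +
   m0) (4 M + 5) eps, rounded up. *)
pose err := B * ((1 + m0) * (5 * M + 6) * eps).
pose A j := `|f (p j)| + B * (d + (wid j + m0 * d)).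
have key j : j \in s -> A j + B * (1 + `|m|) * (2 * d) <= `|f (p j)| + err.
  move=> js; rewrite /A -addrA lerD2l /err -mulrA -mulrDr ler_wpM2l//.
  have /andP[l0 le1] := len01 _ js.
  have w1 : wid j <= eps * (M * (1 + m0) + 2 * (1 + m0)).
    rewrite /wid ler_pM// ?addr_ge0 ?mulr_ge0 ?addr_ge0//.
    rewrite lerD ?delM// -mulrA ler_pM2l// ler_piMl// addr_ge0//.
  have : `|m| * (2 * d) <= m0 * (2 * d) by rewrite ler_wpM2r// mulr_ge0.
  by rewrite /d in d0 *; nra.
have stripped : `|\int[lam2]_(z in E) (f1 z + m * f2 z)| <=
    \sum_(j <- s) wid j * (A j + B * (1 + `|m|) * (2 * d)).
  apply: (@strip_bound R J s lft low wid A f f1 f2 m (2 * d) B r E) => //.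
  - by rewrite mulr_ge0.
  - move=> j x y js; rewrite /lft /low => xx yy.
    have [/andP[l0 _] v1 v2 pr] := samp _ js.
    have xd : `|x - (p j).1| <= d by move: xx; clear; rewrite ler_norml; lra.
    have yd : `|y - ((p j).2 - m * (p j).1)| <= wid j.
      have := mulr_ge0 l0 (normr_ge0 (del j)).
      have := mulr_ge0 (mulr_ge0 l0 e0) (addr_ge0 ler01 m00).
      have : `|len j * del j| = len j * `|del j| by rewrite normrM ger0_norm.
      move: yy; rewrite /low /wid; move: (len j * del j) => ld.
      rewrite (_ : len j * (`|del j| + 2 * eps * (1 + m0)) =
        len j * `|del j| + 2 * (len j * eps * (1 + m0))); last by ring.
      move: (len j * eps * (1 + m0)) (len j * `|del j|) ((p j).2 - m * (p j).1) => a b c.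
      clear; rewrite minEle ler_norml; case: (leP 0 ld) => l0.
        by rewrite ger0_norm//; lra.
      by rewrite ltr0_norm//; lra.
    have := C1_lipschitzT (p j) (x, y + m * x) Cf fB; rewrite /=.
    have -> : y + m * x - (p j).2 = (y - ((p j).2 - m * (p j).1)) + m * (x - (p j).1) by ring.
    have := ler_normD (y - ((p j).2 - m * (p j).1)) (m * (x - (p j).1)).
    have mx : `|m * (x - (p j).1)| <= m0 * d by rewrite normrM ler_pM.
    move=> h1 h2; rewrite /A -lerBlDl; apply: (le_trans (lerB_dist _ _)).
    apply: (le_trans h2); rewrite ler_wpM2l// lerD// (le_trans h1)// lerD//.
  - move=> x1 x2 y x12 noS.
    have T1 t : 0 <= t <= 1 -> ~ T (x1 + t * (x2 - x1), y + m * x1 + t * (y + m * x2 - (y + m * x1))).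
      move=> t01; pose x := x1 + t * (x2 - x1).
      rewrite -/x (_ : _ + t * _ = y + m * x); last by rewrite /x; ring.
      move=> /samT[j js [tau [/andP[tau0 taul] /= z1 z2]]].
      have [/andP[l0 le1] v1 v2 pr] := samp _ js.
      apply: (noS j x js).
      - have tv : `|tau * (v j).1| <= eps * M.
          by rewrite normrM ler_pM// ger0_norm// (le_trans taul).
        have el : eps * len j <= eps by rewrite ler_piMr// (le_trans le1).
        rewrite /lft /d; move: z1 tv el; rewrite mulrDl mul1r [M * _]mulrC.
        by move: (tau * _) (eps * len j) (eps * M) => a b c; clear; rewrite !ler_norml; lra.
      - have em : `|m * (x - ((p j).1 + tau * (v j).1))| <= m0 * (eps * len j).
          by rewrite normrM ler_pM.
        have := ler_wpM2r (normr_ge0 (del j)) taul.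
        have := mulr_ge0 tau0 (normr_ge0 (del j)).
        have := ler_wpM2r m00 (mulr_ge0 e0 l0).
        rewrite /low /wid.
        have -> : y = (p j).2 - m * (p j).1 + tau * del j +
           ((y + m * x - ((p j).2 + tau * (v j).2)) - m * (x - ((p j).1 + tau * (v j).1))).
          by rewrite /del; ring.
        rewrite (_ : len j * (`|del j| + 2 * eps * (1 + m0)) =
          len j * `|del j| + 2 * (eps * len j + m0 * (eps * len j))); last by ring.
        rewrite (_ : len j * eps * (1 + m0) = eps * len j + m0 * (eps * len j)); last by ring.
        move: z2 em.
        move: (y + m * x - _) (m * (x - _)) (eps * len j) ((p j).2 - m * (p j).1) => a b c e.
        move: (m0 * c) => mc.
        rewrite minEle; case: (leP 0 (len j * del j)) => ld.
          have [l00|lp] := eqVneq (len j) 0.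
            have -> : tau = 0 by move: taul tau0; rewrite l00 => ? ?; apply/eqP; rewrite eq_le; apply/andP.
            by rewrite l00 !mul0r; clear; rewrite !ler_norml; lra.
          have dj0 : 0 <= del j by rewrite pmulr_rge0 in ld => //; rewrite lt0r lp.
          rewrite (ger0_norm dj0); move: (tau * del j) (len j * del j) => u w.
          by clear; rewrite !ler_norml; lra.
        have dj0 : del j <= 0.
          by rewrite leNgt; apply/negP => dp; move: ld; rewrite ltNge mulr_ge0// ltW.
        rewrite (ler0_norm dj0) !mulrN; move: (tau * del j) (len j * del j) => u w.
        by clear; rewrite !ler_norml; lra.
      - by rewrite /x; case/andP: t01 => *; apply/andP; split; nra.
    split; first by apply: sep.
    apply: sep => t /andP[t0 t1] /=.
    rewrite (_ : (_, _) = (x1 + (1 - t) * (x2 - x1),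
        y + m * x1 + (1 - t) * (y + m * x2 - (y + m * x1)))).
      by apply: T1; lra.
    by congr (_, _); ring.
apply: (le_trans stripped); rewrite big_seq [leRHS]big_seq; apply: ler_sum => j js.
by rewrite ler_wpM2l ?wid0// key.
Qed.

Lemma compact_square (r : R) : compact (square r : set (R * R)).
Proof. by rewrite squareE; apply: compact_setX; exact: segment_compact. Qed.

Lemma continuous_bounded_square (f : R * R -> R) (r : R) : continuous f ->
  exists2 C, 0 <= C & forall z, square r z -> `|f z| <= C.
Proof.
move=> cf.
have /compact_bounded[C [_ Cf]] : compact (f @` square r).
  by apply: continuous_compact; [exact: continuous_subspaceT|exact: compact_square].
exists (`|C| + 1) => [|z zr]; first by rewrite addr_ge0.
by apply: (Cf (`|C| + 1)); [rewrite ltr_pwDr// ler_norm|exists z].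
Qed.

Lemma continuous_integrable2 (f : R * R -> R) (r : R) (E : set (TR * TR)) :
  continuous f -> measurable E -> E `<=` square r -> lam2.-integrable E (EFin \o f).
Proof.
move=> cf mE Er; have [C _ fC] := continuous_bounded_square r cf.
apply: (@bounded_integrable2 _ r C) => // [|z /Er]; last exact: fC.
by apply: measurable_funS (continuous_measurable2 cf).
Qed.

Lemma Rintegral2_sum (I : Type) (s : seq I) (f : I -> R * R -> R) (r : R) (E : set (TR * TR)) :
  (forall i, continuous (f i)) -> measurable E -> E `<=` square r ->
  \int[lam2]_(z in E) (\sum_(i <- s) f i z) = \sum_(i <- s) \int[lam2]_(z in E) f i z.
Proof.
move=> cf mE Er.
elim: s => [|i s IHs].
  by under eq_Rintegral do rewrite big_nil; rewrite big_nil Rintegral_cst// mul0r.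
under eq_Rintegral do rewrite big_cons.
rewrite RintegralD//; first by rewrite IHs big_cons.
- exact: (@continuous_integrable2 _ r).
- apply: (@continuous_integrable2 _ r) => //; elim: s {IHs} => [|j s IHs].
    by under eq_fun do rewrite big_nil; exact: cst_continuous.
  by under eq_fun do rewrite big_cons; exact: contD.
Qed.

End star.

(** * Cells and the sharp divergence bound *)

Section cell.
Context {R : realType}.
Notation TR := (measurableTypeR R).

Definition cell (h k1 k2 : R) (z : R * R) := bspl k1 (h^-1 * z.1) * bspl k2 (h^-1 * z.2).
Definition cell1 (h k1 k2 : R) (z : R * R) := h^-1 * dbspl k1 (h^-1 * z.1) * bspl k2 (h^-1 * z.2).
Definition cell2 (h k1 k2 : R) (z : R * R) := bspl k1 (h^-1 * z.1) * (h^-1 * dbspl k2 (h^-1 * z.2)).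

Lemma C1_cell (h k1 k2 : R) : C1 (cell h k1 k2) (cell1 h k1 k2) (cell2 h k1 k2).
Proof.
have A := @C1_fst R (bspl k1) (dbspl k1) h^-1 0 (is_derive_bspl k1) (@continuous_dbspl R k1).
have B := @C1_snd R (bspl k2) (dbspl k2) h^-1 0 (is_derive_bspl k2) (@continuous_dbspl R k2).
apply: (C1_eq (C1_mul A B)) => z; rewrite /cell /cell1 /cell2 /cst !addr0 //.
  by rewrite mulr0 addr0.
by rewrite mul0r add0r.
Qed.

Lemma bspl_le1 (k t : R) : bspl k t <= 1.
Proof.
rewrite /bspl; case: (lerP (t - k) 0) => tk; last first.
  have [-> _] := @step_ge1 R (t - k + 1) ltac:(lra).
  by rewrite gerBl; have [<- _] := @step_le0 R 0 (lexx _); rewrite step_homo// ltW.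
have [-> _] := step_le0 tk; rewrite subr0.
by have [s1 _] := @step_ge1 R 1 (lexx _); rewrite -[leRHS]s1 step_homo// gerDr.
Qed.

Lemma cell_bounds (h k1 k2 : R) z : 0 < h -> [/\ 0 <= cell h k1 k2 z <= 1,
  `|cell1 h k1 k2 z| <= 2 / h & `|cell2 h k1 k2 z| <= 2 / h].
Proof.
move=> h0; have b0 := @bspl_ge0 R; have b1 := bspl_le1; have d := @dbspl_bound R.
split.
- by rewrite /cell; apply/andP; split; [apply: mulr_ge0; exact: bspl_ge0|rewrite -[leRHS]mulr1; apply: ler_pM => //; exact: bspl_ge0].
- rewrite /cell1 !normrM (ger0_norm (b0 _ _)) ger0_norm ?invr_ge0 ?(ltW h0)//.
  by rewrite -[leRHS]mulr1 ler_pM ?mulr_ge0 ?invr_ge0 ?(ltW h0)// mulrC ler_wpM2r ?invr_ge0 ?(ltW h0).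
- rewrite /cell2 !normrM (ger0_norm (b0 _ _)) (@ger0_norm _ h^-1) ?invr_ge0 ?(ltW h0)//.
  by rewrite -[leRHS]mul1r ler_pM ?mulr_ge0 ?invr_ge0 ?(ltW h0)// mulrC ler_wpM2r ?invr_ge0 ?(ltW h0).
Qed.

Lemma cell_out (h k1 k2 : R) z : 0 < h ->
  ~ (`|z.1 - h * k1| <= h /\ `|z.2 - h * k2| <= h) ->
  [/\ cell h k1 k2 z = 0, cell1 h k1 k2 z = 0 & cell2 h k1 k2 z = 0].
Proof.
move=> h0 out; rewrite /cell /cell1 /cell2.
have far (x k : R) : ~ `|x - h * k| <= h -> bspl k (h^-1 * x) = 0 /\ dbspl k (h^-1 * x) = 0.
  move=> /negP; rewrite -ltNge => xk; apply: bspl_out.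
  rewrite (_ : _ - k = h^-1 * (x - h * k)); last by field; exact: lt0r_neq0.
  by rewrite normrM normfV (gtr0_norm h0) ler_pdivlMl// mulr1 ltW.
have [/far[-> ->]|z1] := pselect (~ `|z.1 - h * k1| <= h); first by rewrite !(mul0r, mulr0).
have [/far[-> ->]|z2] := pselect (~ `|z.2 - h * k2| <= h); first by rewrite !(mul0r, mulr0).
by exfalso; apply: out; split; exact: contrapT.
Qed.

Lemma Rintegral_lin4 (E : set (TR * TR)) (rho a : R) (g f1 f2 f3 f4 : R * R -> R) :
  measurable E -> E `<=` square rho ->
  continuous f1 -> continuous f2 -> continuous f3 -> continuous f4 ->
  (forall z, g z = a * f1 z + f2 z + (f3 z - f4 z)) ->
  `|\int[lam2]_(z in E) g z| <= `|a| * `|\int[lam2]_(z in E) f1 z| +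
    `|\int[lam2]_(z in E) f2 z| + `|\int[lam2]_(z in E) f3 z| + `|\int[lam2]_(z in E) f4 z|.
Proof.
move=> mE Er c1 c2 c3 c4 gE.
have ci h : continuous h -> lam2.-integrable E (EFin \o h) by move=> ch; exact: (@continuous_integrable2 _ _ rho).
have i1 := ci _ c1; have i2 := ci _ c2; have i3 := ci _ c3; have i4 := ci _ c4.
have c0 : continuous (fun z => a * f1 z) by apply: contM => //; exact: cst_continuous.
have -> : \int[lam2]_(z in E) g z = a * \int[lam2]_(z in E) f1 z + \int[lam2]_(z in E) f2 z +
    (\int[lam2]_(z in E) f3 z - \int[lam2]_(z in E) f4 z).
  rewrite -RintegralZl// -RintegralD//; last exact: ci.
  rewrite -RintegralB// -RintegralD//; last 2 first.
  - by apply: ci; exact: contD.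
  - by apply: ci; exact: contB.
  by apply: eq_Rintegral.
rewrite (le_trans (ler_normD _ _))// -addrA lerD//; last exact: ler_normB.
by rewrite (le_trans (ler_normD _ _))// normrM.
Qed.

Section cell_bound.
Variables (J : eqType) (s : seq J) (p v : J -> R * R) (len : J -> R).
Variables (T : set (R * R)) (E : set (TR * TR)) (eps M rho B : R).

(** On a cell of size [h] the field is almost the constant (F1, F2). Slicing in exactly that
    direction yields the flux |V1 v2 - V2 v1| with factor 1, whereas slicing along the axes would
    give |V1 v2| + |V2 v1|. The rest, the cell times V - F, has size [osc] and is bounded crudely.
    [E1] and [E2] are the costs from [direction_bound] per unit of [eps], with slopes at most B / h
    and 1; the equations keep these constants opaque. *)
Lemma cell_bound (h k1 k2 osc E1 E2 C2 : R) (V1 V11 V12 V2 V21 V22 : R * R -> R) :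
  osc = h * (2 * B + 2) ->
  E1 = 2 / h * ((1 + B / h) * (5 * M + 6)) ->
  E2 = (2 / h * (2 * B + 1) + B) * ((1 + 1) * (5 * M + 6)) ->
  C2 = 2 * (1 + B / h) * (B + 1) * (1 + E1) + 2 * M * (B + 1) * E1 + (4 * M + 12) * E2 ->
  0 <= eps <= 1 -> 0 <= M -> 0 <= rho -> 0 <= B ->
  sampled s p v len T eps M rho ->
  measurable E -> E `<=` square rho -> constant_off T E -> 0 < h <= 1 ->
  square rho (h * k1, h * k2) ->
  C1 V1 V11 V12 -> C1 V2 V21 V22 ->
  (forall z, square (rho + 1) z -> [/\ `|V1 z| <= B, `|V11 z| <= B & `|V12 z| <= B]) ->
  (forall z, square (rho + 1) z -> [/\ `|V2 z| <= B, `|V21 z| <= B & `|V22 z| <= B]) ->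
  `|\int[lam2]_(z in E) (cell1 h k1 k2 z * V1 z + cell h k1 k2 z * V11 z +
      (cell2 h k1 k2 z * V2 z + cell h k1 k2 z * V22 z))| <=
  \sum_(j <- s) len j * (cell h k1 k2 (p j) *
      (`|V1 (p j) * (v j).2 - V2 (p j) * (v j).1| + osc * (6 * M + 12)) + C2 * eps).
Proof.
move=> oscE E1E E2E C2E eps01 M0 rho0 B0 sam mE Er sep /andP[h0 h1] cr CV1 CV2 VB1 VB2.
have /andP[e0 e1] := eps01.
set c := (h * k1, h * k2) in cr *.
have cr1 : square (rho + 1) c.
  by case: cr => a b; split; [rewrite (le_trans a)|rewrite (le_trans b)] => //; rewrite lerDl.
have [V1c _ _] := VB1 _ cr1; have [V2c _ _] := VB2 _ cr1.
(* Keeping |F1| at least [h] bounds the slope [m] by B / h, at the price of an error of at most 2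
   h. *)
pose F1 := if `|V1 c| < h then h else V1 c.
pose F2 := V2 c.
have hF1 : h <= `|F1| by rewrite /F1; case: (ltP `|V1 c| h) => // _; rewrite gtr0_norm.
have F1n0 : F1 != 0 by rewrite -normr_gt0 (lt_le_trans h0).
have F1B : `|F1| <= B + 1.
  by rewrite /F1; case: (ltP `|V1 c| h) => _; [rewrite gtr0_norm// (le_trans h1)// lerDr|rewrite (le_trans V1c)// lerDl].
have F1V : `|V1 c - F1| <= 2 * h.
  rewrite /F1; case: (ltP `|V1 c| h) => V1h; last by rewrite subrr normr0 mulr_ge0// ltW.
  by rewrite (le_trans (ler_normB _ _))// (gtr0_norm h0); move: V1h; lra.
set m := F2 / F1.
have mm0 : `|m| <= B / h.
  by rewrite normrM normfV ler_pM ?invr_ge0// lef_pV2// posrE ?normr_gt0.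
have CX := C1_cell h k1 k2.
have Xout z : ~ square (rho + 1) z -> [/\ cell h k1 k2 z = 0, cell1 h k1 k2 z = 0 & cell2 h k1 k2 z = 0].
  move=> zr; apply: cell_out => // -[z1 z2]; apply: zr; case: cr => /= c1 c2; split.
    by rewrite -(subrK (h * k1) z.1) (le_trans (ler_normD _ _))// addrC lerD// (le_trans z1).
  by rewrite -(subrK (h * k2) z.2) (le_trans (ler_normD _ _))// addrC lerD// (le_trans z2).
have CR1 := C1_mul CX (C1_sub CV1 (C1_cst F1)).
have CR2 := C1_mul CX (C1_sub CV2 (C1_cst F2)).
have rr : rho + 1 <= rho + 1 by [].
have h20 : 0 <= 2 / h by rewrite divr_ge0// ltW.
have B2 : 0 <= 2 / h * (2 * B + 1) + B by rewrite addr_ge0// mulr_ge0// addr_ge0// mulr_ge0.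
have near_c z : square (rho + 1) z -> cell h k1 k2 z != 0 -> `|V1 z - F1| <= osc /\ `|V2 z - F2| <= osc.
  move=> zr X0.
  have [|/cell_out[]// + _ _] := pselect (`|z.1 - h * k1| <= h /\ `|z.2 - h * k2| <= h); last first.
    by move=> X0'; move: X0; rewrite X0' eqxx.
  move=> [z1 z2].
  have b1 := C1_lipschitz CV1 cr1 zr (fun w wr => let: And3 _ a b := VB1 w wr in conj a b).
  have b2 := C1_lipschitz CV2 cr1 zr (fun w wr => let: And3 _ a b := VB2 w wr in conj a b).
  have zz : B * (`|z.1 - c.1| + `|z.2 - c.2|) <= B * (2 * h).
    by rewrite ler_wpM2l//= mulr_natl mulr2n lerD.
  split.
    rewrite (_ : V1 z - F1 = (V1 z - V1 c) + (V1 c - F1)); last by ring.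
    rewrite (le_trans (ler_normD _ _))// (_ : osc = B * (2 * h) + 2 * h); last by rewrite oscE; ring.
    by rewrite lerD// (le_trans b1).
  rewrite (le_trans b2)// (le_trans zz)//.
  by rewrite (_ : osc = B * (2 * h) + 2 * h) ?lerDl ?mulr_ge0 ?(ltW h0)// oscE; ring.
have db1 := @direction_bound R J s p v len T E eps M rho _ _ _ m (B / h) (2 / h) (rho + 1)
  eps01 M0 rho0 sam mE sep mm0 h20 rr CX Xout (fun z => let: And3 _ a b := cell_bounds k1 k2 z h0 in conj a b).
have RB (V Va Vb : R * R -> R) F : `|F| <= B + 1 ->
    (forall z, square (rho + 1) z -> [/\ `|V z| <= B, `|Va z| <= B & `|Vb z| <= B]) ->
    forall z, `|cell1 h k1 k2 z * (V z - cst F z) + cell h k1 k2 z * (Va z - cst 0 z)| <= 2 / h * (2 * B + 1) + B /\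
      `|cell2 h k1 k2 z * (V z - cst F z) + cell h k1 k2 z * (Vb z - cst 0 z)| <= 2 / h * (2 * B + 1) + B.
  move=> FB VB z.
  have [zr|/Xout[-> -> ->]] := pselect (square (rho + 1) z); last by rewrite !mul0r addr0 normr0.
  have [/andP[X0 X1] b1 b2] := cell_bounds k1 k2 z h0; have [a0 a1 a2] := VB z zr.
  have VF : `|V z - cst F z| <= 2 * B + 1.
    by rewrite (le_trans (ler_normB _ _))// (_ : 2 * B + 1 = B + (B + 1)) ?lerD//; ring.
  have Xa (w : R) : `|w| <= B -> `|cell h k1 k2 z * (w - cst 0 z)| <= B.
    by rewrite /cst subr0 normrM ger0_norm// => wB; rewrite -[leRHS]mul1r ler_pM.
  by split; rewrite (le_trans (ler_normD _ _))// lerD ?Xa// normrM ler_pM.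
have Xr0 V Va Vb F z : ~ square (rho + 1) z -> [/\ cell h k1 k2 z * (V z - F) = 0,
    cell1 h k1 k2 z * (V z - F) + cell h k1 k2 z * (Va z - 0) = 0 &
    cell2 h k1 k2 z * (V z - F) + cell h k1 k2 z * (Vb z - 0) = 0].
  by move=> /Xout[-> -> ->]; rewrite !mul0r addr0.
have F2B : `|F2| <= B + 1 by rewrite (le_trans V2c)// lerDl.
have n01 : `|0 : R| <= 1 by rewrite normr0.
have n11 : `|1 : R| <= 1 by rewrite normr1.
have db2 := @direction_bound R J s p v len T E eps M rho _ _ _ 0 1 _ (rho + 1)
  eps01 M0 rho0 sam mE sep n01 B2 rr CR1 (Xr0 _ _ _ _) (RB _ _ _ _ F1B VB1).
have db3 := @direction_bound R J s p v len T E eps M rho _ _ _ 0 1 _ (rho + 1)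
  eps01 M0 rho0 sam mE sep n01 B2 rr CR2 (Xr0 _ _ _ _) (RB _ _ _ _ F2B VB2).
(* No slope is vertical: the derivative of the second remainder in the second variable is taken
   along slope 1 minus along slope 0. *)
have db4 := @direction_bound R J s p v len T E eps M rho _ _ _ 1 1 _ (rho + 1)
  eps01 M0 rho0 sam mE sep n11 B2 rr CR2 (Xr0 _ _ _ _) (RB _ _ _ _ F2B VB2).
have [_ cX cX1 cX2] := CX; have [_ _ cR11 cR12] := CR1; have [_ _ cR21 cR22] := CR2.
have cc (x : R) : continuous (fun _ : R * R => x) by exact: cst_continuous.
apply: le_trans.
  apply: (@Rintegral_lin4 E rho F1 _ _ _ _ _ mE Er (contD cX1 (contM (cc m) cX2))
    (contD cR11 (contM (cc 0) cR12)) (contD cR21 (contM (cc 1) cR22)) (contD cR21 (contM (cc 0) cR22))) => z.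
  by rewrite /cst /m; field; exact: F1n0.
apply: (le_trans (lerD (lerD (lerD (ler_wpM2l (normr_ge0 F1) db1) db2) db4) db3)).
rewrite mulr_sumr -!big_split/= big_seq [leRHS]big_seq; apply: ler_sum => j js.
have [samp _ _] := sam; have [/andP[l0 l1] v1 v2 pj] := samp _ js.
have pj1 : square (rho + 1) (p j).
  by case: pj => a b; split; [rewrite (le_trans a)|rewrite (le_trans b)] => //; rewrite lerDl.
have [/andP[X0 X1] _ _] := cell_bounds k1 k2 (p j) h0.
have osc0 : 0 <= osc by rewrite oscE mulr_ge0 ?(ltW h0)// addr_ge0// mulr_ge0.
have n12 : `|cell h k1 k2 (p j) * (V1 (p j) - cst F1 (p j))| <= cell h k1 k2 (p j) * osc /\
           `|cell h k1 k2 (p j) * (V2 (p j) - cst F2 (p j))| <= cell h k1 k2 (p j) * osc.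
  have [X00|Xn0] := eqVneq (cell h k1 k2 (p j)) 0; first by rewrite X00 !mul0r normr0.
  have [a b] := near_c _ pj1 Xn0.
  by split; rewrite normrM (ger0_norm X0) ler_wpM2l.
case: n12 => n1 n2.
have bh0 : 0 <= B / h by rewrite divr_ge0// ltW.
have E10 : 0 <= E1 by rewrite E1E mulr_ge0// mulr_ge0// addr_ge0// mulr_ge0.
have E20 : 0 <= E2 by rewrite E2E mulr_ge0// mulr_ge0// addr_ge0// mulr_ge0.
clear db1 db2 db3 db4.
rewrite /cst in n1 n2.
pose a := `|F1 * (v j).2 - F2 * (v j).1|.
have aE : `|F1| * `|(v j).2 - m * (v j).1| = a.
  by rewrite -normrM /a /m; congr `|_|; field; exact: F1n0.
have aB : a <= 2 * M * (B + 1).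
  rewrite /a (le_trans (ler_normB _ _))// !normrM (_ : 2 * M * (B + 1) = (B + 1) * M + (B + 1) * M); last by ring.
  by rewrite lerD// ler_pM.
pose W := `|V1 (p j) * (v j).2 - V2 (p j) * (v j).1|.
have aX : cell h k1 k2 (p j) * a <= cell h k1 k2 (p j) * (W + 2 * M * osc).
  have [->|Xn0] := eqVneq (cell h k1 k2 (p j)) 0; first by rewrite !mul0r.
  have [b1 b2] := near_c _ pj1 Xn0; rewrite ler_wpM2l// /a /W.
  rewrite (_ : F1 * _ - _ = V1 (p j) * (v j).2 - V2 (p j) * (v j).1 -
     ((V1 (p j) - F1) * (v j).2 - (V2 (p j) - F2) * (v j).1)); last by ring.
  rewrite (le_trans (ler_normB _ _))// lerD2l (le_trans (ler_normB _ _))// !normrM.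
  by rewrite (_ : 2 * M * osc = osc * M + osc * M) ?lerD ?ler_pM//; ring.
have w0 : `|(v j).2 - 0 * (v j).1| <= M by rewrite mul0r subr0.
have w1 : `|(v j).2 - 1 * (v j).1| <= 2 * M.
  by rewrite mul1r (le_trans (ler_normB _ _))// mulr_natl mulr2n lerD.
set X := cell h k1 k2 (p j) in X0 X1 n1 n2 aX *.
clearbody X.
have -> : `|X| = X by rewrite ger0_norm.
set N1 := `|_ * (V1 _ - _)|; set N2 := `|_ * (V2 _ - _)|.
rewrite -/N1 in n1; rewrite -/N2 in n2.
move: w0 w1; set d0 := `|_ - 0 * _|; set d1 := `|_ - 1 * _| => w0 w1.
rewrite (_ : 2 / h * ((1 + B / h) * (5 * M + 6) * eps) = E1 * eps); last by rewrite E1E !mulrA.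
rewrite (_ : (2 / h * (2 * B + 1) + B) * ((1 + 1) * (5 * M + 6) * eps) = E2 * eps); last by rewrite E2E !mulrA.
rewrite (_ : `|F1| * (len j * _ * _) = len j * ((a + 2 * eps * (1 + B / h) * `|F1|) * (X + E1 * eps))); last by rewrite -aE; ring.
rewrite -!mulrA -!mulrDr ler_wpM2l// !mulrA.
have E1eps : E1 * eps <= E1 by rewrite ler_piMr.
have XE : X + E1 * eps <= 1 + E1 by rewrite lerD.
have X0E : 0 <= X + E1 * eps by rewrite addr_ge0// mulr_ge0.
have a0 : 0 <= a by rewrite /a.
have t1 : (a + 2 * eps * (1 + B / h) * `|F1|) * (X + E1 * eps) <=
    X * (W + 2 * M * osc) + 2 * M * (B + 1) * (E1 * eps) + 2 * eps * (1 + B / h) * (B + 1) * (1 + E1).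
  rewrite mulrDl [a * _]mulrDr lerD// ?lerD//; first by rewrite mulrC.
  - by rewrite ler_wpM2r// mulr_ge0.
  - rewrite ler_pM// ?mulr_ge0// ?addr_ge0//.
    by rewrite ler_wpM2l// ?mulr_ge0// ?addr_ge0.
(* Slope 0 for both remainders and slope 1 for the second give (M + 4) + (M + 4) + (2 M + 4); with
   the 2 M from freezing the field this makes the 6 M + 12 of the statement. *)
have t2 x n y : 0 <= x -> x <= y -> 0 <= n -> n <= X * osc ->
    (x + 2 * eps * (1 + 1)) * (n + E2 * eps) <= (y + 4) * (X * osc + E2 * eps).
  move=> x0 xy n0 nX; rewrite ler_pM// ?addr_ge0// ?mulr_ge0// ?lerD//.
  by rewrite (_ : 2 * eps * (1 + 1) = 4 * eps) ?ler_piMr//; ring.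
have := t2 _ _ _ (normr_ge0 _) w0 (normr_ge0 _) n1; rewrite -/d0 -/N1 => t3.
have := t2 _ _ _ (normr_ge0 _) w1 (normr_ge0 _) n2; rewrite -/d1 -/N2 => t4.
have := t2 _ _ _ (normr_ge0 _) w0 (normr_ge0 _) n2; rewrite -/d0 -/N2 => t5.
apply: (le_trans (lerD (lerD (lerD t1 t3) t4) t5)).
rewrite -/W C2E; clearbody W; move: (B / h) => bh.
by rewrite le_eqVlt; apply/orP; left; apply/eqP; ring.
Qed.

End cell_bound.
(** On [E] the cells sum to 1 and their derivatives to 0, so the integrals of [cell_bound] add up to
    that of the divergence. The size [h] is fixed first, to make the oscillation cost at most e / 2;
    then [eps] is made small against the number of cells times [C2]. As [eps0] depends only on the
    four constants, the bound is uniform in the field and the sample. *)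
Lemma star (B M rho e : R) : 0 <= B -> 0 <= M -> 0 < rho -> 0 < e ->
  exists2 eps0 : R, 0 < eps0 <= 1 &
  forall (J : eqType) (s : seq J) (p v : J -> R * R) (len : J -> R)
    (T : set (R * R)) (E : set (TR * TR)) (eps : R) (V1 V11 V12 V2 V21 V22 : R * R -> R),
  0 <= eps <= eps0 -> sampled s p v len T eps M rho ->
  measurable E -> E `<=` square rho -> constant_off T E ->
  C1 V1 V11 V12 -> C1 V2 V21 V22 ->
  (forall z, square (rho + 1) z -> [/\ `|V1 z| <= B, `|V11 z| <= B & `|V12 z| <= B]) ->
  (forall z, square (rho + 1) z -> [/\ `|V2 z| <= B, `|V21 z| <= B & `|V22 z| <= B]) ->
  `|\int[lam2]_(z in E) (V11 z + V22 z)| <=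
    \sum_(j <- s) len j * `|V1 (p j) * (v j).2 - V2 (p j) * (v j).1| + e.
Proof.
move=> B0 M0 rho0 e0.
pose q := (2 * B + 2) * (6 * M + 12).
have q0 : 0 < q by rewrite mulr_gt0// ltr_wpDl// mulr_ge0.
(* Makes h (1 + q / (e / 2)) < 1, which contains both h <= 1 and h q <= e / 2. *)
have [n nq] : exists n : nat, rho * (1 + q / (e / 2)) < n.+1%:R.
  have := truncnS_gt (rho * (1 + q / (e / 2))).
  by move=> H; eexists; exact: H.
pose h := rho / n.+1%:R.
have h0 : 0 < h by rewrite divr_gt0.
have hq : h * (1 + q / (e / 2)) < 1 by rewrite /h mulrAC ltr_pdivrMr// mul1r.
have qe0 : 0 < q / (e / 2) by rewrite divr_gt0// divr_gt0.
have h1 : h <= 1 by move: hq (mulr_gt0 h0 qe0); rewrite mulrDr mulr1; clear; lra.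
have hqe : h * q <= e / 2.
  have : h * (q / (e / 2)) <= 1 by move: hq; rewrite mulrDr mulr1; move: h0; clear; lra.
  by rewrite mulrA ler_pdivrMr ?mul1r// divr_gt0.
pose osc := h * (2 * B + 2).
pose E1 := 2 / h * ((1 + B / h) * (5 * M + 6)).
pose E2 := (2 / h * (2 * B + 1) + B) * ((1 + 1) * (5 * M + 6)).
pose C2 := 2 * (1 + B / h) * (B + 1) * (1 + E1) + 2 * M * (B + 1) * E1 + (4 * M + 12) * E2.
have C20 : 0 <= C2.
  have i0 : 0 <= h^-1 by rewrite invr_ge0 ltW.
  by rewrite /C2 /E2 /E1 !(addr_ge0, mulr_ge0).
pose I := ('I_(n.+1).*2.+1 * 'I_(n.+1).*2.+1)%type.
pose K : R := #|{: I}|%:R.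
pose k (i : 'I_(n.+1).*2.+1) : R := i%:R - n.+1%:R.
pose D : R := K * C2 + 1.
have D0 : 0 < D by rewrite ltr_wpDl// mulr_ge0.
exists (Num.min 1 (e / 2 / D)).
  by rewrite lt_min ltr01 divr_gt0 ?divr_gt0//= ge_min lexx.
move=> J s p v len T E eps V1 V11 V12 V2 V21 V22 /andP[eps0]; rewrite le_min => /andP[eps1 epsD].
move=> sam mE Er cst CV1 CV2 VB1 VB2.
have kr i : square rho (h * k i.1, h * k i.2).
  have kn j : `|h * k j| <= rho.
    rewrite normrM (gtr0_norm h0) /h mulrAC ler_pdivrMr// ler_wpM2l ?(ltW rho0)//.
    rewrite /k; case: j => j /=; rewrite ltnS -(ler_nat R) -addnn natrD => jn.
    by rewrite ler_norml lerBrDr addNr ler0n lerBlDr.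
  by split; exact: kn.
have CBi (i : I) := @cell_bound J s p v len T E eps M rho B h (k i.1) (k i.2) osc E1 E2 C2
  V1 V11 V12 V2 V21 V22 erefl erefl erefl erefl (introT andP (conj eps0 eps1)) M0 (ltW rho0) B0 sam
  mE Er cst (introT andP (conj h0 h1)) (kr i) CV1 CV2 VB1 VB2.
have zn z : square rho z -> `|h^-1 * z.1| <= n.+1%:R /\ `|h^-1 * z.2| <= n.+1%:R.
  move=> [z1 z2]; have hn x : `|x| <= rho -> `|h^-1 * x| <= n.+1%:R.
    rewrite normrM gtr0_norm ?invr_gt0// ler_pdivrMl// /h mulrAC -mulrA divff ?mulr1//.
  by split; exact: hn.
have sum1 z : square rho z -> [/\ \sum_(i : I) cell h (k i.1) (k i.2) z = 1,
    \sum_(i : I) cell1 h (k i.1) (k i.2) z = 0 & \sum_(i : I) cell2 h (k i.1) (k i.2) z = 0].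
  move=> /zn[/sum_bspl[a1 b1] /sum_bspl[a2 b2]].
  have pairE (f g : 'I_(n.+1).*2.+1 -> R) : \sum_(i : I) f i.1 * g i.2 = (\sum_i f i) * (\sum_i g i).
    rewrite big_distrl/= -(pair_bigA _ (fun i j => f i * g j))/=.
    by apply: eq_bigr => i _; rewrite mulr_sumr.
  split.
  - rewrite (eq_bigr (fun i : I => bspl (k i.1) (h^-1 * z.1) * bspl (k i.2) (h^-1 * z.2)))//.
    by rewrite (pairE (fun i => bspl (k i) (h^-1 * z.1)) (fun i => bspl (k i) (h^-1 * z.2))) a1 a2 mulr1.
  - rewrite (eq_bigr (fun i : I => (h^-1 * dbspl (k i.1) (h^-1 * z.1)) * bspl (k i.2) (h^-1 * z.2)))//.
    by rewrite (pairE (fun i => h^-1 * dbspl (k i) (h^-1 * z.1)) (fun i => bspl (k i) (h^-1 * z.2))) -mulr_sumr b1 mulr0 mul0r.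
  - rewrite (eq_bigr (fun i : I => bspl (k i.1) (h^-1 * z.1) * (h^-1 * dbspl (k i.2) (h^-1 * z.2))))//.
    by rewrite (pairE (fun i => bspl (k i) (h^-1 * z.1)) (fun i => h^-1 * dbspl (k i) (h^-1 * z.2))) -mulr_sumr b2 !mulr0.
have [_ cV1 cV11 _] := CV1; have [_ cV2 _ cV22] := CV2.
pose G (i : I) z := cell1 h (k i.1) (k i.2) z * V1 z + cell h (k i.1) (k i.2) z * V11 z +
      (cell2 h (k i.1) (k i.2) z * V2 z + cell h (k i.1) (k i.2) z * V22 z).
have cG i : continuous (G i).
  have [_ cX cX1 cX2] := C1_cell h (k i.1) (k i.2).
  exact: (contD (contD (contM cX1 cV1) (contM cX cV11)) (contD (contM cX2 cV2) (contM cX cV22))).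
have -> : \int[lam2]_(z in E) (V11 z + V22 z) = \int[lam2]_(z in E) (\sum_(i : I) G i z).
  apply: eq_Rintegral => z; rewrite inE => /Er /sum1[s1 s2 s3].
  by rewrite /G !big_split/= -!mulr_suml s1 s2 s3 !mul0r !mul1r !add0r.
rewrite (@Rintegral2_sum _ _ _ _ rho)//.
apply: (le_trans (ler_norm_sum _ _ _)); apply: (le_trans (ler_sum _ (fun i _ => CBi i))).
rewrite exchange_big/=.
have [samp slen _] := sam.
apply: (@le_trans _ _ (\sum_(j <- s) (len j * `|V1 (p j) * (v j).2 - V2 (p j) * (v j).1| + len j * e))).
  rewrite big_seq [leRHS]big_seq; apply: ler_sum => j js.
  have [/andP[l0 _] _ _ /sum1[s1 _ _]] := samp _ js.
  rewrite -mulr_sumr -mulrDr ler_wpM2l// big_split/= -mulr_suml s1 mul1r -addrA lerD2l.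
  rewrite sumr_const -[X in _ + X]mulr_natl -/K [leRHS]splitr lerD//.
    by rewrite (_ : osc * _ = h * q)// /osc /q mulrA.
  move: epsD; rewrite ler_pdivlMr// mulrC => /(le_trans _); apply.
  by rewrite mulrA ler_wpM2r// /D lerDl.
rewrite big_split/= lerD2l -mulr_suml ler_piMl// ltW//.
Qed.

End cell.

(** * Charts and the reflection kernel *)

Section chart.
Context {R : realType}.

(** The factor [k ^+ 3] equals [k]; it arises from the [k ^+ 2] of the triple product and the [k] of
    the cross product fields of a chart. *)
Lemma unit_inner (k a1 a2 a3 x y t : R) : curvature k ->
  a3 ^+ 2 + k * (a1 ^+ 2 + a2 ^+ 2) = 1 -> t ^+ 2 + k * (x ^+ 2 + y ^+ 2) = 1 ->
  (k != 1 -> 0 < a3) -> (k != 1 -> 0 < t) ->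
  a3 * t + k ^+ 3 * (a1 * x + a2 * y) =
  1 - k * ((x - a1) ^+ 2 + (y - a2) ^+ 2 + k * (t - a3) ^+ 2) / 2.
Proof.
move=> hk; move: hk; rewrite !inE => /or3P[] /eqP ->; first by move=> h1 h2 _ _; lra.
- rewrite eq_sym oner_eq0 => h1 h2 /(_ isT) p1 /(_ isT) p2.
  have -> : a3 = 1 by nra.
  have -> : t = 1 by nra.
  lra.
- by move=> h1 h2 _ _; lra.
Qed.

(** Both sides are the squared generalized sine of the distance. For k = 1 and with p the inner
    product of the two points, N = 2 - 2 p turns the right-hand side into 1 - p^2; for k = -1 signs
    change, and for k = 0 it is the squared distance. *)
Lemma triple_chord (k a1 a2 a3 x y t : R) : curvature k ->
  a3 ^+ 2 + k * (a1 ^+ 2 + a2 ^+ 2) = 1 -> t ^+ 2 + k * (x ^+ 2 + y ^+ 2) = 1 ->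
  (k != 1 -> 0 < a3) -> (k != 1 -> 0 < t) ->
  let n1 := a1 - x in let n2 := a2 - y in let n3 := a3 - t in
  let A1 := k ^+ 2 * (a2 * n3) - a3 * n2 in
  let A2 := a3 * n1 - k ^+ 2 * (a1 * n3) in
  let A3 := k ^+ 2 * (a1 * n2 - a2 * n1) in
  let N := (x - a1) ^+ 2 + (y - a2) ^+ 2 + k * (t - a3) ^+ 2 in
  k * x * (n2 * A3 - k * n3 * A2) + k * y * (k * n3 * A1 - n1 * A3) +
  t * (n1 * A2 - n2 * A1) = N - k * N ^+ 2 / 4.
Proof.
move=> hk /=; move: hk; rewrite !inE => /or3P[] /eqP ->.
- move=> h1 h2 _ _.
  pose p := a3 * t - (a1 * x + a2 * y).
  have h1' : a3 ^+ 2 = 1 + (a1 ^+ 2 + a2 ^+ 2) by lra.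
  have h2' : t ^+ 2 = 1 + (x ^+ 2 + y ^+ 2) by lra.
  have -> : (x - a1) ^+ 2 + (y - a2) ^+ 2 + -1 * (t - a3) ^+ 2 = 2 * p - 2.
    by rewrite /p; lra.
  transitivity (p ^+ 2 - 1); last by field.
  rewrite /p; ring: h1' h2'.
- rewrite eq_sym oner_eq0 => h1 h2 /(_ isT) p1 /(_ isT) p2.
  have -> : a3 = 1 by nra.
  have -> : t = 1 by nra.
  by field.
- move=> h1 h2 _ _.
  pose p := a3 * t + (a1 * x + a2 * y).
  have h1' : a3 ^+ 2 = 1 - (a1 ^+ 2 + a2 ^+ 2) by lra.
  have h2' : t ^+ 2 = 1 - (x ^+ 2 + y ^+ 2) by lra.
  have -> : (x - a1) ^+ 2 + (y - a2) ^+ 2 + 1 * (t - a3) ^+ 2 = 2 - 2 * p.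
    by rewrite /p; lra.
  transitivity (1 - p ^+ 2); last by field.
  rewrite /p; ring: h1' h2'.
Qed.

(** (k X, k Y, Z) is the conormal of the surface in R^3; the three [ch_cross] fields say that the
    Euclidean cross product of the partial derivatives is [dens] times it. [ch_chord] has to be
    recorded because for k = -1 the ambient form is indefinite. *)
Record chart (k : R) := Chart {
  cX : R * R -> R; cY : R * R -> R; cZ : R * R -> R;
  cX1 : R * R -> R; cX2 : R * R -> R; cY1 : R * R -> R; cY2 : R * R -> R;
  cZ1 : R * R -> R; cZ2 : R * R -> R;
  cX11 : R * R -> R; cX12 : R * R -> R; cX22 : R * R -> R;
  cY11 : R * R -> R; cY12 : R * R -> R; cY22 : R * R -> R;
  cZ11 : R * R -> R; cZ12 : R * R -> R; cZ22 : R * R -> R;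
  dens : R * R -> R;
  chX : C1 cX cX1 cX2; chX1 : C1 cX1 cX11 cX12; chX2 : C1 cX2 cX12 cX22;
  chY : C1 cY cY1 cY2; chY1 : C1 cY1 cY11 cY12; chY2 : C1 cY2 cY12 cY22;
  chZ : C1 cZ cZ1 cZ2; chZ1 : C1 cZ1 cZ11 cZ12; chZ2 : C1 cZ2 cZ12 cZ22;
  ch_surface : forall z, cZ z ^+ 2 + k * (cX z ^+ 2 + cY z ^+ 2) = 1;
  ch_crossX : forall z, cY1 z * cZ2 z - cZ1 z * cY2 z = dens z * (k * cX z);
  ch_crossY : forall z, cZ1 z * cX2 z - cX1 z * cZ2 z = dens z * (k * cY z);
  ch_crossZ : forall z, cX1 z * cY2 z - cY1 z * cX2 z = dens z * cZ z;
  ch_pos : forall z, k != 1 -> 0 < cZ z;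
  dens_gt0 : forall z, 0 < dens z;
  dens_cont : continuous dens;
  ch_chord : forall z w, 0 <= (cX z - cX w) ^+ 2 + (cY z - cY w) ^+ 2 + k * (cZ z - cZ w) ^+ 2 }.

Variables (k : R) (c : chart k) (d : R).
Hypotheses (hk : curvature k) (d0 : 0 < d).

Notation X := (cX c). Notation Y := (cY c). Notation Z := (cZ c).

Definition chord (a : R * R * R) (z : R * R) : R :=
  (X z - a.1.1) ^+ 2 + (Y z - a.1.2) ^+ 2 + k * (Z z - a.2) ^+ 2.

Definition emb (z : R * R) : R * R * R := (X z, Y z, Z z).
Definition emb1 (z : R * R) : R * R * R := (cX1 c z, cY1 c z, cZ1 c z).
Definition emb2 (z : R * R) : R * R * R := (cX2 c z, cY2 c z, cZ2 c z).

Lemma chord_gt0 z w : 0 < chord (emb w) z + d.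
Proof. by rewrite ltr_wpDl// /chord ch_chord. Qed.

Section kernel.
Variables (w : R * R) (u : R * R * R).
Let x0 := (emb w).1.1. Let y0 := (emb w).1.2. Let z0 := (emb w).2.
Let ich z := (chord (emb w) z + d)^-1.
Let Qf z := (X z - x0) * u.1.1 + (Y z - y0) * u.1.2 + k * ((Z z - z0) * u.2).
Let Pf1 z := cX1 c z * (X z - x0) + cY1 c z * (Y z - y0) + k * (cZ1 c z * (Z z - z0)).
Let Pf2 z := cX2 c z * (X z - x0) + cY2 c z * (Y z - y0) + k * (cZ2 c z * (Z z - z0)).
Let Gf1 z := cX1 c z * u.1.1 + cY1 c z * u.1.2 + k * (cZ1 c z * u.2).
Let Gf2 z := cX2 c z * u.1.1 + cY2 c z * u.1.2 + k * (cZ2 c z * u.2).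

(** With [ker2], the reflection kernel as a 1-form in [z], for a fixed point [w] and vector [u]; [d]
    removes the singularity at z = w. *)
Definition ker1 z := Gf1 z - 2 * (Pf1 z * (Qf z * ich z)).
Definition ker2 z := Gf2 z - 2 * (Pf2 z * (Qf z * ich z)).

(* The triple product of the conormal at [z] with the chord and [u]. *)
Definition kdet z := Z z * ((X z - x0) * u.1.2 - (Y z - y0) * u.1.1) +
  k ^+ 2 * (X z * ((Y z - y0) * u.2 - (Z z - z0) * u.1.2)) +
  k ^+ 2 * (Y z * ((Z z - z0) * u.1.1 - (X z - x0) * u.2)).

Let CXc := C1_sub (chX c) (C1_cst x0).
Let CYc := C1_sub (chY c) (C1_cst y0).
Let CZc := C1_sub (chZ c) (C1_cst z0).

Lemma C1_ich : C1 ich (fun z => - ich z ^+ 2 * (2 * Pf1 z)) (fun z => - ich z ^+ 2 * (2 * Pf2 z)).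
Proof.
have CN := C1_add (C1_add (C1_mul CXc CXc) (C1_mul CYc CYc)) (C1_scale k (C1_mul CZc CZc)).
have CD := C1_add CN (C1_cst d).
apply: (C1_eq (C1_inv CD _)) => [z|z|z|z]; rewrite /= ?/ich /chord /x0 /y0 /z0 /cst.
- by apply: lt0r_neq0; have := chord_gt0 z w; rewrite /chord !expr2.
- by rewrite !expr2.
- by rewrite /Pf1 /x0 /y0 /z0 -exprVn !expr2; congr (_ * _); ring.
- by rewrite /Pf2 /x0 /y0 /z0 -exprVn !expr2; congr (_ * _); ring.
Qed.

Let CQ := C1_add (C1_add (C1_mul CXc (C1_cst u.1.1)) (C1_mul CYc (C1_cst u.1.2)))
  (C1_scale k (C1_mul CZc (C1_cst u.2))).

Definition ker21 z := cX12 c z * u.1.1 + cY12 c z * u.1.2 + k * (cZ12 c z * u.2) -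
  2 * ((cX12 c z * (X z - x0) + cX2 c z * cX1 c z + (cY12 c z * (Y z - y0) + cY2 c z * cY1 c z) +
        k * (cZ12 c z * (Z z - z0) + cZ2 c z * cZ1 c z)) * (Qf z * ich z) +
       Pf2 z * (Gf1 z * ich z + Qf z * (- ich z ^+ 2 * (2 * Pf1 z)))).
Definition ker12 z := cX12 c z * u.1.1 + cY12 c z * u.1.2 + k * (cZ12 c z * u.2) -
  2 * ((cX12 c z * (X z - x0) + cX1 c z * cX2 c z + (cY12 c z * (Y z - y0) + cY1 c z * cY2 c z) +
        k * (cZ12 c z * (Z z - z0) + cZ1 c z * cZ2 c z)) * (Qf z * ich z) +
       Pf1 z * (Gf2 z * ich z + Qf z * (- ich z ^+ 2 * (2 * Pf2 z)))).
Definition ker11 z := cX11 c z * u.1.1 + cY11 c z * u.1.2 + k * (cZ11 c z * u.2) -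
  2 * ((cX11 c z * (X z - x0) + cX1 c z * cX1 c z + (cY11 c z * (Y z - y0) + cY1 c z * cY1 c z) +
        k * (cZ11 c z * (Z z - z0) + cZ1 c z * cZ1 c z)) * (Qf z * ich z) +
       Pf1 z * (Gf1 z * ich z + Qf z * (- ich z ^+ 2 * (2 * Pf1 z)))).
Definition ker22 z := cX22 c z * u.1.1 + cY22 c z * u.1.2 + k * (cZ22 c z * u.2) -
  2 * ((cX22 c z * (X z - x0) + cX2 c z * cX2 c z + (cY22 c z * (Y z - y0) + cY2 c z * cY2 c z) +
        k * (cZ22 c z * (Z z - z0) + cZ2 c z * cZ2 c z)) * (Qf z * ich z) +
       Pf2 z * (Gf2 z * ich z + Qf z * (- ich z ^+ 2 * (2 * Pf2 z)))).

Lemma C1_ker1 : C1 ker1 ker11 ker12.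
Proof.
have CP := C1_add (C1_add (C1_mul (chX1 c) CXc) (C1_mul (chY1 c) CYc)) (C1_scale k (C1_mul (chZ1 c) CZc)).
have CG := C1_add (C1_add (C1_mul (chX1 c) (C1_cst u.1.1)) (C1_mul (chY1 c) (C1_cst u.1.2)))
  (C1_scale k (C1_mul (chZ1 c) (C1_cst u.2))).
apply: (C1_eq (C1_sub CG (C1_scale 2 (C1_mul CP (C1_mul CQ C1_ich))))) => z //.
- by rewrite /ker11 /Qf /Pf1 /Gf1 /cst; move: (ich z) => i; ring.
- by rewrite /ker12 /Qf /Pf1 /Pf2 /Gf2 /cst; move: (ich z) => i; ring.
Qed.

Lemma C1_ker2 : C1 ker2 ker21 ker22.
Proof.
have CP := C1_add (C1_add (C1_mul (chX2 c) CXc) (C1_mul (chY2 c) CYc)) (C1_scale k (C1_mul (chZ2 c) CZc)).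
have CG := C1_add (C1_add (C1_mul (chX2 c) (C1_cst u.1.1)) (C1_mul (chY2 c) (C1_cst u.1.2)))
  (C1_scale k (C1_mul (chZ2 c) (C1_cst u.2))).
apply: (C1_eq (C1_sub CG (C1_scale 2 (C1_mul CP (C1_mul CQ C1_ich))))) => z //.
- by rewrite /ker21 /Qf /Pf1 /Pf2 /Gf1 /cst; move: (ich z) => i; ring.
- by rewrite /ker22 /Qf /Pf2 /Gf2 /cst; move: (ich z) => i; ring.
Qed.

(** Twice <dz, n> is the differential of N, so with Q = <n, u> the form is <dz, u> - Q / (N + d) dN.
    The first term is closed and the second leaves dN wedge dQ / (N + d). A wedge of two ambient
    linear forms on the surface is read off from the cross product of the partial derivatives. *)
Lemma ker_curl z : ker21 z - ker12 z = 2 * dens c z * kdet z / (chord (emb w) z + d).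
Proof.
have -> : ker21 z - ker12 z = 2 * ich z * (
    (cX1 c z * cY2 c z - cY1 c z * cX2 c z) * ((X z - x0) * u.1.2 - (Y z - y0) * u.1.1) +
    k * (cY1 c z * cZ2 c z - cZ1 c z * cY2 c z) * ((Y z - y0) * u.2 - (Z z - z0) * u.1.2) +
    k * (cZ1 c z * cX2 c z - cX1 c z * cZ2 c z) * ((Z z - z0) * u.1.1 - (X z - x0) * u.2)).
  by rewrite /ker21 /ker12 /Qf /Pf1 /Pf2 /Gf1 /Gf2; move: (ich z) => i; ring.
by rewrite ch_crossX ch_crossY ch_crossZ /kdet /ich; move: (_^-1) => i; ring.
Qed.

End kernel.

Section potential.
Variable z : R * R.
Let a1 := X z. Let a2 := Y z. Let a3 := Z z.
Let iN w := (chord (emb z) w + d)^-1.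
Let Db (x y t : R * R -> R) w := a3 * ((a1 - X w) * y w - (a2 - Y w) * x w) +
  k ^+ 2 * (a1 * ((a2 - Y w) * t w - (a3 - Z w) * y w)) +
  k ^+ 2 * (a2 * ((a3 - Z w) * x w - (a1 - X w) * t w)).
Let Cb (x y t x1 y1 t1 : R * R -> R) w := a3 * (x w * y1 w - y w * x1 w) +
  k ^+ 2 * (a1 * (y w * t1 w - t w * y1 w)) + k ^+ 2 * (a2 * (t w * x1 w - x w * t1 w)).
Let P1 w := cX1 c w * (X w - a1) + cY1 c w * (Y w - a2) + k * (cZ1 c w * (Z w - a3)).
Let P2 w := cX2 c w * (X w - a1) + cY2 c w * (Y w - a2) + k * (cZ2 c w * (Z w - a3)).
Let D1 := Db (cX1 c) (cY1 c) (cZ1 c).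
Let D2 := Db (cX2 c) (cY2 c) (cZ2 c).

(** [kdet] is linear in [u]. When [u] runs over the tangent vectors at [w], the curl of the kernel
    therefore becomes a 1-form in [w], whose components are [pot1] and [pot2] up to the factor
    [dens c z]; the second divergence theorem is applied to it. *)
Definition pot1 w := 2 * (D1 w * iN w).
Definition pot2 w := 2 * (D2 w * iN w).
Definition pot11 w := 2 * (Db (cX11 c) (cY11 c) (cZ11 c) w * iN w -
  2 * (P1 w * (D1 w * iN w ^+ 2))).
Definition pot12 w := 2 * ((Db (cX12 c) (cY12 c) (cZ12 c) w +
  Cb (cX1 c) (cY1 c) (cZ1 c) (cX2 c) (cY2 c) (cZ2 c) w) * iN w - 2 * (P2 w * (D1 w * iN w ^+ 2))).
Definition pot21 w := 2 * ((Db (cX12 c) (cY12 c) (cZ12 c) w -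
  Cb (cX1 c) (cY1 c) (cZ1 c) (cX2 c) (cY2 c) (cZ2 c) w) * iN w - 2 * (P1 w * (D2 w * iN w ^+ 2))).
Definition pot22 w := 2 * (Db (cX22 c) (cY22 c) (cZ22 c) w * iN w -
  2 * (P2 w * (D2 w * iN w ^+ 2))).

Let C_iN : C1 iN (fun w => - (iN w ^+ 2 * (2 * P1 w))) (fun w => - (iN w ^+ 2 * (2 * P2 w))).
Proof.
apply: (C1_eq (C1_ich z)) => w; rewrite // mulNr;
  by congr (- (_ * (2 * _))); rewrite /P1 /P2 /=; ring.
Qed.

Let C_Db x y t x1 x2 y1 y2 t1 t2 : C1 x x1 x2 -> C1 y y1 y2 -> C1 t t1 t2 ->
  C1 (Db x y t)
   (fun w => Db x1 y1 t1 w - Cb (cX1 c) (cY1 c) (cZ1 c) x y t w)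
   (fun w => Db x2 y2 t2 w - Cb (cX2 c) (cY2 c) (cZ2 c) x y t w).
Proof.
move=> Cx Cy Ct.
have CX := C1_sub (C1_cst a1) (chX c).
have CY := C1_sub (C1_cst a2) (chY c).
have CZ := C1_sub (C1_cst a3) (chZ c).
have E1 := C1_scale a3 (C1_sub (C1_mul CX Cy) (C1_mul CY Cx)).
have E2 := C1_scale (k ^+ 2) (C1_scale a1 (C1_sub (C1_mul CY Ct) (C1_mul CZ Cy))).
have E3 := C1_scale (k ^+ 2) (C1_scale a2 (C1_sub (C1_mul CZ Cx) (C1_mul CX Ct))).
by apply: (C1_eq (C1_add (C1_add E1 E2) E3)) => w //; rewrite /Db /Cb /cst; ring.
Qed.

Lemma C1_pot1 : C1 pot1 pot11 pot12.
Proof.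
apply: (C1_eq (C1_scale 2 (C1_mul (C_Db (chX1 c) (chY1 c) (chZ1 c)) C_iN))) => w //.
- by rewrite /pot11 -/(D1 w) /Cb; move: (iN w) (D1 w) => i D; ring.
- by rewrite /pot12 -/(D1 w) /Cb; move: (iN w) (D1 w) => i D; ring.
Qed.

Lemma C1_pot2 : C1 pot2 pot21 pot22.
Proof.
apply: (C1_eq (C1_scale 2 (C1_mul (C_Db (chX2 c) (chY2 c) (chZ2 c)) C_iN))) => w //.
- by rewrite /pot21 -/(D2 w) /Cb; move: (iN w) (D2 w) => i D; ring.
- by rewrite /pot22 -/(D2 w) /Cb; move: (iN w) (D2 w) => i D; ring.
Qed.

(** The bracket is (k (N + d)^2 - 4 d - k d^2) / (N + d)^2. With d = 0 it would be the constant k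
    off the diagonal, and the 4 pi would sit on the diagonal as a point mass; the subtracted term is
    this mass spread out. *)
Lemma pot_curl w : pot21 w - pot12 w =
  dens c w * (k - (4 * d + k * d ^+ 2) / (chord (emb z) w + d) ^+ 2).
Proof.
have i0 := lt0r_neq0 (chord_gt0 w z).
set N := chord (emb z) w in i0 *.
have iNE : iN w = (N + d)^-1 by [].
have -> : pot21 w - pot12 w = 2 * (-2 * Cb (cX1 c) (cY1 c) (cZ1 c) (cX2 c) (cY2 c) (cZ2 c) w * iN w -
   2 * (P1 w * D2 w - P2 w * D1 w) * iN w ^+ 2).
  by rewrite /pot21 /pot12; move: (iN w) (D1 w) (D2 w) (P1 w) (P2 w) => i ? ? ? ?; ring.
have hZ := ch_crossZ c w; have hX := ch_crossX c w; have hY := ch_crossY c w.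
have -> : Cb (cX1 c) (cY1 c) (cZ1 c) (cX2 c) (cY2 c) (cZ2 c) w = dens c w * (1 - k * N / 2).
  transitivity (dens c w * (a3 * Z w + k ^+ 3 * (a1 * X w + a2 * Y w))).
    rewrite /Cb hZ hX (_ : cZ1 c w * cX2 c w - cX1 c w * cZ2 c w = dens c w * (k * Y w))//; ring.
  congr (_ * _); rewrite /N /chord /= -/a1 -/a2 -/a3.
  by apply: unit_inner hk _ _ _ _; [exact: ch_surface| exact: ch_surface| exact: ch_pos| exact: ch_pos].
have -> : P1 w * D2 w - P2 w * D1 w = - (dens c w * (N - k * N ^+ 2 / 4)).
  rewrite /N /chord /=.
  rewrite -(@triple_chord k (X z) (Y z) (Z z) (X w) (Y w) (Z w) hk (ch_surface c z) (ch_surface c w)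
     (@ch_pos _ c z) (@ch_pos _ c w)) /=.
  have E a b e : dens c w * (k * X w * a + k * Y w * b + Z w * e) =
    (cY1 c w * cZ2 c w - cZ1 c w * cY2 c w) * a + (cZ1 c w * cX2 c w - cX1 c w * cZ2 c w) * b +
    (cX1 c w * cY2 c w - cY1 c w * cX2 c w) * e by rewrite hX hY hZ; ring.
  rewrite E.
  rewrite /P1 /P2 /D1 /D2 /Db -/a1 -/a2 -/a3; ring.
by rewrite iNE; field.
Qed.

End potential.
End chart.

(** * Differentiation under the integral sign *)

Section parametric.
Context {R : realType}.
Notation TR := (measurableTypeR R).
Implicit Types (E : set (TR * TR)).

Lemma is_derive_small (f : R -> R) (x d : R) :
  (forall e, 0 < e -> \forall h \near (0 : R), `|f (x + h) - f x - h * d| <= e * `|h|) ->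
  has_deriv x f d.
Proof.
move=> H.
have cv : h^-1 *: ((f \o shift x) (h *: (1 : R)) - f x) @[h --> 0^'] --> d.
  apply/cvgrPdist_le => e e0; near=> h.
  have h0 : h != 0 by near: h; exact: nbhs_dnbhs_neq.
  rewrite /= /GRing.scale/= mulr1 (addrC h) distrC.
  rewrite (_ : _ - d = h^-1 * (f (x + h) - f x - h * d)); last by field.
  rewrite normrM normfV ler_pdivrMl ?normr_gt0// (mulrC `|h|).
  by near: h; apply: cvg_within; exact: H.
split; first by apply/cvg_ex; exists d.
exact: cvg_lim cv.
Unshelve. all: by end_near. Qed.

Lemma C1_mvt f f1 f2 (w v : R * R) (h : R) : C1 f f1 f2 ->
  exists2 c : R, 0 <= c <= 1 & f (w.1 + h * v.1, w.2 + h * v.2) - f w =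
    h * (v.1 * f1 (w.1 + c * h * v.1, w.2 + c * h * v.2) + v.2 * f2 (w.1 + c * h * v.1, w.2 + c * h * v.2)).
Proof.
move=> Cf; pose u := (h * v.1, h * v.2).
have dF t := C1_line w u t Cf.
have cF : {within `[0, 1], continuous (fun t => f (w.1 + t * u.1, w.2 + t * u.2))}.
  by apply: derivable_within_continuous => x _; have [] := dF x.
have [c c01] := MVT_segment ler01 (fun x _ => dF x) cF.
rewrite /= subr0 mulr1 !mul1r !mul0r !addr0 -surjective_pairing => ->.
by exists c; rewrite -?in_itv//= -!mulrA mulrDr !mulrA.
Qed.

Lemma uniform_near (T U : topologicalType) (K : set T) (g : T * U -> R) (w0 : U) (e : R) :
  compact K -> continuous g -> 0 < e ->
  \forall w \near w0, forall z, K z -> `|g (z, w) - g (z, w0)| <= e.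
Proof.
move=> cK cg e0; move/compact_near_coveringP: cK.
move=> /(_ U (nbhs w0) (fun w z => `|g (z, w) - g (z, w0)| <= e) _); apply => z Kz.
have e20 : 0 < e / 2 by rewrite divr_gt0.
have /cvgrPdist_le/(_ _ e20) [[A B] /= [zA wB] AB] := cg (z, w0).
exists (A, B) => //= -[z' w'] /= [Az Bw].
have /= h1 := AB (z', w') (conj Az Bw).
have /= h2 := AB (z', w0) (conj Az (nbhs_singleton wB)).
rewrite -(subrKA (g (z, w0))) (splitr e) addrC (le_trans (ler_normD _ _))// lerD//.
by rewrite distrC.
Qed.

Lemma continuous_section (T U V : topologicalType) (g : T * U -> V) (w : U) :
  continuous g -> continuous (fun z => g (z, w)).
Proof.
move=> cg z; apply: (@continuous_comp _ _ _ (fun z => (z, w)) g); last exact: cg.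
by apply: cvg_pair; [exact: cvg_id|exact: cvg_cst].
Qed.

Lemma Rintegral_bound (E : set (TR * TR)) (r e : R) (f : R * R -> R) : 0 <= e ->
  measurable E -> E `<=` square r -> continuous f -> (forall z, E z -> `|f z| <= e) ->
  `|\int[lam2]_(z in E) f z| <= e * fine (lam2 (square r)).
Proof.
move=> e0 mE Er cf fe.
have lf := continuous_integrable2 cf mE Er.
have ln := continuous_integrable2 (cont_norm cf) mE Er.
have lc := continuous_integrable2 (@cst_continuous _ _ e) mE Er.
apply: (le_trans (le_normr_Rintegral mE lf)).
apply: (le_trans (le_Rintegral mE ln lc fe)).
rewrite Rintegral_cst//; apply: ler_wpM2l => //; apply: fine_le.
- rewrite ge0_fin_numE//; apply: le_lt_trans (lam2_square r).
  by apply: le_measure => //; rewrite inE//; exact: measurable_square.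
- by rewrite ge0_fin_numE// lam2_square.
- by apply: le_measure => //; rewrite inE//; exact: measurable_square.
Qed.

Lemma continuous_Rintegral (U : topologicalType) (g : R * R * U -> R) (E : set (TR * TR)) (r : R) :
  continuous g -> measurable E -> E `<=` square r ->
  continuous (fun w => \int[lam2]_(z in E) g (z, w)).
Proof.
move=> cg mE Er w0; apply/cvgrPdist_le => e e0.
pose A := fine (lam2 (square r)).
have A0 : 0 <= A by rewrite fine_ge0.
have eA : 0 < e / (A + 1) by rewrite divr_gt0// ltr_wpDl.
near=> w.
have cgw w' : continuous (fun z => g (z, w')) by exact: continuous_section.
rewrite -RintegralB//; [|exact: (@continuous_integrable2 _ _ r)..].
apply: (le_trans (@Rintegral_bound E r (e / (A + 1)) _ _ _ _ _ _)) => //.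
- exact: ltW.
- exact: contB.
- move=> z /Er; rewrite distrC; move: z; near: w.
  by apply: uniform_near => //; exact: compact_square.
- by rewrite -/A mulrAC ler_pdivrMr ?ltr_wpDl// ler_wpM2l ?(ltW e0)// lerDl.
Unshelve. all: by end_near. Qed.

Lemma C1_Rintegral (f f1 f2 : (R * R) * (R * R) -> R) (E : set (TR * TR)) (r : R) :
  continuous f -> continuous f1 -> continuous f2 ->
  (forall z, C1 (fun w => f (z, w)) (fun w => f1 (z, w)) (fun w => f2 (z, w))) ->
  measurable E -> E `<=` square r ->
  C1 (fun w => \int[lam2]_(z in E) f (z, w)) (fun w => \int[lam2]_(z in E) f1 (z, w))
     (fun w => \int[lam2]_(z in E) f2 (z, w)).
Proof.
move=> cf cf1 cf2 Cf mE Er; split; [|exact: continuous_Rintegral mE Er..].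
move=> w v; apply: is_derive_small => e e0.
pose A := fine (lam2 (square r)).
have A0 : 0 <= A by rewrite fine_ge0.
have eA : 0 < e / (A + 1) by rewrite divr_gt0// ltr_wpDl.
pose g x := v.1 * f1 x + v.2 * f2 x.
have cg : continuous g by apply: contD; apply: contM => //; exact: cst_continuous.
have /nbhs_ballP[dl /= dl0 Hw] := @uniform_near _ _ _ g w _ (@compact_square R r) cg eA.
pose vv := `|v.1| + `|v.2| + 1.
have vv0 : 0 < vv by rewrite ltr_wpDl ?addr_ge0.
near=> h.
have hd : `|h| * vv < dl.
  rewrite -ltr_pdivlMr//; near: h; apply/nbhs_ballP; exists (dl / vv) => [|x] /=.
    by rewrite divr_gt0.
  by rewrite /ball/= sub0r normrN.
rewrite add0r !mul0r !addr0 -surjective_pairing.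
have ci (f' : R * R * (R * R) -> R) w' : continuous f' -> lam2.-integrable E (EFin \o (fun z => f' (z, w'))).
  by move=> cf'; apply: (@continuous_integrable2 _ _ r) => //; exact: continuous_section.
rewrite -RintegralB//; [|exact: ci..].
have -> : v.1 * (\int[lam2]_(z in E) f1 (z, w)) + v.2 * (\int[lam2]_(z in E) f2 (z, w)) =
    \int[lam2]_(z in E) g (z, w).
  rewrite /g RintegralD//; last 2 first.
  - by apply: (ci (fun x => v.1 * f1 x)); cont.
  - by apply: (ci (fun x => v.2 * f2 x)); cont.
  by rewrite !RintegralZl//; exact: ci.
rewrite -RintegralZl//; last exact: ci.
rewrite -RintegralB//; last 2 first.
- apply: (@continuous_integrable2 _ _ r) => //; apply: contB; exact: continuous_section.
- by apply: (ci (fun x => h * g x)); cont.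
apply: (le_trans (@Rintegral_bound E r (e / (A + 1) * `|h|) _ _ _ _ _ _)) => //.
- by rewrite mulr_ge0// ltW.
- apply: contB; [apply: contB; exact: continuous_section|].
  by apply: contM; [exact: cst_continuous|exact: (@continuous_section _ _ _ g)].
- move=> z Ez; have [c /andP[c0 c1] ->] := C1_mvt w v h (Cf z).
  rewrite -mulrBr normrM mulrC ler_wpM2r//.
  apply: (Hw (w.1 + c * h * v.1, w.2 + c * h * v.2) _ z (Er z Ez)).
  have ch : `|c * h| <= `|h| by rewrite normrM ger0_norm// ler_piMl.
  have n1 := normr_ge0 v.1; have n2 := normr_ge0 v.2.
  split; rewrite /ball/= opprD addNKr normrN normrM; apply: le_lt_trans hd; apply: ler_pM => //.
    by rewrite /vv; move: n1 n2; clear; lra.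
  by rewrite /vv; move: n1 n2; clear; lra.
- by rewrite -/A mulrAC ler_wpM2r// mulrAC ler_pdivrMr ?ltr_wpDl// ler_wpM2l ?(ltW e0)// lerDl.
Unshelve. all: by end_near. Qed.

End parametric.

Section inner.
Context {R : realType}.
Local Notation pt := (R * R * R)%type.
Implicit Types (k d : R) (x y u v : pt).

Definition ip k v u : R := v.1.1 * u.1.1 + v.1.2 * u.1.2 + k * (v.2 * u.2).

Definition vsub x y : pt := (x.1.1 - y.1.1, x.1.2 - y.1.2, x.2 - y.2).

Definition sqd k x y : R := ip k (vsub x y) (vsub x y).

Definition kap k d x v y u : R :=
  ip k v u - 2 * ip k v (vsub x y) * ip k u (vsub x y) / (sqd k x y + d).

Lemma sqdC k x y : sqd k x y = sqd k y x.
Proof. by rewrite /sqd /ip /=; ring. Qed.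

End inner.

(** * The divergence inequality in both variables *)

Section double.
Context {R : realType}.
Variables (k : R) (c : chart k) (d : R).
Hypotheses (hk : curvature k) (d0 : 0 < d).

Definition dmap (z a : R * R) : R * R * R :=
  (a.1 * cX1 c z + a.2 * cX2 c z, a.1 * cY1 c z + a.2 * cY2 c z, a.1 * cZ1 c z + a.2 * cZ2 c z).

Lemma cont_at (U V : topologicalType) (W : topologicalType) (f : V -> W) (g : U -> V) :
  continuous f -> continuous g -> continuous (fun x => f (g x)).
Proof. by move=> cf cg x; apply: continuous_comp; [exact: cg|exact: cf]. Qed.

Lemma continuous_coords : [/\ continuous (fun x : R * R * R => x.1.1),
  continuous (fun x : R * R * R => x.1.2) & continuous (fun x : R * R * R => x.2)].
Proof.
split=> v; last exact: cvg_snd.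
  by apply: (cont_at (f := fst) (g := fst)) => x; exact: cvg_fst.
by apply: (cont_at (f := snd) (g := fst)) => x; [exact: cvg_snd|exact: cvg_fst].
Qed.

Lemma chordE w z : chord c (emb c w) z = sqd k (emb c z) (emb c w).
Proof. by rewrite /chord /sqd /ip /=; ring. Qed.

Lemma ker_kap (z w a : R * R) u :
  ker1 c d w u z * a.1 + ker2 c d w u z * a.2 = kap k d (emb c z) (dmap z a) (emb c w) u.
Proof.
rewrite /ker1 /ker2 /kap -chordE /ip /=; move: (_^-1) => i; ring.
Qed.

Lemma kdet_pot (z w b : R * R) :
  2 * dens c z * kdet c w (dmap w b) z / (chord c (emb c w) z + d) =
  b.1 * (dens c z * pot1 c d z w) + b.2 * (dens c z * pot2 c d z w).
Proof.
rewrite /kdet /pot1 /pot2 !chordE sqdC /=; move: (_^-1) => i; ring.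
Qed.

Lemma cont_ich (U : topologicalType) (g h : U -> R * R) : continuous g -> continuous h ->
  continuous (fun x => (chord c (emb c (g x)) (h x) + d)^-1).
Proof.
move=> cg ch.
have cX' f : continuous f -> continuous (fun x => f (g x)) /\ continuous (fun x : U => f (h x) : R).
  by move=> cf; split; exact: cont_at.
have [xg xh] : continuous (fun x => cX c (g x)) /\ continuous (fun x => cX c (h x)).
  by apply: cX'; have [] := chX c.
have [yg yh] : continuous (fun x => cY c (g x)) /\ continuous (fun x => cY c (h x)).
  by apply: cX'; have [] := chY c.
have [zg zh] : continuous (fun x => cZ c (g x)) /\ continuous (fun x => cZ c (h x)).
  by apply: cX'; have [] := chZ c.
apply: contV; last by move=> x; apply: lt0r_neq0; exact: chord_gt0.
rewrite /chord /emb /=.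
by apply: contD; [apply: contD; [apply: contD|]|exact: cst_continuous];
  [..|apply: contM; first exact: cst_continuous]; apply: contX; apply: contB.
Qed.

Ltac chart_cont :=
  let coord f g H := (refine (@cont_at _ _ _ f g _ _); [by have [] := H|chart_cont]) in
  lazymatch goal with
  | |- continuous (fun x => x) => (move=> ?; exact: cvg_id)
  | |- continuous (fun x => GRing.add (@?f x) (@?g x)) => refine (@contD _ _ f g _ _); chart_cont
  | |- continuous (fun x => GRing.mul (@?f x) (@?g x)) => refine (@contM _ _ f g _ _); chart_cont
  | |- continuous (fun x => GRing.opp (@?f x)) => refine (@contN _ _ f _); chart_cont
  | |- continuous (fun x => GRing.exp (@?f x) ?n) => refine (@contX _ _ f n _); chart_cont
  | |- continuous (fun x => cX _ (@?g x)) => coord constr:(cX c) g constr:(chX c)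
  | |- continuous (fun x => cX1 _ (@?g x)) => coord constr:(cX1 c) g constr:(chX c)
  | |- continuous (fun x => cX2 _ (@?g x)) => coord constr:(cX2 c) g constr:(chX c)
  | |- continuous (fun x => cX11 _ (@?g x)) => coord constr:(cX11 c) g constr:(chX1 c)
  | |- continuous (fun x => cX12 _ (@?g x)) => coord constr:(cX12 c) g constr:(chX1 c)
  | |- continuous (fun x => cX22 _ (@?g x)) => coord constr:(cX22 c) g constr:(chX2 c)
  | |- continuous (fun x => cY _ (@?g x)) => coord constr:(cY c) g constr:(chY c)
  | |- continuous (fun x => cY1 _ (@?g x)) => coord constr:(cY1 c) g constr:(chY c)
  | |- continuous (fun x => cY2 _ (@?g x)) => coord constr:(cY2 c) g constr:(chY c)
  | |- continuous (fun x => cY11 _ (@?g x)) => coord constr:(cY11 c) g constr:(chY1 c)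
  | |- continuous (fun x => cY12 _ (@?g x)) => coord constr:(cY12 c) g constr:(chY1 c)
  | |- continuous (fun x => cY22 _ (@?g x)) => coord constr:(cY22 c) g constr:(chY2 c)
  | |- continuous (fun x => cZ _ (@?g x)) => coord constr:(cZ c) g constr:(chZ c)
  | |- continuous (fun x => cZ1 _ (@?g x)) => coord constr:(cZ1 c) g constr:(chZ c)
  | |- continuous (fun x => cZ2 _ (@?g x)) => coord constr:(cZ2 c) g constr:(chZ c)
  | |- continuous (fun x => cZ11 _ (@?g x)) => coord constr:(cZ11 c) g constr:(chZ1 c)
  | |- continuous (fun x => cZ12 _ (@?g x)) => coord constr:(cZ12 c) g constr:(chZ1 c)
  | |- continuous (fun x => cZ22 _ (@?g x)) => coord constr:(cZ22 c) g constr:(chZ2 c)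
  | |- continuous (fun x => dens _ (@?g x)) => refine (@cont_at _ _ _ (dens c) g _ _); [exact: dens_cont|chart_cont]
  | |- continuous (fun x => (chord _ (emb _ (@?g x)) (@?h x) + _)^-1) => refine (@cont_ich _ g h _ _); chart_cont
  | |- continuous (fun x => fst (@?g x)) => refine (@cont_at _ _ _ fst g _ _); [by move=> ?; exact: cvg_fst|chart_cont]
  | |- continuous (fun x => snd (@?g x)) => refine (@cont_at _ _ _ snd g _ _); [by move=> ?; exact: cvg_snd|chart_cont]
  | |- _ => exact: cst_continuous
  end.

Let T3 := ((R * R) * ((R * R) * (R * R)))%type.

Lemma cont_ker :
  [/\ continuous (fun x : T3 => ker1 c d x.2.1 (dmap x.2.1 x.2.2) x.1),
      continuous (fun x : T3 => ker11 c d x.2.1 (dmap x.2.1 x.2.2) x.1) &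
      continuous (fun x : T3 => ker12 c d x.2.1 (dmap x.2.1 x.2.2) x.1)] /\
  [/\ continuous (fun x : T3 => ker2 c d x.2.1 (dmap x.2.1 x.2.2) x.1),
      continuous (fun x : T3 => ker21 c d x.2.1 (dmap x.2.1 x.2.2) x.1) &
      continuous (fun x : T3 => ker22 c d x.2.1 (dmap x.2.1 x.2.2) x.1)].
Proof.
rewrite /ker1 /ker11 /ker12 /ker2 /ker21 /ker22 /dmap /=.
by split; split; chart_cont.
Qed.

Lemma cont_pot :
  [/\ continuous (fun x => dens c x.1 * pot1 c d x.1 x.2), continuous (fun x => dens c x.1 * pot11 c d x.1 x.2) &
      continuous (fun x => dens c x.1 * pot12 c d x.1 x.2)] /\
  [/\ continuous (fun x => dens c x.1 * pot2 c d x.1 x.2), continuous (fun x => dens c x.1 * pot21 c d x.1 x.2) &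
      continuous (fun x => dens c x.1 * pot22 c d x.1 x.2)].
Proof.
rewrite /pot1 /pot11 /pot12 /pot2 /pot21 /pot22.
by split; split; chart_cont.
Qed.

End double.

Section double.
Context {R : realType}.
Notation TR := (measurableTypeR R).

Lemma continuous_bounded_compact (T : topologicalType) (K : set T) (f : T -> R) :
  compact K -> continuous f -> exists2 C, 0 <= C & forall z, K z -> `|f z| <= C.
Proof.
move=> cK cf.
have /compact_bounded[C [_ Cf]] : compact (f @` K).
  by apply: continuous_compact => //; exact: continuous_subspaceT.
exists (`|C| + 1) => [|z zr]; first by rewrite addr_ge0.
by apply: (Cf (`|C| + 1)); [rewrite ltr_pwDr// ler_norm|exists z].
Qed.

Lemma bounded3 (T : topologicalType) (K : set T) (f g h : T -> R) : compact K ->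
  [/\ continuous f, continuous g & continuous h] ->
  exists2 C, 0 <= C & forall z, K z -> [/\ `|f z| <= C, `|g z| <= C & `|h z| <= C].
Proof.
move=> cK [cf cg ch].
have [A A0 fA] := continuous_bounded_compact cK cf.
have [B B0 gB] := continuous_bounded_compact cK cg.
have [C C0 hC] := continuous_bounded_compact cK ch.
exists (A + B + C) => [|z Kz]; first by rewrite !addr_ge0.
have := fA z Kz; have := gB z Kz; have := hC z Kz; move: A0 B0 C0; clear.
by split; lra.
Qed.

(** The estimate in [w] bounds the double integral by a sum over samples [j'] of integrals over [z].
    Each of these is the integral of [ker_curl] with [w] and [u] taken from sample [j'], to which
    the estimate in [z] applies. The parameters stay in a compact set, so one [eps0] serves all
    samples, and the errors are averaged because the steps sum to at most 1. *)
Lemma double_star (k : R) (c : chart k) (d rho M e : R) (E : set (TR * TR)) :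
  curvature k -> 0 < d -> 0 < rho -> 0 <= M -> 0 < e ->
  measurable E -> E `<=` square rho ->
  exists2 eps0 : R, 0 < eps0 <= 1 &
  forall (J : eqType) (s : seq J) (p v : J -> R * R) (len : J -> R)
    (T : set (R * R)) (eps : R),
  0 <= eps <= eps0 -> sampled s p v len T eps M rho -> constant_off T E ->
  `|\int[lam2]_(w in E) \int[lam2]_(z in E) (dens c z * (dens c w *
      (k - (4 * d + k * d ^+ 2) / (sqd k (emb c z) (emb c w) + d) ^+ 2)))| <=
    \sum_(j' <- s) \sum_(j <- s) len j' * len j *
      `|kap k d (emb c (p j)) (dmap c (p j) (v j)) (emb c (p j')) (dmap c (p j') (v j'))| + e.
Proof.
move=> hk d0 rho0 M0 e0 mE Er.
have e20 : 0 < e / 2 by rewrite divr_gt0.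
have [/bounded3 K1 /bounded3 K2] := cont_ker c d0.
have cK : compact (square (rho + 1) `*` (square rho `*` square M) : set ((R * R) * ((R * R) * (R * R)))).
  by do 2?[apply: compact_setX]; exact: compact_square.
have [B1 B10 {}K1] := K1 _ cK; have [B2 B20 {}K2] := K2 _ cK.
have [e1 e10 star1] := star (addr_ge0 B10 B20) M0 rho0 e20.
have [[c1 c11 c12] [c2 c21 c22]] := cont_pot c d0.
pose Th (f : R * R -> R * R -> R) w := \int[lam2]_(z in E) (dens c z * f z w).
have CTh f f1 f2 : (forall z, C1 (f z) (f1 z) (f2 z)) -> continuous (fun x => dens c x.1 * f x.1 x.2) ->
    continuous (fun x => dens c x.1 * f1 x.1 x.2) -> continuous (fun x => dens c x.1 * f2 x.1 x.2) ->
    C1 (Th f) (Th f1) (Th f2).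
  move=> Cf k1 k2 k3; apply: (@C1_Rintegral _ (fun x => dens c x.1 * f x.1 x.2)
    (fun x => dens c x.1 * f1 x.1 x.2) (fun x => dens c x.1 * f2 x.1 x.2) E rho) => // z.
  exact: (C1_scale (dens c z) (Cf z)).
have CT1 := CTh _ _ _ (C1_pot1 c d0) c1 c11 c12.
have CT2 := CTh _ _ _ (C1_pot2 c d0) c2 c21 c22.
have cSq := @compact_square R (rho + 1).
have /(bounded3 cSq)[B3 B30 T1] : [/\ continuous (Th (pot1 c d)), continuous (Th (pot11 c d)) & continuous (Th (pot12 c d))].
  by have [] := CT1.
have /(bounded3 cSq)[B4 B40 T2] : [/\ continuous (Th (pot2 c d)), continuous (Th (pot21 c d)) & continuous (Th (pot22 c d))].
  by have [] := CT2.
have [e2 e20' star2] := star (addr_ge0 B30 B40) M0 rho0 e20.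
move: e10 e20' => /andP[e10 e11] /andP[e20' e21].
exists (Order.min e1 e2); first by rewrite lt_min e10 e20' ge_min e11.
move=> J s p v len T eps /andP[eps0]; rewrite le_min => /andP[epse1 epse2] smp TE.
have sq1 z : square rho z -> square (rho + 1) z.
  by case=> a b; split; [apply: (le_trans a)|apply: (le_trans b)]; rewrite lerDl.
have ci (g : R * R * (R * R) -> R) w : continuous g -> lam2.-integrable E (EFin \o (fun z => g (z, w))).
  by move=> cg; apply: (continuous_integrable2 _ mE Er); exact: continuous_section.
have -> : \int[lam2]_(w in E) \int[lam2]_(z in E) (dens c z * (dens c w *
      (k - (4 * d + k * d ^+ 2) / (sqd k (emb c z) (emb c w) + d) ^+ 2))) =
    \int[lam2]_(w in E) (Th (pot21 c d) w + - Th (pot12 c d) w).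
  apply: eq_Rintegral => w _.
  rewrite -RintegralB//; last 2 first.
  - by apply: (ci (fun x => dens c x.1 * pot21 c d x.1 x.2)).
  - by apply: (ci (fun x => dens c x.1 * pot12 c d x.1 x.2)).
  apply: eq_Rintegral => z _.
  by rewrite -mulrBr pot_curl// chordE sqdC.
have [smp1 smp2 _] := smp.
apply: (le_trans (star2 J s p v len T E eps _ _ _ _ _ _ _ smp mE Er TE CT2
  (C1_opp CT1) _ _)).
- by rewrite eps0.
- by move=> z /T2[? ? ?]; split; apply: (le_trans (y := B4)); rewrite ?lerDr.
- by move=> z /T1[? ? ?]; rewrite !normrN; split; apply: (le_trans (y := B3)); rewrite ?lerDl.
rewrite [in leRHS](splitr e) addrA lerD2r.
apply: (@le_trans _ _ (\sum_(j' <- s) (\sum_(j <- s) len j' * len j *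
  `|kap k d (emb c (p j)) (dmap c (p j) (v j)) (emb c (p j')) (dmap c (p j') (v j'))| + len j' * (e / 2)))).
  rewrite big_seq [leRHS]big_seq; apply: ler_sum => j' j's.
  have [/andP[l0 _] vM1 vM2 rp] := smp1 _ j's.
  under eq_bigr do rewrite -mulrA.
  rewrite -mulr_sumr -mulrDr ler_wpM2l//.
  have := star1 J s p v len T E eps _ _ _ _ _ _ _ smp mE Er TE
    (C1_ker2 c d0 (p j') (dmap c (p j') (v j')))
    (C1_opp (C1_ker1 c d0 (p j') (dmap c (p j') (v j')))).
  have bK (z : R * R) : square (rho + 1) z ->
      (square (rho + 1) `*` (square rho `*` square M)) (z, (p j', v j')) by [].
  move=> /(_ _ _ _) H.
  apply: le_trans (le_trans (H _ _ _) _).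
  - rewrite (_ : \int[lam2]_(z in E) _ = Th (pot2 c d) (p j') * (v j').2 - - Th (pot1 c d) (p j') * (v j').1)//.
    rewrite mulNr opprK addrC -!RintegralZr//; last 2 first.
    + by apply: (ci (fun x => dens c x.1 * pot2 c d x.1 x.2)).
    + by apply: (ci (fun x => dens c x.1 * pot1 c d x.1 x.2)).
    rewrite -RintegralD//; last 2 first.
    + by apply: (ci (fun x => dens c x.1 * pot1 c d x.1 x.2 * (v j').1)); cont.
    + by apply: (ci (fun x => dens c x.1 * pot2 c d x.1 x.2 * (v j').2)); cont.
    apply: eq_Rintegral => z _; rewrite ker_curl//.
    by rewrite kdet_pot mulrC [X in _ + X]mulrC.
  - by rewrite eps0.
  - by move=> z /bK/K2[/= ? ? ?]; split; apply: (le_trans (y := B2)); rewrite ?lerDr.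
  - by move=> z /bK/K1[/= ? ? ?]; rewrite !normrN; split; apply: (le_trans (y := B1)); rewrite ?lerDl.
  rewrite lerD2r; apply: ler_sum => j _.
  by rewrite -ker_kap mulNr opprK addrC [X in `|X + _|]mulrC [X in `|_ + X|]mulrC lexx.
rewrite big_split/= lerD2l -mulr_suml ler_piMl// ltW//.
Qed.

End double.

(** * The limit of the double inequality *)

Ltac ccont := lazymatch goal with
  | |- continuous (fun x => x) => (move=> ?; exact: cvg_id)
  | |- continuous (fun x => GRing.add (@?f x) (@?g x)) => refine (@contD _ _ f g _ _); ccont
  | |- continuous (fun x => GRing.mul (@?f x) (@?g x)) => refine (@contM _ _ f g _ _); ccont
  | |- continuous (fun x => GRing.opp (@?f x)) => refine (@contN _ _ f _); ccont
  | |- continuous (fun x => GRing.exp (@?f x) ?n) => refine (@contX _ _ f n _); ccont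
  | |- continuous (fun x => Num.norm (@?f x)) => refine (@cont_norm _ _ f _); ccont
  | |- continuous (fun x => fst x) => (move=> ?; exact: cvg_fst)
  | |- continuous (fun x => snd x) => (move=> ?; exact: cvg_snd)
  | |- _ => first [assumption | exact: cst_continuous]
  end.

(** * Affine substitutions and integrals of quadratic forms *)

Section scaling.
Context {R : realType}.
Notation TR := (measurableTypeR R).

Lemma derivative_inv (f : R -> R) (x d : R) : f x != 0 -> has_deriv x f d ->
  has_deriv x (fun t => (f t)^-1) (- d / f x ^+ 2).
Proof.
by move=> f0 df; apply: (der_ext (@is_deriveV R f x _ 1 f0 df)) => //; rewrite /GRing.scale/=; field.
Qed.

Lemma measurable_affine (s c : R) : measurable_fun setT (fun x : TR => c + s * x : TR).
Proof. by apply: measurable_funD => //; exact: measurable_funM. Qed.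

Lemma lebesgue_measureZ (s c : R) (A : set TR) : s != 0 -> measurable A ->
  lam A = (`|s|%:E * lam ((fun x : TR => (c + s * x)%R : TR) @^-1` A))%E.
Proof.
move=> s0 mA; have ma := measurable_affine s c.
rewrite -[X in (_ * X)%E]/(pushforward lam (fun x : TR => c + s * x : TR) A).
pose ns : {nonneg R} := NngNum (normr_ge0 s).
apply: (@lebesgue_measure_unique R (mscale ns
  (measure_function_pushforward__canonical__measure_function_Measure lam ma))) => //= _ [[a b]] _ <-.
rewrite /mscale/= /pushforward.
have [s1|s1|s1] := ltgtP s 0; last by rewrite s1 eqxx in s0.
  rewrite (_ : _ @^-1` _ = `[((b - c) / s)%R, ((a - c) / s)%R[%classic); last first.
    apply/seteqP; split=> x /=; rewrite !in_itv/= ler_ndivrMr// ltr_ndivlMr//;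
      by rewrite ltrBlDr lerBrDr mulrC (addrC _ c) andbC.
  rewrite !lebesgue_measure_itv/= !lte_fin ltr_ndivrMr// mulfVK// ltrD2r ltr0_norm//.
  case: ifP => _; last by rewrite mule0.
  by rewrite -!EFinD -EFinM; congr _%:E; field.
rewrite (_ : _ @^-1` _ = `]((a - c) / s)%R, ((b - c) / s)%R]%classic); last first.
  apply/seteqP; split=> x /=; rewrite !in_itv/= ltr_pdivrMr// ler_pdivlMr//;
    by rewrite ltrBlDr lerBrDr mulrC (addrC _ c).
rewrite !lebesgue_measure_itv/= !lte_fin ltr_pdivrMr// mulfVK// ltrD2r gtr0_norm//.
case: ifP => _; last by rewrite mule0.
by rewrite -!EFinD -EFinM; congr _%:E; field.
Qed.

Lemma ge0_integral_affine (s c : R) (F : TR -> \bar R) : s != 0 ->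
  measurable_fun setT F -> (forall x, 0 <= F x)%E ->
  (\int[lam]_x F x = `|s|%:E * \int[lam]_x F (c + s * x)%R)%E.
Proof.
move=> s0 mF F0; have ma := measurable_affine s c.
pose ns : {nonneg R} := NngNum (normr_ge0 s).
rewrite (eq_measure_integral (mscale ns
  (measure_function_pushforward__canonical__measure_function_Measure lam ma))); last first.
  by move=> A mA _; rewrite [LHS](lebesgue_measureZ c s0).
by rewrite ge0_integral_mscale// ge0_integral_pushforward.
Qed.

Lemma ge0_integral_affine2 (s : R) (c : R * R) (F : TR * TR -> \bar R) : 0 < s ->
  measurable_fun setT F -> (forall x, 0 <= F x)%E ->
  (\int[lam2]_z F z = (s ^+ 2)%:E * \int[lam2]_z F ((c.1 + s * z.1)%R, (c.2 + s * z.2)%R))%E.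
Proof.
move=> s0 mF F0.
have ma : measurable_fun setT (fun z : TR * TR => (c.1 + s * z.1 : TR, c.2 + s * z.2 : TR)).
  apply/measurable_fun_pairP; split => /=.
    exact: (measurableT_comp (measurable_affine s c.1) measurable_fst).
  exact: (measurableT_comp (measurable_affine s c.2) measurable_snd).
have mFa := measurableT_comp mF ma.
have s1 := lt0r_neq0 s0.
rewrite (fubini_tonelli1 F)//.
rewrite [X in (_ * X)%E](_ : _ = \int[lam]_x fubini_F lam
  (fun z : TR * TR => F ((c.1 + s * z.1)%R, (c.2 + s * z.2)%R)) x)%E; last exact: fubini_tonelli1.
rewrite /fubini_F/=.
transitivity (\int[lam]_x (s%:E * \int[lam]_y F (x, c.2 + s * y)%R))%E.
  apply: eq_integral => x _.
  rewrite (ge0_integral_affine (F := fun y => F (x, y)) c.2 s1) ?gtr0_norm//.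
  exact: measurable_fun_pair2.
have mG : measurable_fun setT (fun x : TR => \int[lam]_y F (x, (c.2 + s * y)%R))%E.
  have mF2 : measurable_fun setT (fun z : TR * TR => F (z.1, (c.2 + s * z.2)%R)).
    apply: (measurableT_comp mF); apply/measurable_fun_pairP; split; first exact: measurable_fst.
    by apply: measurable_funD => //; apply: measurable_funM => //; exact: measurable_snd.
  by apply: (measurable_fun_fubini_tonelli_F (fun z : TR * TR => F (z.1, (c.2 + s * z.2)%R))).
rewrite ge0_integralZl//; last 2 first.
- by move=> x _; apply: integral_ge0.
- by rewrite lee_fin ltW.
rewrite (ge0_integral_affine c.1 s1 mG); last by move=> x; apply: integral_ge0.
by rewrite gtr0_norm// muleA -EFinM expr2.
Qed.

(** Plays the part of polar coordinates: on each vertical line other than the axis the height is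
    rescaled by the abscissa, and Tonelli exchanges the integrals. *)
Lemma ge0_integral_slope (F : TR * TR -> \bar R) :
  measurable_fun setT F -> (forall x, 0 <= F x)%E ->
  (\int[lam2]_z F z = \int[lam]_m \int[lam]_x (`|x|%:E * F (x, m * x)%R))%E.
Proof.
move=> mF F0.
have mslope : measurable_fun setT (fun z : TR * TR => (z.1 : TR, z.2 * z.1 : TR)).
  apply/measurable_fun_pairP; split; first exact: measurable_fst.
  by apply: measurable_funM; [exact: measurable_snd|exact: measurable_fst].
pose G (z : TR * TR) := (`|z.1|%:E * F (z.1, z.2 * z.1)%R)%E.
have mG : measurable_fun setT G.
  apply: emeasurable_funM; last exact: (measurableT_comp mF mslope).
  by apply/measurable_EFinP; apply: measurableT_comp => //; exact: measurable_fst.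
have G0 z : (0 <= G z)%E by rewrite mule_ge0.
rewrite -(fubini_tonelli G)// (fubini_tonelli1 F)//.
have mx : measurable [set~ (0 : TR)] by exact: measurableC.
have rm (H : TR -> \bar R) : measurable_fun setT H ->
    (\int[lam]_x H x = \int[lam]_(x in [set~ (0%R : R)]) H x)%E.
  move=> mH; rewrite -setTD integral_setD1//.
    by rewrite setTD.
  exact: measurable_funTS.
rewrite rm ?[RHS]rm; first apply: eq_integral => x /[!inE] /= x0.
- rewrite /fubini_F (ge0_integral_affine 0 (s := x)) //; last 2 first.
  + exact/eqP.
  + exact: measurable_fun_pair2.
  rewrite -ge0_integralZl//.
  + by apply: eq_integral => y _; rewrite /G/= add0r mulrC.
  + have mFx : measurable_fun setT (fun y : TR => F (x, y)) by exact: measurable_fun_pair2.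
    exact: (measurableT_comp mFx (measurable_affine x 0)).
- by apply: (measurable_fun_fubini_tonelli_F G).
- by apply: (measurable_fun_fubini_tonelli_F F).
Qed.

Lemma integral_oneDsqr : (\int[lam]_x ((1 + x ^+ 2)^-1)%:E = (pi : R)%:E)%E.
Proof.
rewrite (@ge0_symfun_integralT R (fun x => (1 + x ^+ 2)^-1)).
- rewrite -set_itvcy (_ : integral _ _ _ = (pi / 2 : R)%:E).
    by rewrite -EFinM; congr _%:E; field.
  exact: integral0y_oneDsqr.
- by move=> x; rewrite invr_ge0 addr_ge0// sqr_ge0.
- exact: continuous_oneDsqrV.
- by move=> x /=; rewrite sqrrN.
Qed.

Lemma integral_quadraticV (a b c : R) : 0 < c -> 0 < a * c - b ^+ 2 ->
  (\int[lam]_m ((a + 2 * b * m + c * m ^+ 2)^-1)%:E = (pi / Num.sqrt (a * c - b ^+ 2))%:E)%E.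
Proof.
move=> c0 D0; set D := a * c - b ^+ 2 in D0 *.
have sD0 : 0 < Num.sqrt D by rewrite sqrtr_gt0.
have sD2 : Num.sqrt D ^+ 2 = D by rewrite sqr_sqrtr// ltW.
pose s := c / Num.sqrt D.
have s0 : 0 < s by rewrite divr_gt0.
have mo : measurable_fun setT (fun x : TR => ((1 + x ^+ 2)^-1)%:E).
  apply/measurable_EFinP; apply: continuous_measurable_fun.
  exact: continuous_oneDsqrV.
have p0 (x : TR) : (0 <= ((1 + x ^+ 2)^-1)%:E)%E by rewrite lee_fin invr_ge0 addr_ge0// sqr_ge0.
have := ge0_integral_affine (b / Num.sqrt D) (lt0r_neq0 s0) mo p0.
rewrite integral_oneDsqr gtr0_norm// -ge0_integralZl//; last 2 first.
- exact: (measurableT_comp mo (measurable_affine s _)).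
- by rewrite lee_fin ltW.
move=> E.
have -> : (pi / Num.sqrt D)%:E = ((Num.sqrt D)^-1%:E * (pi : R)%:E)%E by rewrite -EFinM mulrC.
rewrite E -ge0_integralZl//; last 2 first.
- apply: emeasurable_funM => //; exact: (measurableT_comp mo (measurable_affine s _)).
- by move=> x _; rewrite -EFinM lee_fin mulr_ge0 ?(ltW s0)// -lee_fin.
apply: eq_integral => m _; rewrite -!EFinM; congr _%:E.
have q0 : 0 < a + 2 * b * m + c * m ^+ 2.
  suff : 0 < c * (a + 2 * b * m + c * m ^+ 2) by rewrite pmulr_rgt0.
  rewrite (_ : c * _ = D + (c * m + b) ^+ 2); last by rewrite /D; ring.
  by rewrite ltr_wpDr// sqr_ge0.
have aE : a = (Num.sqrt D ^+ 2 + b ^+ 2) / c by rewrite sD2 /D; field; rewrite lt0r_neq0.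
rewrite aE /s; move: (Num.sqrt D) sD0 => r r0; field.
rewrite !lt0r_neq0//=.
  by rewrite ltr_pwDl ?exprn_gt0// sqr_ge0.
Qed.

Lemma integral_slope_line (q : R) : 0 < q ->
  (\int[lam]_x (`|x| * ((1 + q * x ^+ 2) ^+ 2)^-1)%:E = (q^-1)%:E)%E.
Proof.
move=> q0.
have d0 (x : R) : 0 < 1 + q * x ^+ 2 by rewrite ltr_pwDl// mulr_ge0 ?sqr_ge0 ?ltW.
have cf : continuous (fun x : R => `|x| * ((1 + q * x ^+ 2) ^+ 2)^-1).
  apply: contM; first by apply: cont_norm => x; exact: cvg_id.
  apply: contV => [|x]; last by rewrite expf_neq0// lt0r_neq0.
  by ccont.
rewrite (@ge0_symfun_integralT R (fun x => `|x| * ((1 + q * x ^+ 2) ^+ 2)^-1)) => [|x||x /=].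
- rewrite -set_itvcy.
  pose F (x : R) := - (2 * q)^-1 * (1 + q * x ^+ 2)^-1.
  have dF (x : R) : has_deriv x F (x * ((1 + q * x ^+ 2) ^+ 2)^-1).
    have dD : has_deriv x (fun x => 1 + q * x ^+ 2) (q * (2 * x)).
      by apply: is_derive_eq; rewrite /GRing.scale/= mulr1; ring.
    have dV := derivative_inv (f := fun x => 1 + q * x ^+ 2) (lt0r_neq0 (d0 x)) dD.
    apply: is_derive_eq; rewrite /GRing.scale/=.
    by field; rewrite !lt0r_neq0//=.
  rewrite (@ge0_continuous_FTC2y R (fun x => `|x| * ((1 + q * x ^+ 2) ^+ 2)^-1) F 0 0).
  + by rewrite -EFinB -EFinM /F; congr _%:E; field; rewrite lt0r_neq0// expr0n/= mulr0 addr0 oner_eq0.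
  + by move=> x _; rewrite mulr_ge0// invr_ge0 sqr_ge0.
  + exact: continuous_subspaceT.
  + apply/cvgrPdist_le => e e0; near=> x.
    rewrite sub0r normrN /F mulNr normrN ger0_norm; last first.
      by rewrite mulr_ge0// invr_ge0 ?mulr_ge0 ?ltW.
    rewrite -invfM -[leRHS]invrK lef_pV2 ?posrE ?invr_gt0 ?mulr_gt0//.
    have x1 : 1 <= x by near: x; exact: nbhs_pinfty_ge.
    have xe : e^-1 / (q * q) <= x by near: x; apply: nbhs_pinfty_ge; rewrite num_real.
    apply: (@le_trans _ _ (q * q * x)).
      by move: xe; rewrite ler_pdivrMr ?mulr_gt0// mulrC.
    have : 0 <= q * q * x * (x - 1) by rewrite !mulr_ge0 ?subr_ge0 ?(ltW q0)// (le_trans _ x1).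
    have : 0 <= q * q * x ^+ 2 by rewrite !mulr_ge0 ?sqr_ge0 ?(ltW q0).
    by move: q0; clear; lra.
  + by move=> x _; have [] := dF x.
  + apply: cvg_at_right_filter; apply: differentiable_continuous.
    by apply/derivable1_diffP; have [] := dF 0.
  + move=> x; rewrite in_itv/= andbT => x0; rewrite derive1E.
    by rewrite (@derive_val _ _ _ _ _ _ _ (dF x)) gtr0_norm.
- by rewrite mulr_ge0// invr_ge0 sqr_ge0.
- exact: cf.
- by rewrite normrN sqrrN.
Unshelve. all: by end_near. Qed.

(** On the line of slope m the form is q x^2 with q = a + 2 b m + c m^2; the line contributes 1 / q,
    and what remains is an arctangent integral in m. *)
Lemma integral_quadratic2 (a b c : R) : 0 < c -> 0 < a * c - b ^+ 2 ->
  (\int[lam2]_v (((1 + (a * v.1 ^+ 2 + 2 * b * v.1 * v.2 + c * v.2 ^+ 2)) ^+ 2)^-1)%:E =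
   (pi / Num.sqrt (a * c - b ^+ 2))%:E)%E.
Proof.
move=> c0 D0.
have q0 m : 0 < a + 2 * b * m + c * m ^+ 2.
  suff : 0 < c * (a + 2 * b * m + c * m ^+ 2) by rewrite pmulr_rgt0.
  rewrite (_ : c * _ = (a * c - b ^+ 2) + (c * m + b) ^+ 2); last by ring.
  by rewrite ltr_wpDr// sqr_ge0.
rewrite ge0_integral_slope.
- rewrite -integral_quadraticV//; apply: eq_integral => m _.
  rewrite -integral_slope_line//; apply: eq_integral => x _ /=.
  by rewrite -EFinM; congr (_ * (_ ^+ 2)^-1)%:E; ring.
- apply/measurable_EFinP; apply: continuous_measurable2.
  apply: contV => [|v]; first by ccont.
  rewrite expf_neq0// lt0r_neq0// ltr_pwDl//.
  have [v0|v0] := eqVneq v.1 0.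
    by rewrite v0; rewrite !(mulr0, mul0r, expr0n)/= !add0r mulr_ge0 ?sqr_ge0 ?ltW.
  rewrite (_ : _ + _ = v.1 ^+ 2 * (a + 2 * b * (v.2 / v.1) + c * (v.2 / v.1) ^+ 2)); last by field.
  by rewrite mulr_ge0 ?sqr_ge0 ?ltW.
- by move=> v; rewrite lee_fin invr_ge0 sqr_ge0.
Qed.

End scaling.

(** * Concentration on the diagonal *)

Section density.
Context {R : realType}.
Notation TR := (measurableTypeR R).

Lemma le_limn_einf_near (u : (\bar R)^nat) (a eta : R) : (a%:E <= limn_einf u)%E -> 0 < eta ->
  \forall n \near \oo, ((a - eta)%:E <= u n)%E.
Proof.
move=> au eta0; rewrite limn_einf_lim in au.
have ndu := nondecreasing_einfs u.
have su := ereal_nondecreasing_cvgn ndu.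
have : (((a - eta)%:E < ereal_sup (range (einfs u))))%E.
  by apply: lt_le_trans (le_trans au _); [rewrite lte_fin ltrBlDr ltrDl|rewrite (cvg_lim _ su)].
move=> /ereal_sup_gt[_ [m _ <-] am]; exists m => // n mn.
apply: (le_trans (ltW am)); apply: ereal_inf_lbound; exists n => //=.
Qed.

Lemma curvature_bound (k e : R) : curvature k -> 0 <= e <= 1 -> 0 <= 4 + k * e.
Proof.
by move=> hk /andP[]; move: hk; rewrite !inE => /or3P[] /eqP ->; clear; lra.
Qed.

Variables (k : R) (c : chart k).
Hypothesis hk : curvature k.

Let Ea w := ip k (emb1 c w) (emb1 c w).
Let Eb w := ip k (emb1 c w) (emb2 c w).
Let Ec w := ip k (emb2 c w) (emb2 c w).
Let Q w (v : R * R) := Ea w * v.1 ^+ 2 + 2 * Eb w * v.1 * v.2 + Ec w * v.2 ^+ 2.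

(** Lagrange's identity for the cross product of the partial derivatives, evaluated with the
    conormal and [ch_surface]. *)
Lemma chart_gram w : Ea w * Ec w - Eb w ^+ 2 = dens c w ^+ 2.
Proof.
have hX := ch_crossX c w; have hY := ch_crossY c w; have hZ := ch_crossZ c w.
have -> : Ea w * Ec w - Eb w ^+ 2 = (dens c w * cZ c w) ^+ 2 +
    k * ((dens c w * (k * cX c w)) ^+ 2 + (dens c w * (k * cY c w)) ^+ 2).
  by rewrite -hX -hY -hZ /Ea /Ec /Eb /ip /=; ring.
have -> : (dens c w * cZ c w) ^+ 2 + k * ((dens c w * (k * cX c w)) ^+ 2 + (dens c w * (k * cY c w)) ^+ 2) =
  dens c w ^+ 2 * (cZ c w ^+ 2 + k ^+ 3 * (cX c w ^+ 2 + cY c w ^+ 2)) by ring.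
have -> : k ^+ 3 = k by move: hk; rewrite !inE => /or3P[] /eqP ->; ring.
by rewrite ch_surface mulr1.
Qed.

(** The length scale of the kernel: the regularization is run along [d = ep n ^+ 2], since [d] is
    compared with a squared chord. *)
Let ep (n : nat) : R := n.+1%:R^-1.
Let ep0 n : 0 < ep n. Proof. by rewrite invr_gt0. Qed.
Let ep1 n : ep n <= 1. Proof. by rewrite invf_le1// ler1n. Qed.
Let cep : ep n @[n --> \oo] --> 0. Proof. exact: cvg_harmonic. Qed.

Let line (w v : R * R) (n : nat) : R * R := (w.1 + ep n * v.1, w.2 + ep n * v.2).

Let cline w v : line w v n @[n --> \oo] --> w.
Proof.
have c1 (a b : R) : a + ep n * b @[n --> \oo] --> a.
  by rewrite -[X in _ --> X]addr0 -(mul0r b); apply: cvgD; [exact: cvg_cst|apply: cvgM => //; exact: cvg_cst].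
by case: w => w1 w2; apply: (@cvg_pair _ _ _ \oo (nbhs w1) (nbhs w2)); exact: c1.
Qed.

Let cslope f f1 f2 w v : C1 f f1 f2 ->
  (ep n)^-1 * (f (line w v n) - f w) @[n --> \oo] --> v.1 * f1 w + v.2 * f2 w.
Proof.
move=> [df _ _ _]; have [dd dv] := df w v.
pose F t := f (w.1 + t * v.1, w.2 + t * v.2).
have : h^-1 *: ((F \o shift 0) (h *: (1 : R)) - F 0) @[h --> 0^'] --> v.1 * f1 w + v.2 * f2 w.
  by rewrite -dv; exact: dd.
move=> /cvgr_dnbhsP /(_ ep) H.
have {H} := H (conj (fun n => lt0r_neq0 (ep0 n)) cep); apply: cvg_trans; apply: near_eq_cvg; near=> n => /=.
by rewrite /GRing.scale/= /F mulr1 addr0 !mul0r !addr0 -surjective_pairing.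
Unshelve. all: by end_near. Qed.

Let cchord w v : (ep n ^+ 2)^-1 * sqd k (emb c (line w v n)) (emb c w) @[n --> \oo] --> Q w v.
Proof.
have hX := cslope (w := w) (v := v) (chX c).
have hY := cslope (w := w) (v := v) (chY c).
have hZ := cslope (w := w) (v := v) (chZ c).
have -> : Q w v = (v.1 * cX1 c w + v.2 * cX2 c w) ^+ 2 + (v.1 * cY1 c w + v.2 * cY2 c w) ^+ 2 +
   k * (v.1 * cZ1 c w + v.2 * cZ2 c w) ^+ 2.
  by rewrite /Q /Ea /Eb /Ec /ip /=; ring.
pose A f n := (ep n)^-1 * (f (line w v n) - f w).
rewrite (_ : (fun n => _) = (fun n => A (cX c) n * A (cX c) n + A (cY c) n * A (cY c) n +
    k * (A (cZ c) n * A (cZ c) n))); last first.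
  apply/funext => n; rewrite /A /sqd /ip /=; have /lt0r_neq0 := ep0 n; move: (ep n) => e e0.
  by rewrite expr2 invfM; ring.
rewrite !expr2; apply: cvgD; first by apply: cvgD; exact: cvgM.
by apply: cvgM; [exact: cvg_cst|exact: cvgM].
Qed.

(** The sign cannot be read off from the ambient form, which is indefinite for k = -1. By [cchord],
    [Ec] is a limit of scaled squared chords, and it cannot vanish because the Gram determinant is
    [dens] squared. *)
Let Ec_gt0 w : 0 < Ec w.
Proof.
have Ec0 : 0 <= Ec w.
  have := cchord (w := w) (v := (0, 1)); rewrite /Q /= expr0n/= !mulr0 add0r mul0r add0r expr1n mulr1 => H.
  have <- := cvg_lim _ H => //; apply: limr_ge; first by apply/cvg_ex; exists (Ec w).
  by apply: nearW => n; rewrite mulr_ge0 ?invr_ge0 ?sqr_ge0// -chordE ch_chord.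
rewrite lt_neqAle Ec0 andbT eq_sym; apply/negP => /eqP E0.
have := chart_gram w; rewrite E0 mulr0 sub0r => H.
have : 0 < dens c w ^+ 2 by rewrite exprn_gt0// dens_gt0.
by rewrite -H oppr_gt0 ltNge sqr_ge0.
Qed.

Lemma measurable_affine2 (w : R * R) (s : R) :
  measurable_fun setT (fun z : TR * TR => (w.1 + s * z.1 : TR, w.2 + s * z.2 : TR)).
Proof.
apply/measurable_fun_pairP; split => /=.
  exact: (measurableT_comp (measurable_affine s w.1) measurable_fst).
exact: (measurableT_comp (measurable_affine s w.2) measurable_snd).
Qed.

Variables (E U : set (TR * TR)) (rho : R).
Hypotheses (mE : measurable E) (Er : E `<=` square rho).
Hypotheses (oU : open (U : set (R * R))) (UE : U `<=` E).

Let K n (x : (R * R) * (R * R)) : R := dens c x.1 * (dens c x.2 *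
  ((4 * ep n ^+ 2 + k * (ep n ^+ 2) ^+ 2) / (sqd k (emb c x.1) (emb c x.2) + ep n ^+ 2) ^+ 2)).

Let den n x : 0 < sqd k (emb c x.1) (emb c x.2) + ep n ^+ 2.
Proof. by rewrite -chordE ltr_wpDl ?exprn_gt0// ch_chord. Qed.

Let k4 n : 0 <= 4 + k * ep n ^+ 2.
Proof.
by apply: curvature_bound => //; rewrite sqr_ge0 exprn_ile1// ltW.
Qed.

Let K_ge0 n x : 0 <= K n x.
Proof.
rewrite /K !mulr_ge0 ?(ltW (dens_gt0 _ _)) ?invr_ge0 ?sqr_ge0//.
rewrite (_ : _ + _ = (4 + k * ep n ^+ 2) * ep n ^+ 2); last by ring.
by rewrite mulr_ge0 ?sqr_ge0// k4.
Qed.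

Let cK n : continuous (K n).
Proof.
have cc f : continuous f -> continuous (fun x : (R * R) * (R * R) => f x.1 : R) /\
    continuous (fun x : (R * R) * (R * R) => f x.2 : R).
  by move=> cf; split; apply: cont_at cf _ => x; [exact: cvg_fst|exact: cvg_snd].
have cXc : continuous (cX c) by have [] := chX c.
have [xg xh] := cc _ cXc.
have cYc : continuous (cY c) by have [] := chY c.
have [yg yh] := cc _ cYc.
have cZc : continuous (cZ c) by have [] := chZ c.
have [zg zh] := cc _ cZc.
have [dg dh] := cc _ (@dens_cont _ _ c).
rewrite /K; apply: contM => //; apply: contM => //; apply: contM; first exact: cst_continuous.
apply: contV => [|x]; last by rewrite expf_neq0// lt0r_neq0.
apply: contX; apply: contD; last exact: cst_continuous.
rewrite /sqd /ip /=; apply: contD; [apply: contD|]; [..|apply: contM; first exact: cst_continuous];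
  apply: contM; exact: contB.
Qed.

Let cKs n w : continuous (fun z => K n (z, w)).
Proof. by have H := cK (n := n); exact: continuous_section. Qed.

Let gE n w := (\int[lam2]_(z in E) (K n (z, w))%:E)%E.

(** Blowing up at [w] by z = w + ep n v turns the integrand into one that tends to 4 dens^2 / (1 +
    Q)^2, with integral 4 dens^2 (pi / dens). A lower bound suffices, and this is what Fatou's lemma
    gives. As [w] is interior, every blown-up point eventually lies in [E]. *)
Lemma inner_density w : U w -> ((4 * pi * dens c w)%:E <= limn_einf (gE ^~ w))%E.
Proof.
move=> Uw; set dw := dens c w; have dw0 : 0 < dw by exact: dens_gt0.
pose G n z : R := \1_E z * K n (z, w).
have mG n : measurable_fun setT (EFin \o G n).
  apply/measurable_EFinP; apply: measurable_funM; first exact: measurable_indic.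
  by apply: continuous_measurable2; exact: cKs.
pose f n v : \bar R := ((ep n ^+ 2)%:E * (EFin \o G n) (line w v n))%E.
have gf n : gE n w = (\int[lam2]_v f n v)%E.
  rewrite /gE integral_mkcond.
  rewrite (_ : _ \_ _ = EFin \o G n); last first.
    by apply/funext => z; rewrite /patch /G /= indicE; case: ifPn => _; rewrite ?mul1r ?mul0r.
  rewrite (ge0_integral_affine2 w (ep0 n) (mG n)); last first.
    by move=> x; rewrite lee_fin mulr_ge0.
  rewrite -ge0_integralZl//.
  - exact: (measurableT_comp (mG n) (measurable_affine2 w (ep n))).
  - by move=> x _; rewrite lee_fin mulr_ge0.
  - by rewrite lee_fin sqr_ge0.
rewrite (_ : gE^~ w = fun n => \int[lam2]_v f n v)%E; last exact/funext.
have mf n : measurable_fun setT (f n).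
  by apply: measurable_funeM; exact: (measurableT_comp (mG n) (measurable_affine2 w (ep n))).
have f0 n v : setT v -> (0 <= f n v)%E.
  by move=> _; rewrite /f /= -EFinM lee_fin mulr_ge0 ?sqr_ge0// mulr_ge0.
apply: le_trans (fatou lam2 measurableT mf f0).
pose h (v : R * R) : R := (dw ^+ 2 * 4) * ((1 + Q w v) ^+ 2)^-1.
have hQ v : 0 <= Q w v.
  have H := cchord (w := w) (v := v); rewrite -(cvg_lim _ H)//.
  apply: limr_ge; first by apply/cvg_ex; exists (Q w v).
  by apply: nearW => n; rewrite mulr_ge0 ?invr_ge0 ?sqr_ge0// -chordE ch_chord.
have fh v : (limn_einf (f ^~ v) = (h v)%:E)%E.
  apply: (cvg_limn_einf_sup _).1.
  rewrite (_ : (fun n => f n v) = (fun n => (ep n ^+ 2 * G n (line w v n))%:E)); last first.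
    by apply/funext => n; rewrite /f /= -EFinM.
  apply: cvg_EFin; first exact: nearW.
  have H : dens c (line w v n) * (dw * ((4 + k * (ep n * ep n)) *
      (((ep n ^+ 2)^-1 * sqd k (emb c (line w v n)) (emb c w) + 1) ^+ 2)^-1)) @[n --> \oo] --> h v.
    rewrite (_ : h v = dw * (dw * ((4 + k * (0 * 0)) * ((Q w v + 1) ^+ 2)^-1))); last first.
      by rewrite /h (addrC 1); ring.
    apply: cvgM.
      by have cl := @cline w v; apply: (cvg_comp _ _ cl); exact: dens_cont.
    apply: cvgM; first exact: cvg_cst.
    apply: cvgM.
      by apply: cvgD; [exact: cvg_cst|apply: cvgM; [exact: cvg_cst|exact: cvgM]].
    apply: cvgV; first by rewrite expf_neq0// lt0r_neq0// ltr_wpDl.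
    rewrite !expr2; under eq_fun do rewrite expr2.
    by apply: cvgM; apply: cvgD; (exact: cchord || exact: cvg_cst).
  apply: cvg_trans H; apply: near_eq_cvg; near=> n.
  have El : line w v n \in E.
    by rewrite inE; apply: UE; near: n; apply: cline; exact: open_nbhs_nbhs.
  rewrite /= /G indicE El mul1r /K/= -/dw.
  have := den n (line w v n, w); have := ep0 n; move: (ep n) (sqd _ _ _) => e N /= e0 N0.
  have e1 : e != 0 by exact: lt0r_neq0.
  have N1 : N + e ^+ 2 != 0 by exact: lt0r_neq0.
  by field; rewrite N1 e1.
under eq_integral do rewrite fh.
rewrite /h; under eq_integral do rewrite EFinM.
have m1 : measurable_fun [set: TR * TR] (fun x : TR * TR => (((1 + Q w x) ^+ 2)^-1)%:E).
  apply/measurable_EFinP; apply: continuous_measurable2; apply: contV => [|x].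
    by rewrite /Q; ccont.
  by rewrite expf_neq0// lt0r_neq0// ltr_pwDl.
rewrite ge0_integralZl//; last 2 first.
- by move=> v _; rewrite lee_fin invr_ge0 sqr_ge0.
- by rewrite lee_fin mulr_ge0// sqr_ge0.
rewrite integral_quadratic2//; last by rewrite chart_gram exprn_gt0.
rewrite chart_gram sqrtr_sqr gtr0_norm// -EFinM lee_fin -/dw.
by rewrite le_eqVlt; apply/orP; left; apply/eqP; field; rewrite lt0r_neq0.
Unshelve. all: by end_near. Qed.

(** Fatou's lemma once more, now in [w] over the open set [U] where [inner_density] is available. *)
Lemma energy_limit (eta : R) : lam2 (E `\` U) = 0 -> 0 < eta ->
  \forall n \near \oo, 4 * pi * \int[lam2]_(w in E) dens c w - eta <=
     \int[lam2]_(w in E) \int[lam2]_(z in E) K n (z, w).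
Proof.
move=> EU eta0.
have mU : measurable U by exact: open_measurable2.
have iK n w : lam2.-integrable E (EFin \o (fun z => K n (z, w))).
  by apply: (continuous_integrable2 _ mE Er); exact: cKs.
have gR n w : gE n w = (\int[lam2]_(z in E) K n (z, w))%:E.
  by rewrite /Rintegral fineK//; apply: integrable_fin_num (iK n w).
have cg n : continuous (fun w => \int[lam2]_(z in E) K n (z, w)).
  exact: continuous_Rintegral mE Er.
have g0 n w : (0 <= gE n w)%E by apply: integral_ge0 => z _; rewrite lee_fin.
have mg n : measurable_fun setT (gE n).
  rewrite (_ : gE n = EFin \o (fun w => \int[lam2]_(z in E) K n (z, w))); last exact/funext.
  by apply/measurable_EFinP; exact: continuous_measurable2.
have Fat := fatou lam2 mU (fun n => measurable_funS measurableT (@subsetT _ U) (mg n)) (fun n w _ => g0 n w).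
have id : lam2.-integrable E (EFin \o dens c) by apply: (continuous_integrable2 _ mE Er); exact: dens_cont.
have md (D : set (TR * TR)) : measurable_fun D (fun w => (dens c w)%:E).
  by apply/measurable_EFinP; apply: measurable_funS (continuous_measurable2 (@dens_cont _ _ c)).
have idU : (\int[lam2]_(w in U) (dens c w)%:E = (\int[lam2]_(w in E) dens c w)%:E)%E.
  rewrite /Rintegral fineK; last exact: integrable_fin_num.
  have mD : measurable (E `\` U) by exact: measurableD.
  rewrite -[in RHS](setDUK UE) integral_setU//=.
  - by rewrite [X in (_ + X)%E]null_set_integral ?adde0//; exact: md.
  - by apply/disj_set2P; rewrite setDE setIA (setIC U) -setIA setICr setI0.
have L1 : ((4 * pi * \int[lam2]_(w in E) dens c w)%:E <= limn_einf (fun n => \int[lam2]_(w in U) gE n w))%E.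
  apply: le_trans Fat; rewrite EFinM -idU -ge0_integralZl//; last 2 first.
  - by move=> w _; rewrite lee_fin ltW// dens_gt0.
  - by rewrite lee_fin mulr_ge0// pi_ge0.
  apply: ge0_le_integral => //.
  - by move=> w _; rewrite -EFinM lee_fin !mulr_ge0 ?pi_ge0// ltW// dens_gt0.
  - apply: measurable_funeM.
    exact: md.
  - rewrite (_ : (fun w => _) = (fun w => - limn_esup (fun n => - gE n w)))%E; last first.
      by apply/funext => w; rewrite -[X in limn_einf X](_ : -%E \o (fun n => - gE n w) = _)%E ?limn_einfN//;
        apply/funext => n /=; rewrite oppeK.
    apply: measurableT_comp => //; apply: measurable_fun_limn_esup => n.
    by apply: measurableT_comp => //; exact: measurable_funS (mg n).
  - by move=> w Uw; rewrite -EFinM; exact: inner_density.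
near=> n.
rewrite -lee_fin; apply: (@le_trans _ _ (\int[lam2]_(w in U) gE n w)%E).
  by near: n; exact: le_limn_einf_near.
rewrite /Rintegral fineK; last first.
  by apply: integrable_fin_num => //; exact: (continuous_integrable2 (cg n) mE Er).
under [in leRHS]eq_integral do rewrite -gR.
apply: ge0_subset_integral => //.
by apply: measurable_funS (mg n).
Unshelve. all: by end_near. Qed.

End density.

(** * Algebra of the ambient form and bounds for the kernel *)

Section surface_algebra.
Context {R : realType}.
Local Notation pt := (R * R * R)%type.
Implicit Types (k d : R) (x y u v a b n m : pt).

Definition det3 x y w : R := x.1.1 * (y.1.2 * w.2 - y.2 * w.1.2) +
  x.1.2 * (y.2 * w.1.1 - y.1.1 * w.2) + x.2 * (y.1.1 * w.1.2 - y.1.2 * w.1.1).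

Definition tangent k x v : Prop := x.2 * v.2 + k * (x.1.1 * v.1.1 + x.1.2 * v.1.2) = 0.

Definition comb (s t : R) x y : pt :=
  (s * x.1.1 + t * y.1.1, s * x.1.2 + t * y.1.2, s * x.2 + t * y.2).

Lemma curvature_le0 k : curvature k -> k != 1 -> k <= 0.
Proof. by rewrite !inE => /or3P[] /eqP ->; rewrite ?eqxx// lerN10. Qed.

Lemma signP k : curvature k -> k = 0 \/ k ^+ 2 = 1.
Proof. by rewrite !inE => /or3P[] /eqP ->; [right|left|right]; rewrite ?sqrrN ?expr1n. Qed.

Lemma curvature_cube k : curvature k -> k ^+ 3 = k.
Proof. by move=> /signP[->|k2]; rewrite exprS ?mul0r// k2 mulr1. Qed.

Lemma surface0_height x : surface 0 x -> x.2 = 1.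
Proof. by rewrite surface0E. Qed.

Lemma tangent_ip k x v : k ^+ 2 = 1 -> tangent k x v -> ip k x v = 0.
Proof.
move=> k2 t; have := congr1 (fun s => k * s) t; rewrite mulr0 /ip => <-.
by ring: k2.
Qed.

Lemma ip_self k x : k ^+ 2 = 1 -> surface k x -> ip k x x = k.
Proof.
by move=> k2 [t _]; rewrite -[RHS]mulr1 -t /ip; ring: k2.
Qed.

(** For k = 1 and k = -1 the Gram determinant of y, a, b in the ambient form is k times the squared
    determinant, and it splits because y is orthogonal to its tangent vectors, with <y, y> = k. *)
Lemma det3_gram k y a b : curvature k -> surface k y -> tangent k y a -> tangent k y b ->
  det3 y a b ^+ 2 = ip k a a * ip k b b - ip k a b ^+ 2.
Proof.
move=> /signP[->|k2] sy ta tb.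
  have y3 := surface0_height sy; move: ta tb; rewrite /tangent y3 !mul0r !addr0 !mul1r => a0 b0.
  by rewrite /det3 /ip y3 a0 b0; ring.
have := ip_self k2 sy; have := tangent_ip k2 ta; have := tangent_ip k2 tb => ib ia iy.
have E : k * det3 y a b ^+ 2 = ip k y y * (ip k a a * ip k b b - ip k a b ^+ 2) -
    ip k a a * ip k y b ^+ 2 - ip k b b * ip k y a ^+ 2 + 2 * ip k a b * ip k y a * ip k y b.
  by rewrite /det3 /ip; ring.
have k0 : k != 0 by apply/eqP => k0; move: k2; rewrite k0 expr0n/= => /eqP; rewrite eq_sym oner_eq0.
by apply: (mulfI k0); rewrite E iy ia ib; ring.
Qed.

Lemma tangent_ge0 k x v : curvature k -> surface k x -> tangent k x v -> 0 <= ip k v v.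
Proof.
rewrite !inE => /or3P[] /eqP ->.
- rewrite surfaceN1E => -[sx x0] t; rewrite -(pmulr_rge0 _ (exprn_gt0 2 x0)).
  have tx : x.2 * v.2 = x.1.1 * v.1.1 + x.1.2 * v.1.2 by move: t; rewrite /tangent; lra.
  have -> : x.2 ^+ 2 * ip (-1) v v = x.2 ^+ 2 * (v.1.1 ^+ 2 + v.1.2 ^+ 2) - (x.2 * v.2) ^+ 2.
    by rewrite /ip; ring.
  rewrite sx tx; have := sqr_ge0 (x.1.1 * v.1.2 - x.1.2 * v.1.1); have := sqr_ge0 v.1.1; have := sqr_ge0 v.1.2.
  by clear; nra.
- by move=> _ _; rewrite /ip mul0r addr0 -!expr2 addr_ge0 ?sqr_ge0.
- by move=> _ _; rewrite /ip mul1r -!expr2 !addr_ge0 ?sqr_ge0.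
Qed.

Lemma tangent_cs k x a b : curvature k -> surface k x -> tangent k x a -> tangent k x b ->
  ip k a b ^+ 2 <= ip k a a * ip k b b.
Proof. by move=> hk sx ta tb; rewrite -subr_ge0 -(det3_gram hk sx ta tb) sqr_ge0. Qed.

(** On the hyperboloid this is the reversed Cauchy-Schwarz inequality, obtained from a sum of
    squares for (x3 y3)^2 - p^2. *)
Lemma sqd_surface k x y : curvature k -> surface k x -> surface k y ->
  0 <= sqd k x y /\ (sqd k x y = 0 -> x = y).
Proof.
have pE (p q : pt) : p.1.1 = q.1.1 -> p.1.2 = q.1.2 -> p.2 = q.2 -> p = q.
  by case: p q => [[? ?] ?] [[? ?] ?] /= -> -> ->.
rewrite !inE => /or3P[] /eqP ->.
- rewrite surfaceN1E => -[sx x0] [sy y0].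
  pose p := 1 + x.1.1 * y.1.1 + x.1.2 * y.1.2.
  have E : (x.2 * y.2) ^+ 2 - p ^+ 2 = (x.1.1 * y.1.2 - x.1.2 * y.1.1) ^+ 2 +
      (x.1.1 - y.1.1) ^+ 2 + (x.1.2 - y.1.2) ^+ 2.
    by rewrite exprMn sx sy /p; ring.
  have NE : sqd (-1) x y = 2 * (x.2 * y.2 - p).
    by rewrite /sqd /ip /p /=; move: sx sy; clear; lra.
  have xy0 : 0 < x.2 * y.2 by rewrite mulr_gt0.
  have s1 := sqr_ge0 (x.1.1 * y.1.2 - x.1.2 * y.1.1).
  have s2 := sqr_ge0 (x.1.1 - y.1.1); have s3 := sqr_ge0 (x.1.2 - y.1.2).
  split.
    rewrite NE mulr_ge0// subr_ge0 leNgt; apply/negP => pxy.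
    have : 0 < (p - x.2 * y.2) * (p + x.2 * y.2)
      by apply: mulr_gt0; [rewrite subr_gt0|rewrite addr_gt0// (lt_trans xy0 pxy)].
    by move: E s1 s2 s3; clear; nra.
  move=> N0; have pE' : x.2 * y.2 = p by move: N0; rewrite NE; clear; lra.
  move: E; rewrite pE' subrr => E.
  have e1 : x.1.1 = y.1.1.
    by apply/eqP; rewrite -subr_eq0 -sqrf_eq0 eq_le s2 andbT; move: E s1 s2 s3; clear; lra.
  have e2 : x.1.2 = y.1.2.
    by apply/eqP; rewrite -subr_eq0 -sqrf_eq0 eq_le s3 andbT; move: E s1 s2 s3; clear; lra.
  apply: pE => //; apply/eqP; rewrite -(eqrXn2 (n := 2))// ?ltW//.
  by rewrite sx sy e1 e2.
- move=> /surface0_height sx /surface0_height sy; rewrite /sqd /ip /= mul0r addr0 -!expr2.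
  have s2 := sqr_ge0 (x.1.1 - y.1.1); have s3 := sqr_ge0 (x.1.2 - y.1.2).
  split; first by rewrite addr_ge0.
  move=> E; apply: pE; last by rewrite sx sy.
    by apply/eqP; rewrite -subr_eq0 -sqrf_eq0 eq_le s2 andbT; move: E s2 s3; clear; lra.
  by apply/eqP; rewrite -subr_eq0 -sqrf_eq0 eq_le s3 andbT; move: E s2 s3; clear; lra.
- move=> _ _; rewrite /sqd /ip /= mul1r -!expr2.
  have s2 := sqr_ge0 (x.1.1 - y.1.1); have s3 := sqr_ge0 (x.1.2 - y.1.2); have s4 := sqr_ge0 (x.2 - y.2).
  split; first by rewrite !addr_ge0.
  move=> E; apply: pE.
  + by apply/eqP; rewrite -subr_eq0 -sqrf_eq0 eq_le s2 andbT; move: E s2 s3 s4; clear; lra.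
  + by apply/eqP; rewrite -subr_eq0 -sqrf_eq0 eq_le s3 andbT; move: E s2 s3 s4; clear; lra.
  + by apply/eqP; rewrite -subr_eq0 -sqrf_eq0 eq_le s4 andbT; move: E s2 s3 s4; clear; lra.
Qed.

(* The reflection exchanging [x] and [y] maps tangent vectors at [x] to tangent vectors at [y]. *)
Lemma tangent_reflect k x y v : curvature k -> surface k x -> surface k y -> tangent k x v ->
  tangent k y (comb (sqd k x y) (- 2 * ip k v (vsub x y)) v (vsub x y)).
Proof.
move=> /signP[->|k2] sx sy tv.
  have x3 := surface0_height sx; have y3 := surface0_height sy.
  move: tv; rewrite /tangent /comb /= x3 y3 mul0r addr0 mul1r => ->; rewrite subrr; ring.
have [[hx _] [hy _]] := (sx, sy).
pose B := x.2 * y.2 + k * (x.1.1 * y.1.1 + x.1.2 * y.1.2).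
have NE : sqd k x y = 2 * k * (1 - B).
  transitivity (k * (x.2 ^+ 2 + k * (x.1.1 ^+ 2 + x.1.2 ^+ 2) + (y.2 ^+ 2 + k * (y.1.1 ^+ 2 + y.1.2 ^+ 2)) - 2 * B)).
    by rewrite /B /sqd /ip /=; ring: k2.
  by rewrite hx hy; ring.
pose C := y.2 * v.2 + k * (y.1.1 * v.1.1 + y.1.2 * v.1.2).
have VE : ip k v (vsub x y) = - (k * C).
  transitivity (k * (x.2 * v.2 + k * (x.1.1 * v.1.1 + x.1.2 * v.1.2)) - k * C).
    by rewrite /C /ip /=; ring: k2.
  by rewrite tv mulr0 sub0r.
rewrite /tangent /comb NE VE /=.
transitivity (2 * k * (1 - B) * C + 2 * (k * C) * (B - (y.2 ^+ 2 + k * (y.1.1 ^+ 2 + y.1.2 ^+ 2)))).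
  by rewrite /B /C; ring.
by rewrite hy; ring.
Qed.

Lemma ip_reflect k (N : R) v n : N = ip k n n ->
  ip k (comb N (- 2 * ip k v n) v n) (comb N (- 2 * ip k v n) v n) = N ^+ 2 * ip k v v.
Proof. by move=> ->; rewrite /ip /comb /=; ring. Qed.

(** N times the reflected vector is tangent at [y] and has length N |v|, so [det3_gram] expresses
    the defect in Cauchy-Schwarz against [u]. The square on the left is what has to vanish in the
    equality case. *)
Lemma kap0_gram k x y v u : curvature k -> surface k x -> surface k y ->
  tangent k x v -> tangent k y u ->
  (sqd k x y * det3 y u v - 2 * ip k v (vsub x y) * det3 y u x) ^+ 2 =
  sqd k x y ^+ 2 * (ip k v v * ip k u u) -
  (sqd k x y * ip k v u - 2 * ip k v (vsub x y) * ip k u (vsub x y)) ^+ 2.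
Proof.
move=> hk sx sy tv tu.
have tb := tangent_reflect hk sx sy tv.
have := det3_gram hk sy tu tb; rewrite (ip_reflect v (erefl (sqd k x y))) => G.
transitivity (det3 y u (comb (sqd k x y) (- 2 * ip k v (vsub x y)) v (vsub x y)) ^+ 2).
  by move: (sqd k x y) (ip k v (vsub x y)) => N s; rewrite /det3 /comb /=; ring.
rewrite G; have -> : ip k u (comb (sqd k x y) (- 2 * ip k v (vsub x y)) v (vsub x y)) =
  sqd k x y * ip k v u - 2 * ip k v (vsub x y) * ip k u (vsub x y).
  by move: (sqd k x y) (ip k v (vsub x y)) => N s; rewrite /ip /comb /=; ring.
ring.
Qed.

(** In Minkowski space 4 + N = - <x + y, x + y>. The kernel with d = 4 thus also comes from a
    reflection, the one in x + y: it sends x to - y, hence tangent vectors at x to tangent vectors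
    at y. *)
Lemma kap4_le x y v u : surface (-1) x -> surface (-1) y -> tangent (-1) x v -> tangent (-1) y u ->
  ((4 + sqd (-1) x y) * ip (-1) v u - 2 * ip (-1) v (vsub x y) * ip (-1) u (vsub x y)) ^+ 2 <=
  (4 + sqd (-1) x y) ^+ 2 * (ip (-1) v v * ip (-1) u u).
Proof.
move=> sx sy tv tu.
pose m := comb 1 1 x y; pose N4 := 4 + sqd (-1) x y.
have k2 : (-1 : R) ^+ 2 = 1 by rewrite sqrrN expr1n.
have hm : N4 = - ip (-1) m m.
  by have := ip_self k2 sx; have := ip_self k2 sy; rewrite /N4 /sqd /ip /=; clear; lra.
have vm : ip (-1) v m = - ip (-1) v (vsub x y).
  by have := tangent_ip k2 tv; rewrite /ip /=; clear; lra.
have um : ip (-1) u m = ip (-1) u (vsub x y).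
  by have := tangent_ip k2 tu; rewrite /ip /=; clear; lra.
pose b := comb N4 (2 * ip (-1) v m) v m.
have tb : tangent (-1) y b.
  have hv : ip (-1) y v = ip (-1) v m by have := tangent_ip k2 tv; rewrite /ip /=; clear; lra.
  have hy : ip (-1) y m = - N4 / 2.
    by rewrite hm; have := ip_self k2 sx; have := ip_self k2 sy; rewrite /ip /=; clear; lra.
  have : ip (-1) y b = 0.
    have -> : ip (-1) y b = N4 * ip (-1) y v + 2 * ip (-1) v m * ip (-1) y m by rewrite /b /ip /comb /=; ring.
    by rewrite hv hy; field.
  by rewrite /tangent /ip; clear; lra.
have hn : (-1 : R) \in [:: -1; 0; 1] by rewrite !inE eqxx.
have := tangent_cs hn sy tb tu.
have -> : ip (-1) b b = N4 ^+ 2 * ip (-1) v v.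
  have -> : ip (-1) b b = N4 ^+ 2 * ip (-1) v v + 4 * N4 * ip (-1) v m ^+ 2 + 4 * ip (-1) v m ^+ 2 * ip (-1) m m.
    by rewrite /b /ip /comb /=; ring.
  by rewrite hm; ring.
have -> : ip (-1) b u = N4 * ip (-1) v u - 2 * ip (-1) v (vsub x y) * ip (-1) u (vsub x y).
  have -> : ip (-1) b u = N4 * ip (-1) v u + 2 * ip (-1) v m * ip (-1) u m by rewrite /b /ip /comb /=; ring.
  by rewrite vm um; ring.
by rewrite mulrA.
Qed.

Lemma ip_cs k v u : 0 <= k -> ip k v u ^+ 2 <= ip k v v * ip k u u.
Proof.
move=> k0; rewrite -subr_ge0.
have -> : ip k v v * ip k u u - ip k v u ^+ 2 = (v.1.1 * u.1.2 - v.1.2 * u.1.1) ^+ 2 +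
  k * (v.1.1 * u.2 - v.2 * u.1.1) ^+ 2 + k * (v.1.2 * u.2 - v.2 * u.1.2) ^+ 2 by rewrite /ip; ring.
by apply: addr_ge0; [apply: addr_ge0; [exact: sqr_ge0|]|]; apply: mulr_ge0 => //; exact: sqr_ge0.
Qed.

(** For k >= 0 the ambient form is semidefinite, and the damped reflection v - s n has squared
    length |v|^2 - s^2 d. For k = -1, v - s n is in general not tangent and Cauchy-Schwarz fails;
    but (N + d) times the kernel is affine in d, and the bound holds at d = 0 and at d = 4, hence
    between them. *)
Lemma kap_sqr_le k d x y v u : curvature k -> 0 < d <= 4 -> surface k x -> surface k y ->
  tangent k x v -> tangent k y u -> kap k d x v y u ^+ 2 <= ip k v v * ip k u u.
Proof.
move=> hk /andP[d0 d4] sx sy tv tu.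
have [N0 Nx] := sqd_surface hk sx sy.
have Nd : 0 < sqd k x y + d by rewrite ltr_wpDl.
have [k0|kn] := leP 0 k.
  pose s := 2 * ip k v (vsub x y) / (sqd k x y + d).
  have -> : kap k d x v y u = ip k (comb 1 (- s) v (vsub x y)) u.
    rewrite /kap /s; move: (ip k v (vsub x y)) (_^-1) => a i; rewrite /ip /comb /=; ring.
  apply: (le_trans (ip_cs _ _ k0)); apply: ler_wpM2r; first exact: tangent_ge0 sy tu.
  have -> : ip k (comb 1 (- s) v (vsub x y)) (comb 1 (- s) v (vsub x y)) =
      ip k v v - s * (2 * ip k v (vsub x y) - s * sqd k x y).
    by rewrite /sqd; move: s => s; rewrite /ip /comb /=; ring.
  rewrite gerBl.
  have -> : s * (2 * ip k v (vsub x y) - s * sqd k x y) = s ^+ 2 * d.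
    by rewrite /s; field; rewrite lt0r_neq0.
  by rewrite mulr_ge0 ?sqr_ge0// ltW.
have k1 : k = -1.
  by move: hk kn; rewrite !inE => /or3P[] /eqP -> //; rewrite ?ltxx// ltr10.
rewrite k1 in hk sx sy tv tu N0 Nx Nd *.
have [N00|N00] := eqVneq (sqd (-1) x y) 0.
  have xy := Nx N00; rewrite xy in tv *; rewrite /kap.
  have -> : ip (-1) v (vsub y y) = 0 by rewrite /ip /= !subrr; ring.
  by rewrite mulr0 !mul0r subr0; exact: tangent_cs sy tv tu.
have {}N0 : 0 < sqd (-1) x y by rewrite lt_neqAle eq_sym N00.
have h4 := kap4_le sx sy tv tu.
have h0 : (sqd (-1) x y * ip (-1) v u - 2 * ip (-1) v (vsub x y) * ip (-1) u (vsub x y)) ^+ 2 <=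
   sqd (-1) x y ^+ 2 * (ip (-1) v v * ip (-1) u u).
  by rewrite -subr_ge0 -kap0_gram// sqr_ge0.
have P0 : 0 <= ip (-1) v v * ip (-1) u u by rewrite mulr_ge0//; [exact: tangent_ge0 sx tv|exact: tangent_ge0 sy tu].
rewrite /kap; move: (sqd (-1) x y) (ip (-1) v v * ip (-1) u u) (ip (-1) v u) h4 h0 P0 Nd N0.
move: (2 * ip (-1) v (vsub x y) * ip (-1) u (vsub x y)) => ab N P w h4 h0 P0 Nd N0.
pose r := Num.sqrt P; have r0 : 0 <= r by exact: sqrtr_ge0.
have rP : P = r ^+ 2 by rewrite sqr_sqrtr.
have N4 : 0 < 4 + N by rewrite ltr_wpDr// ltW.
have b0 : `|N * w - ab| <= N * r.
  by rewrite -(ger0_norm (mulr_ge0 (ltW N0) r0)) -ler_sqr ?nnegrE// !real_normK ?num_real// exprMn -rP.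
have b4 : `|(4 + N) * w - ab| <= (4 + N) * r.
  by rewrite -(ger0_norm (mulr_ge0 (ltW N4) r0)) -ler_sqr ?nnegrE// !real_normK ?num_real// exprMn -rP.
rewrite rP -(real_normK (num_real (w - _))) ler_sqr ?nnegrE//.
have -> : w - ab / (N + d) = ((N + d) * w - ab) / (N + d) by field; rewrite lt0r_neq0.
rewrite normrM normfV (gtr0_norm Nd) ler_pdivrMr//.
move: b0 b4; rewrite !ler_norml => /andP[? ?] /andP[? ?]; apply/andP; split; nra.
Qed.

Lemma kap_le k d x y v u : curvature k -> 0 < d <= 4 -> surface k x -> surface k y ->
  tangent k x v -> tangent k y u -> `|kap k d x v y u| <= Num.sqrt (ip k v v) * Num.sqrt (ip k u u).
Proof.
move=> hk d04 sx sy tv tu; have := kap_sqr_le hk d04 sx sy tv tu.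
have v0 := tangent_ge0 hk sx tv; have u0 := tangent_ge0 hk sy tu.
rewrite -sqrtrM// => H; rewrite -sqrtr_sqr; exact: ler_wsqrtr.
Qed.

End surface_algebra.

Section discrete.
Context {R : realType}.
Notation TR := (measurableTypeR R).

Lemma emb_surface (k : R) (c : chart k) z : surface k (emb c z).
Proof.
by split; [exact: ch_surface|move=> /eqP; exact: ch_pos].
Qed.

Lemma dmap_tangent (k : R) (c : chart k) z a : tangent k (emb c z) (dmap c z a).
Proof.
have hX := ch_crossX c z; have hY := ch_crossY c z; have hZ := ch_crossZ c z.
have d0 := lt0r_neq0 (dens_gt0 c z).
apply: (mulfI d0); rewrite mulr0 /tangent /emb /dmap /=.
transitivity ((dens c z * cZ c z) * (a.1 * cZ1 c z + a.2 * cZ2 c z) +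
  (dens c z * (k * cX c z)) * (a.1 * cX1 c z + a.2 * cX2 c z) +
  (dens c z * (k * cY c z)) * (a.1 * cY1 c z + a.2 * cY2 c z)); first by ring.
by rewrite -hX -hY -hZ; ring.
Qed.

(** Order of choices: [energy_limit] fixes [d], then [double_star] fixes [eps0] for that [d]. The
    bound [d0] lets the caller force [d] to be small, as the equality case requires. *)
Lemma isoperimetric_discrete (k : R) (c : chart k) (E U : set (TR * TR)) (rho M eta d0 : R) :
  curvature k -> measurable E -> E `<=` square rho -> open (U : set (R * R)) ->
  U `<=` E -> lam2 (E `\` U) = 0 -> 0 < rho -> 0 <= M -> 0 < eta -> 0 < d0 ->
  let F := \int[lam2]_(z in E) dens c z in
  exists2 d : R, 0 < d < d0 & exists2 eps0 : R, 0 < eps0 <= 1 &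
  forall (J : eqType) (s : seq J) (p v : J -> R * R) (len : J -> R)
    (T : set (R * R)) (eps : R),
  0 <= eps <= eps0 -> sampled s p v len T eps M rho -> constant_off T E ->
  F * (4 * pi - k * F) - eta <= \sum_(j' <- s) \sum_(j <- s) len j' * len j *
      `|kap k d (emb c (p j)) (dmap c (p j) (v j)) (emb c (p j')) (dmap c (p j') (v j'))|.
Proof.
move=> hk mE Er oU UE EU rho0 M0 eta0 d00 F.
have e20 : 0 < eta / 2 by rewrite divr_gt0.
have [n [nd En]] : exists n : nat, n.+1%:R^-1 ^+ 2 < d0 /\
    4 * pi * F - eta / 2 <= \int[lam2]_(w in E) \int[lam2]_(z in E) (dens c z * (dens c w *
     ((4 * n.+1%:R^-1 ^+ 2 + k * (n.+1%:R^-1 ^+ 2) ^+ 2) / (sqd k (emb c z) (emb c w) + n.+1%:R^-1 ^+ 2) ^+ 2))).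
  have [N _ HN] : \forall n \near \oo, n.+1%:R^-1 ^+ 2 < d0 :> R /\
    4 * pi * F - eta / 2 <= \int[lam2]_(w in E) \int[lam2]_(z in E) (dens c z * (dens c w *
     ((4 * n.+1%:R^-1 ^+ 2 + k * (n.+1%:R^-1 ^+ 2) ^+ 2) / (sqd k (emb c z) (emb c w) + n.+1%:R^-1 ^+ 2) ^+ 2))).
    near=> n; split; last by near: n; exact: (@energy_limit R k c hk E U rho mE Er oU UE).
    apply: (@le_lt_trans _ _ n.+1%:R^-1).
      by rewrite expr2 ler_piMl ?invr_ge0// invf_le1 ?ler1n.
    near: n; have /cvgrPdist_lt/(_ _ d00) := @cvg_harmonic R.
    by apply: filterS => n; rewrite sub0r normrN ger0_norm// invr_ge0.
  by exists N; apply: HN => /=.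
pose d : R := n.+1%:R^-1 ^+ 2; have d_gt0 : 0 < d by rewrite exprn_gt0// invr_gt0.
exists d; first by rewrite d_gt0.
have [eps0 eps01 H] := double_star c hk d_gt0 rho0 M0 e20 mE Er.
exists eps0 => // J s p v len T eps epse smp TE.
have := H J s p v len T eps epse smp TE; set S := \sum_(j' <- s) _.
pose K (x : (R * R) * (R * R)) : R := dens c x.1 * (dens c x.2 *
  ((4 * d + k * d ^+ 2) / (sqd k (emb c x.1) (emb c x.2) + d) ^+ 2)).
have cK : continuous K.
  have cc f : continuous f -> continuous (fun x : (R * R) * (R * R) => f x.1 : R) /\
    continuous (fun x : (R * R) * (R * R) => f x.2 : R).
    by move=> cf; split; apply: cont_at cf _ => x; [exact: cvg_fst|exact: cvg_snd].
  have [dg dh] := cc _ (@dens_cont _ _ c).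
  rewrite /K; apply: contM => //; apply: contM => //; apply: contM; first exact: cst_continuous.
  under eq_fun do rewrite sqdC -chordE -exprVn; apply: contX.
  by apply: (@cont_ich R k c d d_gt0 _ fst snd) => x; [exact: cvg_fst|exact: cvg_snd].
have cKs w : continuous (fun z => K (z, w)) by exact: continuous_section.
have cdd w : continuous (fun z => dens c z * (dens c w * k)).
  by apply: contM; [exact: dens_cont|exact: cst_continuous].
have cdk : continuous (fun w => F * (dens c w * k)).
  by apply: contM; [exact: cst_continuous|apply: contM; [exact: dens_cont|exact: cst_continuous]].
have cI : continuous (fun w => \int[lam2]_(z in E) K (z, w)) by exact: continuous_Rintegral mE Er.
have id : lam2.-integrable E (EFin \o dens c) by apply: (continuous_integrable2 _ mE Er); exact: dens_cont.
have -> : \int[lam2]_(w in E) \int[lam2]_(z in E) (dens c z * (dens c w *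
      (k - (4 * d + k * d ^+ 2) / (sqd k (emb c z) (emb c w) + d) ^+ 2))) =
    k * F ^+ 2 - \int[lam2]_(w in E) \int[lam2]_(z in E) K (z, w).
  transitivity (\int[lam2]_(w in E) (F * (dens c w * k) - \int[lam2]_(z in E) K (z, w))).
    apply: eq_Rintegral => w _; rewrite -RintegralZr//.
    rewrite -RintegralB//; [|exact: (continuous_integrable2 (cdd w) mE Er)|exact: (continuous_integrable2 (cKs w) mE Er)].
    by apply: eq_Rintegral => z _; rewrite /K /= !mulrBr.
  rewrite RintegralB//; [|exact: (continuous_integrable2 cdk mE Er)|exact: (continuous_integrable2 cI mE Er)].
  congr (_ - _); rewrite RintegralZl//; last first.
    by apply: (continuous_integrable2 _ mE Er); apply: contM; [exact: dens_cont|exact: cst_continuous].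
  by rewrite RintegralZr// -/F; ring.
move: En; rewrite -/d -/(K _) => En Hs.
have En' : 4 * pi * F - eta / 2 <= \int[lam2]_(w in E) \int[lam2]_(z in E) K (z, w) by exact: En.
move: Hs; rewrite ler_norml => /andP[Hs _]; move: Hs En'; clear; move: (pi : R) => q; lra.
Unshelve. all: by end_near. Qed.

End discrete.

(** * Riemann sums *)

Section riemann.
Context {R : realType}.
Implicit Types (f phi : R -> R).

Lemma cont_integrable_itv phi a b : continuous phi -> lam.-integrable `[a, b] (EFin \o phi).
Proof.
move=> cp; apply: (@continuous_compact_integrable R phi); first exact: segment_compact.
exact: continuous_subspaceT.
Qed.

Lemma uniform_continuity phi a b e : continuous phi -> 0 < e ->
  exists2 dl, 0 < dl & forall s t, a <= s <= b -> `|t - s| <= dl -> `|phi t - phi s| <= e.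
Proof.
move=> cp e0.
have cg : continuous (fun x : R * R => phi (x.1 + x.2)).
  apply: (cont_at (f := phi) cp) => x; apply: cvgD; [exact: cvg_fst|exact: cvg_snd].
have /nbhs_ballP[dl /= dl0 H] := @uniform_near _ _ _ `[a, b]%classic _ (0 : R) e (@segment_compact R a b) cg e0.
exists (dl / 2) => [|s t sab ts]; first by rewrite divr_gt0.
have := H (t - s) _ s; rewrite /= addr0 (addrC s) subrK; apply; last by rewrite in_itv.
by rewrite /ball/= sub0r normrN (le_lt_trans ts)// ltr_pdivrMr// ltr_pMr// ltr1n.
Qed.

Lemma riemann_steps phi a l e n : continuous phi -> 0 <= l ->
  (forall j t, (j < n)%N -> a + l * j%:R <= t <= a + l * j.+1%:R -> `|phi t - phi (a + l * j%:R)| <= e) ->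
  `|\sum_(0 <= j < n) l * phi (a + l * j%:R) - \int[lam]_(t in `[a, a + l * n%:R]) phi t| <= e * l * n%:R.
Proof.
move=> cp l0; elim: n => [|n IHn] H.
  by rewrite big_geq// mulr0 addr0 set_itv1 Rintegral_set1 subr0 normr0 mulr0.
have ln : l * n%:R <= l * n.+1%:R by rewrite ler_wpM2l// ler_nat.
have ci := cont_integrable_itv a (a + l * n.+1%:R) cp.
have := @Rintegral_itvB R phi (BLeft a) (BRight (a + l * n.+1%:R)) (a + l * n%:R) ci.
rewrite !bnd_simp lerDl mulr_ge0// lerD2l => /(_ isT ln) E.
rewrite Rintegral_itv_obnd_cbnd in E; last first.
  apply: integrableS (cont_integrable_itv (a + l * n%:R) (a + l * n.+1%:R) cp) => //.
  by apply: subset_itvr; rewrite bnd_simp.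
have {IHn} := IHn (fun j t jn => H j t (ltnW jn)).
rewrite big_nat_recr//=.
move: E; set S := \sum_(0 <= j < n) _; set I1 := \int[lam]_(t in `[a, a + l * n%:R]) _.
set I2 := Rintegral _ _ _ => E IH.
have {E}E : I2 = I1 + \int[lam]_(t in `[(a + l * n%:R), (a + l * n.+1%:R)]) phi t by rewrite -E addrC subrK.
rewrite E opprD addrACA; apply: (le_trans (ler_normD _ _)).
rewrite (_ : e * l * n.+1%:R = e * l * n%:R + e * l); last by rewrite -natr1; ring.
apply: lerD => //.
have -> : l * phi (a + l * n%:R) = \int[lam]_(t in `[(a + l * n%:R), (a + l * n.+1%:R)]) (phi (a + l * n%:R)).
  rewrite Rintegral_cst//= lebesgue_measure_itv/= lte_fin ltrD2l.
  have [l1|] := ltP (l * n%:R) (l * n.+1%:R).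
    by rewrite -EFinB /= -natr1; ring.
  rewrite -natr1 mulrDr mulr1 gerDl => l0'; have -> : l = 0.
    by apply/eqP; rewrite eq_le l0 l0'.
  by rewrite mul0r mulr0.
rewrite -RintegralB//; [|exact: (cont_integrable_itv _ _ (@cst_continuous _ _ _))|exact: cont_integrable_itv].
apply: (le_trans (le_normr_Rintegral _ _)) => //.
  by apply: cont_integrable_itv; apply: contB => //; exact: cst_continuous.
apply: (@le_trans _ _ (\int[lam]_(t in `[(a + l * n%:R), (a + l * n.+1%:R)]) e)).
  apply: le_Rintegral => //.
  - by apply: cont_integrable_itv; apply: cont_norm; apply: contB => //; exact: cst_continuous.
  - exact: (cont_integrable_itv _ _ (@cst_continuous _ _ _)).
  - by move=> t; rewrite /= in_itv /= distrC; exact: H.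
rewrite Rintegral_cst//= lebesgue_measure_itv/= lte_fin ltrD2l.
case: ifP => _; last first.
  rewrite mulr0 mulr_ge0//; apply: le_trans (H n (a + l * n%:R) _ _) => //; by rewrite lexx lerD2l.
by rewrite -EFinB/= -natr1 le_eqVlt; apply/orP; left; apply/eqP; ring.
Qed.

Lemma riemann_sum phi a b e : continuous phi -> a <= b -> 0 < e ->
  exists N, forall n, (N <= n)%N ->
  `|\sum_(0 <= j < n.+1) (b - a) / n.+1%:R * phi (a + (b - a) / n.+1%:R * j%:R) -
    \int[lam]_(t in `[a, b]) phi t| <= e.
Proof.
move=> cp ab e0.
have e1 : 0 < e / (b - a + 1) by rewrite divr_gt0// ltr_wpDl// subr_ge0.
have [dl dl0 H] := @uniform_continuity phi a b _ cp e1.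
exists (Num.truncn ((b - a) / dl)) => n Nn.
have n0 : 0 < n.+1%:R :> R by [].
set l := (b - a) / n.+1%:R.
have l0 : 0 <= l by rewrite divr_ge0// subr_ge0.
have ln : l * n.+1%:R = b - a by rewrite /l divfK.
have ldl : l <= dl.
  rewrite /l ler_pdivrMr// mulrC -ler_pdivrMr//; apply: ltW.
  by apply: lt_le_trans (truncnS_gt _) _; rewrite ler_nat ltnS.
have lj j : (j < n.+1)%N -> l * j.+1%:R <= b - a by move=> jn; rewrite -ln ler_wpM2l// ler_nat.
have := @riemann_steps phi a l (e / (b - a + 1)) n.+1 cp l0; rewrite ln addrCA subrr addr0.
move=> H'; apply: le_trans (H' _) _.
  move=> j t jn /andP[t1 t2]; apply: H.
    rewrite lerDl mulr_ge0//= -lerBrDl; apply: le_trans (lj j jn).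
    by rewrite ler_wpM2l// ler_nat.
  rewrite ger0_norm ?subr_ge0//; apply: le_trans ldl.
  by move: t2; rewrite -natr1 mulrDr mulr1; lra.
rewrite -mulrA ln mulrAC ler_pdivrMr ?ltr_wpDl ?subr_ge0//.
by rewrite ler_wpM2l ?(ltW e0)// lerDl.
Qed.

(** Composition with [clamp a b] extends a function from [a, b] to the whole line, so that
    continuity need not be relative to the interval. *)
Definition clamp (a b t : R) : R := Num.max a (Num.min b t).

Lemma clamp_in a b t : a <= b -> a <= clamp a b t <= b.
Proof. by move=> ab; rewrite /clamp le_max lexx/= ge_max ab/= ge_min lexx. Qed.

Lemma clamp_id a b t : a <= t <= b -> clamp a b t = t.
Proof. by move=> /andP[at1 tb]; rewrite /clamp min_r// max_r. Qed.

Lemma continuous_clamp a b : continuous (clamp a b).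
Proof.
rewrite (_ : clamp a b = fun t => (a + (b + t - `|b - t|) / 2 + `|a - (b + t - `|b - t|) / 2|) / 2); first by ccont.
by apply/funext => t; rewrite /clamp maxr_absE minr_absE.
Qed.

Lemma continuous_clamped (T : topologicalType) (f : R -> T) a b : a <= b ->
  (forall t, a <= t <= b -> {for t, continuous f}) -> continuous (fun t => f (clamp a b t)).
Proof.
move=> ab cf t; apply: (@continuous_comp _ _ _ (clamp a b) f).
  exact: continuous_clamp.
exact/cf/clamp_in.
Qed.

Lemma half_gap (x y : R) : `|x - y| < x / 2 -> x / 2 < y.
Proof. by rewrite ltr_norml => /andP[_]; lra. Qed.

Lemma gap_sub (s c e x : R) : x <= e -> e < s - c -> c <= s - x.
Proof. lra. Qed.

End riemann.

(** * From samples to piecewise curves in a chart *)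

Section pieces.
Context {R : realType}.
Notation TR := (measurableTypeR R).

Lemma common_rank (m : nat) (P : nat -> nat -> Prop) :
  (forall i, (i < m)%N -> exists N, forall n, (N <= n)%N -> P i n) ->
  exists N, forall n, (N <= n)%N -> forall i, (i < m)%N -> P i n.
Proof.
elim: m => [|m IHm] H; first by exists 0%N.
have [N HN] := IHm (fun i im => H i (ltnW im)); have [N' HN'] := H m (ltnSn m).
exists (maxn N N') => n; rewrite geq_max => /andP[Nn N'n] i; rewrite ltnS leq_eqVlt.
by move=> /orP[/eqP ->|im]; [exact: HN'|exact: HN].
Qed.

Lemma tent_integral (a b s0 r : R) : a < b -> a <= s0 <= b -> 0 < r ->
  0 < \int[lam]_(t in `[a, b]) Num.max 0 (1 - `|t - s0| / r).
Proof.
move=> abi s0ab r0.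
pose f t : R := Num.max 0 (1 - `|t - s0| / r).
have cf : continuous f.
  rewrite (_ : f = fun t => (0 + (1 - `|t - s0| / r) + `|0 - (1 - `|t - s0| / r)|) / 2); first by ccont.
  by apply/funext => t; rewrite /f maxr_absE.
pose al := Num.max (a) (s0 - r / 2); pose be := Num.min (b) (s0 + r / 2).
have [s1 s2] := andP s0ab.
have r2 : 0 < r / 2 by rewrite divr_gt0.
have albe : al < be.
  rewrite /al /be gt_max !lt_min abi/=; apply/and3P; split; move: s1 s2 r2 abi; clear; lra.
have sub : `[al, be]%classic `<=` `[a, b]%classic.
  by apply: subset_itv; rewrite bnd_simp ?le_max ?ge_min lexx.
have ci := cont_integrable_itv (a) (b) cf.
apply: (@lt_le_trans _ _ (\int[lam]_(t in `[al, be]) 2^-1)).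
  by rewrite Rintegral_cst//= lebesgue_measure_itv/= lte_fin albe -EFinB/= mulr_gt0 ?subr_gt0.
apply: (@le_trans _ _ (\int[lam]_(t in `[al, be]) f t)).
  apply: le_Rintegral => //.
  - exact: (cont_integrable_itv _ _ (@cst_continuous _ _ _)).
  - exact: cont_integrable_itv.
  - move=> t; rewrite /= in_itv/= /al /be ge_max le_min => /andP[/andP[_ t1] /andP[_ t2]].
    rewrite /f le_max; apply/orP; right.
    have : `|t - s0| / r <= 2^-1.
      by rewrite ler_pdivrMr// ler_norml mulrC; apply/andP; split; move: t1 t2; clear; lra.
    by clear; lra.
rewrite /Rintegral; apply: fine_le.
- by apply: integrable_fin_num => //; exact: cont_integrable_itv.
- by apply: integrable_fin_num.
- apply: ge0_subset_integral => //.
  + by apply/measurable_EFinP; apply: measurable_funTS; exact: continuous_measurable_fun.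
  + by move=> t _; rewrite lee_fin /f le_max lexx.
Qed.

Lemma continuous_kap (k : R) (T : topologicalType) (x v y u : T -> R * R * R) (d : T -> R) (t0 : T) :
  continuous (fun t => (x t).1.1) -> continuous (fun t => (x t).1.2) -> continuous (fun t => (x t).2) ->
  continuous (fun t => (v t).1.1) -> continuous (fun t => (v t).1.2) -> continuous (fun t => (v t).2) ->
  continuous (fun t => (y t).1.1) -> continuous (fun t => (y t).1.2) -> continuous (fun t => (y t).2) ->
  continuous (fun t => (u t).1.1) -> continuous (fun t => (u t).1.2) -> continuous (fun t => (u t).2) ->
  continuous d -> sqd k (x t0) (y t0) + d t0 != 0 ->
  {for t0, continuous (fun t => kap k (d t) (x t) (v t) (y t) (u t))}.
Proof.
move=> *; rewrite /kap.
have c1 : continuous (fun t => ip k (v t) (u t)) by rewrite /ip; ccont.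
have c2 : continuous (fun t => ip k (v t) (vsub (x t) (y t))) by rewrite /ip /=; ccont.
have c3 : continuous (fun t => ip k (u t) (vsub (x t) (y t))) by rewrite /ip /=; ccont.
have c4 : continuous (fun t => sqd k (x t) (y t) + d t) by rewrite /sqd /ip /=; ccont.
apply: cvgB; first exact: c1.
apply: cvgM; last by apply: cvgV => //; exact: c4.
have : continuous (fun t => 2 * ip k (v t) (vsub (x t) (y t)) * ip k (u t) (vsub (x t) (y t))) by ccont.
exact.
Qed.

Variables (m : nat) (a b : nat -> R) (g w : nat -> R -> R * R).
Hypothesis ab : forall i, (i < m)%N -> a i <= b i.
Hypothesis sum_ab : \sum_(0 <= i < m) (b i - a i) <= 1.
Hypothesis cw1 : forall i, (i < m)%N -> continuous (fun t => (w i t).1).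
Hypothesis cw2 : forall i, (i < m)%N -> continuous (fun t => (w i t).2).
Hypothesis dg1 : forall i t, (i < m)%N -> a i <= t <= b i ->
  has_deriv t (fun t => (g i t).1) (w i t).1.
Hypothesis dg2 : forall i t, (i < m)%N -> a i <= t <= b i ->
  has_deriv t (fun t => (g i t).2) (w i t).2.

Definition ptrace : set (R * R) :=
  [set z | exists i, (i < m)%N /\ exists2 t, a i <= t <= b i & z = g i t].

Let idx n := [seq (i, j) | i <- index_iota 0 m, j <- index_iota 0 n.+1].
Let len n (l : nat * nat) : R := (b l.1 - a l.1) / n.+1%:R.
Let tt n (l : nat * nat) : R := a l.1 + len n l * l.2%:R.
Let pp n l := g l.1 (tt n l).
Let vv n l := w l.1 (tt n l).

Let idxP n l : l \in idx n -> (l.1 < m)%N /\ (l.2 < n.+1)%N.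
Proof.
case: l => i j; move=> /allpairsP[[i' j'] [/=]].
by rewrite !mem_index_iota => i'm j'n [-> ->].
Qed.

Let len0 n l : (l.1 < m)%N -> 0 <= len n l.
Proof. by move=> lm; rewrite divr_ge0// subr_ge0 ab. Qed.

Let ttP n l : l \in idx n -> a l.1 <= tt n l /\ tt n l + len n l <= b l.1.
Proof.
move=> /idxP[l1 l2]; have l0 := len0 n l1.
split; first by rewrite lerDl mulr_ge0.
rewrite /tt -addrA -{2}[len n l]mulr1 -mulrDr natr1 -lerBrDl.
have -> : b l.1 - a l.1 = len n l * n.+1%:R by rewrite /len divfK.
by rewrite ler_wpM2l// ler_nat.
Qed.

Lemma is_derive_continuous (f : R -> R) (t d : R) : has_deriv t f d -> {for t, continuous f}.
Proof. by move=> df; apply: differentiable_continuous; apply/derivable1_diffP; have [] := df. Qed.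

Lemma pieces_bounded : exists K : nat, forall i, (i < m)%N -> forall t, a i <= t <= b i ->
  [/\ `|(w i t).1| <= K%:R, `|(w i t).2| <= K%:R, `|(g i t).1| <= K%:R & `|(g i t).2| <= K%:R].
Proof.
have bd (i : nat) (f : R -> R) : (i < m)%N -> continuous f ->
    exists N, forall n, (N <= n)%N -> forall t, a i <= t <= b i -> `|f t| <= n%:R.
  move=> im cf.
  have [C C0 H] := continuous_bounded_compact (@segment_compact R (a i) (b i)) cf.
  exists (Num.truncn C).+1 => n Nn t tab; apply: (le_trans (H t _)); first by rewrite /= in_itv.
  by apply: (le_trans (ltW (truncnS_gt C))); rewrite ler_nat.
have bd' (i : nat) (f f' : R -> R) : (i < m)%N ->
    (forall t, a i <= t <= b i -> has_deriv t f (f' t)) ->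
    exists N, forall n, (N <= n)%N -> forall t, a i <= t <= b i -> `|f t| <= n%:R.
  move=> im df.
  have [N HN] := bd i _ im (continuous_clamped (ab im) (fun t tab => is_derive_continuous (df t tab))).
  by exists N => n Nn t tab; have := HN n Nn t tab; rewrite clamp_id.
have [N1 H1] := common_rank (fun i im => bd i _ im (cw1 im)).
have [N2 H2] := common_rank (fun i im => bd i _ im (cw2 im)).
have [N3 H3] := common_rank (fun i im => bd' i _ _ im (fun t => dg1 im)).
have [N4 H4] := common_rank (fun i im => bd' i _ _ im (fun t => dg2 im)).
exists (N1 + N2 + N3 + N4)%N => i im t tab.
by split; [apply: H1|apply: H2|apply: H3|apply: H4] => //; lia.
Qed.

Lemma derivative_approx (f f' : R -> R) (t0 t e : R) : t0 <= t ->
  (forall s, t0 <= s <= t -> has_deriv s f (f' s) /\ `|f' s - f' t0| <= e) ->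
  `|f t - f t0 - (t - t0) * f' t0| <= e * (t - t0).
Proof.
move=> t0t H.
have cf : {within `[t0, t], continuous f}.
  by apply: derivable_within_continuous => x; rewrite in_itv/= => /H[[]].
have [|c] := @MVT_segment R f f' t0 t t0t _ cf.
  by move=> x; rewrite in_itv/= => /andP[/ltW x0 /ltW xt]; have [] := H x; rewrite ?x0.
rewrite in_itv/= => /H[_ He] ->; rewrite mulrC -mulrBr normrM ger0_norm ?subr_ge0//.
by rewrite mulrC ler_wpM2r// subr_ge0.
Qed.

Lemma pieces_sampled (K eps : R) : 0 < eps ->
  (forall i, (i < m)%N -> forall t, a i <= t <= b i ->
    [/\ `|(w i t).1| <= K, `|(w i t).2| <= K, `|(g i t).1| <= K & `|(g i t).2| <= K]) ->
  exists N, forall n, (N <= n)%N -> sampled (idx n) (pp n) (vv n) (len n) ptrace eps K K.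
Proof.
move=> eps0 HK.
have uc (i : nat) (f : R -> R) : (i < m)%N -> continuous f -> exists N, forall n, (N <= n)%N ->
    forall s t, a i <= s <= b i -> `|t - s| <= (b i - a i) / n.+1%:R -> `|f t - f s| <= eps.
  move=> im cf; have [dl dl0 H] := @uniform_continuity R f (a i) (b i) eps cf eps0.
  exists (Num.truncn ((b i - a i) / dl)) => n Nn s t sab st; apply: H => //.
  apply: (le_trans st); rewrite ler_pdivrMr// mulrC -ler_pdivrMr//; apply: ltW.
  by apply: lt_le_trans (truncnS_gt _) _; rewrite ler_nat ltnS.
have [N1 H1] := common_rank (fun i im => uc i _ im (cw1 im)).
have [N2 H2] := common_rank (fun i im => uc i _ im (cw2 im)).
exists (maxn (Num.truncn eps^-1) (maxn N1 N2)) => n; rewrite !geq_max => /and3P[n0 n1 n2].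
have neps : n.+1%:R^-1 <= eps.
  rewrite invf_ple ?posrE//; apply: ltW; apply: lt_le_trans (truncnS_gt _) _.
  by rewrite ler_nat ltnS.
have bai i : (i < m)%N -> b i - a i <= 1.
  move=> im; apply: le_trans sum_ab; rewrite (big_cat_nat (n := i))//=; last exact: ltnW.
  have S1 : 0 <= \sum_(0 <= j < i) (b j - a j).
    by rewrite big_nat; apply: sumr_ge0 => j /andP[_ ji]; rewrite subr_ge0 ab// (ltn_trans ji).
  have S2 : 0 <= \sum_(i.+1 <= j < m) (b j - a j).
    by rewrite big_nat; apply: sumr_ge0 => j /andP[_ ji]; rewrite subr_ge0 ab.
  by rewrite (big_ltn im) addrCA lerDl addr_ge0.
split.
- move=> l ls; have [l1 l2] := idxP ls; have [t1 t2] := ttP ls; have l0 := len0 n l1.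
  have [|? ? ? ?] := HK l.1 l1 (tt n l); first by rewrite t1 (le_trans _ t2)// lerDl.
  split=> //; rewrite l0/= /len; apply: le_trans neps.
  by rewrite ler_piMl ?invr_ge0// bai.
- rewrite big_allpairs; apply: le_trans sum_ab.
  rewrite big_seq [leRHS]big_seq; apply: ler_sum => i _; rewrite /len /=.
  rewrite sumr_const_nat subn0 -[leLHS]mulr_natr divfK//.
- move=> _ [i [im [t tab ->]]].
  pose l0 := (b i - a i) / n.+1%:R; have l00 : 0 <= l0 by rewrite divr_ge0// subr_ge0 ab.
  have ln : l0 * n.+1%:R = b i - a i by rewrite /l0 divfK.
  have [j jn /andP[t1 t2]] : exists2 j : nat, (j < n.+1)%N & a i + l0 * j%:R <= t <= a i + l0 * j%:R + l0.
    case/andP: tab => ta tb; move: l00; rewrite le_eqVlt => /predU1P[l00|l00].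
      exists 0%N => //; rewrite -l00 mul0r !addr0 ta/=.
      by move: ln; rewrite -l00 mul0r => /eqP; rewrite eq_sym subr_eq0 => /eqP <-.
    pose x := (t - a i) / l0; have x0 : 0 <= x by rewrite divr_ge0 ?subr_ge0// ltW.
    have xn : x <= n.+1%:R by rewrite ler_pdivrMr// mulrC ln lerD2r.
    have tx : t = a i + l0 * x by rewrite /x mulrC divfK ?lt0r_neq0// addrC subrK.
    have /andP[x1 x2] := truncn_itv x0.
    (* At t = b i the quotient [x] is n + 1, one past the last step; the minimum assigns it to the
       last one. *)
    exists (minn n (Num.truncn x)); first by rewrite ltnS geq_minl.
    set q := minn _ _; have -> : a i + l0 * q%:R + l0 = a i + l0 * q.+1%:R by rewrite -natr1 mulrDr mulr1 addrA.
    rewrite tx !lerD2l !ler_pM2l// /q.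
    rewrite /minn; case: ifP => nx; last by rewrite x1 ltW.
    by rewrite xn andbT (le_trans _ x1)// ler_nat ltnW.
  exists (i, j); first by apply/allpairsP; exists (i, j); rewrite /= !mem_index_iota im jn.
  have lE : len n (i, j) = l0 by [].
  exists (t - tt n (i, j)); rewrite /tt lE /=.
  have tj : a i + l0 * j%:R + l0 <= b i by have [] := @ttP n (i, j); rewrite ?/tt ?lE//;
    apply/allpairsP; exists (i, j); rewrite /= !mem_index_iota im jn.
  have aj : a i <= a i + l0 * j%:R by rewrite lerDl mulr_ge0.
  have tl : t - (a i + l0 * j%:R) <= l0 by rewrite lerBlDl.
  have inab s : a i + l0 * j%:R <= s <= t -> a i <= s <= b i.
    by move=> /andP[s1 s2]; rewrite (le_trans aj s1) (le_trans s2)// (le_trans t2).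
  have near_ s : a i + l0 * j%:R <= s <= t -> `|s - (a i + l0 * j%:R)| <= (b i - a i) / n.+1%:R.
    move=> /andP[s1 s2]; rewrite ger0_norm ?subr_ge0//; apply: le_trans tl; by rewrite lerD2r.
  have a0 : a i <= a i + l0 * j%:R <= b i by apply: inab; rewrite lexx t1.
  split; first by rewrite subr_ge0 t1.
  - rewrite /pp /vv /tt lE /= opprD addrA.
    apply: le_trans (ler_wpM2l (ltW eps0) tl).
    apply: (@derivative_approx (fun s => (g i s).1) (fun s => (w i s).1)) => // s st.
    by split; [apply: dg1 => //; exact: inab|exact: (H1 n n1 i im _ s a0 (near_ s st))].
  - rewrite /pp /vv /tt lE /= opprD addrA.
    apply: le_trans (ler_wpM2l (ltW eps0) tl).
    apply: (@derivative_approx (fun s => (g i s).2) (fun s => (w i s).2)) => // s st.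
    by split; [apply: dg2 => //; exact: inab|exact: (H2 n n2 i im _ s a0 (near_ s st))].
Qed.

Lemma pieces_riemann (phi : nat -> R -> R) : (forall i, (i < m)%N -> continuous (phi i)) ->
  \sum_(l <- idx n) len n l * phi l.1 (tt n l) @[n --> \oo] -->
  \sum_(0 <= i < m) \int[lam]_(t in `[a i, b i]) phi i t.
Proof.
move=> cphi; apply/cvgrPdist_le => e e0.
have em : 0 < e / m.+1%:R by rewrite divr_gt0.
have [N HN] := common_rank (fun i im => riemann_sum (cphi i im) (ab im) em).
exists N => // n /= Nn; rewrite distrC big_allpairs -sumrB.
apply: (le_trans (ler_norm_sum _ _ _)).
apply: (@le_trans _ _ (\sum_(0 <= i < m) (e / m.+1%:R))).
  by rewrite !big_nat; apply: ler_sum => i /andP[_ im]; exact: HN.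
rewrite sumr_const_nat subn0 -[leLHS]mulr_natr mulrAC ler_pdivrMr// ler_wpM2l ?(ltW e0)// ler_nat//.
Qed.

Variables (k : R) (c : chart k) (E U : set (TR * TR)).
Hypothesis hk : curvature k.
Hypotheses (mE : measurable E) (oU : open (U : set (R * R))) (UE : U `<=` E).
Hypotheses (EU : lam2 (E `\` U) = 0) (TE : constant_off ptrace E).
Variable rho0 : R.
Hypothesis (Er : E `<=` square rho0).
Variable spd : nat -> R -> R.
Hypothesis cspd : forall i, (i < m)%N -> continuous (spd i).
Hypothesis spdE : forall i t, (i < m)%N -> a i <= t <= b i ->
  spd i t = Num.sqrt (ip k (dmap c (g i t) (w i t)) (dmap c (g i t) (w i t))).

Let F := \int[lam2]_(z in E) dens c z.
Let L := \sum_(0 <= i < m) \int[lam]_(t in `[a i, b i]) spd i t.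
Let kp d i s j t := kap k d (emb c (g i s)) (dmap c (g i s) (w i s)) (emb c (g j t)) (dmap c (g j t) (w j t)).

(** A slack in the pointwise kernel bound that holds for all small [d] survives the passage from
    double sums to integrals. Zero slack gives the inequality, tent-shaped slack the equality
    case. *)
Lemma pieces_slack (tau tau' : nat -> R -> R) (eta d1 : R) :
  (forall i, (i < m)%N -> continuous (tau i)) -> (forall i, (i < m)%N -> continuous (tau' i)) ->
  0 < d1 ->
  (forall d i j s t, 0 < d < d1 -> (i < m)%N -> (j < m)%N -> a i <= s <= b i -> a j <= t <= b j ->
    `|kp d i s j t| <= spd i s * spd j t - eta * tau i s * tau' j t) ->
  F * (4 * pi - k * F) <= L ^+ 2 - eta * (\sum_(0 <= i < m) \int[lam]_(t in `[a i, b i]) tau i t) *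
     (\sum_(0 <= i < m) \int[lam]_(t in `[a i, b i]) tau' i t).
Proof.
move=> ctau ctau' d10 H; set I := \sum_(0 <= i < m) _; set I' := \sum_(0 <= i < m) _.
apply/ler_addgt0Pr => e e0.
have [K HK] := pieces_bounded.
pose r := K%:R + `|rho0| + 1; have r0 : 0 < r by rewrite ltr_wpDl// addr_ge0.
have HKr i : (i < m)%N -> forall t, a i <= t <= b i ->
    [/\ `|(w i t).1| <= r, `|(w i t).2| <= r, `|(g i t).1| <= r & `|(g i t).2| <= r].
  move=> im t tab; have [? ? ? ?] := HK i im t tab.
  have Kr : K%:R <= r by rewrite /r -addrA lerDl addr_ge0.
  by split; apply: le_trans Kr.
have Er' : E `<=` square r.
  move=> z /Er[z1 z2]; have rr : rho0 <= r by rewrite /r addrAC (le_trans (ler_norm rho0))// lerDr addr_ge0.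
  by split; apply: le_trans rr.
have [d /andP[d0 dd1] [eps0 /andP[eps00 eps01] iso]] :=
  isoperimetric_discrete c hk mE Er' oU UE EU r0 (ltW r0) e0 d10.
have [N HN] := pieces_sampled eps00 HKr.
have cS := pieces_riemann cspd; have cI := pieces_riemann ctau; have cI' := pieces_riemann ctau'.
pose S n := \sum_(l <- idx n) len n l * spd l.1 (tt n l).
pose In n := \sum_(l <- idx n) len n l * tau l.1 (tt n l).
pose In' n := \sum_(l <- idx n) len n l * tau' l.1 (tt n l).
have cU : S n * S n - eta * In n * In' n + e @[n --> \oo] --> L ^+ 2 - eta * I * I' + e.
  rewrite expr2; apply: cvgD; last exact: cvg_cst.
  apply: cvgB; first exact: cvgM.
  by apply: cvgM => //; apply: cvgM => //; exact: cvg_cst.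
rewrite -(cvg_lim _ cU)//; apply: limr_ge; first by apply/cvg_ex; eexists; exact: cU.
exists N => // n /= Nn.
have := iso _ (idx n) (pp n) (vv n) (len n) ptrace eps0 _ (HN n Nn) TE.
rewrite lexx (ltW eps00) => /(_ isT); rewrite -/F => H'.
rewrite -lerBlDr; apply: (le_trans H').
apply: (@le_trans _ _ (\sum_(l' <- idx n) \sum_(l <- idx n) len n l' * len n l *
   (spd l.1 (tt n l) * spd l'.1 (tt n l') - eta * tau l.1 (tt n l) * tau' l'.1 (tt n l')))).
  rewrite big_seq [leRHS]big_seq; apply: ler_sum => l' l's.
  rewrite big_seq [leRHS]big_seq; apply: ler_sum => l ls.
  have [l1 _] := idxP ls; have [l1' _] := idxP l's.
  have l0 := len0 n l1; have l0' := len0 n l1'.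
  apply: ler_wpM2l; first exact: mulr_ge0.
  have [t1 t2] := ttP ls; have [t1' t2'] := ttP l's.
  apply: H => //; rewrite ?d0//.
    by rewrite t1 (le_trans _ t2)// lerDl.
  by rewrite t1' (le_trans _ t2')// lerDl.
rewrite le_eqVlt; apply/orP; left; apply/eqP.
transitivity (\sum_(l' <- idx n) ((len n l' * spd l'.1 (tt n l')) * S n -
   eta * (len n l' * tau' l'.1 (tt n l')) * In n)).
  apply: eq_bigr => l' _; rewrite /S /In !mulr_sumr -sumrB; apply: eq_bigr => l _; ring.
rewrite sumrB -mulr_suml -/(S n) -mulr_suml -mulr_sumr -/(In' n); ring.
Qed.

Lemma pieces_kap d i s j t : 0 < d <= 4 -> (i < m)%N -> (j < m)%N -> a i <= s <= b i -> a j <= t <= b j ->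
  `|kp d i s j t| <= spd i s * spd j t.
Proof.
move=> d04 im jm sab tab; rewrite !spdE//.
by apply: kap_le => //; [exact: emb_surface|exact: emb_surface|exact: dmap_tangent|exact: dmap_tangent].
Qed.

Lemma isoperimetric_pieces : F * (4 * pi - k * F) <= L ^+ 2.
Proof.
have := @pieces_slack (fun=> cst 0) (fun=> cst 0) 0 4; rewrite !mul0r subr0; apply => //.
- by move=> i _; exact: cst_continuous.
- by move=> i _; exact: cst_continuous.
- move=> d i j s t /andP[d0 d4] im jm sab tab; rewrite !mul0r subr0.
  by apply: pieces_kap => //; rewrite d0 ltW.
Qed.

(** If the bound were strict at (s0, t0), half of the gap would persist for nearby parameters and
    all small [d], by joint continuity in (s, t, d) at d = 0, where the positive chord keeps the
    denominator away from 0. Tents on these neighbourhoods then make the inequality strict. *)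
Lemma pieces_equality i j s0 t0 : L ^+ 2 <= F * (4 * pi - k * F) ->
  (i < m)%N -> (j < m)%N -> a i < b i -> a j < b j -> a i <= s0 <= b i -> a j <= t0 <= b j ->
  0 < sqd k (emb c (g i s0)) (emb c (g j t0)) ->
  spd i s0 * spd j t0 <= `|kp 0 i s0 j t0|.
Proof.
move=> LF im jm abi abj sab tab N0; rewrite leNgt; apply/negP => gap.
pose gc i t := g i (clamp (a i) (b i) t).
have cgc f i' : (i' < m)%N -> continuous f -> continuous (fun t => f (gc i' t) : R).
  move=> im' cf; apply: (cont_at cf).
  have e1 : continuous (fun t => (gc i' t).1).
    by apply: (continuous_clamped (f := fun t => (g i' t).1)) (ab im') _ => t tab'; exact: is_derive_continuous (dg1 im' tab').
  have e2 : continuous (fun t => (gc i' t).2).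
    by apply: (continuous_clamped (f := fun t => (g i' t).2)) (ab im') _ => t tab'; exact: is_derive_continuous (dg2 im' tab').
  have := continuous_pair e1 e2; rewrite (_ : (fun x => _) = gc i')//; apply/funext => t; exact/esym/surjective_pairing.
have [_ cX0 cX1' cX2'] := chX c; have [_ cY0 cY1' cY2'] := chY c; have [_ cZ0 cZ1' cZ2'] := chZ c.
pose kq (x : (R * R) * R) := kap k x.2 (emb c (gc i x.1.1)) (dmap c (gc i x.1.1) (w i x.1.1))
   (emb c (gc j x.1.2)) (dmap c (gc j x.1.2) (w j x.1.2)).
have [p11 p12 _] := @continuous_coords R.
have at1 f : continuous f -> continuous (fun x : (R * R) * R => f x.1.1 : R) by move=> cf; exact: (cont_at cf).
have at2 f : continuous f -> continuous (fun x : (R * R) * R => f x.1.2 : R) by move=> cf; exact: (cont_at cf).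
have ckq : {for ((s0, t0), 0), continuous kq}.
  have Xc i' (im' : (i' < m)%N) : [/\ continuous (fun t => (emb c (gc i' t)).1.1),
      continuous (fun t => (emb c (gc i' t)).1.2) & continuous (fun t => (emb c (gc i' t)).2)].
    by split; exact: cgc.
  have Vc i' (im' : (i' < m)%N) : [/\ continuous (fun t => (dmap c (gc i' t) (w i' t)).1.1),
      continuous (fun t => (dmap c (gc i' t) (w i' t)).1.2) & continuous (fun t => (dmap c (gc i' t) (w i' t)).2)].
    by split; rewrite /dmap /=; apply: contD; apply: contM; (exact: cw1 || exact: cw2 || exact: cgc).
  have [x1 x2 x3] := Xc i im; have [y1 y2 y3] := Xc j jm.
  have [v1 v2 v3] := Vc i im; have [u1 u2 u3] := Vc j jm.
  apply: (@continuous_kap k _ (fun x : (R * R) * R => emb c (gc i x.1.1)) (fun x => dmap c (gc i x.1.1) (w i x.1.1))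
     (fun x => emb c (gc j x.1.2)) (fun x => dmap c (gc j x.1.2) (w j x.1.2)) snd ((s0, t0), 0)
     (at1 _ x1) (at1 _ x2) (at1 _ x3) (at1 _ v1) (at1 _ v2) (at1 _ v3)
     (at2 _ y1) (at2 _ y2) (at2 _ y3) (at2 _ u1) (at2 _ u2) (at2 _ u3)).
    by move=> ?; exact: cvg_snd.
  by rewrite addr0 /gc !clamp_id// lt0r_neq0.
pose A x := spd i x.1.1 * spd j x.1.2 - `|kq x|.
have cA : {for ((s0, t0), 0), continuous A}.
  apply: cvgB; last by apply: cvg_norm; exact: ckq.
  have : continuous (fun x : (R * R) * R => spd i x.1.1 * spd j x.1.2).
    by apply: contM; [apply: at1; exact: cspd|apply: at2; exact: cspd].
  exact.
have kqE s t d : a i <= s <= b i -> a j <= t <= b j -> kq ((s, t), d) = kp d i s j t.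
  by move=> hs ht; rewrite /kq /gc /= !clamp_id.
pose eta := A ((s0, t0), 0) / 2.
have eta0 : 0 < eta by rewrite divr_gt0// /A kqE//= subr_gt0.
have /cvgrPdist_lt/(_ _ eta0)/nbhs_ballP[r /= r0 Hr] := cA.
have Hr' s t d : `|s0 - s| < r -> `|t0 - t| < r -> `|0 - d| < r -> eta < A ((s, t), d).
  move=> hs ht hd; have := Hr ((s, t), d) (conj (conj hs ht) hd).
  exact: half_gap.
pose tent (s t : R) := Num.max 0 (1 - `|t - s| / r) : R.
have ctent s : continuous (tent s).
  rewrite (_ : tent s = fun t => (0 + (1 - `|t - s| / r) + `|0 - (1 - `|t - s| / r)|) / 2); first by ccont.
  by apply/funext => t; rewrite /tent maxr_absE.
have tent0 s t : 0 <= tent s t by rewrite /tent le_max lexx.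
have tent1 s t : tent s t <= 1 by rewrite /tent ge_max ler01/= gerBl divr_ge0// ltW.
have tentr s t : r <= `|s - t| -> tent s t = 0.
  by move=> rt; apply/max_l; rewrite subr_le0 ler_pdivlMr// mul1r distrC.
pose tau i' t := if i' == i then tent s0 t else 0 : R.
pose tau' j' t := if j' == j then tent t0 t else 0 : R.
have ctau q q' x : continuous (fun t => if q == q' :> nat then tent x t else 0).
  by case: (q == q') => //; exact: cst_continuous.
have := @pieces_slack tau tau' eta (Num.min r 4) (fun _ _ => ctau _ _ _) (fun _ _ => ctau _ _ _).
have Ipos q x : (q < m)%N -> a q < b q -> a q <= x <= b q ->
    0 < \sum_(0 <= i' < m) \int[lam]_(t in `[a i', b i']) (if i' == q then tent x t else 0).
  move=> qm abq xab; rewrite big_mkord (bigD1 (Ordinal qm))//= eqxx big1 ?addr0; last first.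
    move=> i' /negP; rewrite -val_eqE/= => /negP/negPf ->; rewrite Rintegral_cst// mul0r//.
  exact: tent_integral.
move=> H; have {H} : F * (4 * pi - k * F) <= L ^+ 2 -
     eta * (\sum_(0 <= i < m) \int[lam]_(t in `[a i, b i]) tau i t) *
     (\sum_(0 <= i < m) \int[lam]_(t in `[a i, b i]) tau' i t).
  apply: H; first by rewrite lt_min r0 ltr0n.
  move=> d i' j' s t /andP[d0]; rewrite lt_min => /andP[dr d4] im' jm' hs ht.
  have K := pieces_kap (d := d) _ im' jm' hs ht.
  have {}K : `|kp d i' s j' t| <= spd i' s * spd j' t by apply: K; rewrite d0 ltW.
  rewrite /tau /tau'; have [ii|ii] := eqVneq i' i; last by rewrite mulr0 mul0r subr0.
  have [jj|jj] := eqVneq j' j; last by rewrite mulr0 subr0.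
  rewrite ii jj in hs ht K *.
  have [sr|sr] := leP r `|s0 - s|; first by rewrite (tentr _ _ sr) mulr0 mul0r subr0.
  have [tr|tr] := leP r `|t0 - t|; first by rewrite (tentr _ _ tr) mulr0 subr0.
  have d0r : `|0 - d| < r by rewrite sub0r normrN gtr0_norm.
  have := Hr' s t d sr tr d0r; rewrite /A kqE//=; apply: gap_sub.
  by rewrite -mulrA ler_piMr ?(ltW eta0)// mulr_ile1.
apply/negP; rewrite -ltNge; apply: lt_le_trans LF; rewrite gtrBl.
by apply: mulr_gt0; [apply: mulr_gt0 => //|]; exact: Ipos.
Qed.

End pieces.

(** * Charts of the surfaces and piecewise smooth curves *)

Section charts.
Context {R : realType}.
Local Notation pt := (R * R * R)%type.

Lemma is_derive_sqrt (x : R) : 0 < x -> has_deriv x Num.sqrt (2 * Num.sqrt x)^-1.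
Proof. by move=> x0; exact: is_derive1_sqrt. Qed.

Lemma C1_sqrt (f f1 f2 : R * R -> R) : C1 f f1 f2 -> (forall z, 0 < f z) ->
  C1 (fun z => Num.sqrt (f z)) (fun z => (2 * Num.sqrt (f z))^-1 * f1 z) (fun z => (2 * Num.sqrt (f z))^-1 * f2 z).
Proof.
move=> [df cf cf1 cf2] f0.
have cs : continuous (fun z => Num.sqrt (f z)) by apply: cont_comp => //; exact: sqrt_continuous.
have ci : continuous (fun z => (2 * Num.sqrt (f z))^-1).
  apply: contV => [|z]; last by rewrite mulf_neq0// lt0r_neq0// sqrtr_gt0.
  by apply: contM => //; exact: cst_continuous.
split; [|exact: cs|exact: contM|exact: contM] => z v.
have := df z v; set F := fun t : R => _; move=> dF.
have F0 : F 0 = f z by rewrite /F !mul0r !addr0 -surjective_pairing.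
have := @is_derive_sqrt (F 0); rewrite F0 => /(_ (f0 z)); rewrite -F0 => ds.
apply: (der_ext (der_comp ds dF)) => //; rewrite F0; ring.
Qed.

Lemma C1_proj1 : C1 (fun z : R * R => z.1) (cst 1) (cst 0).
Proof.
have := @C1_fst R id (cst 1) 1 0 (fun x => is_derive_id x 1) (@cst_continuous _ _ _).
by move/C1_eq; apply => z; rewrite /cst ?mul1r ?addr0.
Qed.

Lemma C1_proj2 : C1 (fun z : R * R => z.2) (cst 0) (cst 1).
Proof.
have := @C1_snd R id (cst 1) 1 0 (fun x => is_derive_id x 1) (@cst_continuous _ _ _).
by move/C1_eq; apply => z; rewrite /cst ?mul1r ?addr0.
Qed.

Section vertical.
Variable k : R.
Hypotheses (hk : curvature k) (k1 : k != 1).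
Let k0 : k <= 0.
Proof. by move: hk k1; rewrite !inE => /or3P[] /eqP ->; rewrite ?eqxx// oppr_le0. Qed.

Definition height (z : R * R) : R := Num.sqrt (1 - k * (z.1 ^+ 2 + z.2 ^+ 2)).
Let ih z := (height z)^-1.

Let arg_gt0 z : 0 < 1 - k * (z.1 ^+ 2 + z.2 ^+ 2).
Proof. by rewrite subr_gt0 (@le_lt_trans _ _ 0)// mulr_le0_ge0// addr_ge0 ?sqr_ge0. Qed.

Lemma height_gt0 z : 0 < height z. Proof. by rewrite sqrtr_gt0. Qed.

Lemma height_sqr z : height z ^+ 2 = 1 - k * (z.1 ^+ 2 + z.2 ^+ 2).
Proof. by rewrite sqr_sqrtr// ltW. Qed.

Let h0 z : height z != 0. Proof. by rewrite lt0r_neq0// height_gt0. Qed.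

Let Ch : C1 height (fun z => - k * (z.1 * ih z)) (fun z => - k * (z.2 * ih z)).
Proof.
have Ca := C1_sub (C1_cst 1) (C1_scale k (C1_add (C1_mul C1_proj1 C1_proj1) (C1_mul C1_proj2 C1_proj2))).
apply: (C1_eq (C1_sqrt Ca _)) => [z|z|z|z] /=; rewrite ?/cst ?/ih ?/height -?expr2//;
  by have := h0 z; rewrite /height => hz; field.
Qed.

Let Ci : C1 ih (fun z => k * (z.1 * ih z ^+ 3)) (fun z => k * (z.2 * ih z ^+ 3)).
Proof.
apply: (C1_eq (C1_inv Ch h0)) => z //; rewrite /ih -exprVn; move: (_^-1) => i; ring.
Qed.

Program Definition vertical_chart : chart k := {|
  cX := fun z => z.1; cY := fun z => z.2; cZ := height;
  cX1 := cst 1; cX2 := cst 0; cY1 := cst 0; cY2 := cst 1;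
  cZ1 := fun z => - k * (z.1 * ih z); cZ2 := fun z => - k * (z.2 * ih z);
  cX11 := cst 0; cX12 := cst 0; cX22 := cst 0; cY11 := cst 0; cY12 := cst 0; cY22 := cst 0;
  cZ11 := fun z => - k * (ih z + k * z.1 ^+ 2 * ih z ^+ 3);
  cZ12 := fun z => - k * (k * z.1 * z.2 * ih z ^+ 3);
  cZ22 := fun z => - k * (ih z + k * z.2 ^+ 2 * ih z ^+ 3);
  dens := ih |}.
Next Obligation. exact: C1_proj1. Qed.
Next Obligation. exact: C1_cst. Qed.
Next Obligation. exact: C1_cst. Qed.
Next Obligation. exact: C1_proj2. Qed.
Next Obligation. exact: C1_cst. Qed.
Next Obligation. exact: C1_cst. Qed.
Next Obligation. exact: Ch. Qed.
Next Obligation.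
apply: (C1_eq (C1_scale (- k) (C1_mul C1_proj1 Ci))) => z //; rewrite /cst; move: (ih z) => i; ring.
Qed.
Next Obligation.
apply: (C1_eq (C1_scale (- k) (C1_mul C1_proj2 Ci))) => z //; rewrite /cst; move: (ih z) => i; ring.
Qed.
Next Obligation. by move=> z; rewrite height_sqr /= subrK. Qed.
Next Obligation. by move=> z; rewrite /cst /=; move: (ih _) => i; ring. Qed.
Next Obligation. by move=> z; rewrite /cst /=; move: (ih _) => i; ring. Qed.
Next Obligation. by move=> z; rewrite /cst /ih mulVf// mul1r mul0r subr0. Qed.
Next Obligation. by move=> z _; exact: height_gt0. Qed.
Next Obligation. by move=> z; rewrite /ih invr_gt0 height_gt0. Qed.
Next Obligation. by have [] := Ci. Qed.
Next Obligation.
move=> z w; have sz (p : R * R) : surface k (p, height p).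
  by split => /=; [rewrite height_sqr subrK|rewrite height_gt0].
by have [+ _] := sqd_surface hk (sz z) (sz w); rewrite /sqd /ip /= -!expr2.
Qed.
End vertical.

Section stereographic.
Let io (z : R * R) : R := (1 + (z.1 ^+ 2 + z.2 ^+ 2))^-1.

Lemma stereo_den_gt0 (z : R * R) : 0 < 1 + (z.1 ^+ 2 + z.2 ^+ 2).
Proof. by rewrite ltr_pwDl// addr_ge0 ?sqr_ge0. Qed.

Let Ci : C1 io (fun z => - 2 * (z.1 * io z ^+ 2)) (fun z => - 2 * (z.2 * io z ^+ 2)).
Proof.
have Ca := C1_add (C1_cst 1) (C1_add (C1_mul C1_proj1 C1_proj1) (C1_mul C1_proj2 C1_proj2)).
apply: (C1_eq (C1_inv Ca _)) => [z|z|z|z] /=; rewrite ?/cst ?/io -?expr2//.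
- by rewrite lt0r_neq0// stereo_den_gt0.
- by rewrite -exprVn; move: (_^-1) => i; ring.
- by rewrite -exprVn; move: (_^-1) => i; ring.
Qed.

Let Ci2 := C1_mul Ci Ci.

Program Definition stereo_chart : chart (1 : R) := {|
  cX := fun z => 2 * (z.1 * io z); cY := fun z => 2 * (z.2 * io z); cZ := fun z => 2 * io z - 1;
  cX1 := fun z => 2 * (io z - 2 * (z.1 ^+ 2 * io z ^+ 2));
  cX2 := fun z => - 4 * (z.1 * z.2 * io z ^+ 2);
  cY1 := fun z => - 4 * (z.1 * z.2 * io z ^+ 2);
  cY2 := fun z => 2 * (io z - 2 * (z.2 ^+ 2 * io z ^+ 2));
  cZ1 := fun z => - 4 * (z.1 * io z ^+ 2); cZ2 := fun z => - 4 * (z.2 * io z ^+ 2);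
  cX11 := fun z => 2 * (- 6 * (z.1 * io z ^+ 2) + 8 * (z.1 ^+ 3 * io z ^+ 3));
  cX12 := fun z => - 4 * (z.2 * io z ^+ 2) + 16 * (z.1 ^+ 2 * z.2 * io z ^+ 3);
  cX22 := fun z => - 4 * (z.1 * io z ^+ 2) + 16 * (z.1 * z.2 ^+ 2 * io z ^+ 3);
  cY11 := fun z => - 4 * (z.2 * io z ^+ 2) + 16 * (z.1 ^+ 2 * z.2 * io z ^+ 3);
  cY12 := fun z => - 4 * (z.1 * io z ^+ 2) + 16 * (z.1 * z.2 ^+ 2 * io z ^+ 3);
  cY22 := fun z => 2 * (- 6 * (z.2 * io z ^+ 2) + 8 * (z.2 ^+ 3 * io z ^+ 3));
  cZ11 := fun z => - 4 * (io z ^+ 2) + 16 * (z.1 ^+ 2 * io z ^+ 3);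
  cZ12 := fun z => 16 * (z.1 * z.2 * io z ^+ 3);
  cZ22 := fun z => - 4 * (io z ^+ 2) + 16 * (z.2 ^+ 2 * io z ^+ 3);
  dens := fun z => 4 * io z ^+ 2 |}.
Next Obligation.
apply: (C1_eq (C1_scale 2 (C1_mul C1_proj1 Ci))) => z //; rewrite /cst; move: (io z) => i; ring.
Qed.
Next Obligation.
apply: (C1_eq (C1_scale 2 (C1_sub Ci (C1_scale 2 (C1_mul (C1_mul C1_proj1 C1_proj1) Ci2))))) => z;
  rewrite /cst; move: (io z) => i; ring.
Qed.
Next Obligation.
apply: (C1_eq (C1_scale (-4) (C1_mul (C1_mul C1_proj1 C1_proj2) Ci2))) => z;
  rewrite /cst; move: (io z) => i; ring.
Qed.
Next Obligation.
apply: (C1_eq (C1_scale 2 (C1_mul C1_proj2 Ci))) => z //; rewrite /cst; move: (io z) => i; ring.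
Qed.
Next Obligation.
apply: (C1_eq (C1_scale (-4) (C1_mul (C1_mul C1_proj1 C1_proj2) Ci2))) => z;
  rewrite /cst; move: (io z) => i; ring.
Qed.
Next Obligation.
apply: (C1_eq (C1_scale 2 (C1_sub Ci (C1_scale 2 (C1_mul (C1_mul C1_proj2 C1_proj2) Ci2))))) => z;
  rewrite /cst; move: (io z) => i; ring.
Qed.
Next Obligation.
apply: (C1_eq (C1_sub (C1_scale 2 Ci) (C1_cst 1))) => z //; rewrite /cst; move: (io z) => i; ring.
Qed.
Next Obligation.
apply: (C1_eq (C1_scale (-4) (C1_mul C1_proj1 Ci2))) => z; rewrite /cst; move: (io z) => i; ring.
Qed.
Next Obligation.
apply: (C1_eq (C1_scale (-4) (C1_mul C1_proj2 Ci2))) => z; rewrite /cst; move: (io z) => i; ring.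
Qed.
Next Obligation. by move=> z; rewrite /io /=; field; rewrite lt0r_neq0// stereo_den_gt0. Qed.
Next Obligation. by move=> z; rewrite /io /=; field; rewrite lt0r_neq0// stereo_den_gt0. Qed.
Next Obligation. by move=> z; rewrite /io /=; field; rewrite lt0r_neq0// stereo_den_gt0. Qed.
Next Obligation. by move=> z; rewrite /io /=; field; rewrite lt0r_neq0// stereo_den_gt0. Qed.
Next Obligation. by move=> z; rewrite eqxx. Qed.
Next Obligation. by move=> z; rewrite mulr_gt0// exprn_gt0// invr_gt0 stereo_den_gt0. Qed.
Next Obligation.
by apply: contM; [exact: cst_continuous|apply: contX; have [] := Ci].
Qed.
Next Obligation. by move=> z w; rewrite mul1r !addr_ge0 ?sqr_ge0. Qed.
End stereographic.

(* For [k <> 1] the projection of the first two coordinates, for [k = 1] the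
   stereographic projection from (0, 0, -1). *)
Definition slant (k : R) : R := if k == 1 then 1 else 0.

Definition zt (k : R) (p : pt) : R * R :=
  (p.1.1 * (1 + slant k * p.2)^-1, p.1.2 * (1 + slant k * p.2)^-1).

Definition dzt (k : R) (p v : pt) : R * R :=
  ((v.1.1 * (1 + slant k * p.2) - p.1.1 * (slant k * v.2)) * (1 + slant k * p.2)^-1 ^+ 2,
   (v.1.2 * (1 + slant k * p.2) - p.1.2 * (slant k * v.2)) * (1 + slant k * p.2)^-1 ^+ 2).

Record chart_inverse (k : R) (c : chart k) : Prop := ChartInverse {
  emb_zt : forall p, surface k p -> 1 + slant k * p.2 != 0 -> emb c (zt k p) = p;
  dmap_dzt : forall p v, surface k p -> 1 + slant k * p.2 != 0 -> tangent k p v ->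
    dmap c (zt k p) (dzt k p v) = v;
  zt_emb : forall z, zt k (emb c z) = z;
  emb_slant : forall z, 1 + slant k * (emb c z).2 != 0 }.

Lemma pt_eq (p q : pt) : p.1.1 = q.1.1 -> p.1.2 = q.1.2 -> p.2 = q.2 -> p = q.
Proof. by case: p q => [[? ?] ?] [[? ?] ?] /= -> -> ->. Qed.

Lemma vertical_inverse k (hk : curvature k) (k1 : k != 1) : chart_inverse (vertical_chart hk k1).
Proof.
have s0 : slant k = 0 by rewrite /slant (negPf k1).
have hE p : surface k p -> height k p.1 = p.2.
  move=> [sp p0]; have {}p0 : 0 < p.2 by apply: p0; exact/eqP.
  by rewrite /height -[RHS]gtr0_norm// -sqrtr_sqr; congr Num.sqrt; move: sp; lra.
split.
- by move=> p sp _; apply: pt_eq; rewrite /emb /zt s0 /= mul0r addr0 invr1 mulr1 ?mulr1 -?surjective_pairing ?hE.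
- move=> p v sp _ tv.
  have p0 : p.2 != 0 by rewrite lt0r_neq0//; case: sp => _; apply; exact/eqP.
  have -> : zt k p = p.1 by rewrite /zt s0 mul0r addr0 invr1 !mulr1 -surjective_pairing.
  have -> : dzt k p v = v.1.
    by rewrite /dzt s0 !(mul0r, mulr0, addr0, subr0, invr1, mulr1, expr1n) -surjective_pairing.
  rewrite /dmap /= hE//; apply: pt_eq => /=; rewrite ?mulr1 ?mulr0 ?addr0 ?add0r//.
  rewrite -[RHS](mulfK p0) -[X in X = _](mulfK p0); congr (_ / _).
  by rewrite [v.2 * _]mulrC (_ : p.2 * v.2 = - (k * (p.1.1 * v.1.1 + p.1.2 * v.1.2)));
    [field|move: tv; rewrite /tangent; lra].
- by move=> [x y]; rewrite /zt /emb s0 /= !mul0r !addr0 invr1 !mulr1.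
- by move=> z; rewrite s0 mul0r addr0 oner_eq0.
Qed.

Lemma stereo_inverse : chart_inverse stereo_chart.
Proof.
have s1 : slant (1 : R) = 1 by rewrite /slant eqxx.
split.
- move=> p [sp _]; rewrite /zt s1 !mul1r => p1.
  have d0 := lt0r_neq0 (stereo_den_gt0 (p.1.1 / (1 + p.2), p.1.2 / (1 + p.2))).
  have dE : 1 + ((p.1.1 / (1 + p.2)) ^+ 2 + (p.1.2 / (1 + p.2)) ^+ 2) = 2 / (1 + p.2).
    apply: (mulIf (expf_neq0 2 p1)); rewrite [LHS](_ : _ = (1 + p.2) ^+ 2 + (p.1.1 ^+ 2 + p.1.2 ^+ 2)); last by field.
    by rewrite [RHS](_ : _ = 2 * (1 + p.2)); [move: sp; rewrite mul1r; lra|field].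
  by apply: pt_eq; rewrite /emb /= dE; field; rewrite ?p1.
- move=> p v [sp _]; rewrite /zt /dzt s1 !mul1r => p1; rewrite /tangent mul1r => tv.
  have dE : 1 + ((p.1.1 / (1 + p.2)) ^+ 2 + (p.1.2 / (1 + p.2)) ^+ 2) = 2 / (1 + p.2).
    apply: (mulIf (expf_neq0 2 p1)); rewrite [LHS](_ : _ = (1 + p.2) ^+ 2 + (p.1.1 ^+ 2 + p.1.2 ^+ 2)); last by field.
    by rewrite [RHS](_ : _ = 2 * (1 + p.2)); [move: sp; rewrite mul1r; lra|field].
  rewrite /dmap /= dE invf_div.
  have sp' : p.1.1 ^+ 2 + p.1.2 ^+ 2 = (1 - p.2) * (1 + p.2) by move: sp; rewrite mul1r; lra.
  have tv' : p.1.1 * v.1.1 + p.1.2 * v.1.2 = - (p.2 * v.2) by move: tv; lra.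
  set q := 1 + p.2 in p1 sp' *.
  have qE : p.2 = q - 1 by rewrite /q; ring.
  apply: pt_eq => /=.
  + transitivity (v.1.1 - p.1.1 * (q * (p.2 * v.2 + (p.1.1 * v.1.1 + p.1.2 * v.1.2)) +
        v.2 * (q * (1 - p.2) - (p.1.1 ^+ 2 + p.1.2 ^+ 2))) / q ^+ 2).
      by rewrite qE; field.
    by rewrite sp' tv'; ring.
  + transitivity (v.1.2 - p.1.2 * (q * (p.2 * v.2 + (p.1.1 * v.1.1 + p.1.2 * v.1.2)) +
        v.2 * (q * (1 - p.2) - (p.1.1 ^+ 2 + p.1.2 ^+ 2))) / q ^+ 2).
      by rewrite qE; field.
    by rewrite sp' tv'; ring.
  + transitivity (((p.1.1 ^+ 2 + p.1.2 ^+ 2) * v.2 - q * (p.1.1 * v.1.1 + p.1.2 * v.1.2)) / q).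
      by field.
    by rewrite sp' tv' qE; field; rewrite ?p1.
- move=> z; have := lt0r_neq0 (stereo_den_gt0 z); rewrite -invr_eq0 [RHS]surjective_pairing /zt s1 /emb /=.
  move: (_^-1) => i i0; have -> : 1 + 1 * (2 * i - 1) = 2 * i by ring.
  by congr (_, _); field; rewrite i0.
- move=> z; have d0 := stereo_den_gt0 z; rewrite s1 /emb /= mul1r.
  by rewrite addrC subrK mulf_neq0 ?invr_eq0 ?lt0r_neq0 ?pnatr_eq0.
Qed.

End charts.

(** * Piecewise smooth curves *)

Section curves.
Context {R : realType}.
Local Notation pt := (R * R * R)%type.
Implicit Types (k : R) (g h : R -> pt).

Lemma smooth_is_derive (f : R -> R) (t : R) : smooth f -> has_deriv t f (derive1 f t).
Proof. by move=> sf; rewrite derive1E; apply/derivableP; exact: (sf 0%N). Qed.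

Lemma smooth_continuous_derive (f : R -> R) : smooth f -> continuous (derive1 f).
Proof. by move=> sf t; apply: differentiable_continuous; apply/derivable1_diffP; exact: (sf 1%N). Qed.

Lemma smooth_continuous (f : R -> R) : smooth f -> continuous f.
Proof. by move=> sf t; apply: differentiable_continuous; apply/derivable1_diffP; exact: (sf 0%N). Qed.

Definition smooth3 h : Prop :=
  [/\ smooth (fun t => (h t).1.1), smooth (fun t => (h t).1.2) & smooth (fun t => (h t).2)].

Definition vel h (t : R) : pt :=
  (derive1 (fun t => (h t).1.1) t, derive1 (fun t => (h t).1.2) t, derive1 (fun t => (h t).2) t).

Definition spd k h (t : R) : R := Num.sqrt (ip k (vel h t) (vel h t)).

Definition partition01 (m : nat) (a b : nat -> R) : Prop :=
  [/\ (0 < m)%N /\ (forall i, (i < m)%N -> a i < b i),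
      a 0%N = 0 /\ b m.-1 = 1 & (forall i, (i.+1 < m)%N -> b i = a i.+1)].

(** Each [H i] is smooth on the whole line, so one-sided derivatives of [g] at the break points
    become ordinary derivatives of [H i]. *)
Definition curve_pieces k g (m : nat) (a b : nat -> R) (H : nat -> R -> pt) : Prop :=
  [/\ partition01 m a b, (forall i, (i < m)%N -> smooth3 (H i)) &
      forall i t, (i < m)%N -> a i <= t <= b i -> g t = H i t /\ surface k (g t)].

(** The reverse of the kernel bound at d = 0, for all pairs of points, multiplied by the squared
    chord to clear the denominator. Together with the bound it forces equality. *)
Definition conformal_pairs k (m : nat) (a b : nat -> R) (H : nat -> R -> pt) : Prop := forall i j s t,
  (i < m)%N -> (j < m)%N -> a i <= s <= b i -> a j <= t <= b j -> H i s <> H j t ->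
  sqd k (H i s) (H j t) * (spd k (H i) s * spd k (H j) t) <=
  `|sqd k (H i s) (H j t) * ip k (vel (H i) s) (vel (H j) t) -
    2 * ip k (vel (H i) s) (vsub (H i s) (H j t)) * ip k (vel (H j) t) (vsub (H i s) (H j t))|.

Lemma speedE k h t : speed k h t = spd k h t.
Proof. by rewrite /speed /spd /ip /vel /= mulrA -!expr2 -mulrA -expr2. Qed.

Lemma continuous_vel h : smooth3 h -> [/\ continuous (fun t => (vel h t).1.1),
  continuous (fun t => (vel h t).1.2) & continuous (fun t => (vel h t).2)].
Proof. by case=> s1 s2 s3; split; [exact: (smooth_continuous_derive s1)|exact: (smooth_continuous_derive s2)|exact: (smooth_continuous_derive s3)]. Qed.

Lemma continuous_spd k h : smooth3 h -> continuous (spd k h).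
Proof.
move=> /continuous_vel[c1 c2 c3]; apply: (@cont_comp _ _ Num.sqrt); first exact: sqrt_continuous.
by rewrite /ip; ccont.
Qed.

Lemma near_eq_derive1 (f f' : R -> R) (t : R) : (\forall s \near t, f s = f' s) -> derive1 f t = derive1 f' t.
Proof.
by move=> ff'; rewrite !derive1E; exact: near_eq_derive.
Qed.

Lemma partition_le m a b : partition01 m a b -> forall i, (i < m)%N -> 0 <= a i /\ b i <= 1.
Proof.
move=> [[m0 ab] [a0 b1] ba] i im; split.
  elim: i im => [|i IHi] im; first by rewrite a0.
  by rewrite -ba// (le_trans (IHi (ltnW im)))// ltW// ab// ltnW.
have : forall n, (i <= n)%N -> (n < m)%N -> b i <= b n.
  elim => [|n IHn]; first by rewrite leqn0 => /eqP ->.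
  rewrite leq_eqVlt => /predU1P[<-//|]; rewrite ltnS => in_ nm.
  by apply: (le_trans (IHn in_ (ltnW nm))); rewrite ba// ltW// ab.
by move=> /(_ m.-1); rewrite b1; apply; rewrite -ltnS prednK.
Qed.

Lemma partition_cover m a b : partition01 m a b ->
  forall t, 0 <= t <= 1 -> exists2 i, (i < m)%N & a i <= t <= b i.
Proof.
move=> [[m0 ab] [a0 b1] ba].
have : forall n, (n < m)%N -> forall t, 0 <= t <= b n -> exists2 i, (i < m)%N & a i <= t <= b i.
  elim => [|n IHn] nm t /andP[t0 tb]; first by exists 0%N; rewrite // a0 t0.
  have [tn|tn] := leP t (b n); first by apply: IHn; rewrite ?t0// ltnW.
  by exists n.+1 => //; rewrite tb -ba// ltW.
by move=> /(_ m.-1); rewrite b1; apply; rewrite prednK.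
Qed.

Lemma partition_sum m a b : partition01 m a b -> \sum_(0 <= i < m) (b i - a i) = 1.
Proof.
move=> [[m0 ab] [a0 b1] ba].
have : forall n, (n < m)%N -> \sum_(0 <= i < n.+1) (b i - a i) = b n.
  elim => [|n IHn] nm; first by rewrite big_nat1 a0 subr0.
  by rewrite big_nat_recr//= IHn ?(ltnW nm)// -ba// addrC subrK.
by move=> /(_ m.-1); rewrite b1 prednK//; apply.
Qed.

Lemma piecewise_smoothP k g : piecewise_smooth k g -> exists m a b H, curve_pieces k g m a b H.
Proof.
move=> [sg [s [ps /eqP ls] Hs]].
have /choice[H HH] : forall i, exists h : R -> pt, (i < size s)%N ->
    smooth3 h /\ {in `[nth 1 (0 :: s) i, nth 1 s i], g =1 h}.
  move=> i; have [im|im] := ltnP i (size s); last by exists (fun=> (0, 0, 0)).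
  by have [h [h1 h2 h3 gh]] := Hs i im; exists h.
have s0 : (0 < size s)%N.
  by case: s ls {ps Hs HH} => //= /eqP; rewrite eq_sym oner_eq0.
have lt_s i : (i < size s)%N -> nth 1 (0 :: s) i < nth 1 s i.
  by move=> im; have /(pathP 1) := ps; apply.
have P0 : partition01 (size s) (nth 1 (0 :: s)) (nth 1 s).
  by split => //; split=> //; rewrite nth_last; case: (s) s0 ls.
exists (size s), (nth 1 (0 :: s)), (nth 1 s), H; split => //.
- by move=> i im; have [] := HH i im.
- move=> i t im tab; have [_ gh] := HH i im; have [a0 b1] := partition_le P0 im.
  split; first by rewrite gh// in_itv.
  by apply: sg; rewrite in_itv/=; case/andP: tab => ta tb; rewrite (le_trans a0 ta) (le_trans tb).
Qed.

(** Inside a piece the speed of [g] is that of its smooth extension; the break points, where the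
    derivative of [g] may be meaningless, are removed as null sets. *)
Lemma arc_length_pieces k g m a b H : curve_pieces k g m a b H ->
  arc_length k g = (\sum_(0 <= i < m) \int[lam]_(t in `[a i, b i]) spd k (H i) t)%:E.
Proof.
move=> [P01 sH gH]; have [[m0 ab] [a0 b1] ba] := P01.
have E i t : (i < m)%N -> a i < t < b i -> speed k g t = spd k (H i) t.
  move=> im /andP[ta tb]; rewrite speedE /spd; congr Num.sqrt.
  have gh : \forall s \near t, g s = H i s.
    have : \forall s \near t, s \in `]a i, b i[ by apply: near_in_itvoo; rewrite in_itv/= ta.
    by apply: filterS => s; rewrite in_itv/= => /andP[/ltW sa /ltW sb]; have [] := gH i s im; rewrite ?sa.
  have -> : vel g t = vel (H i) t by congr (_, _, _); apply: near_eq_derive1; apply: filterS gh => s ->.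
  by [].
have mE i : (i < m)%N -> measurable_fun `]a i, b i[ (fun t => (speed k g t)%:E).
  move=> im; apply/measurable_EFinP.
  apply: (eq_measurable_fun (spd k (H i))).
    by move=> t; rewrite inE/= in_itv/= => tab; rewrite (E i).
  by apply: measurable_funTS; apply: continuous_measurable_fun; exact: continuous_spd (sH i im).
have sp0 t : (0 <= (speed k g t)%:E)%E by rewrite lee_fin sqrtr_ge0.
have IE i : (i < m)%N -> (\int[lam]_(t in `[a i, b i[) (speed k g t)%:E =
    (\int[lam]_(t in `[a i, b i]) spd k (H i) t)%:E)%E.
  move=> im; rewrite -integral_itv_obnd_cbnd; last exact: mE.
  rewrite /Rintegral fineK; last first.
    by apply: integrable_fin_num => //; exact: cont_integrable_itv (continuous_spd (sH i im)).
  have mf (D : set (measurableTypeR R)) : measurable_fun D (fun t => (spd k (H i) t)%:E).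
    by apply/measurable_EFinP; apply: measurable_funTS; apply: continuous_measurable_fun; exact: continuous_spd (sH i im).
  transitivity (\int[lam]_(t in `]a i, b i[) (spd k (H i) t)%:E)%E.
    by apply: eq_integral => t; rewrite inE/= in_itv/= => tab; rewrite (E i).
  have -> := @integral_itv_obnd_cbnd R (a i) (BLeft (b i)) _ (mf _).
  exact: (@integral_itv_bndo_bndc R (BLeft (a i)) (b i) _ (mf _)).
have mcE i : (i < m)%N -> measurable_fun `[a i, b i[ (fun t => (speed k g t)%:E).
  move=> im; apply/measurable_EFinP/measurable_fun_itv_obnd_cbndP.
  by apply/measurable_EFinP; exact: mE.
have main n : (n < m)%N -> measurable_fun `[0, b n[ (fun t => (speed k g t)%:E) /\
   (\int[lam]_(t in `[0%R, b n[) (speed k g t)%:E =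
   (\sum_(0 <= i < n.+1) \int[lam]_(t in `[a i, b i]) spd k (H i) t)%R%:E)%E.
  elim: n => [|n IHn] nm; first by rewrite big_nat1 -a0; split; [exact: mcE|exact: IE].
  have [m1 I1] := IHn (ltnW nm).
  have U : `[0, b n.+1[%classic = `[0, b n[ `|` `[a n.+1, b n.+1[ :> set R.
    have [z0 _] := partition_le P01 (ltnW nm); have abn := ab n (ltnW nm); have abn1 := ab _ nm.
    rewrite -ba//; rewrite -ba// in abn1.
    apply/seteqP; split => t /=; rewrite !in_itv/=.
      by move=> /andP[-> ->]; rewrite andbT /=; have [_|_] := ltP t (b n); [left|right].
    case=> /andP[t1 t2]; first by rewrite t1/= (lt_trans t2).
    by rewrite t2 andbT (le_trans _ t1)// (le_trans z0)// ltW.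
  have mU : measurable_fun (`[0, b n[ `|` `[a n.+1, b n.+1[) (fun t => (speed k g t)%:E).
    by apply/measurable_funU => //; split=> //; exact: mcE.
  rewrite U; split => //; rewrite ge0_integral_setU//=.
    by rewrite [in RHS]big_nat_recr//= EFinD -I1 -IE.
  apply/disj_set2P; rewrite -ba//; apply/seteqP; split => // t [] /=.
  by rewrite !in_itv/= => /andP[_ t1] /andP[t2 _]; move: t1; rewrite ltNge t2.
have m1 : (m.-1 < m)%N by rewrite prednK.
have [M1 M2] := main m.-1 m1.
rewrite /arc_length -integral_itv_bndo_bndc; last by rewrite -b1.
by move: M2; rewrite b1 prednK.
Qed.

(* Compactness and one-sided difference quotients make the velocity tangent up to the end points. *)
Lemma vel_tangent k h (a b : R) : a < b -> smooth3 h -> (forall t, a <= t <= b -> surface k (h t)) ->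
  forall t, a <= t <= b -> tangent k (h t) (vel h t).
Proof.
move=> ab sh hs.
pose f t := (h t).2 ^+ 2 + k * ((h t).1.1 ^+ 2 + (h t).1.2 ^+ 2).
pose q t := (h t).2 * (vel h t).2 + k * ((h t).1.1 * (vel h t).1.1 + (h t).1.2 * (vel h t).1.2).
have [s1 s2 s3] := sh; have [v1 v2 v3] := continuous_vel sh.
have c1 := smooth_continuous s1; have c2 := smooth_continuous s2; have c3 := smooth_continuous s3.
have cq : continuous q by rewrite /q; ccont.
have df t : has_deriv t f (2 * q t).
  have d1 := smooth_is_derive t s1; have d2 := smooth_is_derive t s2; have d3 := smooth_is_derive t s3.
  have D : has_deriv t (fun t => (h t).2 * (h t).2 + k * ((h t).1.1 * (h t).1.1 + (h t).1.2 * (h t).1.2))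
      (2 * q t).
    by apply: is_derive_eq; rewrite /GRing.scale/= /q /vel /=; ring.
  by apply: (der_ext D) => // s; rewrite /f !expr2.
have f1 t : a <= t <= b -> f t = 1 by move=> /hs[].
have right t : a <= t < b -> q t = 0.
  move=> /andP[ta tb]; apply/eqP; rewrite -normr_le0; apply/ler_addgt0Pr => e e0; rewrite add0r.
  have [dl dl0 Hd] := @uniform_continuity R q a b e cq e0.
  pose s := Num.min b (t + dl); have ts : t < s by rewrite lt_min tb ltrDl.
  have sb : s <= b by rewrite ge_min lexx.
  have H : `|f s - f t - (s - t) * (2 * q t)| <= 2 * e * (s - t).
    apply: (@derivative_approx R f (fun t => 2 * q t) t s (2 * e)); first exact: ltW.
    move=> x /andP[x1 x2]; split => //; rewrite -mulrBr normrM ger0_norm// ler_pM2l//.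
    apply: Hd; first by rewrite ta ltW.
    rewrite ger0_norm ?subr_ge0// lerBlDl; apply: (le_trans x2); by rewrite ge_min lexx orbT.
  move: H; rewrite !f1 ?ta ?(ltW tb)//; last by rewrite sb andbT (le_trans ta)// ltW.
  have st : 0 < s - t by rewrite subr_gt0.
  rewrite subrr sub0r normrN normrM (gtr0_norm st) normrM (ger0_norm (_ : 0 <= 2))// [leRHS]mulrC.
  by rewrite ler_pM2l// ler_pM2l.
move=> t /andP[ta]; rewrite le_eqVlt => /predU1P[->|tb]; last by apply: right; rewrite ta.
suff : q b = 0 by [].
apply/eqP; rewrite -normr_le0; apply/ler_addgt0Pr => e e0; rewrite add0r.
have [dl dl0 Hd] := @uniform_continuity R q a b e cq e0.
pose s := Num.max a (b - dl); have sb : s < b by rewrite gt_max ab gtrBl.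
have sa : a <= s by rewrite le_max lexx.
have := Hd s b; rewrite (right s) ?sa// subr0; apply; first by rewrite ltW.
rewrite ger0_norm; last by rewrite subr_ge0 ltW.
by rewrite lerBlDr -lerBlDl le_max lexx orbT.
Qed.

End curves.

(** * Curves read in a chart *)

Section chart_curve.
Context {R : realType}.
Local Notation pt := (R * R * R)%type.
Notation TR := (measurableTypeR R).

Lemma zt_derive (k : R) (h : R -> pt) (t : R) : smooth3 h -> 1 + slant k * (h t).2 != 0 ->
  has_deriv t (fun t => (zt k (h t)).1) (dzt k (h t) (vel h t)).1 /\
  has_deriv t (fun t => (zt k (h t)).2) (dzt k (h t) (vel h t)).2.
Proof.
move=> [s1 s2 s3] n0.
have d1 := smooth_is_derive t s1; have d2 := smooth_is_derive t s2; have d3 := smooth_is_derive t s3.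
have dD : has_deriv t (fun t => 1 + slant k * (h t).2) (slant k * (vel h t).2).
  by apply: is_derive_eq; rewrite /GRing.scale/= /vel /=; ring.
have dI := derivative_inv (f := fun t => 1 + slant k * (h t).2) n0 dD.
split; rewrite /zt /dzt /=.
  by apply: is_derive_eq; rewrite /GRing.scale/= /vel /=; field.
by apply: is_derive_eq; rewrite /GRing.scale/= /vel /=; field.
Qed.

Variables (k : R) (c : chart k).
Hypotheses (hk : curvature k) (cc : chart_inverse c).
Variables (g : R -> pt) (m : nat) (a b : nat -> R) (H : nat -> R -> pt).
Hypothesis gH : curve_pieces k g m a b H.
Hypothesis dom : forall t, 0 <= t <= 1 -> 1 + slant k * (g t).2 != 0.

Let gam i t := zt k (H i t).
(** Beyond its interval the extension [H i] may leave the domain of the chart; the clamp keeps the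
    chart velocity continuous on the whole line. *)
Let w i t := dzt k (H i (clamp (a i) (b i) t)) (vel (H i) (clamp (a i) (b i) t)).

Let P01 : partition01 m a b. Proof. by case: gH. Qed.
Let ltab i : (i < m)%N -> a i < b i. Proof. by have [[_ h] _ _] := P01; exact: h. Qed.
Let leab i : (i < m)%N -> a i <= b i. Proof. by move=> /ltab/ltW. Qed.
Let sH i : (i < m)%N -> smooth3 (H i). Proof. by have [_ h _] := gH; exact: h. Qed.
Let in01 i t : (i < m)%N -> a i <= t <= b i -> 0 <= t <= 1.
Proof.
by move=> im /andP[ta tb]; have [a0 b1] := partition_le P01 im; rewrite (le_trans a0)// (le_trans tb).
Qed.
Let gHi i t : (i < m)%N -> a i <= t <= b i -> g t = H i t.
Proof. by case: gH => _ _ h im tab; have [] := h i t im tab. Qed.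
Let sHi i t : (i < m)%N -> a i <= t <= b i -> surface k (H i t).
Proof. by case: gH => _ _ h im tab; have [<-] := h i t im tab. Qed.
Let domH i t : (i < m)%N -> a i <= t <= b i -> 1 + slant k * (H i t).2 != 0.
Proof. by move=> im tab; rewrite -(gHi im tab) dom// (in01 im). Qed.
Let tangH i t : (i < m)%N -> a i <= t <= b i -> tangent k (H i t) (vel (H i) t).
Proof. by move=> im tab; apply: (vel_tangent (ltab im) (sH im)) => // s; exact: sHi. Qed.

Let embE i t : (i < m)%N -> a i <= t <= b i -> emb c (gam i t) = H i t.
Proof. by move=> im tab; rewrite /gam (emb_zt cc)//; [exact: sHi|exact: domH]. Qed.
Let dmapE i t : (i < m)%N -> a i <= t <= b i -> dmap c (gam i t) (w i t) = vel (H i) t.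
Proof.
by move=> im tab; rewrite /gam /w clamp_id// (dmap_dzt cc)//; [exact: sHi|exact: domH|exact: tangH].
Qed.

Let cw i : (i < m)%N -> continuous (fun t => (w i t).1) /\ continuous (fun t => (w i t).2).
Proof.
move=> im; have [s1 s2 s3] := sH im; have [v1 v2 v3] := continuous_vel (sH im).
have cl (f : R -> R) : continuous f -> continuous (fun t => f (clamp (a i) (b i) t)).
  by move=> cf; apply: (continuous_clamped (leab im)) => t _; exact: cf.
have c1 := cl _ (smooth_continuous s1); have c2 := cl _ (smooth_continuous s2); have c3 := cl _ (smooth_continuous s3).
have {}v1 := cl _ v1; have {}v2 := cl _ v2; have {}v3 := cl _ v3.
have ci : continuous (fun t => (1 + slant k * (H i (clamp (a i) (b i) t)).2)^-1).
  by apply: contV => [|t]; [ccont|apply: domH => //; apply: clamp_in; exact: leab].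
by split; rewrite /w /dzt /=; ccont.
Qed.

Variables (E U : set (TR * TR)) (rho0 : R).
Hypotheses (mE : measurable E) (oU : open (U : set (R * R))) (UE : U `<=` E).
Hypotheses (EU : lam2 (E `\` U) = 0) (Er : E `<=` square rho0).
Hypothesis TE : constant_off (zt k @` trace g) E.

Let F := \int[lam2]_(z in E) dens c z.
Let L := \sum_(0 <= i < m) \int[lam]_(t in `[a i, b i]) spd k (H i) t.

Let cw1 i (im : (i < m)%N) := (cw im).1.
Let cw2 i (im : (i < m)%N) := (cw im).2.
Let dg i t : (i < m)%N -> a i <= t <= b i ->
  has_deriv t (fun t => (gam i t).1) (w i t).1 /\
  has_deriv t (fun t => (gam i t).2) (w i t).2.
Proof. by move=> im tab; rewrite /w clamp_id//; apply: zt_derive; [exact: sH|exact: domH]. Qed.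
Let dg1 i t (im : (i < m)%N) (tab : a i <= t <= b i) := (dg im tab).1.
Let dg2 i t (im : (i < m)%N) (tab : a i <= t <= b i) := (dg im tab).2.

Let sum1 : \sum_(0 <= i < m) (b i - a i) <= 1.
Proof. by rewrite (partition_sum P01). Qed.

Let TE' : constant_off (ptrace m a b gam) E.
Proof.
move=> z z' zz'; apply: TE => t t01 /= [p [s s01 <-] zp]; apply: (zz' t t01).
rewrite /= in_itv /= in s01; have [i im sab] := partition_cover P01 s01.
exists i; split => //; exists s => //.
by rewrite -zp (gHi im).
Qed.

Let cspd i : (i < m)%N -> continuous (spd k (H i)).
Proof. by move=> /sH; exact: continuous_spd. Qed.

Let spdE i t : (i < m)%N -> a i <= t <= b i ->
  spd k (H i) t = Num.sqrt (ip k (dmap c (gam i t) (w i t)) (dmap c (gam i t) (w i t))).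
Proof. by move=> im tab; rewrite dmapE. Qed.

Lemma chart_curve_bounds : exists (w : nat -> R -> R * R) (K : nat), forall i t, (i < m)%N -> a i <= t <= b i ->
  [/\ has_deriv t (fun t => (zt k (H i t)).1) (w i t).1 /\
      has_deriv t (fun t => (zt k (H i t)).2) (w i t).2,
      `|(w i t).1| <= K%:R, `|(w i t).2| <= K%:R, `|(zt k (H i t)).1| <= K%:R & `|(zt k (H i t)).2| <= K%:R].
Proof.
have [K HK] := pieces_bounded leab sum1 cw1 cw2 dg1 dg2.
by exists w, K => i t im tab; have [? ? ? ?] := HK i im t tab; split => //; exact: dg.
Qed.

Lemma isoperimetric_chart : F * (4 * pi - k * F) <= L ^+ 2.
Proof. exact: (isoperimetric_pieces leab sum1 cw1 cw2 dg1 dg2 hk mE oU UE EU TE' Er cspd spdE). Qed.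

Lemma equality_chart : L ^+ 2 <= F * (4 * pi - k * F) -> conformal_pairs k m a b H.
Proof.
move=> LF i j s t im jm sab tab st.
have [N0 Ns] := sqd_surface hk (sHi im sab) (sHi jm tab).
have {}N0 : 0 < sqd k (H i s) (H j t) by rewrite lt_neqAle N0 andbT eq_sym; apply/eqP => /Ns.
have := pieces_equality leab sum1 cw1 cw2 dg1 dg2 hk mE oU UE EU TE' Er cspd spdE LF im jm
  (ltab im) (ltab jm) sab tab.
rewrite !embE// !dmapE// => /(_ N0) Hk.
rewrite -[X in _ <= X](mulfVK (lt0r_neq0 N0)) [leRHS]mulrC ler_pM2l//.
apply: (le_trans Hk); rewrite /kap addr0.
have Ni : (sqd k (H i s) (H j t))^-1 = `|(sqd k (H i s) (H j t))^-1| by rewrite gtr0_norm// invr_gt0.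
rewrite [X in _ <= _ * X]Ni -normrM.
set x := ip k _ _; rewrite le_eqVlt; apply/orP; left; apply/eqP; congr `|_|.
by field; rewrite lt0r_neq0.
Qed.

End chart_curve.

(** * Spherical area in stereographic coordinates *)

Section substitution.
Context {R : realType}.
Notation TR := (measurableTypeR R).
Notation lam := (@lebesgue_measure R).

Lemma ge0_integral_mrestr (d : measure_display) (T : measurableType d)
    (mu : {measure set T -> \bar R}) (S : set T) (mS : measurable S) (F : T -> \bar R) :
  measurable_fun setT F -> (forall x, 0 <= F x)%E ->
  (\int[mrestr mu mS]_x F x = \int[mu]_(x in S) F x)%E.
Proof.
move=> mF F0; have mC : measurable (~` S) by exact: measurableC.
rewrite -(setUv S) ge0_integral_setU//=; last 2 first.
- exact: measurable_funS mF.
- by apply/disj_set2P; rewrite setICr.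
rewrite [X in (_ + X)%E]null_set_integral ?adde0//; last 2 first.
- exact: measurable_funS mF.
- by rewrite -[LHS]/(mu (~` S `&` S)) setICl measure0.
rewrite [RHS](eq_measure_integral (measure_add (mrestr mu mS) (mrestr mu mC))).
  rewrite ge0_integral_measure_add//; last exact: measurable_funS mF.
  rewrite [X in (_ + X)%E]null_set_integral ?adde0//; first exact: measurable_funS mF.
  by rewrite -[LHS]/(mu (S `&` ~` S)) setICr measure0.
move=> A mA _; transitivity (mrestr mu mS A + mrestr mu mC A)%E; last first.
  by rewrite [RHS]measure_addE.
rewrite /mrestr -measureU//; [|exact: measurableI|exact: measurableI|].
  by rewrite -setIUr setUv setIT.
by rewrite setIACA setICr setI0.
Qed.

(* Change of variables for an arbitrary measurable integrand: the measure w(t) dt is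
   transported by [phi] as soon as this holds on half-open intervals. *)
Lemma ge0_integral_subst (w phi : TR -> R) (J : set TR) (F : TR -> \bar R) :
  measurable J -> measurable_fun setT w -> measurable_fun setT (phi : TR -> TR) -> (forall x, 0 <= w x) ->
  (forall x, w x != 0 -> J (phi x)) ->
  (forall a b : R, a < b -> (\int[lam]_x (w x * \1_(`]a, b]%classic) (phi x))%:E = lam (`]a, b] `&` J))%E) ->
  measurable_fun setT F -> (forall x, 0 <= F x)%E ->
  (\int[lam]_x ((w x)%:E * F (phi x)) = \int[lam]_(x in J) F x)%E.
Proof.
move=> mJ mw mp w0 wJ H mF F0.
(* The region under the graph of [w]: projecting its area to the first coordinate realizes the
   measure w(t) dt. *)
pose S : set (TR * TR) := [set z | 0 <= z.2 < w z.1].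
have mS : measurable S.
  rewrite (_ : S = ((fun z => z.2) @^-1` `[0, +oo[) `&` ((fun z => w z.1 - z.2) @^-1` `]0, +oo[)); last first.
    by apply/seteqP; split => z /=; rewrite !in_itv/= !andbT subr_gt0 => /andP.
  apply: measurableI.
    by rewrite -[X in measurable X]setTI; exact: measurable_snd.
  rewrite -[X in measurable X]setTI; apply: measurable_funB => //.
  exact: (measurableT_comp mw measurable_fst).
have mpf : measurable_fun setT (fun z : TR * TR => phi z.1 : TR) by exact: (measurableT_comp mp measurable_fst).
have lS x : lam (xsection S x) = (w x)%:E.
  rewrite (_ : xsection S x = `[0, w x[%classic).
    rewrite lebesgue_measure_itv/= lte_fin; case: ltP => [_|wx]; first by rewrite sube0.
    by have -> : w x = 0 by apply/eqP; rewrite eq_le wx w0.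
  by apply/seteqP; split => y; rewrite /xsection /S /= inE/= in_itv.
have IS (G : TR -> \bar R) : measurable_fun setT G -> (forall x, 0 <= G x)%E ->
    (\int[lam2]_(z in S) G (phi z.1) = \int[lam]_x ((w x)%:E * G (phi x)))%E.
  move=> mG G0; rewrite integral_mkcond/=.
  pose g := (fun z => G (phi z.1)) \_ S.
  have mg : measurable_fun setT g.
    apply/(measurable_restrictT _ _).1 => //; apply: measurable_funTS; exact: (measurableT_comp mG mpf).
  have g0 z : (0 <= g z)%E by rewrite /g /patch; case: ifP.
  rewrite (fubini_tonelli1 g)//; apply: eq_integral => x _; rewrite /fubini_F.
  have -> : (fun y => g (x, y)) = ((fun=> G (phi x)) \_ (xsection S x)).
    by apply/funext => y; rewrite /g /patch /= mem_xsection.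
  have mx : measurable (xsection S x) by exact: measurable_xsection.
  transitivity (\int[lam]_(y in xsection S x) cst (G (phi x)) y)%E; first exact/esym/integral_mkcond.
  by rewrite [LHS](integral_cst lam mx) muleC; congr (_ * _)%E; exact: lS.
pose mu0 := mrestr lam2 mS.
pose mu1 := measure_function_pushforward__canonical__measure_function_Measure mu0 mpf.
have mJc : measurable (~` J) by exact: measurableC.
(* Lebesgue measure off [J] completes the transported measure, so that the uniqueness of Lebesgue
   measure on half-open intervals applies to the sum. *)
pose mu := measure_add mu1 (mrestr lam mJc).
have muE A : measurable A -> lam A = mu A.
  apply: lebesgue_measure_unique => _ [[a b]] _ <- /=.
  rewrite [X in _ = X](_ : _ = mu1 `]a, b]%classic + mrestr lam mJc `]a, b]%classic)%E; last first.
    by rewrite /msum big_ord_recr/= big_ord1.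
  have [ab|ba] := ltP a b; last first.
    rewrite set_itv_ge ?measure0 ?adde0 ?bnd_simp -?leNgt//.
  have -> : mu1 `]a, b]%classic = lam (`]a, b] `&` J).
    rewrite -H//; transitivity (\int[lam2]_(z in S) (\1_(`]a, b]%classic) (phi z.1))%:E)%E.
      rewrite integral_indic//=.
        by have := mpf measurableT _ (measurable_itv `]a, b]); rewrite setTI.
    have -> := IS (fun x => (\1_(`]a, b]%classic) x)%:E).
    - by apply: eq_integral => x _; rewrite EFinM.
    - by apply/measurable_EFinP; exact: measurable_indic.
    - by move=> x; rewrite lee_fin.
  rewrite /mrestr -measureU; first by rewrite -setIUr setUv setIT.
  - by apply: measurableI.
  - by apply: measurableI.
  - by rewrite setIACA setICr setI0.
have FJ0 x : (0 <= (F \_ J) x)%E by rewrite /patch; case: ifP.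
have mFJ : measurable_fun setT (F \_ J) by apply/(measurable_restrictT _ _).1 => //; exact: measurable_funTS.
rewrite [RHS]integral_mkcond (eq_measure_integral mu); last by move=> A mA _; exact: muE.
rewrite ge0_integral_measure_add// [X in (_ + X)%E]ge0_integral_mrestr//.
rewrite [X in (_ + X)%E]integral0_eq ?adde0; last by move=> x Jx; rewrite /patch memNset.
rewrite ge0_integral_pushforward//= ge0_integral_mrestr//; last exact: (measurableT_comp mFJ mpf).
rewrite (IS (F \_ J))//; apply: eq_integral => x _.
have [->|/wJ Jx] := eqVneq (w x) 0; first by rewrite !mul0e.
by rewrite /patch mem_set.
Qed.

Lemma clamp_length (a b p q ca cb : R) : a < b -> p < q ->
  [\/ a <= p /\ ca = p, q <= a /\ ca = q | p <= a <= q /\ ca = a] ->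
  [\/ b <= p /\ cb = p, q <= b /\ cb = q | p <= b <= q /\ cb = b] ->
  ((cb - ca)%:E = lam (`]a, b] `&` `]p, q]))%E.
Proof.
move=> ab pq ha hb.
rewrite (_ : `]a, b] `&` `]p, q] = `]Num.max a (p), Num.min b (q)]%classic); last first.
  by apply/seteqP; split => x /=; rewrite !in_itv/= gt_max le_min; [move=> [/andP[-> ->] /andP[-> ->]]|move=> /andP[/andP[-> ->] /andP[-> ->]]].
have hM : (a <= p /\ Num.max a (p) = p) \/ (p <= a /\ Num.max a (p) = a).
  by case: (leP a (p)) => ?; [left|right; split => //; exact: ltW].
have hm : (b <= q /\ Num.min b (q) = b) \/ (q <= b /\ Num.min b (q) = q).
  by case: (leP b (q)) => ?; [left|right; split => //; exact: ltW].
rewrite lebesgue_measure_itv/= lte_fin; case: ltP => h; rewrite -?EFinB; congr (_%:E);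
  case: hM h => -[? ->]; case: hm => -[? ->]; case: (ha) => -[? ->]; case: (hb) => -[? ->]; lra.
Qed.

(** The fundamental theorem of calculus between preimages of the two clamped end points, which the
    intermediate value theorem provides. *)
Lemma increasing_transport (p q : R) (phi dphi : R -> R) : p < q ->
  (forall x, has_deriv x phi (dphi x)) -> continuous dphi ->
  {in `[p, q] &, {mono phi : x y / x <= y}} ->
  forall a b : R, a < b ->
  (\int[lam]_x ((\1_(`]p, q]%classic) x * dphi x) * \1_(`]a, b]%classic) (phi x))%:E =
    lam (`]a, b] `&` `]phi p, phi q]))%E.
Proof.
move=> pq dp cd mono a b ab.
have pm : p \in `[p, q] by rewrite in_itv/= lexx ltW.
have qm : q \in `[p, q] by rewrite in_itv/= lexx ltW.
have lt := leW_mono_in mono.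
have pq' : phi p < phi q by rewrite lt.
have cphi : continuous phi by move=> x; apply: differentiable_continuous; apply/derivable1_diffP; have [] := dp x.
pose cl y := Num.max (phi p) (Num.min (phi q) y).
have clP y : [\/ y <= phi p /\ cl y = phi p, phi q <= y /\ cl y = phi q | phi p <= y <= phi q /\ cl y = y].
  have [yp|py] := leP y (phi p); first by apply: Or31; rewrite /cl min_r ?max_l//; lra.
  have [yq|qy] := leP (phi q) y; first by apply: Or32; rewrite /cl min_l ?max_r//; lra.
  by apply: Or33; rewrite /cl min_r ?max_r//; lra.
have ivt y : exists2 x, x \in `[p, q] & phi x = cl y.
  apply: IVT; [exact: ltW|exact: continuous_subspaceT|].
  rewrite min_l ?max_r ?(ltW pq')//; case: (clP y) => -[]; lra.
have [p' p'i p'E] := ivt a; have [q' q'i q'E] := ivt b.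
have p'q' : p' <= q' by rewrite -mono// p'E q'E; case: (clP a) => -[? ->]; case: (clP b) => -[? ->]; lra.
have clE x : phi p < x <= phi q -> (a < x) = (cl a < x) /\ (x <= b) = (x <= cl b).
  move=> /andP[h1 h2]; split; [case: (clP a) => -[? ->]|case: (clP b) => -[? ->]]; apply/idP/idP; lra.
transitivity (\int[lam]_(x in `[p', q']) (dphi x)%:E)%E.
  rewrite [RHS]integral_mkcond -[RHS]integral_mkcond -(integral_itv_obnd_cbnd (r := p')); last first.
    by apply/measurable_EFinP; apply: measurable_funTS; exact: continuous_measurable_fun.
  rewrite [RHS]integral_mkcond; apply: eq_integral => x _.
  rewrite /patch mem_setE !indicE !mem_setE !in_itv/=.
  move: (p'i) (q'i); rewrite !in_itv/= => /andP[h1 h2] /andP[h3 h4].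
  have [px|px] := ltP p x; last first.
    by rewrite mul0r mul0r ltNge (le_trans px h1).
  have [xq|xq] := leP x q; last first.
    by rewrite mul0r mul0r andbC leNgt (le_lt_trans h4 xq).
  have xi : x \in `[p, q] by rewrite in_itv/= (ltW px).
  have [|-> ->] := clE (phi x); first by rewrite lt// px mono.
  by rewrite -p'E -q'E lt// mono// mul1r; case: ifP; rewrite ?mulr1 ?mulr0.
transitivity ((cl b - cl a)%:E).
  rewrite -q'E -p'E -(FTC_Rintegral p'q' dp cd) /Rintegral fineK//.
  apply: integrable_fin_num => //; apply: cont_integrable_itv; exact: cd.
exact: clamp_length (clP a) (clP b).
Qed.

Lemma integral_inverse_pos (F : TR -> \bar R) : measurable_fun setT F -> (forall x, 0 <= F x)%E ->
  (\int[lam]_x ((\1_(`]0%R, +oo[%classic) x * (x ^+ 2)^-1)%:E * F (x^-1)%R) =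
   \int[lam]_(x in `]0%R, +oo[) F x)%E.
Proof.
have mV : measurable_fun setT (fun x : TR => x^-1 : TR).
  have -> : setT = [set 0] `|` ~` [set (0 : TR)] by rewrite setUv.
  apply/measurable_funU; [exact: measurable_set1|exact: measurableC|split].
    exact: measurable_fun_set1.
  apply: open_continuous_measurable_fun; first by rewrite openC; exact: closed_eq.
  by move=> x; rewrite inE => /eqP x0; apply: continuousV => //; exact: cvg_id.
move=> mF F0; apply: (ge0_integral_subst (w := fun x => \1_(`]0, +oo[%classic) x * (x ^+ 2)^-1)
  (phi := fun x => x^-1)) => //.
- by apply: measurable_funM; [exact: measurable_indic|apply: (measurableT_comp mV); exact: measurable_funX].
- by move=> x; rewrite mulr_ge0// invr_ge0 sqr_ge0.
- move=> x; rewrite indicE mem_setE in_itv/= andbT; have [x0 _|_] := ltP 0 x; last by rewrite mul0r eqxx.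
  by rewrite /= in_itv/= invr_gt0 x0.
move=> a b ab.
have dV (x : R) : 0 < x -> has_deriv x (fun x => - x^-1) ((x ^+ 2)^-1).
  move=> x0; apply: is_derive_eq; first by apply: is_deriveN; apply: derivative_inv (lt0r_neq0 x0) _.
  by rewrite mulN1r opprK.
have [b0|b0] := leP b 0.
  rewrite integral0_eq => [|x _]; last first.
    rewrite !indicE !mem_setE !in_itv/= andbT; have [x0|] := ltP 0 x; last by rewrite !mul0r.
    by rewrite [x^-1 <= b]leNgt (le_lt_trans b0) ?invr_gt0// andbF mulr0.
  rewrite (_ : _ `&` _ = set0) ?measure0//; apply/seteqP; split => x //=; rewrite !in_itv/= => -[]; lra.
have bV : 0 < b^-1 by rewrite invr_gt0.
have cV (x : R) : 0 < x -> {for x, continuous (fun x : R => (x ^+ 2)^-1)}.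
  move=> x0; apply: continuousV; first by rewrite expf_neq0// lt0r_neq0.
  exact: exprn_continuous.
have cN (x : R) : 0 < x -> {for x, continuous (fun x : R => - x^-1)}.
  by move=> x0; apply: continuousN; apply: continuousV; [exact: lt0r_neq0|exact: cvg_id].
have [a0|a0] := leP a 0.
  transitivity (\int[lam]_(x in `[(b^-1)%R, +oo[) ((x ^+ 2)^-1)%:E)%E.
    rewrite [RHS]integral_mkcond; apply: eq_integral => x _.
    rewrite /patch mem_setE !indicE !mem_setE !in_itv/= !andbT.
    have [x0|x0] := ltP 0 x; last by rewrite !mul0r leNgt (le_lt_trans x0 bV).
    rewrite (le_lt_trans a0) ?invr_gt0//= mul1r -[X in x^-1 <= X]invrK lef_pV2 ?posrE//.
    by case: ifP; rewrite ?mulr1 ?mulr0.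
  rewrite (@ge0_continuous_FTC2y R _ (fun x => - x^-1) _ 0).
  - rewrite invrK sub0e -EFinN opprK (_ : _ `&` _ = `]0, b]%classic).
      by rewrite lebesgue_measure_itv/= lte_fin b0 sube0.
    by apply/seteqP; split => x /=; rewrite !in_itv/= andbT; lra.
  - by move=> x _; rewrite invr_ge0 sqr_ge0.
  - apply: continuous_in_subspaceT => x; rewrite inE/= in_itv/= andbT => bx; apply: cV; exact: lt_le_trans bx.
  - rewrite -oppr0; apply: cvgN; apply/(gtr0_cvgV0 _).2; [exact: nbhs_pinfty_gt|exact: cvg_id].
  - by move=> x bx; have [] := dV x (lt_trans bV bx).
  - by apply: cvg_at_right_filter; exact: cN.
  - move=> x; rewrite in_itv/= andbT => bx; rewrite derive1E; by have [_ ->] := dV x (lt_trans bV bx).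
have aV : 0 < a^-1 by rewrite invr_gt0.
have abV : b^-1 < a^-1 by rewrite ltf_pV2.
transitivity (\int[lam]_(x in `[(b^-1)%R, (a^-1)%R[) ((x ^+ 2)^-1)%:E)%E.
  rewrite [RHS]integral_mkcond; apply: eq_integral => x _.
  rewrite /patch mem_setE !indicE !mem_setE !in_itv/= !andbT.
  have [x0|x0] := ltP 0 x; last by rewrite !mul0r leNgt (le_lt_trans x0 bV).
  rewrite mul1r -[X in x^-1 <= X]invrK lef_pV2 ?posrE// -[X in X < x^-1]invrK ltf_pV2 ?posrE// andbC.
  by case: ifP; rewrite ?mulr1 ?mulr0.
have cw : {within `[b^-1, a^-1], continuous (fun x : R => (x ^+ 2)^-1)}.
  by apply: continuous_in_subspaceT => x; rewrite inE/= in_itv/= => /andP[bx _]; apply: cV; exact: lt_le_trans bx.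
rewrite integral_itv_bndo_bndc; last first.
  apply/measurable_EFinP; apply: measurable_funS (_ : measurable_fun `[b^-1, a^-1]%classic _) => //.
    by apply: subset_itvl; rewrite bnd_simp.
  exact: subspace_continuous_measurable_fun.
rewrite (@continuous_FTC2 R _ (fun x => - x^-1))//.
- rewrite !invrK -EFinB opprK (_ : _ `&` _ = `]a, b]%classic).
    by rewrite lebesgue_measure_itv/= lte_fin ab -EFinB addrC.
  by apply/seteqP; split => x /=; rewrite !in_itv/= andbT; [case|]; lra.
- split.
  + by move=> x; rewrite in_itv/= => /andP[bx _]; have [] := dV x (lt_trans bV bx).
  + by apply: cvg_at_right_filter; exact: cN.
  + by apply: cvg_at_left_filter; exact: cN.
- move=> x; rewrite in_itv/= => /andP[bx _]; rewrite derive1E; by have [_ ->] := dV x (lt_trans bV bx).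
Qed.

Lemma measurable_inverse : measurable_fun setT (fun x : TR => x^-1 : TR).
Proof.
have -> : setT = [set 0] `|` ~` [set (0 : TR)] by rewrite setUv.
apply/measurable_funU; [exact: measurable_set1|exact: measurableC|split].
  exact: measurable_fun_set1.
apply: open_continuous_measurable_fun; first by rewrite openC; exact: closed_eq.
by move=> x; rewrite inE => /eqP x0; apply: continuousV => //; exact: cvg_id.
Qed.

Lemma ge0_integral_halves (F : TR -> \bar R) : measurable_fun setT F -> (forall x, 0 <= F x)%E ->
  (\int[lam]_x F x = \int[lam]_(x in `]0%R, +oo[) (F x + F (- x)%R))%E.
Proof.
move=> mF F0.
have mN : measurable_fun setT (fun x : TR => F (- x)%R).
  by apply: (measurableT_comp mF); exact: oppr_measurable.
have mPF (G : TR -> \bar R) : measurable_fun setT G -> measurable_fun setT (fun x : TR => ((\1_(`]0%R, +oo[%classic) x)%:E * G x)%E).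
  by move=> mG; apply: emeasurable_funM => //; apply/measurable_EFinP; exact: measurable_indic.
have restr (G : TR -> \bar R) : (\int[lam]_(x in `]0%R, +oo[) G x = \int[lam]_x ((\1_(`]0%R, +oo[%classic) x)%:E * G x))%E.
  rewrite integral_mkcond; apply: eq_integral => x _; rewrite /patch indicE.
  by case: ifP; rewrite ?mul1e ?mul0e.
rewrite ge0_integralD//; last 2 first.
- exact: measurable_funTS.
- exact: measurable_funTS.
rewrite !restr [X in (_ + X)%E](@ge0_integral_affine R (-1) 0)//; last 2 first.
- exact: mPF.
- by move=> x; rewrite mule_ge0// lee_fin.
rewrite normrN1 mul1e -ge0_integralD//; last 4 first.
- by move=> x _; rewrite mule_ge0// lee_fin.
- exact: mPF.
- by move=> x _; rewrite mule_ge0// lee_fin.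
- have := measurableT_comp (mPF _ mN) (measurable_affine (-1) 0); exact.
rewrite -[in RHS](setvU [set (0 : TR)]) ge0_integral_setU//; last 4 first.
- exact: measurableC.
- apply: measurable_funTS; apply: emeasurable_funD; first exact: mPF.
  have := measurableT_comp (mPF _ mN) (measurable_affine (-1) 0); exact.
- by move=> x _; rewrite adde_ge0// mule_ge0// lee_fin.
- by apply/disj_set2P; rewrite setICl.
rewrite integral_set1 adde0 -[in LHS](setvU [set (0 : TR)]) ge0_integral_setU//; last 3 first.
- exact: measurableC.
- by rewrite setvU.
- by apply/disj_set2P; rewrite setICl.
rewrite integral_set1 adde0; apply: eq_integral => x; rewrite inE /= => /eqP x0.
rewrite !indicE !mem_setE !in_itv/= !andbT add0r mulN1r opprK oppr_gt0.
by case: ltgtP x0 => // _ _; rewrite mul0e mul1e ?adde0 ?add0e.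
Qed.

Lemma ge0_integral_inverse (a : R) (F : TR -> \bar R) : 0 < a -> measurable_fun setT F -> (forall x, 0 <= F x)%E ->
  (\int[lam]_x F x = \int[lam]_x ((a / x ^+ 2)%:E * F (a / x)%R))%E.
Proof.
move=> a0 mF F0.
have m2 : measurable_fun setT (fun x : TR => (x ^+ 2)^-1 : TR).
  by apply: (measurableT_comp measurable_inverse); exact: measurable_funX.
have mb G : measurable_fun setT G -> measurable_fun setT (fun x : TR => ((x ^+ 2)^-1)%:E * G (x^-1)%R)%E.
  move=> mG; apply: emeasurable_funM; first exact/measurable_EFinP.
  exact: (measurableT_comp mG measurable_inverse).
have w0 (x : R) : (0 <= ((x ^+ 2)^-1)%:E)%E by rewrite lee_fin invr_ge0 sqr_ge0.
have base G : measurable_fun setT G -> (forall x, 0 <= G x)%E ->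
    (\int[lam]_x G x = \int[lam]_x (((x ^+ 2)^-1)%:E * G (x^-1)%R))%E.
  move=> mG G0; rewrite !ge0_integral_halves//; last 2 first.
  - exact: mb.
  - by move=> x; rewrite mule_ge0.
  have mGG : measurable_fun setT (fun x : TR => G x + G (- x)%R)%E.
    by apply: emeasurable_funD => //; apply: (measurableT_comp mG); exact: oppr_measurable.
  rewrite -(integral_inverse_pos mGG); last by move=> x; rewrite adde_ge0.
  rewrite [RHS]integral_mkcond; apply: eq_integral => x _.
  rewrite /patch indicE mem_setE; case: ifP => _; last by rewrite mul0r mul0e.
  by rewrite mul1r sqrrN invrN ge0_muleDr.
rewrite base// (@ge0_integral_affine R a^-1 0) ?invr_eq0 ?lt0r_neq0//; last 2 first.
- exact: mb.
- by move=> x; rewrite mule_ge0.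
rewrite -ge0_integralZl//; last 2 first.
- have := measurableT_comp (mb _ mF) (measurable_affine a^-1 0); exact.
- by move=> x _; rewrite mule_ge0.
have aV : (a^-1)^-1 = a := invrK a.
apply: eq_integral => x _; rewrite add0r [in F _]invfM aV muleA -EFinM; congr (_%:E * _)%E.
by rewrite gtr0_norm ?invr_gt0// exprMn invfM -[X in _ * (X * _)]exprVn aV expr2 !mulrA mulVf ?lt0r_neq0// mul1r.
Qed.

End substitution.

(** * From the two hemispheres to the stereographic chart *)

Section archimedes.
Context {R : realType}.
Notation TR := (measurableTypeR R).

Lemma ge0_integral_setC1 (a : TR) (F : TR -> \bar R) : measurable_fun setT F -> (forall x, 0 <= F x)%E ->
  (\int[lam]_x F x = \int[lam]_(x in ~` [set a]) F x)%E.
Proof.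
move=> mF F0; rewrite -[in LHS](setvU [set a]) ge0_integral_setU//; last 3 first.
- exact: measurableC.
- by rewrite setvU.
- by apply/disj_set2P; rewrite setICl.
by rewrite integral_set1 adde0.
Qed.

(** Distance from the axis of the point of the sphere with stereographic radius t. The upper
    hemisphere has t <= 1, and its mirror image in the equator has radius 1 / t. *)
Let phi (t : R) := 2 * t * (1 + t ^+ 2)^-1.
Let dphi (t : R) := 2 * (1 - t ^+ 2) * (1 + t ^+ 2)^-1 ^+ 2.

Let den0 (t : R) : 0 < 1 + t ^+ 2. Proof. by rewrite ltr_pwDl// sqr_ge0. Qed.

Let phi_derive (x : R) : has_deriv x phi (dphi x).
Proof.
have dd : has_deriv x (fun t : R => 1 + t ^+ 2) (2 * x).
  by derive_ring.
have dv := derivative_inv (f := fun t : R => 1 + t ^+ 2) (lt0r_neq0 (den0 x)) dd.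
have dm : has_deriv x (fun t : R => 2 * t) 2.
  by derive_ring.
apply: (der_ext (is_deriveM dm dv)) => //.
rewrite /dphi /GRing.scale/=; field; exact: lt0r_neq0.
Qed.

Let phi_mono : {in `[0, 1] &, {mono phi : x y / x <= y}}.
Proof.
apply: le_mono_in => x y; rewrite !in_itv/= => /andP[x0 x1] /andP[y0 y1] xy.
rewrite -subr_gt0; have -> : phi y - phi x = 2 * (y - x) * (1 - x * y) * ((1 + x ^+ 2)^-1 * (1 + y ^+ 2)^-1).
  by rewrite /phi; field; rewrite !lt0r_neq0.
rewrite !mulr_gt0 ?invr_gt0// subr_gt0//; nra.
Qed.

Let hh (x : R) := Num.sqrt (1 - x ^+ 2).

Let phi_facts (t : R) : 0 < t < 1 -> [/\ 0 < phi t < 1, hh (phi t) = (1 - t ^+ 2) * (1 + t ^+ 2)^-1,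
  phi t * (1 + hh (phi t))^-1 = t & phi t * (1 - hh (phi t))^-1 = t^-1].
Proof.
move=> /andP[t0 t1]; have d0 := den0 t.
have hE : hh (phi t) = (1 - t ^+ 2) * (1 + t ^+ 2)^-1.
  rewrite /hh (_ : 1 - phi t ^+ 2 = ((1 - t ^+ 2) * (1 + t ^+ 2)^-1) ^+ 2).
    rewrite sqrtr_sqr ger0_norm// mulr_ge0 ?invr_ge0 ?(ltW d0)// subr_ge0; nra.
  by rewrite /phi; field; exact: lt0r_neq0.
split => //.
- apply/andP; split; first by rewrite /phi !mulr_gt0// invr_gt0.
  rewrite /phi ltr_pdivrMr// mul1r; nra.
- rewrite hE /phi; field; rewrite lt0r_neq0//=; apply: lt0r_neq0.
  lra.
- rewrite hE /phi; field; rewrite lt0r_neq0//= lt0r_neq0//=; apply: lt0r_neq0.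
  have := exprn_gt0 2 t0; lra.
Qed.

(** On a line through the origin, the left side is area in vertical coordinates, two sheets of
    density |x| / h; the right side is stereographic area. Substituting x = phi t turns the upper
    sheet into 0 < t < 1, and the inverse 1 / t turns the lower sheet into t > 1. *)
Lemma archimedes_line (f : TR -> \bar R) : measurable_fun setT f -> (forall x, 0 <= f x)%E ->
  (\int[lam]_x ((`|x| * \1_([set x : R | x ^+ 2 < 1]) x * (hh x)^-1)%:E *
     (f (x * (1 + hh x)^-1)%R + f (x * (1 - hh x)^-1)%R)) =
   \int[lam]_x ((`|x| * (4 * (1 + x ^+ 2)^-1 ^+ 2))%:E * f x))%E.
Proof.
move=> mf f0.
pose f2 (x : TR) := (f x + f (- x)%R)%E.
have mN (g : TR -> \bar R) : measurable_fun setT g -> measurable_fun setT (fun x : TR => g (- x)%R).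
  by move=> mg; apply: (measurableT_comp mg); exact: oppr_measurable.
have mf2 : measurable_fun setT f2 by apply: emeasurable_funD => //; exact: mN.
have f20 x : (0 <= f2 x)%E by rewrite adde_ge0.
have mh : measurable_fun setT (hh : TR -> TR).
  apply: continuous_measurable_fun; apply: (cont_at (f := Num.sqrt)); [exact: sqrt_continuous|ccont].
have mq s : measurable_fun setT (fun x : TR => x * (1 + s * hh x)^-1 : TR).
  apply: measurable_funM => //; apply: (measurableT_comp measurable_inverse).
  by apply: measurable_funD => //; exact: measurable_funM.
have mq1 : measurable_fun setT (fun x : TR => x * (1 + hh x)^-1 : TR).
  by apply: eq_measurable_fun (mq 1) => x _; rewrite mul1r.
have mq2 : measurable_fun setT (fun x : TR => x * (1 - hh x)^-1 : TR).
  by apply: eq_measurable_fun (mq (-1)) => x _; rewrite mulN1r.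
have mhV : measurable_fun setT (fun x : TR => (hh x)^-1 : TR) by exact: (measurableT_comp measurable_inverse).
have msq : measurable ([set x : R | x ^+ 2 < 1] : set TR).
  rewrite (_ : mkset _ = `]-1, 1[%classic)//; apply/seteqP; split => x /=; rewrite in_itv/=; [move=> ?; apply/andP; split; nra|move=> /andP[]; nra].
have mabs : measurable_fun setT (fun x : TR => `|x| : TR) by exact: normr_measurable.
have mg : measurable_fun setT (fun x : TR => 4 * (1 + x ^+ 2)^-1 ^+ 2 : TR).
  apply: continuous_measurable_fun; apply: contM; first exact: cst_continuous.
  by apply: contX; apply: contV => [|x]; [ccont|exact: lt0r_neq0].
have mI (S : set TR) : measurable S -> measurable_fun setT (\1_S : TR -> TR) by move=> mS; exact: measurable_indic.
have mff : measurable_fun setT (fun x : TR => f (x * (1 + hh x)^-1)%R + f (x * (1 - hh x)^-1)%R)%E.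
  by apply: emeasurable_funD; [exact: (measurableT_comp mf mq1)|exact: (measurableT_comp mf mq2)].
have mff2 : measurable_fun setT (fun x : TR => f2 (x * (1 + hh x)^-1)%R + f2 (x * (1 - hh x)^-1)%R)%E.
  by apply: emeasurable_funD; [exact: (measurableT_comp mf2 mq1)|exact: (measurableT_comp mf2 mq2)].
have h0 x : 0 <= hh x by rewrite sqrtr_ge0.
have hN x : hh (- x) = hh x by rewrite /hh sqrrN.
pose P (x : TR) := ((\1_(`]0, 1[%classic) x * x * (hh x)^-1)%:E *
   (f2 (x * (1 + hh x)^-1)%R + f2 (x * (1 - hh x)^-1)%R))%E.
have mP : measurable_fun setT P.
  apply: emeasurable_funM => //; apply/measurable_EFinP; do 2 apply: measurable_funM => //; exact: mI.
have P0 x : (0 <= P x)%E.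
  rewrite /P indicE mem_setE in_itv/=; case: (boolP (_ && _)) => [/andP[x0 _]|_]; last by rewrite !mul0r mul0e.
  by rewrite mul1r mule_ge0 ?adde_ge0// lee_fin mulr_ge0 ?invr_ge0// ltW.
pose g (x : R) : R := 4 * x * (1 + x ^+ 2)^-1 ^+ 2.
have g0 x : 0 <= x -> 0 <= g x by move=> x0; rewrite /g mulr_ge0 ?sqr_ge0// mulr_ge0.
have mgg : measurable_fun setT (g : TR -> TR).
  by apply: eq_measurable_fun (measurable_funM (@measurable_id _ TR setT) mg) => x _; rewrite /g /=; ring.
have mG (S : set TR) F : measurable S -> measurable_fun setT F ->
    measurable_fun setT (fun x : TR => (\1_S x * g x)%:E * F x)%E.
  move=> mS mF; apply: emeasurable_funM => //; apply/measurable_EFinP; apply: measurable_funM => //; exact: mI.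
have gi x (S : set R) : (S x -> 0 < x) -> (0 <= (\1_S x * g x)%:E)%E.
  move=> Sx; rewrite lee_fin indicE; case: (boolP (x \in S)) => [/set_mem/Sx x0|_]; last by rewrite mul0r.
  by rewrite mul1r g0// ltW.
have g01 (x : R) : (`]0, 1[%classic x -> 0 < x) by rewrite /= in_itv/= => /andP[].
have g1y (x : R) : (`]1, +oo[%classic x -> 0 < x) by rewrite /= in_itv/= andbT; exact: lt_trans.
transitivity (\int[lam]_x P x)%E.
  rewrite ge0_integral_halves; last 2 first.
  - apply: emeasurable_funM => //; apply/measurable_EFinP; do 2 apply: measurable_funM => //; exact: mI.
  - by move=> x; rewrite mule_ge0 ?adde_ge0// lee_fin !mulr_ge0// invr_ge0.
  rewrite integral_mkcond; apply: eq_integral => x _; rewrite /patch mem_setE in_itv/= andbT.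
  have [x0|x0] := ltP 0 x; last by rewrite /P indicE mem_setE in_itv/= ltNge x0/= !mul0r mul0e.
  rewrite hN normrN ger0_norm ?(ltW x0)// /P /f2 !indicE !mulNr.
  rewrite (_ : (- x \in _) = (x \in [set x : R | x ^+ 2 < 1])); last first.
    by apply/idP/idP; rewrite !inE/= sqrrN.
  rewrite -ge0_muleDr ?adde_ge0//; congr ((_)%:E * _)%E; last by rewrite !addeA; congr (_ + _)%E; rewrite addeAC.
  rewrite [x * _]mulrC; congr (_ * _ * _); congr (nat_of_bool _)%:R.
  by apply/idP/idP; rewrite !inE/= in_itv/= x0/= => ?; nra.
transitivity (\int[lam]_x ((\1_(`]0%R, 1%R[%classic) x * g x)%:E * (f2 x + f2 (x^-1)%R)))%E.
  rewrite (_ : \int[lam]_x P x = \int[lam]_(x in `]phi 0%R, phi 1%R]) P x)%E; last first.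
    rewrite [RHS]integral_mkcond; apply: eq_integral => x _; rewrite /patch mem_setE in_itv/=.
    have -> : phi 0 = 0 by rewrite /phi mulr0 mul0r.
    have -> : phi 1 = 1 by rewrite /phi expr1n mulr1 mulfV// (_ : 1 + 1 = 2)// pnatr_eq0.
    case: ifP => // xn; rewrite /P indicE mem_setE in_itv/=; case: (boolP (_ && _)) => [/andP[x0 x1]|_]; last by rewrite !mul0r mul0e.
    by rewrite x0 (ltW x1) in xn.
  have cd : continuous dphi.
    apply: contM; first by ccont.
    by apply: contX; apply: contV => [|x]; [ccont|exact: lt0r_neq0].
  rewrite -(ge0_integral_subst (w := fun x => \1_(`]0, 1]%classic) x * dphi x) (phi := phi))//.
  - apply: eq_integral => t _; rewrite !indicE !mem_setE !in_itv/=.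
    have [t0|t0] := ltP 0 t; last by rewrite !mul0r !mul0e.
    have [t1|t1] := ltP t 1; last first.
      rewrite mul0r mul0e; have [t1'|] := leP t 1; last by rewrite mul0r mul0e.
      have -> : t = 1 by apply/eqP; rewrite eq_le t1 t1'.
      by rewrite /dphi expr1n subrr mulr0 mul0r mulr0 mul0e.
    rewrite (ltW t1) /= !mul1r /P; have [|pi hE -> ->] := phi_facts (t := t); first by rewrite t0.
    rewrite indicE mem_setE in_itv/= pi mul1r muleA -EFinM hE; congr (_%:E * _)%E.
    rewrite /dphi /phi /g; field; rewrite lt0r_neq0//=; apply: lt0r_neq0; rewrite subr_gt0; nra.
  - apply: measurable_funM; [exact: mI|exact: continuous_measurable_fun].
  - apply: continuous_measurable_fun => x; exact: is_derive_continuous (phi_derive x).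
  - move=> x; rewrite indicE mem_setE in_itv/=; case: (boolP (_ && _)) => [/andP[x0 x1]|_]; last by rewrite mul0r.
    rewrite mul1r /dphi mulr_ge0 ?sqr_ge0// mulr_ge0// subr_ge0; nra.
  - move=> x; rewrite indicE mem_setE in_itv/=; case: (boolP (_ && _)) => [/andP[x0 x1] _|_]; last by rewrite mul0r eqxx.
    have i0 : (0 : R) \in `[0, 1] by rewrite in_itv/= lexx ler01.
    have i1 : (1 : R) \in `[0, 1] by rewrite in_itv/= lexx ler01.
    have ix : (x : R) \in `[0, 1] by rewrite in_itv/= (ltW x0).
    by rewrite /= in_itv/= (leW_mono_in phi_mono)// phi_mono// x0.
  - exact: (increasing_transport ltr01 phi_derive cd phi_mono).
rewrite (_ : \int[lam]_x _ = \int[lam]_x ((\1_(`]0%R, 1%R[%classic) x * g x)%:E * f2 x) +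
   \int[lam]_x ((\1_(`]0%R, 1%R[%classic) x * g x)%:E * f2 (x^-1)%R))%E; last first.
  rewrite -ge0_integralD//; last 4 first.
  - by move=> x _; rewrite mule_ge0// gi//; exact: g01.
  - exact: mG.
  - by move=> x _; rewrite mule_ge0// gi//; exact: g01.
  - apply: mG => //; exact: (measurableT_comp mf2 measurable_inverse).
  by apply: eq_integral => x _; rewrite ge0_muleDr.
have i1 : measurable (`]1%R, +oo[%classic : set TR) by [].
have -> : (\int[lam]_x ((\1_(`]0%R, 1%R[%classic) x * g x)%:E * f2 (x^-1)%R) =
    \int[lam]_x ((\1_(`]1%R, +oo[%classic) x * g x)%:E * f2 x))%E.
  transitivity (\int[lam]_(x in `]0%R, +oo[) ((\1_(`]1%R, +oo[%classic) x * g x)%:E * f2 x))%E; last first.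
    rewrite integral_mkcond; apply: eq_integral => x _; rewrite /patch mem_setE in_itv/= andbT.
    case: ifP => // /negbT; rewrite -leNgt => x0; rewrite indicE mem_setE in_itv/= andbT ltNge.
    by rewrite (le_trans x0)// mul0r mul0e.
  rewrite -integral_inverse_pos; last 2 first.
  - exact: mG.
  - by move=> x; rewrite mule_ge0// gi//= in_itv/= andbT; apply: lt_trans.
  apply: eq_integral => x _; rewrite !indicE !mem_setE !in_itv/= !andbT.
  have [x0|x0] := ltP 0 x; last by rewrite !mul0r !mul0e.
  rewrite invf_gt1//; case: (boolP (x < 1)) => x1; last by rewrite !mul0r mul0e mule0.
  rewrite !mul1r muleA -EFinM; congr (_%:E * _)%E; rewrite /g; field.
  by rewrite !lt0r_neq0// ltr_pwDr// sqr_ge0.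
rewrite -ge0_integralD//; last 4 first.
- by move=> x _; rewrite mule_ge0// gi//; exact: g01.
- exact: mG.
- by move=> x _; rewrite mule_ge0// gi//; exact: g1y.
- exact: mG.
have mR : measurable_fun setT (fun x : TR => (`|x| * (4 * (1 + x ^+ 2)^-1 ^+ 2))%:E * f x)%E.
  apply: emeasurable_funM => //; apply/measurable_EFinP; exact: measurable_funM.
have R0 (x : R) : (0 <= (`|x| * (4 * (1 + x ^+ 2)^-1 ^+ 2))%:E * f x)%E.
  by rewrite mule_ge0// lee_fin mulr_ge0// mulr_ge0// sqr_ge0.
rewrite [RHS]ge0_integral_halves// [RHS]integral_mkcond.
rewrite (ge0_integral_setC1 1) ?[RHS](ge0_integral_setC1 1)//; last 4 first.
- apply/(measurable_restrictT _ _).1 => //; apply: measurable_funTS; apply: emeasurable_funD => //; exact: mN mR.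
- by move=> x; rewrite /patch; case: ifP => // _; rewrite adde_ge0.
- by apply: emeasurable_funD; exact: mG.
- by move=> x; rewrite adde_ge0// mule_ge0// gi//; [exact: g01|exact: g1y].
apply: eq_integral => x; rewrite inE/= => /eqP x1.
rewrite /patch !indicE !mem_setE !in_itv/= !andbT.
have [x0|x0] := ltP 0 x; last by rewrite [1 < x]ltNge (le_trans x0)// !mul0r !mul0e adde0.
rewrite normrN sqrrN ger0_norm ?(ltW x0)// -ge0_muleDr//.
have -> : x * (4 * (1 + x ^+ 2)^-1 ^+ 2) = g x by rewrite /g; ring.
by case: ltgtP x1 => // _ _; rewrite ?mul0r ?mul0e ?mul1r ?adde0 ?add0e.
Qed.

Lemma measurable_sum_sq : measurable_fun setT (fun q : TR * TR => q.1 ^+ 2 + q.2 ^+ 2 : TR).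
Proof.
by apply: measurable_funD; apply: measurable_funX; [exact: measurable_fst|exact: measurable_snd].
Qed.

Lemma measurable_dilation (l : TR * TR -> TR) : measurable_fun setT l ->
  measurable_fun setT (fun q : TR * TR => (q.1 * l q : TR, q.2 * l q : TR)).
Proof.
move=> ml; apply/measurable_fun_pairP; by split; apply: measurable_funM.
Qed.

Lemma stereo_vertical (q : R * R) (s : R) : s ^+ 2 = 1 - (q.1 ^+ 2 + q.2 ^+ 2) -> 1 + s != 0 ->
  emb (stereo_chart (R := R)) (q.1 * (1 + s)^-1, q.2 * (1 + s)^-1) = (q, s).
Proof.
move=> s2 s1; have := emb_zt (stereo_inverse (R := R)) (p := (q, s)).
rewrite /zt /slant eqxx /= mul1r; apply => //; split; last by [].
by rewrite /= mul1r s2 subrK.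
Qed.

Lemma area_stereo (D : set (R * R * R)) :
  measurable (emb (stereo_chart (R := R)) @^-1` D : set (TR * TR)) ->
  area 1 D = (\int[lam2]_z (\1_D (emb (stereo_chart (R := R)) z) * dens (stereo_chart (R := R)) z)%:E)%E.
Proof.
set c := stereo_chart (R := R) => mD.
pose G (z : TR * TR) : TR := \1_D (emb c z).
have mG : measurable_fun setT G.
  rewrite (_ : G = \1_(emb c @^-1` D)); first exact: measurable_indic.
  by apply/funext => z; rewrite /G !indicE; congr (nat_of_bool _)%:R; apply/idP/idP; rewrite !inE.
have G0 z : 0 <= G z by rewrite /G indicE.
pose h (q : TR * TR) : TR := Num.sqrt (1 - (q.1 ^+ 2 + q.2 ^+ 2)).
have mh : measurable_fun setT h.
  have ms : measurable_fun setT (Num.sqrt : TR -> TR) by apply: continuous_measurable_fun; exact: sqrt_continuous.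
  apply: (measurableT_comp ms); apply: measurable_funB => //; exact: measurable_sum_sq.
have minv (f : TR * TR -> TR) : measurable_fun setT f -> measurable_fun setT (fun q => (f q)^-1 : TR).
  by move=> mf; exact: (measurableT_comp measurable_inverse mf).
pose S : set (TR * TR) := [set q | q.1 ^+ 2 + q.2 ^+ 2 < 1].
have mS : measurable S.
  rewrite (_ : S = (fun q : TR * TR => q.1 ^+ 2 + q.2 ^+ 2 : TR) @^-1` `]-oo, 1[%classic); last first.
    by apply/seteqP; split => q /=; rewrite in_itv.
  by rewrite -[X in measurable X]setTI; apply: measurable_sum_sq.
pose K (q : TR * TR) : TR := \1_S q * (h q)^-1 * (G (q.1 * (1 + h q)^-1, q.2 * (1 + h q)^-1) +
   G (q.1 * (1 - h q)^-1, q.2 * (1 - h q)^-1)).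
have mK : measurable_fun setT K.
  apply: measurable_funM.
    by apply: measurable_funM; [exact: measurable_indic|exact: minv].
  apply: measurable_funD; apply: (measurableT_comp mG); apply: measurable_dilation; apply: minv.
    exact: measurable_funD.
  exact: measurable_funB.
pose A (q : TR * TR) : TR := \1_S q * ((\1_D (q, h q) + \1_D (q, - h q)) / h q).
(* Below the origin lies the projection centre (0, 0, -1), where 1 - h q vanishes and the
   stereographic coordinates are not defined. *)
have AK q : q <> (0, 0) -> A q = K q.
  move=> q0; rewrite /A /K indicE; case: (boolP (q \in S)) => [/set_mem qS|_]; last by rewrite !mul0r.
  have qp : 0 < q.1 ^+ 2 + q.2 ^+ 2.
    rewrite lt_neqAle addr_ge0 ?sqr_ge0// andbT eq_sym paddr_eq0 ?sqr_ge0// !sqrf_eq0.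
    by apply/negP => /andP[/eqP q1 /eqP q2]; apply: q0; case: q q1 q2 {qS} => ? ? /= -> ->.
  have h2 : h q ^+ 2 = 1 - (q.1 ^+ 2 + q.2 ^+ 2) by rewrite sqr_sqrtr// subr_ge0 ltW.
  have hp : 0 <= h q by rewrite sqrtr_ge0.
  rewrite !mul1r mulrC; congr (_ * _); rewrite /G !stereo_vertical//.
  - by rewrite sqrrN.
  - by apply/eqP => h1; move: h2; rewrite (_ : h q = 1); [lra|lra].
  - by rewrite lt0r_neq0// ltr_pwDl.
have mA : measurable_fun setT A.
  have m0 : measurable ([set (0, 0)] : set (TR * TR)).
    by rewrite (_ : [set _] = [set (0 : TR)] `*` [set (0 : TR)]); [exact: measurableX|apply/seteqP; split => -[x y] /=; [move=> [-> ->]|case=> -> ->]].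
  have -> : setT = [set (0, 0)] `|` ~` [set (0 : TR, 0 : TR)] by rewrite setUv.
  apply/measurable_funU => //; [exact: measurableC|split; first exact: measurable_fun_set1].
  by apply: (eq_measurable_fun K) => [q|]; [rewrite inE => /AK ->|exact: measurable_funTS].
have A0 q : 0 <= A q.
  rewrite /A !mulr_ge0// ?invr_ge0 ?sqrtr_ge0// ?addr_ge0//.
transitivity (\int[lam2]_q (A q)%:E)%E.
  rewrite /area integral_mkcond; apply: eq_integral => q _; rewrite /patch /A.
  have -> : \1_S q = (q \in S)%:R :> R by rewrite indicE.
  rewrite (_ : (q \in [set q | _]) = (q \in S)); last by apply/idP/idP; rewrite !inE/= mul1r.
  by case: (boolP (q \in S)) => _; [rewrite /h !mul1r|rewrite mul0r].
have md : measurable_fun setT (dens c : TR * TR -> TR) := continuous_measurable2 (@dens_cont _ _ c).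
rewrite ge0_integral_slope; last 2 first.
- exact/measurable_EFinP.
- by move=> q; rewrite lee_fin.
rewrite ge0_integral_slope; last 2 first.
- by apply/measurable_EFinP; exact: measurable_funM.
- by move=> q; rewrite lee_fin mulr_ge0// ltW// dens_gt0.
apply: eq_integral => m _.
(* Dilation by [e] replaces the abscissa by the Euclidean length along the line of slope [m], the
   parameter of [archimedes_line]. *)
pose e := Num.sqrt (1 + m ^+ 2).
have m1 : 0 < 1 + m ^+ 2 by rewrite ltr_pwDl// sqr_ge0.
have e0 : 0 < e by rewrite sqrtr_gt0.
have e2 : e ^+ 2 = 1 + m ^+ 2 by rewrite sqr_sqrtr// ltW.
have en := lt0r_neq0 e0.
pose f (y : TR) : \bar R := (G ((y / e)%R, (m * (y / e))%R))%:E.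
have mf : measurable_fun setT f.
  apply/measurable_EFinP; apply: (measurableT_comp mG); apply/measurable_fun_pairP; split.
    by apply: measurable_funM.
  by apply: measurable_funM => //; exact: measurable_funM.
have f0 x : (0 <= f x)%E by rewrite lee_fin.
have := archimedes_line mf f0; set L1 := fun x => ((`|x| * \1__ x / hh x)%:E * _)%E; set R1 := fun x => (_ * f x)%E.
pose L1' (x : TR) : \bar R := L1 x.
have mR1 : measurable_fun setT R1.
  apply: emeasurable_funM => //; apply/measurable_EFinP; apply: measurable_funM; first exact: normr_measurable.
  apply: continuous_measurable_fun; apply: contM; first exact: cst_continuous.
  by apply: contX; apply: contV => [|x]; [ccont|exact: lt0r_neq0].
have mhh : measurable_fun setT (fun x : TR => (hh x : TR)).
  by apply: continuous_measurable_fun; apply: (cont_at (f := Num.sqrt)); [exact: sqrt_continuous|ccont].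
have mq s : measurable_fun setT (fun x : TR => f (x * (1 + s * hh x)^-1)%R).
  apply: (measurableT_comp mf); apply: measurable_funM => //; apply: (measurableT_comp measurable_inverse).
  by apply: measurable_funD => //; exact: measurable_funM.
have mL1 : measurable_fun setT L1.
  apply: emeasurable_funM.
    apply/measurable_EFinP; apply: measurable_funM; last exact: (measurableT_comp measurable_inverse).
    apply: measurable_funM; first exact: normr_measurable.
    apply: measurable_indic; rewrite (_ : mkset _ = `]-1, 1[%classic)//; apply/seteqP; split => x /=; rewrite in_itv/=; [move=> ?; apply/andP; split; nra|move=> /andP[]; nra].
  apply: emeasurable_funD.
    by apply: eq_measurable_fun (mq 1) => x _; rewrite mul1r.
  by apply: eq_measurable_fun (mq (-1)) => x _; rewrite mulN1r.
have L10 x : (0 <= L1 x)%E by rewrite /L1 mule_ge0 ?adde_ge0// lee_fin !mulr_ge0// ?invr_ge0 ?sqrtr_ge0.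
have R10 x : (0 <= R1 x)%E by rewrite /R1 mule_ge0// lee_fin mulr_ge0// mulr_ge0// sqr_ge0.
have scaled (F : TR -> \bar R) : measurable_fun setT F -> (forall x, 0 <= F x)%E ->
    (\int[lam]_x ((e^-1)%:E * F (0 + e * x)%R) = (e^-1 ^+ 2)%:E * \int[lam]_x F x)%E.
  move=> mF F0; rewrite ge0_integralZl//; last 2 first.
  - exact: (measurableT_comp mF (measurable_affine e 0)).
  - by rewrite lee_fin invr_ge0 ltW.
  rewrite (ge0_integral_affine 0 en mF F0) muleA gtr0_norm// -EFinM; congr (_%:E * _)%E.
  by rewrite expr2 -mulrA mulVf// mulr1.
move=> LR.
transitivity (\int[lam]_x ((e^-1)%:E * L1 (0 + e * x)%R))%E; last first.
  rewrite scaled// LR -scaled//; apply: eq_integral => x _.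
  rewrite /R1 /f add0r -!EFinM [e * x]mulrC mulfK//; congr (_%:E).
  rewrite normrM [`|e|]gtr0_norm// -[dens c _]/(4 * (1 + (x ^+ 2 + (m * x) ^+ 2))^-1 ^+ 2).
  rewrite (_ : x ^+ 2 + (m * x) ^+ 2 = (x * e) ^+ 2); last by rewrite [(x * e) ^+ 2]exprMn e2; ring.
  by rewrite -/(G (x, m * x)); field; rewrite en/= lt0r_neq0//= ltr_pwDl// sqr_ge0.
apply: eq_integral => x _; rewrite add0r.
have [->|x0] := eqVneq x 0; first by rewrite /L1 normr0 !mul0e mulr0 normr0 !mul0r mul0e mule0.
rewrite AK; last by move=> [/eqP]; rewrite (negbTE x0).
rewrite /L1 /f -EFinD -!EFinM; congr (_%:E).
have hE : hh (e * x) = h (x, m * x).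
  by rewrite /hh /h /=; congr Num.sqrt; rewrite exprMn e2; ring.
have sE : \1_[set x : R | x ^+ 2 < 1] (e * x) = \1_S (x, m * x) :> R.
  rewrite !indicE; congr (nat_of_bool _)%:R; apply/idP/idP; rewrite !inE /S/=;
    rewrite (_ : (e * x) ^+ 2 = x ^+ 2 + (m * x) ^+ 2)// [LHS]exprMn e2; ring.
rewrite hE sE /K /= normrM gtr0_norm//.
have fE s : G (e * x * s / e, m * (e * x * s / e)) = G (x * s, m * x * s).
  have -> : e * x * s / e = x * s by field.
  by rewrite mulrA.
by rewrite !fE; move: ((h (x, m * x))^-1) (G _ + G _) => i w; field.
Qed.

(** Inversion in the circle about [c] with squared radius 1 + |c|^2. *)
Definition inversion (c : R * R) (z : R * R) : R * R :=
  let u1 := z.1 - c.1 in let u2 := z.2 - c.2 in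
  let l := (1 + (c.1 ^+ 2 + c.2 ^+ 2)) * (u1 ^+ 2 + u2 ^+ 2)^-1 in
  (c.1 + u1 * l, c.2 + u2 * l).

Lemma measurable_inversion (c : R * R) : measurable_fun setT (inversion c : TR * TR -> TR * TR).
Proof.
have m1 : measurable_fun setT (fun z : TR * TR => z.1 - c.1 : TR) by apply: measurable_funB => //; exact: measurable_fst.
have m2 : measurable_fun setT (fun z : TR * TR => z.2 - c.2 : TR) by apply: measurable_funB => //; exact: measurable_snd.
have ml : measurable_fun setT (fun z : TR * TR => (1 + (c.1 ^+ 2 + c.2 ^+ 2)) * ((z.1 - c.1) ^+ 2 + (z.2 - c.2) ^+ 2)^-1 : TR).
  apply: measurable_funM => //; apply: (measurableT_comp measurable_inverse).
  by apply: measurable_funD; exact: measurable_funX.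
by apply/measurable_fun_pairP; split; apply: measurable_funD => //; exact: measurable_funM.
Qed.

(* The inversions of this family are the reflections of the sphere that move the
   projection centre (0, 0, -1). *)
Lemma integral_inversion (c : R * R) (G : TR * TR -> TR) : measurable_fun setT G -> (forall z, 0 <= G z) ->
  (\int[lam2]_z (G z * dens (stereo_chart (R := R)) z)%:E =
   \int[lam2]_z (G (inversion c z) * dens (stereo_chart (R := R)) z)%:E)%E.
Proof.
move=> mG G0; set ch := stereo_chart (R := R).
have md : measurable_fun setT (dens ch : TR * TR -> TR) := continuous_measurable2 (@dens_cont _ _ ch).
have mi := measurable_inversion c.
have mGi : measurable_fun setT (fun z : TR * TR => G (inversion c z)) by exact: (measurableT_comp mG mi).
have trans (F : TR * TR -> TR) : measurable_fun setT F -> (forall z, 0 <= F z) ->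
   (\int[lam2]_z (F z)%:E = \int[lam]_m \int[lam]_x (`|x|%:E * (F (c.1 + x, c.2 + m * x)%R)%:E))%E.
  move=> mF F0; rewrite (ge0_integral_affine2 c ltr01); last 2 first.
  - exact/measurable_EFinP.
  - by move=> z; rewrite lee_fin.
  rewrite expr1n mul1e ge0_integral_slope.
  - by apply: eq_integral => m _; apply: eq_integral => x _ /=; rewrite !mul1r.
  - apply/measurable_EFinP; apply: (measurableT_comp mF); apply/measurable_fun_pairP; split.
      exact: (measurableT_comp (measurable_affine 1 c.1) measurable_fst).
    exact: (measurableT_comp (measurable_affine 1 c.2) measurable_snd).
  - by move=> z; rewrite lee_fin.
rewrite trans; last 2 first.
- exact: measurable_funM.
- by move=> z; rewrite mulr_ge0// ltW// dens_gt0.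
rewrite trans; last 2 first.
- exact: measurable_funM.
- by move=> z; rewrite mulr_ge0// ltW// dens_gt0.
apply: eq_integral => m _.
pose r := 1 + (c.1 ^+ 2 + c.2 ^+ 2).
have r0 : 0 < r by exact: stereo_den_gt0.
have m1 : 0 < 1 + m ^+ 2 by rewrite ltr_pwDl// sqr_ge0.
(* In the abscissa measured from [c], the inversion acts on the line of slope [m] through [c] by x
   to a / x. *)
pose a := r / (1 + m ^+ 2).
have a0 : 0 < a by rewrite divr_gt0.
rewrite (ge0_integral_inverse a0); last 2 first.
- apply: emeasurable_funM; first by apply/measurable_EFinP; exact: normr_measurable.
  apply/measurable_EFinP.
  have ma : measurable_fun setT (fun x : TR => (c.1 + x : TR, c.2 + m * x : TR)).
    apply/measurable_fun_pairP; split; first exact: measurable_funD.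
    by apply: measurable_funD => //; exact: measurable_funM.
  apply: (measurableT_comp (f := fun z : TR * TR => G z * dens ch z)) ma; exact: measurable_funM.
- by move=> x; rewrite mule_ge0// lee_fin mulr_ge0// ltW// dens_gt0.
apply: eq_integral => x _; rewrite -!EFinM; congr (_%:E).
have [->|x0] := eqVneq x 0; first by rewrite normr0 expr0n/= invr0 mulr0 !mul0r.
have -> : inversion c (c.1 + x, c.2 + m * x) = (c.1 + a / x, c.2 + m * (a / x)).
  rewrite /inversion /= -/r; have q0 := lt0r_neq0 m1.
  have ->: (c.1 + x - c.1) ^+ 2 + (c.2 + m * x - c.2) ^+ 2 = x ^+ 2 * (1 + m ^+ 2) by ring.
  by rewrite /a; congr (_, _); field; rewrite x0 q0.
have n0 : 0 < `|x| by rewrite normr_gt0.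
have x2 : x ^+ 2 = `|x| ^+ 2 by rewrite real_normK ?num_real.
rewrite normrM normfV (gtr0_norm a0) /=.
set A1 := 1 + ((c.1 + a / x) ^+ 2 + _); set B1 := 1 + ((c.1 + x) ^+ 2 + _).
have A10 : 0 < A1 by have := stereo_den_gt0 (c.1 + a / x, c.2 + m * (a / x)).
have B10 : 0 < B1 by have := stereo_den_gt0 (c.1 + x, c.2 + m * x).
have AB : A1 * x ^+ 2 = a * B1.
  have rE : r = a * (1 + m ^+ 2) by rewrite /a mulfVK// lt0r_neq0.
  have -> : A1 = r + 2 * (c.1 + m * c.2) * (a / x) + (1 + m ^+ 2) * (a / x) ^+ 2 by rewrite /A1 /r; ring.
  have -> : B1 = r + 2 * (c.1 + m * c.2) * x + (1 + m ^+ 2) * x ^+ 2 by rewrite /B1 /r; ring.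
  by rewrite !rE; field.
have -> : A1^-1 = x ^+ 2 * a^-1 * B1^-1.
  apply: (mulfI (lt0r_neq0 A10)); rewrite mulfV ?lt0r_neq0//.
  rewrite (_ : A1 * _ = (A1 * x ^+ 2) * (a^-1 * B1^-1)); [rewrite AB; field; rewrite !lt0r_neq0//|ring].
rewrite x2; field; rewrite !lt0r_neq0//.
Qed.

End archimedes.

(** * Reflections of the surface *)

Section smooth_curves.
Context {R : realType}.
Local Notation pt := (R * R * R)%type.
Implicit Types (k : R) (g h : R -> pt) (p q v w : pt).

Lemma cont_pair_at (X Y Z : topologicalType) (f : X -> Y) (h : X -> Z) x : {for x, continuous f} ->
  {for x, continuous h} -> {for x, continuous (fun x => (f x, h x))}.
Proof. by move=> cf ch; apply: cvg_pair; [exact: cf|exact: ch]. Qed.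

Lemma cont_pair (X Y Z : topologicalType) (f : X -> Y) (h : X -> Z) : continuous f -> continuous h ->
  continuous (fun x => (f x, h x)).
Proof. by move=> cf ch x; apply: cvg_pair; [exact: cf|exact: ch]. Qed.

(** Iterated derivatives need not be computed: it suffices to exhibit a class of functions that a
    single derivation maps to itself. *)
Lemma smooth_closed (P : set (R -> R)) :
  (forall f, P f -> exists2 f', P f' & forall t : R, has_deriv t f (f' t)) ->
  forall f, P f -> smooth f.
Proof.
move=> HP f Pf.
have Pn n : P (derive1n n f).
  elim: n => [//|n /HP[f' Pf' df]]; rewrite derive1nS (_ : derive1 _ = f')//.
  by apply/funext => t; rewrite derive1E; have [_ ->] := df t.
by move=> n t; have [f' _ /(_ t)[]] := HP _ (Pn n).
Qed.

Definition lincomb3 (c0 c1 c2 c3 : R) (f1 f2 f3 : R -> R) : R -> R :=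
  fun t => c0 + c1 * f1 t + c2 * f2 t + c3 * f3 t.

Lemma lincomb3_derive c0 c1 c2 c3 (f1 f2 f3 : R -> R) (t d1 d2 d3 : R) :
  has_deriv t f1 d1 -> has_deriv t f2 d2 -> has_deriv t f3 d3 ->
  has_deriv t (lincomb3 c0 c1 c2 c3 f1 f2 f3) (c1 * d1 + c2 * d2 + c3 * d3).
Proof.
move=> h1 h2 h3; rewrite /lincomb3; derive_ring.
Qed.

Lemma smooth_lincomb3 c0 c1 c2 c3 (f1 f2 f3 : R -> R) : smooth f1 -> smooth f2 -> smooth f3 ->
  smooth (lincomb3 c0 c1 c2 c3 f1 f2 f3).
Proof.
move=> s1 s2 s3.
have sm (f : R -> R) : smooth f -> smooth (derive1 f).
  move=> sf n t; have -> : derive1n n (derive1 f) = derive1n n.+1 f; last exact: sf.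
  by elim: n => [|n IHn]; rewrite ?derive1n0 ?derive1n1// derive1nS IHn -derive1nS.
apply: (@smooth_closed [set f | exists d0 f1 f2 f3,
  [/\ smooth f1, smooth f2, smooth f3 & f = lincomb3 d0 c1 c2 c3 f1 f2 f3]]); last by exists c0, f1, f2, f3; split; [exact: s1|exact: s2|exact: s3|by []].
move=> _ [d0 [e1 [e2 [e3 [h1 h2 h3 ->]]]]].
exists (lincomb3 0 c1 c2 c3 (derive1 e1) (derive1 e2) (derive1 e3)).
  by exists 0, (derive1 e1), (derive1 e2), (derive1 e3); split; [exact: sm|exact: sm|exact: sm|by []].
move=> t; rewrite {2}/lincomb3 add0r; apply: lincomb3_derive; exact: smooth_is_derive.
Qed.

Lemma smooth_cst (c : R) : smooth (fun=> c).
Proof.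
apply: (@smooth_closed [set f | exists c, f = (fun=> c)]); last by exists c.
by move=> _ [d ->]; exists (fun=> 0); [exists 0|move=> t; exact: is_derive_cst].
Qed.

Lemma smooth_id : smooth (fun t : R => t).
Proof.
apply: (@smooth_closed [set f | f = id \/ exists c, f = (fun=> c)]); last by left.
move=> _ [->|[d ->]].
  by exists (fun=> 1); [right; exists 1|move=> t; exact: is_derive_id].
by exists (fun=> 0); [right; exists 0|move=> t; exact: is_derive_cst].
Qed.

Lemma trig_derive (c t : R) :
  has_deriv t (fun s => cos (c * s)) (- c * sin (c * t)) /\
  has_deriv t (fun s => sin (c * s)) (c * cos (c * t)).
Proof.
have dl : has_deriv t (fun s : R => c * s) c by derive_ring.
split; derive_ring.
Qed.

Lemma smooth_trig (c a1 a2 : R) : smooth (fun t => a1 * cos (c * t) + a2 * sin (c * t)).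
Proof.
apply: (@smooth_closed [set f | exists a1 a2, f = (fun t => a1 * cos (c * t) + a2 * sin (c * t))]); last by exists a1, a2.
move=> _ [b1 [b2 ->]]; exists (fun t => (c * b2) * cos (c * t) + (- c * b1) * sin (c * t)); first by exists (c * b2), (- c * b1).
move=> t; have [d1 d2] := trig_derive c t; derive_ring.
Qed.

Lemma expR_derive (c t : R) : has_deriv t (fun s => expR (c * s)) (c * expR (c * t)).
Proof.
have dl : has_deriv t (fun s : R => c * s) c by derive_ring.
derive_ring.
Qed.

Lemma smooth_expR (c a1 a2 : R) : smooth (fun t => a1 * expR (c * t) + a2 * expR (- c * t)).
Proof.
apply: (@smooth_closed [set f | exists a1 a2, f = (fun t => a1 * expR (c * t) + a2 * expR (- c * t))]); last by exists a1, a2.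
move=> _ [b1 [b2 ->]]; exists (fun t => (c * b1) * expR (c * t) + (- c * b2) * expR (- c * t)); first by exists (c * b1), (- c * b2).
move=> t; have d1 := expR_derive c t; have d2 := expR_derive (- c) t.
derive_ring.
Qed.

Section arc.
Variables (k : R) (g : R -> pt) (m : nat) (a b : nat -> R) (H : nat -> R -> pt).
Hypothesis cp : curve_pieces k g m a b H.

Let P01 : partition01 m a b. Proof. by case: cp. Qed.
Let ab i : (i < m)%N -> a i < b i. Proof. by move: i; have [[_ +] _ _] := P01. Qed.

Lemma partition_lt i j : (i < j)%N -> (j < m)%N -> b i <= a j.
Proof.
have [_ _ ba] := P01; elim: j => [//|j IHj]; rewrite ltnS leq_eqVlt => /predU1P[->|ij] jm; first by rewrite ba.
by rewrite (le_trans (IHj ij (ltnW jm)))// -ba// ltW// ab// ltnW.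
Qed.

Lemma nondecreasing_pieces (F : R -> R) s t :
  (forall i x y, (i < m)%N -> a i <= x -> x <= y -> y <= b i -> s <= x -> y <= t -> F x <= F y) ->
  0 <= s -> s <= t -> t <= 1 -> F s <= F t.
Proof.
move=> HF s0 st t1; have [[m0 _] [a0 b1] ba] := P01.
suff main n x : (n < m)%N -> a n <= x <= b n -> s <= x -> x <= t -> F s <= F x.
  by have [|i im tab] := partition_cover P01 (t := t); [rewrite (le_trans s0 st)|exact: (main i)].
elim: n x => [|n IHn] x nm /andP[ax xb] sx xt.
  by apply: (HF 0%N) => //; rewrite a0.
have [as1|sa] := leP (a n.+1) s; first exact: (HF n.+1).
apply: le_trans (HF n.+1 (a n.+1) x nm _ ax xb _ xt) => //; last exact: ltW.
apply: IHn; [exact: ltnW| |exact: ltW|exact: le_trans ax xt].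
by rewrite -ba// lexx andbT ltW// ab// ltnW.
Qed.

Lemma constant_pieces (F : R -> R) s t :
  (forall i x y, (i < m)%N -> a i <= x -> x <= y -> y <= b i -> s <= x -> y <= t -> F x = F y) ->
  0 <= s -> s <= t -> t <= 1 -> F s = F t.
Proof.
move=> HF s0 st t1; apply/eqP; rewrite eq_le; apply/andP; split.
  by apply: nondecreasing_pieces => // i x y im ax xy yb sx yt; rewrite (HF i x y).
rewrite -lerN2; apply: (nondecreasing_pieces (F := fun x => - F x)) => // i x y im ax xy yb sx yt.
by rewrite (HF i x y).
Qed.

(** While the parameter runs through piece [j], the clamps hold every other summand at one of its
    ends. *)
Lemma glue_pieces (I : nat -> R -> R) j x y : (j < m)%N -> a j <= x <= b j -> a j <= y <= b j ->
  \sum_(0 <= i < m) I i (clamp (a i) (b i) x) - \sum_(0 <= i < m) I i (clamp (a i) (b i) y) = I j x - I j y.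
Proof.
move=> jm xj yj; rewrite -sumrB (bigD1_seq j) ?iota_uniq ?mem_index_iota//= !clamp_id//.
rewrite big1_seq ?addr0// => i /andP[ij]; rewrite mem_index_iota => /andP[_ im].
suff -> : clamp (a i) (b i) x = clamp (a i) (b i) y by rewrite subrr.
have ai := ltW (ab im); case: ltngtP ij => // ij _.
  have c z : a j <= z -> clamp (a i) (b i) z = b i.
    move=> jz; rewrite /clamp min_l ?max_r//; exact: le_trans (partition_lt ij jm) jz.
  by case/andP: xj yj => xj _ /andP[yj _]; rewrite !c.
have c z : z <= b j -> clamp (a i) (b i) z = a i.
  move=> zj; have za : z <= a i by exact: le_trans zj (partition_lt ij im).
  by rewrite /clamp min_r ?max_l// (le_trans za).
by case/andP: xj yj => _ xj /andP[_ yj]; rewrite !c.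
Qed.

(** The values of [g] outside [0, 1] are arbitrary, so the continuous function on the line is
    assembled from the clamped pieces. *)
Lemma curve_continuous (f : pt -> R) : continuous f ->
  exists2 phi : R -> R, continuous phi & forall t, 0 <= t <= 1 -> phi t = f (g t).
Proof.
move=> cf; have [_ sH gH] := cp.
pose I i t := f (H i t).
pose s t := \sum_(0 <= i < m) I i (clamp (a i) (b i) t).
exists (fun t => s t - s 0 + f (g 0)).
  have cs : continuous s.
    have cI i : (i < m)%N -> continuous (fun t => I i (clamp (a i) (b i) t)).
      move=> im; have [s1 s2 s3] := sH i im.
      have cH : continuous (fun t => ((H i t).1.1, (H i t).1.2, (H i t).2)).
        apply: cont_pair; first by apply: cont_pair; [exact: smooth_continuous s1|exact: smooth_continuous s2].
        exact: smooth_continuous s3.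
      have HE : (fun t => ((H i t).1.1, (H i t).1.2, (H i t).2)) = H i.
        by apply/funext => t; case: (H i t) => -[].
      rewrite HE in cH; apply: (cont_at (f := fun t => I i t)); last exact: continuous_clamp.
      exact: (cont_at (f := f) (g := H i)).
    suff cn n : (n <= m)%N -> continuous (fun t => \sum_(0 <= i < n) I i (clamp (a i) (b i) t)) by exact: cn.
    elim: n => [_|n IHn nm].
      rewrite (_ : (fun t => _) = cst 0); first exact: cst_continuous.
      by apply/funext => t; rewrite big_geq.
    rewrite (_ : (fun t => _) = fun t => \sum_(0 <= i < n) I i (clamp (a i) (b i) t) + I n (clamp (a n) (b n) t)).
      by apply: contD; [exact: IHn (ltnW nm)|exact: cI].
    by apply/funext => t; rewrite big_nat_recr.
  by ccont.
move=> t /andP[t0 t1].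
suff : s 0 - f (g 0) = s t - f (g t) by lra.
apply: (constant_pieces (F := fun t => s t - f (g t)) (s := 0) (t := t)) => // i x y im ax xy yb _ _.
have xab : a i <= x <= b i by rewrite ax (le_trans xy).
have yab : a i <= y <= b i by rewrite yb (le_trans ax).
have [-> _] := gH _ _ im xab; have [-> _] := gH _ _ im yab.
by have := glue_pieces I im xab yab; rewrite /s /I; lra.
Qed.

Let I i t := \int[lam]_(s in `[a i, t]) spd k (H i) s.
Let sigma t := \sum_(0 <= i < m) I i (clamp (a i) (b i) t).

Let sigma_piece j x y : (j < m)%N -> a j <= x <= b j -> a j <= y <= b j ->
  sigma x - sigma y = I j x - I j y.
Proof. exact: glue_pieces. Qed.

(** Comparison principle: a function that changes along each piece no faster than the speed changes
    between two parameters by at most the arc length. It yields lower bounds for distances and for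
    the length of a loop around a circle. *)
Lemma arc_function : exists sigma : R -> R, [/\ sigma 0 = 0, arc_length k g = (sigma 1)%:E &
  forall phi : pt -> R,
    (forall i t, (i < m)%N -> a i <= t <= b i ->
       exists2 d, has_deriv t (fun s => phi (H i s)) d & a i < t < b i -> d <= spd k (H i) t) ->
    forall s t, 0 <= s -> s <= t -> t <= 1 -> phi (g t) - phi (g s) <= sigma t - sigma s].
Proof.
have [_ sH gH] := cp.
exists sigma; split.
- rewrite /sigma big1_seq// => i /andP[_]; rewrite mem_index_iota => /andP[_ im].
  have [ai _] := partition_le P01 im.
  rewrite /clamp min_r ?max_l//; last exact: le_trans ai (ltW (ab im)).
  by rewrite /I set_itv1 Rintegral_set1.
- rewrite (arc_length_pieces cp); congr _%:E; rewrite /sigma; apply: eq_big_nat => i /andP[_ im].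
  have [_ bi] := partition_le P01 im.
  by rewrite /clamp min_l ?max_r// ltW// ab.
move=> phi dphi s t s0 st t1.
suff : sigma s - phi (g s) <= sigma t - phi (g t) by lra.
apply: (nondecreasing_pieces (F := fun t => sigma t - phi (g t))) => // i x y im ax xy yb _ _.
suff : I i x - phi (H i x) <= I i y - phi (H i y).
  have xab : a i <= x <= b i by rewrite ax (le_trans xy).
  have yab : a i <= y <= b i by rewrite yb (le_trans ax).
  have [-> _] := gH _ _ im xab; have [-> _] := gH _ _ im yab.
  by have := sigma_piece im xab yab; lra.
have cs := continuous_spd (k := k) (sH i im).
have dI z : z \in `]a i, b i[ -> derivable (I i) z 1 /\ derive1 (I i) z = spd k (H i) z.
  rewrite in_itv/= => /andP[az zb].
  apply: (@continuous_FTC1_closed R (spd k (H i)) (a i) z (b i)) => //; last exact: cs.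
  exact: cont_integrable_itv.
have dG z : z \in `]a i, b i[ -> has_deriv z (fun t => I i t - phi (H i t)) (spd k (H i) z - derive1 (fun s => phi (H i s)) z).
  move=> zi; have [dv dE] := dI z zi.
  have d1 : has_deriv z (I i) (spd k (H i) z) by split; [exact: dv|rewrite -derive1E; exact: dE].
  move: zi; rewrite in_itv/= => /andP[az zb].
  have [|d d2 _] := dphi i z im; first by rewrite !ltW.
  have -> : derive1 (fun s => phi (H i s)) z = d by rewrite derive1E; case: d2.
  exact: is_deriveB.
apply: (ger0_derive1_ndecr (f := fun t => I i t - phi (H i t)) (a := a i) (b := b i)) => //.
- by move=> z /dG[].
- move=> z zi; rewrite derive1E; have [_ ->] := dG z zi; rewrite subr_ge0.
  move: zi; rewrite in_itv/= => /andP[az zb].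
  have [|d d2 ds] := dphi i z im; first by rewrite !ltW.
  by rewrite derive1E; have [_ ->] := d2; apply: ds; rewrite az.
- move=> z; apply: continuousB.
    exact: (parameterized_integral_continuous (ltW (ab im)) (cont_integrable_itv _ _ cs)).
  have cw : {within `[a i, b i], continuous (fun t => phi (H i t))}.
    apply: continuous_in_subspaceT => u; rewrite inE/= in_itv/= => ui.
    by have [d d2 _] := dphi i u im ui; exact: is_derive_continuous d2.
  exact: cw.
Qed.

Lemma surface_curve t : 0 <= t <= 1 -> surface k (g t).
Proof.
by have [_ _ gH] := cp; move=> /(partition_cover P01)[i im tab]; have [] := gH i t im tab.
Qed.

End arc.

(** * Reflections are isometries *)

Section reflection.
Variables (k : R) (p q : pt).
Hypotheses (hk : curvature k) (sp : surface k p) (sq : surface k q) (pq : p <> q).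
Let n := vsub p q.
Let N := sqd k p q.
Let N0 : 0 < N.
Proof.
have [N0 Ns] := sqd_surface hk sp sq.
by rewrite lt_neqAle N0 andbT eq_sym; apply/eqP => /Ns.
Qed.

Definition refl_lin k p q v : pt :=
  let n := vsub p q in let s := 2 * ip k v n * (sqd k p q)^-1 in
  (v.1.1 - s * n.1.1, v.1.2 - s * n.1.2, v.2 - s * n.2).

(* The isometry of the ambient space that exchanges [p] and [q]; it is linear
   unless [k = 0]. *)
Definition refl k p q v : pt :=
  let n := vsub p q in let s := (2 * ip k v n + (ip k q q - ip k p p)) * (sqd k p q)^-1 in
  (v.1.1 - s * n.1.1, v.1.2 - s * n.1.2, v.2 - s * n.2).

Lemma refl_vsub v w : vsub (refl k p q v) (refl k p q w) = refl_lin k p q (vsub v w).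
Proof. by rewrite /refl /refl_lin /vsub /ip /=; move: (_^-1) => i; congr (_, _, _); ring. Qed.

Lemma refl_lin_ip v w : ip k (refl_lin k p q v) (refl_lin k p q w) = ip k v w.
Proof.
have -> : ip k (refl_lin k p q v) (refl_lin k p q w) =
    ip k v w - 4 * ip k v n * ip k w n * N^-1 * (1 - N * N^-1).
  by rewrite /refl_lin /N /sqd /n /vsub /ip /=; move: (_^-1) => i; ring.
by rewrite mulfV ?lt0r_neq0// subrr mulr0 subr0.
Qed.

Lemma refl_sqd v w : sqd k (refl k p q v) (refl k p q w) = sqd k v w.
Proof. by rewrite /sqd refl_vsub refl_lin_ip. Qed.

Lemma refl_inv v : refl k p q (refl k p q v) = v.
Proof.
have Ni : N * N^-1 = 1 by rewrite mulfV// lt0r_neq0.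
pose s := (2 * ip k v n + (ip k q q - ip k p p)) * N^-1.
have sE : (2 * ip k (refl k p q v) n + (ip k q q - ip k p p)) * N^-1 = - s.
  have -> : 2 * ip k (refl k p q v) n + (ip k q q - ip k p p) = s * N * (1 - 2) + (1 - N * N^-1) * (2 * ip k v n + (ip k q q - ip k p p)).
    by rewrite /refl /s /N /sqd /n /vsub /ip /=; move: (_^-1) => i; ring.
  rewrite Ni subrr mul0r addr0 (_ : s * N * (1 - 2) = - s * N); last by move: s N {Ni} => *; ring.
  by rewrite -mulrA Ni mulr1.
rewrite [LHS]/refl -/N -/n sE /refl /= -/N -/n -/s; case: v @s sE => -[v1 v2] v3 s sE /=; congr (_, _, _); ring.
Qed.

Lemma refl_p : refl k p q p = q.
Proof.
have -> : refl k p q p = (p.1.1 - n.1.1, p.1.2 - n.1.2, p.2 - n.2).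
  rewrite /refl -/n -/N (_ : 2 * ip k p n + _ = N); last by rewrite /N /sqd /n /vsub /ip /=; ring.
  by rewrite mulfV ?lt0r_neq0// !mul1r.
by case: (p) (q) @n => -[? ?] ? [[? ?] ?] /=; congr (_, _, _); ring.
Qed.

Lemma refl_q : refl k p q q = p. Proof. by have := refl_inv p; rewrite refl_p. Qed.

(** For k = -1 the upper sheet must be preserved. If the image u were on the lower sheet, - u would
    be on the upper one, and the squared chords from - u to [q] and from [v] to [p] would be
    nonnegative with sum 4 k = -4. *)
Lemma refl_surface v : surface k v -> surface k (refl k p q v).
Proof.
move=> sv; have [k0|k2] := signP hk.
  have p1 : p.2 = 1 by apply: surface0_height; rewrite -k0.
  have q1 : q.2 = 1 by apply: surface0_height; rewrite -k0.
  have v1 : v.2 = 1 by apply: surface0_height; rewrite -k0.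
  by rewrite /surface /refl /vsub /ip /= p1 q1 v1 k0 subrr mulr0 subr0; split; [ring|].
have selfE u : ip k u u = k -> u.2 ^+ 2 + k * (u.1.1 ^+ 2 + u.1.2 ^+ 2) = 1.
  by rewrite /ip => h; rewrite -k2 [in RHS]expr2 -[X in _ = _ * X]h; ring: k2.
have lin : refl k p q v = refl_lin k p q v.
  by rewrite /refl /refl_lin !ip_self// subrr addr0.
have rr : ip k (refl k p q v) (refl k p q v) = k by rewrite lin refl_lin_ip ip_self.
split; first exact: selfE.
move=> k1; have kN : k = -1 by move: hk k2 k1; rewrite !inE => /or3P[] /eqP -> //; rewrite expr0n.
set u := refl k p q v in rr *.
have su : u.2 ^+ 2 + k * (u.1.1 ^+ 2 + u.1.2 ^+ 2) = 1 by exact: selfE.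
rewrite ltNge; apply/negP => u0.
have uq : ip k u q = ip k v p.
  have := refl_sqd v p; rewrite refl_p -/u /sqd => e.
  have h x y : ip k (vsub x y) (vsub x y) = ip k x x - 2 * ip k x y + ip k y y by rewrite /ip /=; ring.
  by move: e; rewrite !h rr !ip_self//; lra.
pose u' : pt := (- u.1.1, - u.1.2, - u.2).
have su' : surface k u'.
  split; first by rewrite /= !sqrrN.
  have u20 : u.2 != 0 by apply/eqP => u2; move: su; rewrite u2 kN; nra.
  by move=> _; change (0 < - u.2); rewrite oppr_gt0 lt_neqAle u0 u20.
have [h1 _] := sqd_surface hk su' sq; have [h2 _] := sqd_surface hk sv sp.
have e1 : sqd k u' q = 2 * k + 2 * ip k u q.
  have -> : 2 * k + 2 * ip k u q = ip k u u + 2 * ip k u q + ip k q q by rewrite rr ip_self//; ring.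
  by rewrite /sqd /ip /=; ring.
have e2 : sqd k v p = 2 * k - 2 * ip k v p.
  have -> : 2 * k - 2 * ip k v p = ip k v v - 2 * ip k v p + ip k p p by rewrite !ip_self//; ring.
  by rewrite /sqd /ip /=; ring.
by move: h1 h2; rewrite e1 e2 uq kN; lra.
Qed.

Let coef (e : R) (c1 c2 c3 : R) f1 f2 f3 := lincomb3 (- (ip k q q - ip k p p) * N^-1 * e)
  (c1 - 2 * n.1.1 * N^-1 * e) (c2 - 2 * n.1.2 * N^-1 * e) (c3 - 2 * k * n.2 * N^-1 * e) f1 f2 f3.

Let reflE1 h : (fun t => (refl k p q (h t)).1.1) = coef n.1.1 1 0 0 (fun t => (h t).1.1) (fun t => (h t).1.2) (fun t => (h t).2).
Proof. by apply/funext => t; rewrite /coef /lincomb3 /refl -/n -/N /ip /=; move: (N^-1) => i; ring. Qed.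
Let reflE2 h : (fun t => (refl k p q (h t)).1.2) = coef n.1.2 0 1 0 (fun t => (h t).1.1) (fun t => (h t).1.2) (fun t => (h t).2).
Proof. by apply/funext => t; rewrite /coef /lincomb3 /refl -/n -/N /ip /=; move: (N^-1) => i; ring. Qed.
Let reflE3 h : (fun t => (refl k p q (h t)).2) = coef n.2 0 0 1 (fun t => (h t).1.1) (fun t => (h t).1.2) (fun t => (h t).2).
Proof. by apply/funext => t; rewrite /coef /lincomb3 /refl -/n -/N /ip /=; move: (N^-1) => i; ring. Qed.

Lemma smooth3_refl h : smooth3 h -> smooth3 (fun t => refl k p q (h t)).
Proof. by case=> s1 s2 s3; split; rewrite ?reflE1 ?reflE2 ?reflE3; exact: smooth_lincomb3. Qed.

Lemma vel_refl h t : smooth3 h -> vel (fun t => refl k p q (h t)) t = refl_lin k p q (vel h t).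
Proof.
move=> [s1 s2 s3].
have d c0 c1 c2 c3 := lincomb3_derive c0 c1 c2 c3 (smooth_is_derive t s1) (smooth_is_derive t s2) (smooth_is_derive t s3).
rewrite /vel reflE1 reflE2 reflE3 /coef /refl_lin -/n -/N /ip /=.
congr (_, _, _); rewrite derive1E; [have [_ ->] := d (- (ip k q q - ip k p p) * N^-1 * n.1.1) (1 - 2 * n.1.1 * N^-1 * n.1.1) (0 - 2 * n.1.2 * N^-1 * n.1.1) (0 - 2 * k * n.2 * N^-1 * n.1.1)|have [_ ->] := d (- (ip k q q - ip k p p) * N^-1 * n.1.2) (0 - 2 * n.1.1 * N^-1 * n.1.2) (1 - 2 * n.1.2 * N^-1 * n.1.2) (0 - 2 * k * n.2 * N^-1 * n.1.2)|have [_ ->] := d (- (ip k q q - ip k p p) * N^-1 * n.2) (0 - 2 * n.1.1 * N^-1 * n.2) (0 - 2 * n.1.2 * N^-1 * n.2) (1 - 2 * k * n.2 * N^-1 * n.2)]; rewrite /n /=; move: (N^-1) => i; ring.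
Qed.

Lemma spd_refl h t : smooth3 h -> spd k (fun t => refl k p q (h t)) t = spd k h t.
Proof. by move=> sh; rewrite /spd vel_refl// refl_lin_ip. Qed.

Lemma curve_pieces_refl g m a b H : curve_pieces k g m a b H ->
  curve_pieces k (fun t => refl k p q (g t)) m a b (fun i t => refl k p q (H i t)).
Proof.
move=> [P01 sH gH]; split => // [i im|i t im tab]; first exact/smooth3_refl/sH.
by have [-> s] := gH i t im tab; split => //; apply: refl_surface; have [<-] := gH i t im tab.
Qed.

Lemma arc_length_refl g : piecewise_smooth k g -> arc_length k (fun t => refl k p q (g t)) = arc_length k g.
Proof.
move=> /piecewise_smoothP[m [a [b [H cp]]]].
have L1 := arc_length_pieces cp.
have L2 := arc_length_pieces (curve_pieces_refl cp).
have [_ sH _] := cp.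
have E : \sum_(0 <= i < m) \int[lam]_(t in `[a i, b i]) spd k (fun t => refl k p q (H i t)) t =
   \sum_(0 <= i < m) \int[lam]_(t in `[a i, b i]) spd k (H i) t.
  apply: eq_big_nat => i /andP[_ im]; apply: eq_Rintegral => t _; rewrite spd_refl//; exact: sH.
by rewrite L1 -E; exact: L2.
Qed.

Lemma piecewise_smooth_refl g : piecewise_smooth k g -> piecewise_smooth k (fun t => refl k p q (g t)).
Proof.
move=> [sg [s ps Hs]]; split; first by move=> t /sg; exact: refl_surface.
exists s => // i im; have [h [h1 h2 h3 gh]] := Hs i im.
have [r1 r2 r3] : smooth3 (fun t => refl k p q (h t)) by apply: smooth3_refl.
by exists (fun t => refl k p q (h t)); split => // t ti; rewrite gh.
Qed.

Let dist_refl_le v w : (dist k (refl k p q v) (refl k p q w) <= dist k v w)%E.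
Proof.
apply: le_ereal_inf => _ [g [pg g0 g1] <-]; exists (fun t => refl k p q (g t)); last exact: arc_length_refl.
by split; [exact: piecewise_smooth_refl|rewrite g0|rewrite g1].
Qed.

Lemma dist_refl v w : dist k (refl k p q v) (refl k p q w) = dist k v w.
Proof.
apply/eqP; rewrite eq_le dist_refl_le /=.
by have := dist_refl_le (refl k p q v) (refl k p q w); rewrite !refl_inv.
Qed.

Lemma refl_isometry : is_isometry k (refl k p q).
Proof.
split; last by move=> v w _ _; exact: dist_refl.
split.
- by move=> v sv; exact: refl_surface.
- by move=> v w _ _ /(congr1 (refl k p q)); rewrite !refl_inv.
- by move=> v sv; exists (refl k p q v); [exact: refl_surface|exact: refl_inv].
Qed.

End reflection.
End smooth_curves.

(** * Regions enclosed by a curve *)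

Section null.
Context {R : realType}.
Notation TR := (measurableTypeR R).

(** The curve is covered by n + 1 squares of side 2 K (b - a) / n, whose total area is of order 1 /
    n. *)
Lemma lipschitz_curve_null (f1 f2 : R -> R) (K a b : R) : a <= b -> 0 <= K ->
  (forall s t, a <= s <= b -> a <= t <= b -> `|f1 s - f1 t| <= K * `|s - t| /\ `|f2 s - f2 t| <= K * `|s - t|) ->
  measurable ((fun t => (f1 t, f2 t)) @` `[a, b] : set (TR * TR)) ->
  lam2 ((fun t => (f1 t, f2 t)) @` `[a, b]) = 0%E.
Proof.
move=> ab K0 lip mI; set I := image _ _ in mI *.
have step (n : nat) : (0 < n)%N -> (lam2 I <= (2 * (2 * K * (b - a)) ^+ 2 / n%:R)%:E)%E.
  move=> n0; have nR : 0 < n%:R :> R by rewrite ltr0n.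
  pose d := (b - a) / n%:R; have d0 : 0 <= d by rewrite divr_ge0 ?subr_ge0// ltW.
  pose t j := a + j%:R * d.
  pose B j : set (TR * TR) := `[f1 (t j) - K * d, f1 (t j) + K * d]%classic `*` `[f2 (t j) - K * d, f2 (t j) + K * d]%classic.
  have mB j : measurable (B j) by exact: measurableX.
  have Kd : 0 <= K * d by rewrite mulr_ge0.
  have lB j : lam2 (B j) = ((2 * K * d) ^+ 2)%:E.
    rewrite /B product_measure1E//= !lebesgue_measure_itv/= !lte_fin.
    have [h|h] := ltP 0 (K * d).
      rewrite !ifT; [|lra|lra]; rewrite -!EFinB -EFinM; congr _%:E; ring.
    have -> : K * d = 0 by apply/eqP; rewrite eq_le h.
    by rewrite !subr0 !addr0 !ltxx mul0e -mulrA (_ : K * d = 0) ?mulr0 ?expr0n//; apply/eqP; rewrite eq_le h.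
  have IB : I `<=` \big[setU/set0]_(j < n.+1) B j.
    move=> _ [s /= + <-]; rewrite in_itv/= => /andP[as_ sb].
    rewrite -(bigcup_mkord n.+1 B).
    have [dz|dp] := leP d 0.
      have {}dz : d = 0 by apply/eqP; rewrite eq_le dz.
      have ba : b = a by move: dz => /eqP; rewrite mulf_eq0 invr_eq0 (gt_eqF nR) orbF subr_eq0 => /eqP.
      have sa : s = a by apply/eqP; rewrite eq_le as_ andbT -ba.
      exists 0%N => //; rewrite /B /t dz mulr0 addr0 mulr0 subr0 addr0 sa; split; rewrite /= in_itv/=.
        by rewrite !lexx.
  by rewrite subr0 addr0 !lexx.
    pose j := Num.truncn ((s - a) / d).
    have q0 : 0 <= (s - a) / d by rewrite divr_ge0// subr_ge0.
    have [j1 j2] : j%:R * d <= s - a /\ s - a < j.+1%:R * d.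
      have /andP[h1 h2] := truncn_itv q0.
      by rewrite -ler_pdivlMr// -ltr_pdivrMr// h1 h2.
    have jn : (j < n.+1)%N.
      rewrite -(@ltr_nat R); apply: (@le_lt_trans _ _ n%:R); last by rewrite ltr_nat.
      rewrite -(ler_pM2r dp); apply: le_trans j1 _; rewrite /d mulrC divfK ?lt0r_neq0//; lra.
    exists j => //; have tj : a <= t j <= b by rewrite /t; apply/andP; split; [rewrite lerDl mulr_ge0|lra].
    have [] := lip s (t j) _ tj; first by rewrite as_.
    have st : `|s - t j| <= d.
      by rewrite ger0_norm /t; [rewrite mulrSr mulrDl mul1r in j2; lra|lra].
    have Kst : K * `|s - t j| <= K * d by rewrite ler_wpM2l.
    move=> h1 h2; have := le_trans h1 Kst; have := le_trans h2 Kst.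
    by rewrite !ler_distl => /andP[? ?] /andP[? ?]; split; rewrite /= in_itv/=; lra.
  have mU : measurable (\big[setU/set0]_(j < n.+1) B j) by apply: bigsetU_measurable.
  apply: (@le_trans _ _ (\sum_(j < n.+1) lam2 (B j))%E).
    apply: le_trans (le_mu_bigsetU lam2 (n := n.+1) (A := B) (fun j _ => mB j)).
    by apply: le_measure; rewrite ?inE.
  rewrite (eq_bigr (fun=> ((2 * K * d) ^+ 2)%:E)) => [|j _]; last exact: lB.
  rewrite sumEFin sumr_const card_ord lee_fin.
  rewrite -mulr_natr /d [X in X <= _](_ : _ = (2 * K * (b - a)) ^+ 2 * n%:R^-1 * (n.+1%:R / n%:R)); last first.
    by field; exact: lt0r_neq0.
  rewrite [X in _ <= X](_ : _ = (2 * K * (b - a)) ^+ 2 * n%:R^-1 * 2); last by ring.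
  apply: ler_wpM2l; first by rewrite divr_ge0 ?sqr_ge0// ltW.
  rewrite ler_pdivrMr// -natrM ler_nat.
  by rewrite mul2n -addnn -addn1 leq_add2l.
apply/eqP; rewrite eq_le measure_ge0 andbT; apply/lee_addgt0Pr => e e0; rewrite add0e.
set C := 2 * (2 * K * (b - a)) ^+ 2 in step.
have C0 : 0 <= C by rewrite mulr_ge0// sqr_ge0.
apply: le_trans (step (Num.truncn (C / e)).+1 _) _ => //.
rewrite lee_fin ler_pdivrMr ?ltr0n// mulrC -ler_pdivrMr// ltW//.
exact: truncnS_gt.
Qed.

End null.

(** * Regions in a chart *)

Section region.
Context {R : realType}.
Notation TR := (measurableTypeR R).
Local Notation pt := (R * R * R)%type.
Implicit Types (T E : set (R * R)) (z w : R * R).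

Lemma convex_gt (r x y t : R) : 0 <= t <= 1 -> r < x -> r < y -> r < x + t * (y - x).
Proof.
move=> /andP[t0 t1] rx ry; have [xy|yx] := leP x y.
  by have := mulr_ge0 t0 (_ : 0 <= y - x); rewrite subr_ge0 => /(_ xy); lra.
have : 0 <= (1 - t) * (x - y) by rewrite mulr_ge0 ?subr_ge0 ?(ltW yx).
by lra.
Qed.

Definition seg z w (t : R) : R * R := (z.1 + t * (w.1 - z.1), z.2 + t * (w.2 - z.2)).

Lemma continuous_seg z w : continuous (seg z w).
Proof. by apply: cont_pair; ccont. Qed.

Lemma constant_offC T E : constant_off T E -> constant_off T (~` E).
Proof.
move=> TE z w zw Ez Ew; apply: Ez; apply: (TE w z) => // t /andP[t0 t1].
have := zw (1 - t); rewrite -[(w.1 + _, _)]/(seg w z t) -[X in ~ T X]/(seg z w (1 - t)).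
have -> : seg z w (1 - t) = seg w z t by rewrite /seg; congr (_, _); ring.
by apply; lra.
Qed.

(** A ball that misses [T] consists of segments from its centre that miss [T]. *)
Lemma open_constant_off T E : closed T -> constant_off T E -> open (E `\` T).
Proof.
move=> cT TE; rewrite openE => z [Ez Tz].
have : nbhs z (~` T) by apply: open_nbhs_nbhs; split => //; exact: closed_openC.
move=> /nbhs_ballP[e /= e0 zT]; apply/nbhs_ballP; exists e => //= w zw; split; last exact: zT.
apply: (TE z w) => // t /andP[t0 t1]; apply: zT; case: zw => /= z1 z2.
have h (x y : R) : `|x - y| < e -> `|x - (x + t * (y - x))| < e.
  move=> xy; apply: le_lt_trans xy; rewrite (_ : x - _ = t * (x - y)); last by ring.
  by rewrite normrM (ger0_norm t0) ler_piMl.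
by split; exact: h.
Qed.

(* The complement of a square is connected by segments through the four half
   planes covering it. *)
Lemma constant_off_exterior T E (r : R) : T `<=` square r -> constant_off T E ->
  (forall z, E z -> square r z) \/ (forall z, ~ E z -> square r z).
Proof.
move=> Tr TE.
have far z w : (r < z.1 /\ r < w.1) \/ (z.1 < - r /\ w.1 < - r) \/ (r < z.2 /\ r < w.2) \/ (z.2 < - r /\ w.2 < - r) ->
    forall F, constant_off T F -> F z -> F w.
  move=> zw F; apply => t t01 /Tr[/=]; rewrite !ler_norml => /andP[h1 h2] /andP[h3 h4].
  case: zw => [[]|[[]|[[]|[]]]] u v.
  - by have := convex_gt t01 u v; lra.
  - by have := convex_gt (x := - z.1) (y := - w.1) (r := r) t01; lra.
  - by have := convex_gt t01 u v; lra.
  - by have := convex_gt (x := - z.2) (y := - w.2) (r := r) t01; lra.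
pose c1 : R * R := (`|r| + 1, `|r| + 1). pose c2 : R * R := (- `|r| - 1, - `|r| - 1).
have rr := ler_norm r; have rN : - r <= `|r| by rewrite -normrN ler_norm.
pose c3 : R * R := (`|r| + 1, - `|r| - 1).
have link F : constant_off T F -> forall z, ~ square r z -> F z -> F c1.
  move=> TF.
  have c31 : F c3 -> F c1 by apply: (far c3 c1) TF; left; rewrite /=; lra.
  have c23 : F c2 -> F c3 by apply: (far c2 c3) TF; right; right; right; rewrite /=; lra.
  move=> z zr Fz.
  have : [\/ r < z.1, z.1 < - r | r < z.2 \/ z.2 < - r].
    have [h1|h1] := ltP r z.1; first by apply: Or31.
    have [h2|h2] := ltP z.1 (- r); first by apply: Or32.
    have [h3|h3] := ltP r z.2; first by apply: Or33; left.
    have [h4|h4] := ltP z.2 (- r); first by apply: Or33; right.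
    by exfalso; apply: zr; rewrite /square /= !ler_norml h1 h2 h3 h4.
  case=> [h|h|[h|h]].
  - by apply: (far z c1) TF Fz; left; rewrite /=; lra.
  - by apply/c31/c23; apply: (far z c2) TF Fz; right; left; rewrite /=; lra.
  - by apply: (far z c1) TF Fz; right; right; left; rewrite /=; lra.
  - by apply/c31/c23; apply: (far z c2) TF Fz; right; right; right; rewrite /=; lra.
have [Ec|Ec] := pselect (E c1); [right|left] => z Ez; apply: contrapT => zr.
  by apply: (link (~` E) (constant_offC TE) z zr Ez).
by apply: Ec; exact: link zr Ez.
Qed.

Variables (k : R) (c : chart k).
Hypotheses (hk : curvature k) (cc : chart_inverse c).

Lemma continuous_emb : continuous (emb c).
Proof.
have [_ cX _ _] := chX c; have [_ cY _ _] := chY c; have [_ cZ _ _] := chZ c.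
by apply: cont_pair => //; apply: cont_pair.
Qed.

Section component.
Variables (C : set pt) (p : pt).
Let D := connected_component (surface k `\` C) p.

Lemma component_connect (S : set (R * R)) z w : connected S -> (forall u, S u -> ~ C (emb c u)) ->
  S z -> S w -> D (emb c z) -> D (emb c w).
Proof.
move=> cS SC Sz Sw Dz; apply: connected_component_trans Dz _.
apply: (@connected_component_max _ _ (emb c @` S)).
- by exists z.
- by move=> _ [u Su <-]; split; [exact: emb_surface|exact: SC].
- by apply: connected_continuous_connected => //; exact: continuous_subspaceT continuous_emb.
- by exists w.
Qed.

Lemma component_constant_off : constant_off (emb c @^-1` C) (emb c @^-1` D).
Proof.
move=> z w zw /=; apply: (@component_connect (seg z w @` `[0, 1])).
- apply: connected_continuous_connected; [exact: segment_connected|exact: continuous_subspaceT (@continuous_seg z w)].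
- by move=> _ [t + <-]; rewrite /= in_itv/=; exact: zw.
- by exists 0; rewrite /= ?in_itv/= ?lexx ?ler01// /seg !mul0r !addr0 -surjective_pairing.
- by exists 1; rewrite /= ?in_itv/= ?lexx ?ler01// /seg !mul1r !subrKC -surjective_pairing.
Qed.
End component.

Variables (g : R -> pt) (m : nat) (a b : nat -> R) (H : nat -> R -> pt).
Hypothesis cp : curve_pieces k g m a b H.
Hypothesis dom : forall t, 0 <= t <= 1 -> 1 + slant k * (g t).2 != 0.
Let T := zt k @` trace g.

Let TE : T = emb c @^-1` trace g.
Proof.
apply/seteqP; split => [_ [x [t t01 <-] <-]|z /= Tz]; last by exists (emb c z); rewrite ?(zt_emb cc).
rewrite /= in_itv/= in t01; rewrite /= (emb_zt cc); [by exists t; rewrite //= in_itv|exact: surface_curve cp _ t01|exact: dom].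
Qed.

Let piece i : set (R * R) := (fun t => ((zt k (H i t)).1, (zt k (H i t)).2)) @` `[a i, b i].

Let T_pieces : T = \big[setU/set0]_(i < m) piece i.
Proof.
have [P01 _ gH] := cp; rewrite -(bigcup_mkord m piece); apply/seteqP; split.
  move=> _ [x [t + <-] <-]; rewrite /= in_itv/= => t01.
  have [i im tab] := partition_cover P01 t01; exists i => //.
  by exists t; [rewrite /= in_itv|have [-> _] := gH i t im tab].
move=> _ [i /= im [t + <-]]; rewrite /= in_itv/= => tab; exists (g t).
  have [a0 b1] := partition_le P01 im; exists t => //; rewrite /= in_itv/=.
  by case/andP: tab => ta tb; rewrite (le_trans a0)// (le_trans tb).
by have [-> _] := gH i t im tab.
Qed.

Let compact_piece i : (i < m)%N -> compact (piece i).
Proof.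
move=> im; have [w [K HK]] := chart_curve_bounds cp dom.
apply: continuous_compact; last exact: segment_compact.
apply: continuous_in_subspaceT => t; rewrite inE/= in_itv/= => tab.
have [[d1 d2] _ _ _ _] := HK i t im tab.
by apply: (cont_pair_at (f := fun t => (zt k (H i t)).1) (h := fun t => (zt k (H i t)).2)); [exact: is_derive_continuous d1|exact: is_derive_continuous d2].
Qed.

Lemma chart_trace_closed : closed T.
Proof.
apply: compact_closed; first exact: norm_hausdorff.
by rewrite T_pieces; apply: bigsetU_compact => i _; exact: compact_piece.
Qed.

Lemma chart_trace_bounded : exists r : R, T `<=` square r.
Proof.
have [w [K HK]] := chart_curve_bounds cp dom.
exists K%:R; rewrite T_pieces -(bigcup_mkord m piece) => _ [i /= im [t + <-]]; rewrite /= in_itv/= => tab.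
by have [_ _ _ ? ?] := HK i t im tab.
Qed.

Lemma chart_trace_null : lam2 (T : set (TR * TR)) = 0%E.
Proof.
have [[[m0 ab] _ _] _ _] := cp.
have [w [K HK]] := chart_curve_bounds cp dom.
have mp i : (i < m)%N -> measurable (piece i : set (TR * TR)).
  move=> im; rewrite -[piece i]setCK; apply: measurableC; apply: open_measurable2; apply: closed_openC.
  by apply: compact_closed; [exact: norm_hausdorff|exact: compact_piece].
have p0 i : (i < m)%N -> lam2 (piece i : set (TR * TR)) = 0%E.
  move=> im; apply: (@lipschitz_curve_null R _ _ K%:R); [exact/ltW/ab|by []| |exact: mp].
  have mv (f df : R -> R) : (forall t, a i <= t <= b i -> has_deriv t f (df t) /\ `|df t| <= K%:R) ->
      forall s t, a i <= s <= b i -> a i <= t <= b i -> `|f s - f t| <= K%:R * `|s - t|.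
    move=> hf; suff wl s t : a i <= s <= b i -> a i <= t <= b i -> s <= t -> `|f s - f t| <= K%:R * `|s - t|.
      move=> s t hs ht; have [st|ts] := leP s t; first exact: wl.
      by rewrite distrC [`|s - t|]distrC; apply: wl => //; exact: ltW.
    move=> hs ht st.
    have dst u : s <= u <= t -> a i <= u <= b i.
      by move=> /andP[su ut]; case/andP: hs ht => hs _ /andP[_ ht]; rewrite (le_trans hs su) (le_trans ut ht).
    have [||u] := @MVT_segment R f df s t st.
    - by move=> u; rewrite in_itv/= => /andP[su ut]; have [|] := hf u; rewrite ?dst// !ltW.
    - apply: continuous_in_subspaceT => u; rewrite inE/= in_itv/= => ui.
      by have [d _] := hf u (dst u ui); exact: is_derive_continuous d.
    rewrite in_itv/= => ui E; rewrite distrC E normrM [`|t - s|]distrC ler_wpM2r//.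
    by have [] := hf u (dst u ui).
  move=> s t hs ht; split.
    by apply: (mv (fun t => (zt k (H i t)).1) (fun t => (w i t).1)) => // u hu; have [[? ?] ? ? ? ?] := HK i u im hu.
  by apply: (mv (fun t => (zt k (H i t)).2) (fun t => (w i t).2)) => // u hu; have [[? ?] ? ? ? ?] := HK i u im hu.
apply/eqP; rewrite eq_le measure_ge0 andbT.
pose piece' i : set (TR * TR) := if (i < m)%N then piece i else set0.
have -> : (T : set (TR * TR)) = \big[setU/set0]_(i < m) piece' i.
  by rewrite T_pieces; apply: eq_bigr => i _; rewrite /piece' ltn_ord.
apply: le_trans (le_mu_bigsetU lam2 _) _ => [i im|]; first by rewrite /piece' im; exact: mp.
rewrite big1// => i _; rewrite /piece' ltn_ord; exact: p0.
Qed.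

Section enclosed.
Variables (B : R) (p : pt).
Let D := connected_component (surface k `\` trace g) p.
Let E0 : set (R * R) := emb c @^-1` D.
Hypothesis Dd : (\int[lam2]_(z in E0) (dens c z)%:E)%E = B%:E.
Hypothesis Dr : (exists r, E0 `<=` square r) \/
  k = 1 /\ (\int[lam2]_z (dens c z)%:E)%E = (4 * pi : R)%:E.

Let offE0 : constant_off T E0.
Proof. rewrite TE; exact: component_constant_off. Qed.

Let E0T z : E0 z -> ~ T z.
Proof. by rewrite TE /E0 => /(@connected_component_sub _ _ _ _)[]. Qed.

Let oE0 : open E0.
Proof.
have -> : E0 = E0 `\` T by apply/seteqP; split => z; [move=> Ez; split => //; exact: E0T|case].
exact: open_constant_off chart_trace_closed offE0.
Qed.

Let mE0 : measurable (E0 : set (TR * TR)). Proof. exact: open_measurable2. Qed.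

(** In the stereographic chart the component may be unbounded. Then its complement is bounded and
    has area 4 pi - B, and F (4 pi - F) does not change under this exchange. The complement contains
    the trace, a null set; this is why [E] and the open set [U] are kept apart. *)
Let region : exists (E U : set (TR * TR)) r, [/\ [/\ measurable E, open (U : set (R * R)) & U `<=` E],
  lam2 (E `\` U) = 0%E, E `<=` square r, constant_off T E &
  let F := \int[lam2]_(z in E) dens c z in F * (4 * pi - k * F) = B * (4 * pi - k * B)].
Proof.
have inner r : E0 `<=` square r -> exists (E U : set (TR * TR)) r, [/\ [/\ measurable E, open (U : set (R * R)) & U `<=` E],
  lam2 (E `\` U) = 0%E, E `<=` square r, constant_off T E &
  let F := \int[lam2]_(z in E) dens c z in F * (4 * pi - k * F) = B * (4 * pi - k * B)].
  move=> Er; exists E0, E0, r; split; [by split; [exact: mE0|exact: oE0|]|by rewrite setDv measure0|exact: Er|exact: offE0|].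
  by rewrite /Rintegral Dd.
case: Dr => [[r]|[k1 D4]]; first exact: inner.
have [r Tr] := chart_trace_bounded; have [h|h] := constant_off_exterior Tr offE0; first exact: (inner r).
exists (~` E0), ((~` E0) `\` T), r; split.
- split; [exact: measurableC|apply: open_constant_off; [exact: chart_trace_closed|exact: constant_offC]|by move=> z []].
- apply/eqP; rewrite eq_le measure_ge0 andbT -chart_trace_null; apply: le_measure; rewrite ?inE.
  + apply: measurableD; [exact: measurableC|apply: measurableD; first exact: measurableC].
    by rewrite -[T]setCK; apply: measurableC; apply: open_measurable2; apply: closed_openC; exact: chart_trace_closed.
  + by rewrite -[T]setCK; apply: measurableC; apply: open_measurable2; apply: closed_openC; exact: chart_trace_closed.
  + by move=> z [Ez nz]; apply: contrapT => nT; apply: nz.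
- exact: h.
- exact: constant_offC.
have : (\int[lam2]_(z in E0) (dens c z)%:E + \int[lam2]_(z in ~` E0) (dens c z)%:E = (4 * pi : R)%:E)%E.
  rewrite -D4 -[in RHS](setUv E0) ge0_integral_setU//.
  - exact: measurableC.
  - by rewrite setUv; apply/measurable_EFinP; exact: (continuous_measurable2 (@dens_cont _ _ c)).
  - by move=> z _; rewrite lee_fin ltW// dens_gt0.
  - by apply/disj_set2P; rewrite setICr.
rewrite Dd /Rintegral; case: integral => [x|//|//]; rewrite -EFinD => -[e] /=.
have -> : x = 4 * pi - B by lra.
rewrite k1; ring.
Qed.

Let L := \sum_(0 <= i < m) \int[lam]_(t in `[a i, b i]) spd k (H i) t.

Lemma isoperimetric_enclosed : B * (4 * pi - k * B) <= L ^+ 2 /\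
  (L ^+ 2 <= B * (4 * pi - k * B) -> conformal_pairs k m a b H).
Proof.
have [E [U [r [[mE oU UE] EU Er TEo]]]] := region; cbv zeta => FB.
split; first by rewrite -FB; exact: (isoperimetric_chart hk cc cp dom mE oU UE EU Er TEo).
by move=> LB; apply: (equality_chart hk cc cp dom mE oU UE EU Er TEo); rewrite FB.
Qed.

End enclosed.
End region.

(** * The isoperimetric inequality on the surface *)

Section isoperimetric.
Context {R : realType}.
Notation TR := (measurableTypeR R).
Local Notation pt := (R * R * R)%type.
Implicit Types (k B : R) (g : R -> pt) (m : nat) (a b : nat -> R) (H : nat -> R -> pt).

Definition pieces_length k m a b H : R := \sum_(0 <= i < m) \int[lam]_(t in `[a i, b i]) spd k (H i) t.

Definition isoperimetric_conclusion k B L m a b H : Prop :=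
  B * (4 * pi - k * B) <= L ^+ 2 /\ (L ^+ 2 <= B * (4 * pi - k * B) -> conformal_pairs k m a b H).

Lemma precompact_bounded (D : set pt) : precompact D ->
  exists r, forall x, D x -> `|x.1.1| <= r /\ `|x.1.2| <= r.
Proof.
case=> U DU [cU _]; have [M [_ HM]] := compact_bounded cU.
exists (M + 1) => x /DU Ux; have := HM (M + 1) _ x Ux; rewrite ltrDl ltr01 => /(_ isT).
by rewrite /= prod_normE ge_max prod_normE ge_max => /andP[/andP[-> ->] _].
Qed.

Lemma area_vertical k (hk : curvature k) (k1 : k != 1) (D : set pt) : D `<=` surface k ->
  area k D = (\int[lam2]_(z in emb (vertical_chart hk k1) @^-1` D) (dens (vertical_chart hk k1) z)%:E)%E.
Proof.
move=> DS; have k0 := curvature_le0 hk k1.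
apply/esym; rewrite /area integral_mkcond [RHS]integral_mkcond; apply: eq_integral => q _.
have kq : k * (q.1 ^+ 2 + q.2 ^+ 2) <= 0 by rewrite mulr_le0_ge0// addr_ge0 ?sqr_ge0.
have hE : (q, Num.sqrt (1 - k * (q.1 ^+ 2 + q.2 ^+ 2))) = emb (vertical_chart hk k1) q by case: q {kq}.
rewrite [RHS]/patch ifT; last by rewrite inE/=; lra.
rewrite /patch.
rewrite hE [\1_D (q, - _)](_ : _ = 0); last first.
  rewrite indicE memNset// => /DS[_ /(_ (elimN eqP k1))] /=.
  by rewrite oppr_gt0 ltNge sqrtr_ge0.
rewrite addr0 indicE; case: ifPn => [/set_mem qD|nq].
  by rewrite mem_set// mul1r.
by rewrite memNset ?mul0r// => h; move/negP: nq; apply; rewrite inE.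
Qed.

Lemma isoperimetric_flat k B g m a b H : curvature k -> k != 1 ->
  curve_pieces k g m a b H -> encloses k (trace g) B -> isoperimetric_conclusion k B (pieces_length k m a b H) m a b H.
Proof.
move=> hk k1 cp [p _ [pD aD]]; set D := connected_component _ _ in pD aD.
have DS : D `<=` surface k by move=> x /(@connected_component_sub _ _ _ _)[].
apply: (@isoperimetric_enclosed R k _ hk (vertical_inverse hk k1) g m a b H cp _ B p).
- by move=> t _; rewrite /slant (negbTE k1) mul0r addr0 oner_eq0.
- by rewrite -aD (area_vertical hk k1 DS).
- left; have [r Hr] := precompact_bounded (pD (elimN eqP k1)).
  by exists r => z /= /Hr.
Qed.

Let sc := stereo_chart (R := R).
Let S : pt := (0, 0, -1).

Lemma surface_S : surface 1 S.
Proof. by split => //=; rewrite sqrrN expr1n expr0n/=; ring. Qed.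

Lemma stereo_total : (\int[lam2]_z (dens sc z)%:E)%E = (4 * pi : R)%:E.
Proof.
have := @integral_quadratic2 R 1 0 1 ltr01; rewrite mulr1 expr0n/= subr0 => /(_ ltr01).
rewrite sqrtr1 divr1 EFinM => <-; rewrite -ge0_integralZl//.
- apply: eq_integral => z _; rewrite -EFinM; congr _%:E.
  rewrite [LHS]/= exprVn.
  by congr (_ * (_ ^+ 2)^-1); ring.
- apply/measurable_EFinP; apply: continuous_measurable2; apply: contV => [|z].
    by ccont.
  by rewrite expf_neq0// lt0r_neq0// mulr0 mul0r mul0r addr0 !mul1r stereo_den_gt0.
- by move=> z _; rewrite lee_fin invr_ge0 sqr_ge0.
Qed.

Lemma trace_closed k g m a b H : curve_pieces k g m a b H -> closed (trace g).
Proof.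
move=> [P01 sH gH]; have -> : trace g = \big[setU/set0]_(i < m) (H i @` `[a i, b i]).
  rewrite -(bigcup_mkord m (fun i => H i @` `[a i, b i])); apply/seteqP; split.
    move=> _ [t + <-]; rewrite /= in_itv/= => t01.
    have [i im tab] := partition_cover P01 t01; exists i => //.
    by exists t; [rewrite /= in_itv|have [-> _] := gH i t im tab].
  move=> _ [i /= im [t + <-]]; rewrite /= in_itv/= => tab; have [<- _] := gH i t im tab.
  have [a0 b1] := partition_le P01 im; exists t => //; rewrite /= in_itv/=.
  by case/andP: tab => ta tb; rewrite (le_trans a0)// (le_trans tb).
apply: compact_closed; first exact: norm_hausdorff.
apply: bigsetU_compact => i _; apply: continuous_compact; last exact: segment_compact.
have [s1 s2 s3] := sH i (ltn_ord i).
have cH : continuous (fun t => ((H i t).1.1, (H i t).1.2, (H i t).2)).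
  apply: cont_pair; first by apply: cont_pair; [exact: smooth_continuous s1|exact: smooth_continuous s2].
    exact: smooth_continuous s3.
have -> : (H i : R -> pt) = fun t => ((H i t).1.1, (H i t).1.2, (H i t).2).
  by apply/funext => t; case: (H i t) => -[].
exact: continuous_subspaceT cH.
Qed.

Lemma component_measurable k (c : chart k) g m a b H p : curve_pieces k g m a b H ->
  measurable (emb c @^-1` connected_component (surface k `\` trace g) p : set (TR * TR)).
Proof.
move=> cp; set D := connected_component _ _; apply: open_measurable2.
have -> : emb c @^-1` D = (emb c @^-1` D) `\` (emb c @^-1` trace g).
  apply/seteqP; split => z; last by case.
  by move=> Dz; split => //; have [] := @connected_component_sub _ _ _ _ Dz.
apply: open_constant_off; last exact: component_constant_off.
have /continuous_closedP := @continuous_emb R k c; apply; exact: trace_closed cp.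
Qed.

Lemma isoperimetric_stereo B g m a b H : (forall t, 0 <= t <= 1 -> g t <> S) ->
  curve_pieces 1 g m a b H -> encloses 1 (trace g) B -> isoperimetric_conclusion 1 B (pieces_length 1 m a b H) m a b H.
Proof.
move=> gS cp [p _ [_ aD]]; set D := connected_component _ _ in aD.
have hk : (1 : R) \in [:: -1; 0; 1] by rewrite !inE eqxx !orbT.
have dom t : 0 <= t <= 1 -> 1 + slant (1 : R) * (g t).2 != 0.
  move=> t01; rewrite /slant eqxx mul1r; apply/eqP => z0; apply: (gS t t01).
  have [] := surface_curve cp t01; rewrite mul1r => + _.
  have z1 : (g t).2 = -1 by lra.
  rewrite z1 sqrrN expr1n => /eqP; rewrite -subr_eq0 addrAC subrr add0r paddr_eq0 ?sqr_ge0// !sqrf_eq0 => /andP[/eqP x0 /eqP y0].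
  exact: pt_eq.
apply: (@isoperimetric_enclosed R 1 _ hk (stereo_inverse (R := R)) g m a b H cp dom B p).
- rewrite -/D; transitivity (area 1 D); last exact: aD.
  rewrite area_stereo; last first.
    exact: component_measurable cp.
  rewrite integral_mkcond; apply: eq_integral => z _; rewrite /patch indicE.
  case: ifPn => [/set_mem zD|nz]; first by rewrite mem_set// mul1r.
  by rewrite memNset ?mul0r// => h; move/negP: nz; apply; rewrite inE.
- by right; split => //; exact: stereo_total.
Qed.

(** Identifies the reflection that exchanges [emb sc c] with the projection centre as an inversion,
    so that [integral_inversion] yields its invariance of area. *)
Lemma refl_inversion (c z : R * R) : z <> c -> refl 1 (emb sc c) S (emb sc z) = emb sc (inversion c z).
Proof.
move=> zc; pose u := (z.1 - c.1) ^+ 2 + (z.2 - c.2) ^+ 2.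
have u0 : 0 < u.
  rewrite lt_neqAle addr_ge0 ?sqr_ge0// andbT eq_sym paddr_eq0 ?sqr_ge0// !sqrf_eq0 !subr_eq0.
  by apply/negP => /andP[/eqP h1 /eqP h2]; apply: zc; case: z c h1 h2 {u} => ? ? [? ?] /= -> ->.
have c0 := stereo_den_gt0 c; have z0 := stereo_den_gt0 z.
set r := 1 + (c.1 ^+ 2 + c.2 ^+ 2) in c0; set d := 1 + (z.1 ^+ 2 + z.2 ^+ 2) in z0.
have iE : 1 + ((inversion c z).1 ^+ 2 + (inversion c z).2 ^+ 2) = r * d * u^-1.
  rewrite /inversion /= -/u -/r.
  transitivity (r + 2 * r * (c.1 * (z.1 - c.1) + c.2 * (z.2 - c.2)) * u^-1 + r ^+ 2 * (u * u^-1) * u^-1).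
    by rewrite /r /u; move: (_^-1) => w; ring.
  have -> : d = u + 2 * (c.1 * (z.1 - c.1) + c.2 * (z.2 - c.2)) + r by rewrite /d /u /r; ring.
  by field; exact: lt0r_neq0.
have nE : sqd 1 (emb sc c) S = 4 * r^-1.
  rewrite /sqd /ip /= -/r.
  transitivity (4 * r^-1 ^+ 2 * r); first by rewrite /r; move: (_^-1) => w; ring.
  by field; exact: lt0r_neq0.
have dE : 2 * ip 1 (emb sc z) (vsub (emb sc c) S) + (ip 1 S S - ip 1 (emb sc c) (emb sc c)) =
    4 * r^-1 * d^-1 * (2 * (z.1 * c.1 + z.2 * c.2) + 2 - d).
  rewrite (ip_self (expr1n _ 2) surface_S) (ip_self (expr1n _ 2) (emb_surface _ _)) subrr addr0 /ip /= -/r -/d.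
  by field; rewrite !lt0r_neq0.
rewrite /refl nE dE.
have -> : 4 * r^-1 * d^-1 * (2 * (z.1 * c.1 + z.2 * c.2) + 2 - d) / (4 * r^-1) = d^-1 * (2 * (z.1 * c.1 + z.2 * c.2) + 2 - d).
  by field; rewrite !lt0r_neq0.
have rE := erefl r; have dE' := erefl d; have uE := erefl u.
rewrite {2}/r in rE; rewrite {2}/d in dE'; rewrite {2}/u in uE.
have du : d = u + 2 * (c.1 * (z.1 - c.1) + c.2 * (z.2 - c.2)) + r by rewrite /d /u /r; ring.
have H1 : r - 1 = c.1 ^+ 2 + c.2 ^+ 2 by rewrite /r; ring.
rewrite /emb /= iE -/r -/d /inversion /= -/u -/r.
have -> : (r * d * u^-1)^-1 = u * r^-1 * d^-1 by field; rewrite !lt0r_neq0.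
congr (_, _, _).
- transitivity (2 * (c.1 * u + (z.1 - c.1) * r) * r^-1 * d^-1); last by field; rewrite !lt0r_neq0.
  transitivity (2 * (z.1 * r - (2 * (z.1 * c.1 + z.2 * c.2) + 2 - d) * c.1) * r^-1 * d^-1); first by field; rewrite !lt0r_neq0.
  by congr (_ * _ * _ * _); rewrite /u /r /d; ring.
- transitivity (2 * (c.2 * u + (z.2 - c.2) * r) * r^-1 * d^-1); last by field; rewrite !lt0r_neq0.
  transitivity (2 * (z.2 * r - (2 * (z.1 * c.1 + z.2 * c.2) + 2 - d) * c.2) * r^-1 * d^-1); first by field; rewrite !lt0r_neq0.
  by congr (_ * _ * _ * _); rewrite /u /r /d; ring.
- transitivity ((2 * r - d * r - 2 * (2 * (z.1 * c.1 + z.2 * c.2) + 2 - d)) * r^-1 * d^-1); first by field; rewrite !lt0r_neq0.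
  transitivity ((2 * u - d * r) * r^-1 * d^-1); last by field; rewrite !lt0r_neq0.
  by congr (_ * _ * _); rewrite /u /r /d; ring.
Qed.

Lemma continuous_refl k (p q : pt) : continuous (refl k p q).
Proof.
rewrite /refl; apply: cont_pair; [apply: cont_pair|]; rewrite /ip /=.
all: have c1 : continuous (fun v : pt => v.1.1) by move=> v; apply: (@continuous_comp _ _ _ fst fst); [exact: cvg_fst|exact: cvg_fst].
all: have c2 : continuous (fun v : pt => v.1.2) by move=> v; apply: (@continuous_comp _ _ _ fst snd); [exact: cvg_fst|exact: cvg_snd].
all: have c3 : continuous (fun v : pt => v.2) by move=> v; exact: cvg_snd.
all: by ccont.
Qed.

Lemma lam2_point (c : TR * TR) : lam2 [set c] = 0%E.
Proof.
rewrite (_ : [set c] = [set c.1] `*` [set c.2]); last first.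
  by apply/seteqP; split => -[x y] /=; [move=> <-|case: c => ? ? /= [-> ->]].
rewrite product_measure1E; [|exact: measurable_set1|exact: measurable_set1].
by rewrite [X in (X * _)%E](_ : _ = 0%E); [rewrite mul0e|exact: lebesgue_measure_set1].
Qed.

(** The reflection is its own continuous inverse, so it matches the components of the two
    complements; areas agree by [integral_inversion]. The chart point [c] of [p], which goes to the
    projection centre, is discarded as a null set. *)
Lemma encloses_refl (p : pt) B g m a b H : curve_pieces 1 g m a b H -> surface 1 p -> p <> S ->
  ~ trace g p -> encloses 1 (trace g) B -> encloses 1 (trace (fun t => refl 1 p S (g t))) B.
Proof.
move=> cp sp pS Tp.
have hk : (1 : R) \in [:: -1; 0; 1] by rewrite !inE eqxx !orbT.
pose r := refl 1 p S; have rr : involutive r by move=> v; exact: (refl_inv hk sp surface_S pS).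
have sr v : surface 1 v -> surface 1 (r v) by exact: (refl_surface hk sp surface_S pS).
have T' : trace (fun t => r (g t)) = r @` trace g by rewrite /trace image_comp.
move=> [x [sx Tx] [_ aD]]; set D := connected_component _ _ in aD.
exists (r x).
  by split; [exact: sr|rewrite T' => -[y Ty /(congr1 r)]; rewrite !rr => yx; apply: Tx; rewrite -yx].
cbv zeta; split; first by [].
set D' := connected_component _ _.
have conn (A A' : set pt) (y : pt) : (forall v, A v -> A' (r v)) -> A y ->
    r @` connected_component A y `<=` connected_component A' (r y).
  move=> AA' Ay; apply: connected_component_max.
  - by exists y => //; exact: connected_component_refl.
  - by move=> _ [v /(@connected_component_sub _ _ _ _)/AA' ? <-].
  - apply: connected_continuous_connected; first exact: component_connected.
    exact: continuous_subspaceT (@continuous_refl 1 p S).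
have D'E : D' = r @` D.
  apply/seteqP; split; last first.
    apply: conn => // v [sv Tv]; split; first exact: sr.
    by rewrite T' => -[y Ty /(can_inj rr) yv]; apply: Tv; rewrite -yv.
  move=> v D'v; exists (r v); last exact: rr.
  rewrite /D -(rr x); apply: (conn (surface 1 `\` trace (fun t => r (g t)))); last by exists v.
  - move=> y [sy Ty]; split; first exact: sr.
    by move=> Try; apply: Ty; rewrite T'; exists (r y) => //; exact: rr.
  - split; first exact: sr.
    by rewrite T' => -[y Ty /(congr1 r)]; rewrite !rr => yx; apply: Tx; rewrite -yx.
pose c := zt 1 p.
have pc : emb sc c = p.
  apply: (emb_zt (stereo_inverse (R := R))) => //; rewrite /slant eqxx mul1r; apply/eqP => z0; apply: pS.
  have [] := sp; rewrite mul1r => + _.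
  have z1 : p.2 = -1 by lra.
  rewrite z1 sqrrN expr1n => /eqP; rewrite -subr_eq0 addrAC subrr add0r paddr_eq0 ?sqr_ge0// !sqrf_eq0 => /andP[/eqP x0 /eqP y0].
  exact: pt_eq.
have cp' := curve_pieces_refl hk sp surface_S pS cp.
have mD := component_measurable sc x cp; have mD' := component_measurable sc (r x) cp'.
have mind (A : set pt) : measurable (emb sc @^-1` A : set (TR * TR)) ->
    measurable_fun setT (fun z : TR * TR => \1_A (emb sc z) : TR).
  move=> mA; rewrite (_ : (fun z => _) = \1_(emb sc @^-1` A)); first exact: measurable_indic.
  by apply/funext => z; rewrite !indicE; congr (nat_of_bool _)%:R; apply/idP/idP; rewrite !inE.
have md : measurable_fun setT (dens sc : TR * TR -> TR) := continuous_measurable2 (@dens_cont _ _ sc).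
have m1 : measurable ([set c] : set (TR * TR)).
  move: (c) => d; rewrite (_ : [set d] = [set d.1] `*` [set d.2]); first by apply: measurableX; exact: measurable_set1.
  by apply/seteqP; split => -[u v] /=; [move=> <-|case: d => ? ? /= [-> ->]].
have offc (F : TR * TR -> TR) : measurable_fun setT F -> (forall z, 0 <= F z) ->
    (\int[lam2]_z (F z)%:E = \int[lam2]_(z in ~` [set c]) (F z)%:E)%E.
  move=> mF F0; rewrite -[in LHS](setUv [set c]) ge0_integral_setU//.
  - rewrite [X in (X + _)%E]null_set_integral ?add0e//; last exact: lam2_point.
    by apply/measurable_EFinP; exact: measurable_funTS.
  - exact: measurableC.
  - by rewrite setUv; apply/measurable_EFinP.
  - by move=> z _; rewrite lee_fin.
  - by apply/disj_set2P; rewrite setICr.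
have d0 z : 0 <= dens sc z by rewrite ltW// dens_gt0.
rewrite area_stereo// offc; last 2 first.
- apply: measurable_funM => //; exact: mind.
- by move=> z; rewrite mulr_ge0// indicE.
transitivity (\int[lam2]_(z in ~` [set c]) (\1_D (emb sc (inversion c z)) * dens sc z)%:E)%E.
  apply: eq_integral => z; rewrite inE /= => zc; congr (_ * _)%:E.
  rewrite -refl_inversion// pc -/(r _) !indicE D'E; congr (nat_of_bool _)%:R.
  apply/idP/idP; rewrite !inE; first by move=> [v Dv <-]; rewrite rr.
  by move=> Dr; exists (r (emb sc z)) => //; exact: rr.
rewrite -aD (area_stereo mD) (@integral_inversion R c (fun z => \1_D (emb sc z))); last 2 first.
- exact: mind.
- by move=> z; rewrite indicE.
rewrite offc//.
- apply: measurable_funM => //; have mi : measurable_fun setT (inversion c : TR * TR -> TR * TR) by exact: measurable_inversion.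
  exact: (measurableT_comp (mind _ mD) mi).
- by move=> z; rewrite mulr_ge0// indicE.
Qed.

Lemma conformal_pairs_refl k (p q : pt) m a b H : curvature k -> surface k p -> surface k q -> p <> q ->
  (forall i, (i < m)%N -> smooth3 (H i)) ->
  conformal_pairs k m a b (fun i t => refl k p q (H i t)) <-> conformal_pairs k m a b H.
Proof.
move=> hk sp sq pq sH.
have E i j s t : (i < m)%N -> (j < m)%N ->
    [/\ spd k (fun t => refl k p q (H i t)) s = spd k (H i) s,
        ip k (vel (fun t => refl k p q (H i t)) s) (vel (fun t => refl k p q (H j t)) t) = ip k (vel (H i) s) (vel (H j) t) &
        ip k (vel (fun t => refl k p q (H i t)) s) (vsub (refl k p q (H i s)) (refl k p q (H j t))) = ip k (vel (H i) s) (vsub (H i s) (H j t)) /\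
        ip k (vel (fun t => refl k p q (H j t)) t) (vsub (refl k p q (H i s)) (refl k p q (H j t))) = ip k (vel (H j) t) (vsub (H i s) (H j t))].
  move=> im jm; rewrite (@vel_refl R k p q (H i) s (sH i im)) (@vel_refl R k p q (H j) t (sH j jm)).
  rewrite refl_vsub !(refl_lin_ip hk sp sq pq); split => //.
  by rewrite (spd_refl hk sp sq pq)//; exact: sH.
have ne i j s t : H i s <> H j t <-> refl k p q (H i s) <> refl k p q (H j t).
  by split => h e; apply: h; [move: e => /(congr1 (refl k p q)); rewrite !(refl_inv hk sp sq pq)|rewrite e].
split => h i j s t im jm si tj st.
  have := h i j s t im jm si tj ((ne i j s t).1 st).
  have [-> -> [-> ->]] := E i j s t im jm; have [-> _ _] := E j i t s jm im.
  by rewrite (refl_sqd hk sp sq pq).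
have := h i j s t im jm si tj ((ne i j s t).2 st).
have [-> -> [-> ->]] := E i j s t im jm; have [-> _ _] := E j i t s jm im.
by rewrite (refl_sqd hk sp sq pq).
Qed.

Theorem isoperimetric k B g m a b H : curvature k ->
  curve_pieces k g m a b H -> encloses k (trace g) B -> isoperimetric_conclusion k B (pieces_length k m a b H) m a b H.
Proof.
move=> hk cp eB; have [k1|k1] := eqVneq k 1; last exact: isoperimetric_flat cp eB.
(* [encloses] supplies a point [p] off the curve; exchanging it with [S] takes the curve off the
   projection centre. *)
rewrite k1 in hk cp eB *; have [p [sp Tp] _] := eB.
have [pS|pS] := pselect (p = S).
  apply: (isoperimetric_stereo _ cp eB) => t t01 gt; apply: Tp; rewrite pS -gt; exists t => //.
have cp' := curve_pieces_refl hk sp surface_S pS cp.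
have eB' := encloses_refl cp sp pS Tp eB.
have [_ sH _] := cp.
have LE : pieces_length 1 m a b (fun i t => refl 1 p S (H i t)) = pieces_length 1 m a b H.
  apply: eq_big_nat => i /andP[_ im]; apply: eq_Rintegral => t _.
  by rewrite (spd_refl hk sp surface_S pS)//; exact: sH.
have rS t : 0 <= t <= 1 -> refl 1 p S (g t) <> S.
  move=> t01 /(congr1 (refl 1 p S)); rewrite (refl_inv hk sp surface_S pS) (refl_q hk sp surface_S pS) => gt.
  by apply: Tp; rewrite -gt; exists t => //; rewrite /= in_itv.
have := isoperimetric_stereo rS cp' eB'.
by rewrite LE => -[h1 h2]; split; [exact: h1|move=> /h2/(conformal_pairs_refl a b hk sp surface_S pS sH)].
Qed.

End isoperimetric.

(** * Equality forces a circle *)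

Section loop.
Context {R : realType}.

(** The mean of the values at 0 and at 1/2 is taken on both halves of [0, 1], by the intermediate
    value theorem. *)
Lemma loop_not_injective (phi : R -> R) : continuous phi -> phi 0 = phi 1 ->
  exists s t, [/\ 0 <= s, s < t, t < 1 & phi s = phi t].
Proof.
move=> cphi p01; have [e|ne] := eqVneq (phi (2^-1)) (phi 0).
  by exists 0, 2^-1; split => //; rewrite invf_lt1//; lra.
have h0 : 0 <= 2^-1 :> R by rewrite invr_ge0.
have h1 : 2^-1 <= 1 :> R by rewrite invf_le1//; lra.
pose v := (phi 0 + phi 2^-1) / 2.
have vi : Num.min (phi 0) (phi 2^-1) <= v <= Num.max (phi 0) (phi 2^-1).
  by rewrite /v; case: (ltgtP (phi 0) (phi 2^-1)) ne => // h _; lra.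
have [s si sv] := @IVT R phi 0 2^-1 v h0 (continuous_subspaceT cphi) vi.
have [|t ti tv] := @IVT R phi 2^-1 1 v h1 (continuous_subspaceT cphi).
  by rewrite -p01 minC maxC.
move: si ti; rewrite !in_itv/= => /andP[s0 s1] /andP[t0 t1].
have vn : v != phi 2^-1 by rewrite /v; apply/eqP => e; move/eqP: ne; apply; lra.
have vn0 : v != phi 0 by rewrite /v; apply/eqP => e; move/eqP: ne; apply; lra.
have sn : s != 2^-1 by apply/eqP => e; move/eqP: vn; apply; rewrite -sv e.
have tn : t != 2^-1 by apply/eqP => e; move/eqP: vn; apply; rewrite -tv e.
have tn1 : t != 1 by apply/eqP => e; move/eqP: vn0; apply; rewrite -tv e.
exists s, t; split => //; last by rewrite sv tv.
- by apply: (@lt_trans _ _ 2^-1); rewrite lt_neqAle ?sn// eq_sym tn.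
- by rewrite lt_neqAle tn1.
Qed.

(** The quotient is the cotangent of half the angle from (X, Y): the stereographic coordinate of the
    circle projected from (X, Y). *)
Lemma chord_parameter_inj (X Y e1 e2 f1 f2 : R) : X ^+ 2 + Y ^+ 2 = 1 -> e1 ^+ 2 + e2 ^+ 2 = 1 -> f1 ^+ 2 + f2 ^+ 2 = 1 ->
  (e1, e2) <> (X, Y) -> (f1, f2) <> (X, Y) ->
  (e2 * X - e1 * Y) / (1 - (e1 * X + e2 * Y)) = (f2 * X - f1 * Y) / (1 - (f1 * X + f2 * Y)) -> (e1, e2) = (f1, f2).
Proof.
move=> hX he hf ne nf.
have pos (a b : R) : a ^+ 2 + b ^+ 2 = 1 -> (a, b) <> (X, Y) -> 0 < 1 - (a * X + b * Y).
  move=> hab nab; have -> : 1 - (a * X + b * Y) = ((a - X) ^+ 2 + (b - Y) ^+ 2) / 2 by lra.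
  rewrite divr_gt0// lt_neqAle addr_ge0 ?sqr_ge0// andbT eq_sym paddr_eq0 ?sqr_ge0// !sqrf_eq0 !subr_eq0.
  by apply/negP => /andP[/eqP h1 /eqP h2]; apply: nab; rewrite h1 h2.
have pe := pos _ _ he ne; have pf := pos _ _ hf nf.
set ce := e1 * X + e2 * Y in pe *; set cf := f1 * X + f2 * Y in pf *.
set se := e2 * X - e1 * Y; set sf := f2 * X - f1 * Y.
have Ee : ce ^+ 2 + se ^+ 2 = 1.
  rewrite (_ : ce ^+ 2 + se ^+ 2 = (e1 ^+ 2 + e2 ^+ 2) * (X ^+ 2 + Y ^+ 2)); last by rewrite /ce /se; ring.
  by rewrite he hX mulr1.
have Ef : cf ^+ 2 + sf ^+ 2 = 1.
  rewrite (_ : cf ^+ 2 + sf ^+ 2 = (f1 ^+ 2 + f2 ^+ 2) * (X ^+ 2 + Y ^+ 2)); last by rewrite /cf /sf; ring.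
  by rewrite hf hX mulr1.
set tau := se / _ => tE.
have se_ : se = tau * (1 - ce) by rewrite /tau divfK// lt0r_neq0.
have sf_ : sf = tau * (1 - cf) by rewrite tE divfK// lt0r_neq0.
have te : 1 + ce = tau ^+ 2 * (1 - ce).
  by apply: (mulIf (lt0r_neq0 pe)); move: Ee; rewrite se_ exprMn; lra.
have tf : 1 + cf = tau ^+ 2 * (1 - cf).
  by apply: (mulIf (lt0r_neq0 pf)); move: Ef; rewrite sf_ exprMn; lra.
have cc : ce = cf.
  have t1 : 0 < 1 + tau ^+ 2 by rewrite ltr_pwDl// sqr_ge0.
  by apply: (mulIf (lt0r_neq0 t1)); lra.
have ss : se = sf by rewrite se_ sf_ cc.
have r1 (c s a b : R) : c = a * X + b * Y -> s = b * X - a * Y -> a = c * X - s * Y.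
  by move=> -> ->; rewrite -[LHS]mulr1 -hX; ring.
have r2 (c s a b : R) : c = a * X + b * Y -> s = b * X - a * Y -> b = c * Y + s * X.
  by move=> -> ->; rewrite -[LHS]mulr1 -hX; ring.
by rewrite (r1 ce se e1 e2)// (r2 ce se e1 e2)// (r1 cf sf f1 f2)// (r2 cf sf f1 f2)// cc ss.
Qed.

(* A continuous loop in the unit circle without self-intersection is onto: otherwise
   the stereographic coordinate from a missed point maps it injectively to a line. *)
Lemma circle_loop_onto (e1 e2 : R -> R) : continuous e1 -> continuous e2 ->
  (forall t, 0 <= t <= 1 -> e1 t ^+ 2 + e2 t ^+ 2 = 1) -> e1 0 = e1 1 -> e2 0 = e2 1 ->
  (forall s t, 0 <= s -> s < t -> t < 1 -> (e1 s, e2 s) <> (e1 t, e2 t)) ->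
  forall X Y, X ^+ 2 + Y ^+ 2 = 1 -> exists2 t, 0 <= t <= 1 & (e1 t, e2 t) = (X, Y).
Proof.
move=> c1 c2 he h1 h2 inj X Y hX; apply: contrapT => no.
have miss t : 0 <= t <= 1 -> (e1 t, e2 t) <> (X, Y) by move=> t01 h; apply: no; exists t.
pose cl := clamp (0 : R) 1.
have clin t : 0 <= cl t <= 1 by exact: clamp_in.
have ce1 : continuous (fun t => e1 (cl t)) by apply: (cont_at (f := e1)) => //; exact: continuous_clamp.
have ce2 : continuous (fun t => e2 (cl t)) by apply: (cont_at (f := e2)) => //; exact: continuous_clamp.
pose psi t := (e2 (cl t) * X - e1 (cl t) * Y) / (1 - (e1 (cl t) * X + e2 (cl t) * Y)).
have cpsi : continuous psi.
  apply: contM; first by ccont.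
  apply: contV => [|t]; first by ccont.
  have -> : 1 - (e1 (cl t) * X + e2 (cl t) * Y) = ((e1 (cl t) - X) ^+ 2 + (e2 (cl t) - Y) ^+ 2) / 2 by have := he _ (clin t); lra.
  rewrite mulf_neq0// ?invr_eq0 ?pnatr_eq0// paddr_eq0 ?sqr_ge0// !sqrf_eq0 !subr_eq0.
  by apply/negP => /andP[/eqP k1 /eqP k2]; apply: (miss _ (clin t)); rewrite k1 k2.
have cl0 : cl 0 = 0 by rewrite /cl clamp_id// lexx ler01.
have cl1 : cl 1 = 1 by rewrite /cl clamp_id// lexx ler01.
have [|s [t [s0 st t1]]] := loop_not_injective cpsi; first by rewrite /psi cl0 cl1 h1 h2.
have clt : cl t = t by rewrite /cl clamp_id// ltW ?ltW//; exact: le_lt_trans s0 st.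
have cls : cl s = s by rewrite /cl clamp_id// s0 ltW// (lt_trans st).
rewrite /psi clt cls => /chord_parameter_inj E; apply: (inj s t) => //; apply: E => //.
- by apply: he; rewrite s0 ltW// (lt_trans st).
- by apply: he; rewrite ltW ?ltW//; exact: le_lt_trans s0 st.
- by apply: miss; rewrite s0 ltW// (lt_trans st).
- by apply: miss; rewrite ltW ?ltW//; exact: le_lt_trans s0 st.
Qed.

Lemma near_is_derive_unique (f h : R -> R) (t d e : R) : has_deriv t f d ->
  has_deriv t h e -> (\forall s \near t, f s = h s) -> d = e.
Proof.
move=> df dh /near_eq_derive1; rewrite !derive1E.
by have [_ ->] := df; have [_ ->] := dh.
Qed.

Lemma is_derive_acos_comp (f : R -> R) (t d : R) : -1 < f t < 1 -> has_deriv t f d ->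
  has_deriv t (fun s => acos (f s)) (- d / Num.sqrt (1 - f t ^+ 2)).
Proof.
move=> ft df; have da := is_derive1_acos ft.
have D := der_comp da df; apply: (der_ext D) => //; ring.
Qed.

End loop.

Section circle.
Context {R : realType}.
Local Notation pt := (R * R * R)%type.
Variables (k : R) (g : R -> pt) (m : nat) (a b : nat -> R) (H : nat -> R -> pt).
Hypothesis cp : curve_pieces k g m a b H.

(* Going from [g 0] to its antipode and back takes at least twice the half
   circumference; [acos] is made smooth by shrinking its argument. *)
Lemma circle_loop_length (e1 e2 : pt -> R) (c L : R) : 0 < c ->
  (forall i t, (i < m)%N -> a i <= t <= b i -> exists d1 d2,
    [/\ has_deriv t (fun s => e1 (H i s)) d1, has_deriv t (fun s => e2 (H i s)) d2 &
        (a i < t < b i -> d1 ^+ 2 + d2 ^+ 2 <= c ^+ 2 * spd k (H i) t ^+ 2)]) ->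
  (forall t, 0 <= t <= 1 -> e1 (g t) ^+ 2 + e2 (g t) ^+ 2 = 1) -> g 0 = g 1 ->
  (exists2 t, 0 <= t <= 1 & e1 (g t) = - e1 (g 0) /\ e2 (g t) = - e2 (g 0)) ->
  arc_length k g = L%:E -> 2 * pi <= c * L.
Proof.
move=> c0 de he g01 [t1 /andP[t10 t11] [E1 E2]] gL.
have [sigma [s0 sL bound]] := arc_function cp.
have {gL} LE : sigma 1 = L by move: gL; rewrite sL => -[].
set X := e1 (g 0) in E1; set Y := e2 (g 0) in E2.
have hX : X ^+ 2 + Y ^+ 2 = 1 by apply: he; rewrite lexx ler01.
have main d : 0 < d < 1 -> 2 * (pi - 2 * acos (1 - d)) <= c * L.
  move=> /andP[d0 d1].
  pose f (x : pt) := (1 - d) * (e1 x * X + e2 x * Y).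
  have fb x : e1 x ^+ 2 + e2 x ^+ 2 = 1 -> -1 < f x < 1 /\ f x ^+ 2 = (1 - d) ^+ 2 * (1 - (e2 x * X - e1 x * Y) ^+ 2).
    move=> hx; have E : (e1 x * X + e2 x * Y) ^+ 2 + (e2 x * X - e1 x * Y) ^+ 2 = 1.
      rewrite (_ : _ + _ = (e1 x ^+ 2 + e2 x ^+ 2) * (X ^+ 2 + Y ^+ 2)); last by ring.
      by rewrite hx hX mulr1.
    have fE : f x ^+ 2 = (1 - d) ^+ 2 * (1 - (e2 x * X - e1 x * Y) ^+ 2) by rewrite /f exprMn -E addrK.
    split => //; have : f x ^+ 2 < 1.
      rewrite fE; apply: (@le_lt_trans _ _ ((1 - d) ^+ 2)); last by nra.
      by rewrite ler_piMr ?sqr_ge0// gerBl sqr_ge0.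
    by move=> h; apply/andP; split; nra.
  (* The sign e = 1 serves the way out to the antipode, e = -1 the way back. *)
  have step (e : R) : e ^+ 2 = 1 -> forall s t, 0 <= s -> s <= t -> t <= 1 ->
      e / c * acos (f (g t)) - e / c * acos (f (g s)) <= sigma t - sigma s.
    move=> e1_; apply: (bound (fun x => e / c * acos (f x))) => i t im tab.
    have [d1_ [d2_ [D1 D2 Dle]]] := de i t im tab.
    have [_ _ gH] := cp; have [gHt _] := gH i t im tab.
    have [a0 b1] := partition_le (let: And3 P _ _ := cp in P) im.
    have t01 : 0 <= t <= 1 by case/andP: tab => ta tb; rewrite (le_trans a0)// (le_trans tb).
    have hx : e1 (H i t) ^+ 2 + e2 (H i t) ^+ 2 = 1 by rewrite -gHt; exact: he.
    have [fi fE] := fb _ hx.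
    have Df : has_deriv t (fun s => f (H i s)) ((1 - d) * (d1_ * X + d2_ * Y)).
      by rewrite /f; derive_ring.
    have Da := is_derive_acos_comp (f := fun s => f (H i s)) fi Df.
    pose N := Num.sqrt (1 - f (H i t) ^+ 2).
    have fl : 0 < 1 - f (H i t) ^+ 2 by move: fi => /andP[? ?]; nra.
    have N0 : 0 < N by rewrite sqrtr_gt0.
    have N2 : N ^+ 2 = 1 - f (H i t) ^+ 2 by rewrite sqr_sqrtr// ltW.
    exists (e / c * (- ((1 - d) * (d1_ * X + d2_ * Y)) / N)).
      by derive_ring.
    move=> tin; have spd0 : 0 <= spd k (H i) t by rewrite sqrtr_ge0.
    (* The velocity is orthogonal to the radius, so its component along (X, Y) carries the
       factor e2 X - e1 Y. *)
    have orth : e1 (H i t) * d1_ + e2 (H i t) * d2_ = 0.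
      pose F s := e1 (H i s) ^+ 2 + e2 (H i s) ^+ 2.
      have DF : has_deriv t F (2 * (e1 (H i t) * d1_ + e2 (H i t) * d2_)).
        by rewrite /F; derive_ring.
      have : derive1 F t = derive1 (fun=> 1 : R) t.
        apply: near_eq_derive1.
        have : \forall s \near t, s \in `]a i, b i[ by apply: near_in_itvoo; rewrite in_itv/=.
        apply: filterS => s; rewrite in_itv/= => /andP[sa sb].
        have sab : a i <= s <= b i by rewrite !ltW.
        rewrite /F; have [<- _] := gH i s im sab; apply: he.
        by rewrite (le_trans a0 (ltW sa)) (le_trans (ltW sb) b1).
      have -> : derive1 F t = 2 * (e1 (H i t) * d1_ + e2 (H i t) * d2_) by rewrite derive1E; have [_ ->] := DF.
      rewrite derive1E derive_cst => /eqP; rewrite mulf_eq0 pnatr_eq0/= => /eqP; exact.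
    pose la := e1 (H i t) * d2_ - e2 (H i t) * d1_.
    have d1E : d1_ = - la * e2 (H i t).
      have -> : - la * e2 (H i t) = (e1 (H i t) ^+ 2 + e2 (H i t) ^+ 2) * d1_ - e1 (H i t) * (e1 (H i t) * d1_ + e2 (H i t) * d2_) by rewrite /la; ring.
      by rewrite hx orth; ring.
    have d2E : d2_ = la * e1 (H i t).
      have -> : la * e1 (H i t) = (e1 (H i t) ^+ 2 + e2 (H i t) ^+ 2) * d2_ - e2 (H i t) * (e1 (H i t) * d1_ + e2 (H i t) * d2_) by rewrite /la; ring.
      by rewrite hx orth; ring.
    have laE : la ^+ 2 <= c ^+ 2 * spd k (H i) t ^+ 2.
      apply: le_trans (Dle tin); rewrite [X in _ <= X](_ : _ = (e1 (H i t) ^+ 2 + e2 (H i t) ^+ 2) * la ^+ 2); first by rewrite hx mul1r.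
      by rewrite [in LHS]d1E [in LHS]d2E; ring.
    pose w := e2 (H i t) * X - e1 (H i t) * Y.
    have vE : d1_ * X + d2_ * Y = - (la * w) by rewrite d1E d2E /w; ring.
    have sq : (e / c * (- ((1 - d) * (d1_ * X + d2_ * Y)) / N)) ^+ 2 <= spd k (H i) t ^+ 2.
      rewrite vE (_ : _ ^+ 2 = e ^+ 2 * la ^+ 2 * ((1 - d) ^+ 2 * w ^+ 2) / (c ^+ 2 * N ^+ 2)); last first.
        by field; rewrite !lt0r_neq0.
      rewrite e1_ mul1r ler_pdivrMr ?mulr_gt0 ?exprn_gt0//.
      rewrite (_ : _ * (c ^+ 2 * N ^+ 2) = (c ^+ 2 * spd k (H i) t ^+ 2) * N ^+ 2); last by ring.
      apply: ler_pM => //; [exact: sqr_ge0|by apply: mulr_ge0; exact: sqr_ge0|].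
      rewrite N2 fE -/w; have : 0 <= 1 - (1 - d) ^+ 2 by nra.
      lra.
    by rewrite leNgt; apply/negP => hlt; move: sq; rewrite leNgt => /negP; apply; rewrite ltrXn2r// ?nnegrE// ltW// (le_lt_trans spd0).
  have g1E : f (g 0) = 1 - d by rewrite /f -/X -/Y -!expr2 hX mulr1.
  have gt1 : f (g t1) = - (1 - d).
    by rewrite /f E1 E2 -[RHS]mulr1 -hX; ring.
  have I1 : -1 <= 1 - d <= 1 by lra.
  have S1 := step 1 (expr1n _ 2) 0 t1 (lexx 0) t10 t11.
  have S2 := step (-1) (etrans (sqrrN 1) (expr1n _ 2)) t1 1 t10 t11 (lexx 1).
  rewrite -g01 in S2; rewrite g1E gt1 acosN// in S1 S2.
  rewrite s0 in S1; rewrite LE in S2.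
  have : 2 / c * (pi - 2 * acos (1 - d)) <= L.
    have -> : 2 / c * (pi - 2 * acos (1 - d)) = (1 / c * (pi - acos (1 - d)) - 1 / c * acos (1 - d)) + (-1 / c * acos (1 - d) - -1 / c * (pi - acos (1 - d))).
      by ring.
    lra.
  by rewrite -(ler_pM2l c0); congr (_ <= _); field; exact: lt0r_neq0.
(* If the claim failed, [th] would be a positive lower bound of acos (1 - d) for all d in ]0, 1[;
   the choice d = (1 - cos th) / 4 contradicts it. *)
rewrite leNgt; apply/negP => hlt; pose th := (2 * pi - c * L) / 4.
have th0 : 0 < th by rewrite /th divr_gt0//; lra.
have key d : 0 < d < 1 -> th <= acos (1 - d) by move=> /main; rewrite /th; lra.
have thpi : th <= pi.
  apply: le_trans (key 2^-1 _) (acos_lepi _); first by rewrite invr_gt0 invf_lt1//; lra.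
  by lra.
have ci : th \in `[0, pi] by rewrite in_itv/= (ltW th0).
have z0 : (0 : R) \in `[0, pi] by rewrite in_itv/= lexx pi_ge0.
have c1 : cos th < 1 by rewrite -cos0 ltr_cos.
have cm : -1 <= cos th by exact: cos_geN1.
have d01 : 0 < (1 - cos th) / 4 < 1 by lra.
have I1 : -1 <= 1 - (1 - cos th) / 4 <= 1 by lra.
have := key _ d01.
have ai : acos (1 - (1 - cos th) / 4) \in `[0, pi] by rewrite in_itv/= acos_ge0// acos_lepi.
by rewrite leNgt -ltr_cos// acosK ?in_itv//= -leNgt; lra.
Qed.

End circle.

(** * The extremal curve is a plane section *)

Section equality.
Context {R : realType}.
Local Notation pt := (R * R * R)%type.
Implicit Types (k : R) (g : R -> pt).

Definition north : pt := (0, 0, 1).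

Lemma surface_north k : surface k north.
Proof. by split; rewrite /= ?expr0n /= ?expr1n; [ring|]. Qed.

Lemma north_coords k (x : pt) : curvature k -> surface k x ->
  x.2 = 1 - k * sqd k x north / 2 /\
  x.1.1 ^+ 2 + x.1.2 ^+ 2 = sqd k x north - k * sqd k x north ^+ 2 / 4.
Proof.
move=> hk sx; have [k0|k2] := signP hk.
  have x1 : x.2 = 1 by apply: surface0_height; rewrite -k0.
  by rewrite /sqd /ip /= k0 x1; split; ring.
have [e _] := sx.
have zE : x.2 = 1 - k * sqd k x north / 2.
  rewrite /sqd /ip /= !subr0 -!expr2.
  have -> : k * (x.1.1 ^+ 2 + x.1.2 ^+ 2 + k * (x.2 - 1) ^+ 2) = 1 - x.2 ^+ 2 + k ^+ 2 * (x.2 - 1) ^+ 2 by rewrite -e; ring.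
  by rewrite k2; field.
split => //.
have kM : k * (x.1.1 ^+ 2 + x.1.2 ^+ 2) = k * (sqd k x north - k * sqd k x north ^+ 2 / 4).
  transitivity (1 - x.2 ^+ 2); first by rewrite -e; ring.
  rewrite zE (_ : 1 - _ = k * sqd k x north - k ^+ 2 * sqd k x north ^+ 2 / 4); first by ring.
  by field.
have k0 : k != 0 by apply/eqP => k0; move: k2; rewrite k0 expr0n => /eqP; rewrite eq_sym oner_eq0.
exact: (mulfI k0).
Qed.

Section at_north.
Variables (k : R) (g : R -> pt) (m : nat) (a b : nat -> R) (H : nat -> R -> pt).
Hypotheses (hk : curvature k) (cp : curve_pieces k g m a b H).
Hypotheses (gl : g 0 = g 1) (inj : {in `[0, 1[ &, injective g}).
Variables (w1 w2 q : R).
Hypotheses (w12 : w1 ^+ 2 + w2 ^+ 2 = 1).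
Hypothesis section_eq : forall t, 0 <= t <= 1 ->
  w1 * (g t).1.2 - w2 * (g t).1.1 = q * sqd k (g t) north.

Let kap := k + 4 * q ^+ 2.
Let nu (x : pt) := sqd k x north.
Let be (x : pt) := w1 * x.1.1 + w2 * x.1.2.
Let ga (x : pt) := w1 * x.1.2 - w2 * x.1.1.

Let nu_ge0 x : surface k x -> 0 <= nu x.
Proof. by move=> sx; have [] := sqd_surface hk sx (surface_north k). Qed.

Let bega x : surface k x -> be x ^+ 2 + ga x ^+ 2 = nu x - k * nu x ^+ 2 / 4.
Proof.
move=> sx; have [_ <-] := north_coords hk sx; rewrite /be /ga -[RHS]mul1r -w12; ring.
Qed.

Let be_kap x : surface k x -> ga x = q * nu x -> be x ^+ 2 = nu x - kap * nu x ^+ 2 / 4.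
Proof. by move=> /bega + gx; rewrite gx /kap => h; rewrite -[LHS](addrK ((q * nu x) ^+ 2)) h; field. Qed.

Let sg t : 0 <= t <= 1 -> surface k (g t). Proof. exact: surface_curve cp t. Qed.
Let gaE t : 0 <= t <= 1 -> ga (g t) = q * nu (g t). Proof. exact: section_eq. Qed.

Let determined x y : surface k x -> surface k y -> be x = be y -> ga x = ga y -> nu x = nu y -> x = y.
Proof.
move=> sx sy eb eg en.
have r1 z : z.1.1 = w1 * be z - w2 * ga z by rewrite /be /ga -[LHS]mul1r -w12; ring.
have r2 z : z.1.2 = w2 * be z + w1 * ga z by rewrite /be /ga -[LHS]mul1r -w12; ring.
apply: pt_eq; rewrite ?(r1 x) ?(r1 y) ?(r2 x) ?(r2 y) ?eb ?eg//.
by have [-> _] := north_coords hk sx; have [-> _] := north_coords hk sy; rewrite -!/(nu _) en.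
Qed.

Let noloop s t : 0 <= s -> s < t -> t < 1 -> g s <> g t.
Proof.
move=> s0 st t1 gst; have := inj (x := s) (y := t); rewrite !in_itv/= s0 t1 (lt_trans st t1) (le_trans s0 (ltW st)).
by move=> /(_ isT isT gst) e; move: st; rewrite e ltxx.
Qed.

Let cbe : continuous be.
Proof. by have [? ? ?] := @continuous_coords R; rewrite /be; ccont. Qed.

Let cnu : continuous nu.
Proof. by have [? ? ?] := @continuous_coords R; rewrite /nu /sqd /ip /=; ccont. Qed.

(* Otherwise the abscissa [be] would be injective on the plane section. *)
Lemma kap_gt0 : 0 < kap.
Proof.
rewrite ltNge; apply/negP => kap0.
have [phi cphi phiE] := curve_continuous cp cbe.
have i0 : 0 <= (0 : R) <= 1 by rewrite lexx ler01.
have i1 : 0 <= (1 : R) <= 1 by rewrite lexx ler01.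
have [|s [t [s0 st t1 e]]] := loop_not_injective cphi; first by rewrite !phiE// gl.
have s01 : 0 <= s <= 1 by rewrite s0 ltW// (lt_trans st).
have t01 : 0 <= t <= 1 by rewrite (le_trans s0 (ltW st)) ltW.
rewrite !phiE// in e; apply: (noloop s0 st t1).
have nn : nu (g s) = nu (g t).
  have e2 : nu (g s) - kap * nu (g s) ^+ 2 / 4 = nu (g t) - kap * nu (g t) ^+ 2 / 4.
    by rewrite -(be_kap (sg s01) (gaE s01)) -(be_kap (sg t01) (gaE t01)) e.
  have ns := nu_ge0 (sg s01); have nt := nu_ge0 (sg t01).
  apply/eqP; rewrite -subr_eq0; apply/eqP.
  have : (nu (g s) - nu (g t)) * (1 - kap * (nu (g s) + nu (g t)) / 4) = 0 by move: e2 => /eqP; rewrite -subr_eq0 => /eqP <-; field.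
  move=> /eqP; rewrite mulf_eq0 => /orP[/eqP //|/eqP h]; exfalso.
  have : 0 <= - kap * (nu (g s) + nu (g t)) by apply: mulr_ge0; [rewrite oppr_ge0|exact: addr_ge0].
  lra.
by apply: determined; [exact: sg|exact: sg|exact: e|rewrite !gaE// nn|exact: nn].
Qed.

Let sk := Num.sqrt kap.
Let sk0 : 0 < sk. Proof. by rewrite sqrtr_gt0 kap_gt0. Qed.
Let sk2 : sk ^+ 2 = kap. Proof. by rewrite sqr_sqrtr// ltW// kap_gt0. Qed.
Let sgn : R := if 0 <= q then 1 else -1.
Let sgn2 : sgn ^+ 2 = 1. Proof. by rewrite /sgn; case: ifP; rewrite ?sqrrN expr1n. Qed.
Let sgnq : sgn * q = `|q|.
Proof. by rewrite /sgn; case: (leP 0 q) => h; [rewrite mul1r ger0_norm|rewrite mulN1r ltr0_norm]. Qed.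

(** [P] is the candidate centre, on the normal of the curve at [north], with height [zP]. The sign
    [sgn] makes this height nonnegative: for k = -1 this puts [P] on the upper sheet, and for k = 1
    it selects, of two antipodal centres, the one with squared chord [n0] at most 2. *)
Let ca := sgn / sk.
Let zP := 2 * `|q| / sk.
Let P : pt := (- w2 * ca, w1 * ca, zP).
Let n0 := ca ^+ 2 + k * (1 - zP) ^+ 2.

Let ca2 : ca ^+ 2 = kap^-1.
Proof. by rewrite /ca expr_div_n sgn2 sk2 mul1r. Qed.
Let caq : 2 * ca * q = zP.
Proof. by rewrite /ca /zP -sgnq; ring. Qed.
Let zP2 : zP ^+ 2 + k * ca ^+ 2 = 1.
Proof.
rewrite ca2 /zP expr_div_n sk2 exprMn real_normK ?num_real// /kap.
by field; rewrite -/kap lt0r_neq0// kap_gt0.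
Qed.
Let zP_ge0 : 0 <= zP. Proof. by rewrite /zP divr_ge0 ?mulr_ge0// ltW. Qed.
Let zP_flat : k = 0 -> zP = 1.
Proof.
by move=> k0; move: zP2; rewrite k0 mul0r addr0 => h; have := zP_ge0; nra.
Qed.

Let P_surface : surface k P.
Proof.
split => /=.
  by rewrite -[RHS]zP2 -[in RHS](mul1r (ca ^+ 2)) -w12; ring.
move=> k1; rewrite lt_neqAle zP_ge0 andbT eq_sym; apply/eqP => z0.
have k0 := curvature_le0 hk (introN eqP k1).
by move: zP2; rewrite z0 expr0n/= add0r => h; have := sqr_ge0 ca; nra.
Qed.

Let coefP : 1 - k ^+ 2 * (1 - zP) = 2 * ca * q.
Proof.
have [k0|->] := signP hk; last by rewrite caq; ring.
by rewrite caq (zP_flat k0) subrr mulr0 subr0.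
Qed.

(** Along the surface the squared chord from [P] differs from [n0] by a multiple of q nu - ga; the
    section is therefore exactly the circle about [P] through [north]. *)
Let sqdP x : surface k x -> sqd k P x = n0 + 2 * ca * (q * nu x - ga x).
Proof.
move=> sx; have [zE ME] := north_coords hk sx.
have kk := curvature_cube hk.
have -> : sqd k P x = x.1.1 ^+ 2 + x.1.2 ^+ 2 - 2 * ca * ga x + (w1 ^+ 2 + w2 ^+ 2) * ca ^+ 2 + k * (x.2 - zP) ^+ 2.
  by rewrite /sqd /ip /= /ga; ring.
rewrite w12 mul1r ME zE -/(nu x).
have -> : nu x - k * nu x ^+ 2 / 4 - 2 * ca * ga x + ca ^+ 2 + k * (1 - k * nu x / 2 - zP) ^+ 2 =
  n0 + nu x * (1 - k ^+ 2 * (1 - zP)) - 2 * ca * ga x + (k ^+ 3 - k) * nu x ^+ 2 / 4 by rewrite /n0; field.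
rewrite kk coefP; ring.
Qed.

Let ca0 : ca != 0.
Proof. by apply/eqP => h; have := kap_gt0; rewrite -invr_gt0 -ca2 h expr0n ltxx. Qed.

Let sectionP x : surface k x -> sqd k P x = n0 <-> ga x = q * nu x.
Proof.
move=> sx; rewrite sqdP//; split => [h|->]; last by rewrite subrr mulr0 addr0.
have /eqP : ca * (q * nu x - ga x) = 0 by lra.
by rewrite mulf_eq0 (negbTE ca0) /= subr_eq0 => /eqP.
Qed.

(** With [e2], the cosine and sine of the position on the circle, the angle being measured from
    [north]. *)
Let e1 (x : pt) := 1 - kap * nu x / 2.
Let e2 (x : pt) := sk * be x.

Let e_unit x : surface k x -> ga x = q * nu x -> e1 x ^+ 2 + e2 x ^+ 2 = 1.
Proof.
move=> sx gx; by rewrite /e1 /e2 exprMn sk2 be_kap//; field.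
Qed.

Let e_inj x y : surface k x -> surface k y -> ga x = q * nu x -> ga y = q * nu y ->
  (e1 x, e2 x) = (e1 y, e2 y) -> x = y.
Proof.
move=> sx sy gx gy [h1 h2].
have nn : nu x = nu y by apply: (mulfI (lt0r_neq0 kap_gt0)); move: h1; rewrite /e1; lra.
have bb : be x = be y by apply: (mulfI (lt0r_neq0 sk0)).
by apply: determined => //; rewrite gx gy nn.
Qed.

Lemma conformal_circle_north (L : R) : arc_length k g = L%:E -> exists P n0, [/\ surface k P, 0 < n0,
  (k = 1 -> n0 <= 2), trace g = [set x | surface k x /\ sqd k P x = n0] &
  2 * pi * Num.sqrt (n0 - k * n0 ^+ 2 / 4) <= L].
Proof.
move=> gL.
have i0 : 0 <= (0 : R) <= 1 by rewrite lexx ler01.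
have i1 : 0 <= (1 : R) <= 1 by rewrite lexx ler01.
have onto X Y : X ^+ 2 + Y ^+ 2 = 1 -> exists2 t, 0 <= t <= 1 & (e1 (g t), e2 (g t)) = (X, Y).
  have ce1 : continuous e1 by rewrite /e1; ccont.
  have ce2 : continuous e2 by rewrite /e2; ccont.
  have [f1 cf1 f1E] := curve_continuous cp ce1; have [f2 cf2 f2E] := curve_continuous cp ce2.
  move=> hX; have [||||t t01] := @circle_loop_onto R f1 f2 cf1 cf2 _ _ _ _ X Y hX.
  - by move=> t t01; rewrite f1E// f2E//; apply: e_unit; [exact: sg|exact: gaE].
  - by rewrite !f1E// gl.
  - by rewrite !f2E// gl.
  - move=> s t s0 st t1.
    have s01 : 0 <= s <= 1 by rewrite s0 ltW// (lt_trans st).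
    have t01 : 0 <= t <= 1 by rewrite (le_trans s0 (ltW st)) ltW.
    rewrite !f1E// !f2E// => /e_inj E; apply: (noloop s0 st t1).
    by apply: E; [exact: sg|exact: sg|exact: gaE|exact: gaE].
  by rewrite f1E// f2E// => E; exists t.
have rho : n0 - k * n0 ^+ 2 / 4 = kap^-1.
  have [k0|k2] := signP hk; first by rewrite /n0 k0 !mul0r subr0 addr0 ca2.
  have c2 : ca ^+ 2 = k * (1 - zP ^+ 2) by rewrite -zP2 addrAC subrr add0r mulrA -expr2 k2 mul1r.
  have nE : n0 = 2 * k * (1 - zP) by rewrite /n0 c2; ring.
  by rewrite -ca2 c2 nE; field: k2.
exists P, n0; split.
- exact: P_surface.
- have [h|h] := leP 0 k.
    by apply: ltr_pwDl; [rewrite ca2 invr_gt0 kap_gt0|rewrite mulr_ge0// sqr_ge0].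
  have kN : k = -1 by move: hk h; rewrite !inE => /or3P[] /eqP -> //; rewrite ?ltxx// ltr10.
  have cc : 0 < ca ^+ 2 by rewrite ca2 invr_gt0 kap_gt0.
  move: zP2; rewrite /n0 kN => h2.
  by have := zP_ge0; nra.
- by move=> k1; move: zP2; rewrite /n0 k1 => h2; have := zP_ge0; nra.
- apply/seteqP; split => [_ [t + <-]|x [sx /(sectionP sx) gx]].
    by rewrite /= in_itv/= => t01; split; [exact: sg|apply/sectionP; [exact: sg|exact: gaE]].
  have [t t01 E] := onto _ _ (e_unit sx gx); exists t; first by rewrite /= in_itv.
  by apply: e_inj E => //; [exact: sg|exact: gaE].
have e00 := e_unit (sg i0) (gaE i0).
have [|t t01 [E1 E2]] := onto (- e1 (g 0)) (- e2 (g 0)); first by rewrite !sqrrN.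
have : 2 * pi <= sk * L.
  apply: (@circle_loop_length R k g m a b H cp e1 e2 sk L sk0) => //; last by exists t.
    move=> i s im sab; have [_ sH gH] := cp; have [s1 s2 s3] := sH i im.
    have D1 := smooth_is_derive s s1; have D2 := smooth_is_derive s s2; have D3 := smooth_is_derive s s3.
    set v1 := derive1 _ s in D1; set v2 := derive1 _ s in D2; set v3 := derive1 _ s in D3.
    pose dn := 2 * ((H i s).1.1 * v1 + (H i s).1.2 * v2 + k * (((H i s).2 - 1) * v3)).
    have Dn : has_deriv s (fun t => nu (H i t)) dn.
      by rewrite /nu /sqd /ip /=; apply: is_derive_eq; rewrite /GRing.scale/= /dn; ring.
    have Db : has_deriv s (fun t => be (H i t)) (w1 * v1 + w2 * v2).
      by rewrite /be; derive_ring.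
    have Dg : has_deriv s (fun t => ga (H i t)) (w1 * v2 - w2 * v1).
      by rewrite /ga; derive_ring.
    exists (- kap / 2 * dn), (sk * (w1 * v1 + w2 * v2)); split.
    - by rewrite /e1; derive_ring.
    - by rewrite /e2; derive_ring.
    move=> sin; have [a0 b1] := partition_le (let: And3 P _ _ := cp in P) im.
    have near_sg : \forall t \near s, surface k (H i t) /\ ga (H i t) = q * nu (H i t).
      have : \forall t \near s, t \in `]a i, b i[ by apply: near_in_itvoo; rewrite in_itv/=.
      apply: filterS => r; rewrite in_itv/= => /andP[ta tb].
      have tab : a i <= r <= b i by rewrite !ltW.
      have [E st] := gH i r im tab; rewrite -E; split => //; apply: gaE.
      by rewrite (le_trans a0 (ltW ta)) (le_trans (ltW tb) b1).
    (* The derivatives of the equation of the section and of the height express the velocity through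
       the rates of [be] and [nu]; the map (e1, e2) then multiplies the speed by exactly [sk]. *)
    have gq : w1 * v2 - w2 * v1 = q * dn.
      have Dq : has_deriv s (fun t => q * nu (H i t)) (q * dn).
        by derive_ring.
      by apply: near_is_derive_unique Dg Dq _; apply: filterS near_sg => r [].
    have zq : v3 = - k / 2 * dn.
      have Dq : has_deriv s (fun t => 1 - k * nu (H i t) / 2) (- k / 2 * dn).
        by derive_ring.
      apply: near_is_derive_unique D3 Dq _; apply: filterS near_sg => r [st _].
      by have [-> _] := north_coords hk st.
    have kk := curvature_cube hk.
    have ipE : ip k (vel (H i) s) (vel (H i) s) = (w1 * v1 + w2 * v2) ^+ 2 + kap / 4 * dn ^+ 2.
      have -> : ip k (vel (H i) s) (vel (H i) s) = (w1 ^+ 2 + w2 ^+ 2) * (v1 ^+ 2 + v2 ^+ 2) + k * v3 ^+ 2.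
        by rewrite w12 mul1r /ip /= !expr2.
      have -> : (w1 ^+ 2 + w2 ^+ 2) * (v1 ^+ 2 + v2 ^+ 2) = (w1 * v1 + w2 * v2) ^+ 2 + (w1 * v2 - w2 * v1) ^+ 2 by ring.
      rewrite gq zq (_ : k * (- k / 2 * dn) ^+ 2 = k ^+ 3 * dn ^+ 2 / 4); last by field.
      by rewrite kk /kap; field.
    have spE : spd k (H i) s ^+ 2 = (w1 * v1 + w2 * v2) ^+ 2 + kap / 4 * dn ^+ 2.
      rewrite /spd sqr_sqrtr ipE// addr_ge0 ?sqr_ge0//.
      by apply: mulr_ge0; [rewrite divr_ge0// ltW// kap_gt0|exact: sqr_ge0].
    rewrite spE sk2 [(sk * _) ^+ 2]exprMn sk2 (_ : (- kap / 2 * dn) ^+ 2 = kap * (kap / 4 * dn ^+ 2)); last by field.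
    by rewrite -mulrDr addrC.
  by move=> s s01; apply: e_unit; [exact: sg|exact: gaE].
have -> : Num.sqrt (n0 - k * n0 ^+ 2 / 4) = sk^-1.
  by rewrite rho /sk sqrtrV// ltW// kap_gt0.
by rewrite ler_pdivrMr// [L * sk]mulrC.
Qed.

End at_north.

(** * Equality for all pairs gives a plane section *)

Section from_pairs.
Variables (k : R) (g : R -> pt) (m : nat) (a b : nat -> R) (H : nat -> R -> pt).
Hypotheses (hk : curvature k) (cp : curve_pieces k g m a b H).
Hypotheses (gl : g 0 = g 1) (inj : {in `[0, 1[ &, injective g}).
Hypothesis pairs : conformal_pairs k m a b H.
Variables (i0 : nat) (t0 : R).
Hypotheses (i0m : (i0 < m)%N) (t0i : a i0 < t0 < b i0).
Let y := H i0 t0.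
Let u := vel (H i0) t0.

Let P01 : partition01 m a b. Proof. by case: cp. Qed.
Let t0ab : a i0 <= t0 <= b i0. Proof. by case/andP: t0i => *; rewrite !ltW. Qed.
Let gy : g t0 = y. Proof. by have [_ _ gH] := cp; have [->] := gH i0 t0 i0m t0ab. Qed.
Let t001 : 0 < t0 < 1.
Proof.
have [a0 b1] := partition_le P01 i0m; case/andP: t0i => h1 h2.
by rewrite (le_lt_trans a0 h1) (lt_le_trans h2 b1).
Qed.

Let g_ne t : 0 <= t <= 1 -> t != t0 -> g t <> y.
Proof.
move=> /andP[tge tle] tt0 gt; case/andP: t001 => h1 h2; move/eqP: tt0; apply.
have [t1|t1] := ltP t 1.
  by apply: inj; rewrite ?in_itv/= ?tge ?t1 ?(ltW h1) ?h2// gt gy.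
have e1 : t = 1 by apply/eqP; rewrite eq_le tle t1.
have : (0 : R) = t0 by apply: inj; rewrite ?in_itv/= ?lexx ?ltr01 ?(ltW h1) ?h2// gl -e1 gt gy.
by move=> e0; move: h1; rewrite -e0 ltxx.
Qed.

Let phi (x : pt) := det3 y u x / sqd k x y.

(** Up to the factor N^2 the derivative of [phi] is the quantity whose square is the defect in
    [kap0_gram]. Equality for the pair (t, t0) makes it vanish. *)
Let phi_derive j t : (j < m)%N -> a j <= t <= b j -> t != t0 ->
  has_deriv t (fun s => phi (H j s)) 0.
Proof.
move=> jm tab tt0; have [_ sH gH] := cp.
have [a0 b1] := partition_le P01 jm.
have t01 : 0 <= t <= 1 by case/andP: tab => ta tb; rewrite (le_trans a0)// (le_trans tb).
have [gE sx] := gH j t jm tab; have [_ sy] := gH i0 t0 i0m t0ab.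
have xy : H j t <> y by rewrite -gE; exact: g_ne.
rewrite gE in sx; rewrite gy in sy.
have [[_ lab] _ _] := P01.
have tx : tangent k (H j t) (vel (H j) t).
  by apply: (vel_tangent (lab j jm) (sH j jm)) => // s sab; have [<- hs] := gH j s jm sab.
have ty : tangent k y u.
  by apply: (vel_tangent (lab i0 i0m) (sH i0 i0m)) => // s sab; have [<- hs] := gH i0 s i0m sab.
have [N0 Ns] := sqd_surface hk sx sy.
have {}N0 : 0 < sqd k (H j t) y by rewrite lt_neqAle N0 andbT eq_sym; apply/eqP => /Ns.
have := pairs jm i0m tab t0ab xy; have := kap0_gram hk sx sy tx ty; rewrite -/y -/u.
set N := sqd k (H j t) y; set A := N * ip k (vel (H j) t) u - 2 * ip k (vel (H j) t) (vsub (H j t) y) * ip k u (vsub (H j t) y) => gram pr.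
have sv2 : spd k (H j) t ^+ 2 = ip k (vel (H j) t) (vel (H j) t) by rewrite /spd sqr_sqrtr// (tangent_ge0 hk sx tx).
have su2 : spd k (H i0) t0 ^+ 2 = ip k u u by rewrite /spd sqr_sqrtr// (tangent_ge0 hk sy ty).
have X0 : N * det3 y u (vel (H j) t) - 2 * ip k (vel (H j) t) (vsub (H j t) y) * det3 y u (H j t) = 0.
  apply/eqP; rewrite -sqrf_eq0 eq_le sqr_ge0 andbT gram subr_le0 -sv2 -su2.
  rewrite -exprMn -exprMn -[X in _ <= X](real_normK (num_real A)) ler_sqr ?nnegrE//.
  by rewrite !mulr_ge0 ?sqrtr_ge0// ltW.
have [s1 s2 s3] := sH j jm.
have D1 := smooth_is_derive t s1; have D2 := smooth_is_derive t s2; have D3 := smooth_is_derive t s3.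
have Dd : has_deriv t (fun s => det3 y u (H j s)) (det3 y u (vel (H j) t)).
  by rewrite /det3; apply: is_derive_eq; rewrite /GRing.scale/= /vel /=; ring.
have Dq : has_deriv t (fun s => sqd k (H j s) y) (2 * ip k (vel (H j) t) (vsub (H j t) y)).
  by rewrite /sqd /ip /vsub /=; apply: is_derive_eq; rewrite /GRing.scale/= /vel /=; ring.
have DV := derivative_inv (f := fun s => sqd k (H j s) y) (lt0r_neq0 N0) Dq.
have DM : has_deriv t (fun s => phi (H j s)) (det3 y u (H j t) * (- (2 * ip k (vel (H j) t) (vsub (H j t) y)) / N ^+ 2) + N^-1 * det3 y u (vel (H j) t)).
  exact: is_deriveM Dd DV.
apply: (der_ext DM) => //.
have key (n d1 d2 p : R) : n != 0 -> n * d1 - 2 * p * d2 = 0 -> d2 * (- (2 * p) / n ^+ 2) + n^-1 * d1 = 0.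
  by move=> n0 e; apply: (mulfI (expf_neq0 2 n0)); rewrite mulr0 -[RHS]e; field.
exact: key (lt0r_neq0 N0) X0.
Qed.

Lemma zero_derive_eq (f : R -> R) (s t : R) : s <= t -> (forall x, s <= x <= t -> has_deriv x f 0) ->
  f s = f t.
Proof.
move=> st df; have [||c _] := @MVT_segment R f (fun=> 0) s t st.
- by move=> x; rewrite in_itv/= => /andP[h1 h2]; apply: df; rewrite !ltW.
- apply: continuous_in_subspaceT => x; rewrite inE/= in_itv/= => xi.
  exact: is_derive_continuous (df x xi).
by rewrite mul0r => /eqP; rewrite subr_eq0 => /eqP.
Qed.

(** [phi] is singular only at t0, so it is constant on both sides; the two constants agree because
    the curve closes up at g 0 = g 1. *)
Lemma conformal_section : exists q, forall t, 0 <= t <= 1 -> det3 y u (g t) = q * sqd k (g t) y.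
Proof.
have [_ _ gH] := cp.
have const s t : 0 <= s -> s <= t -> t <= 1 -> (t < t0 \/ t0 < s) -> phi (g s) = phi (g t).
  move=> s0 st t1 out; apply: (constant_pieces cp (F := fun t => phi (g t))) => // j x z jm ax xz zb sx zt.
  have [-> _] := gH j x jm (ltac:(by rewrite ax (le_trans xz))).
  have [-> _] := gH j z jm (ltac:(by rewrite zb (le_trans ax))).
  apply: (zero_derive_eq (f := fun s => phi (H j s))) => // r /andP[xr rz]; apply: phi_derive => //.
    by rewrite (le_trans ax xr) (le_trans rz zb).
  by apply/eqP => e; case: out => h; lra.
exists (phi (g 0)) => t /andP[tge tle].
have [->|tt0] := eqVneq t t0; first by rewrite gy /det3 /sqd /ip /=; ring.
have nz : sqd k (g t) y != 0.
  apply/eqP => h; have [_ sy] := gH i0 t0 i0m t0ab; rewrite gy in sy.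
  have sg : surface k (g t) by apply: (surface_curve cp); rewrite tge.
  have [_ /(_ h)] := sqd_surface hk sg sy; apply: g_ne => //; by rewrite tge.
have -> : phi (g 0) = phi (g t).
  case/andP: t001 => h1 h2; have [lt|gt] := ltP t t0; first by apply: const => //; left.
  by rewrite gl; apply/esym; apply: const => //; right; rewrite lt_neqAle eq_sym tt0.
by rewrite /phi divfK.
Qed.

End from_pairs.

Lemma conformal_circle_at_north k g m a b H i0 t0 (L : R) : curvature k -> curve_pieces k g m a b H ->
  g 0 = g 1 -> {in `[0, 1[ &, injective g} -> conformal_pairs k m a b H -> (i0 < m)%N -> a i0 < t0 < b i0 ->
  H i0 t0 = north -> vel (H i0) t0 <> (0, 0, 0) -> arc_length k g = L%:E -> exists P n0, [/\ surface k P, 0 < n0,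
  (k = 1 -> n0 <= 2), trace g = [set x | surface k x /\ sqd k P x = n0] &
  2 * pi * Num.sqrt (n0 - k * n0 ^+ 2 / 4) <= L].
Proof.
move=> hk cp gl inj pairs im ti HN u0 gL.
have [q] := conformal_section hk cp gl inj pairs im ti; rewrite HN.
have [[[_ lab] _ _] sH gH] := cp.
have tab : a i0 <= t0 <= b i0 by case/andP: ti => *; rewrite !ltW.
have : tangent k north (vel (H i0) t0).
  by rewrite -HN; apply: (vel_tangent (lab i0 im) (sH i0 im)) => // s sab; have [<- hs] := gH i0 s im sab.
move: (vel (H i0) t0) u0 => [[u1 u2] u3] u0 tu hq.
have u30 : u3 = 0 by move: tu; rewrite /tangent /= !mul0r addr0 mulr0 addr0 mul1r.
have un0 : 0 < u1 ^+ 2 + u2 ^+ 2.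
  rewrite lt_neqAle addr_ge0 ?sqr_ge0// andbT eq_sym paddr_eq0 ?sqr_ge0// !sqrf_eq0.
  by apply/negP => /andP[/eqP h1 /eqP h2]; apply: u0; rewrite h1 h2 u30.
pose un := Num.sqrt (u1 ^+ 2 + u2 ^+ 2).
have unp : 0 < un by rewrite sqrtr_gt0.
have un2 : un ^+ 2 = u1 ^+ 2 + u2 ^+ 2 by rewrite sqr_sqrtr// ltW.
apply: (@conformal_circle_north k g m a b H hk cp gl inj (u1 / un) (u2 / un) (q / un)) => //.
  by rewrite !expr_div_n -mulrDl -un2 mulfV// expf_neq0// lt0r_neq0.
move=> t t01; rewrite [RHS]mulrAC -[q * _](hq t t01) /det3 /=; field; exact: lt0r_neq0.
Qed.

Lemma conformal_circle k g m a b H (L : R) : curvature k -> simple_closed_curve k g ->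
  curve_pieces k g m a b H -> conformal_pairs k m a b H -> arc_length k g = L%:E -> exists P n0, [/\ surface k P, 0 < n0,
  (k = 1 -> n0 <= 2), trace g = [set x | surface k x /\ sqd k P x = n0] &
  2 * pi * Num.sqrt (n0 - k * n0 ^+ 2 / 4) <= L].
Proof.
move=> hk [pg gl inj] cp pairs gL.
have [[[m0 lab] _ _] sH gH] := cp; have ab0 := lab 0%N m0.
(* A piece with zero velocity throughout would be constant, against injectivity. The point with
   nonzero velocity is then moved to [north]. *)
have [t0 ti u0] : exists2 t0, a 0%N < t0 < b 0%N & vel (H 0%N) t0 <> (0, 0, 0).
  apply: contrapT => no.
  have z t : a 0%N < t < b 0%N -> vel (H 0%N) t = (0, 0, 0) by move=> ti; apply: contrapT => h; apply: no; exists t.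
  pose s := a 0%N + (b 0%N - a 0%N) / 3; pose t := a 0%N + (b 0%N - a 0%N) / 2.
  have si : a 0%N < s < b 0%N by rewrite /s; lra.
  have tin : a 0%N < t < b 0%N by rewrite /t; lra.
  have st : s < t by rewrite /s /t; lra.
  have within x : s <= x <= t -> a 0%N < x < b 0%N.
    by move=> /andP[h1 h2]; case/andP: si => ? _; case/andP: tin => _ ?; lra.
  have [s1 s2 s3] := sH 0%N m0.
  have E : H 0%N s = H 0%N t.
    apply: pt_eq.
    - apply: (zero_derive_eq (f := fun t => (H 0%N t).1.1) (ltW st)) => x /within/z [E1 _ _].
      by have := smooth_is_derive x s1; rewrite E1.
    - apply: (zero_derive_eq (f := fun t => (H 0%N t).1.2) (ltW st)) => x /within/z [_ E1 _].
      by have := smooth_is_derive x s2; rewrite E1.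
    - apply: (zero_derive_eq (f := fun t => (H 0%N t).2) (ltW st)) => x /within/z [_ _ E1].
      by have := smooth_is_derive x s3; rewrite E1.
  have [a0 b1] := partition_le (let: And3 P _ _ := cp in P) m0.
  have in1 x : a 0%N < x < b 0%N -> x \in `[0, 1[.
    by move=> /andP[h1 h2]; rewrite in_itv/= (le_trans a0 (ltW h1)) (lt_le_trans h2 b1).
  have ge x : a 0%N < x < b 0%N -> g x = H 0%N x.
    by move=> /andP[h1 h2]; have [|] := gH 0%N x m0; rewrite ?ltW.
  have := inj s t (in1 _ si) (in1 _ tin); rewrite !ge// => /(_ E) e.
  by move: st; rewrite e ltxx.
pose y := H 0%N t0.
have sy : surface k y.
  by have [|gE sg] := gH 0%N t0 m0; [case/andP: ti => *; rewrite !ltW|rewrite /y -gE].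
have [yN|yN] := pselect (y = north).
  exact: (conformal_circle_at_north hk cp gl inj pairs m0 ti yN u0 gL).
have sN := surface_north k.
have rr := refl_inv hk sy sN yN.
have cp' := curve_pieces_refl hk sy sN yN cp.
have [||||||P [n0 [sP n00 n02 tr Lr]]] := @conformal_circle_at_north k _ m a b _ 0%N t0 L hk cp' _ _ _ m0 ti _ _ _.
- by rewrite gl.
- by move=> s t si tin /(congr1 (refl k y north)); rewrite !rr; exact: inj.
- by apply/(conformal_pairs_refl a b hk sy sN yN sH).
- by rewrite -/y (refl_p hk sy sN yN).
- move=> h; apply: u0.
  have s3 := sH 0%N m0.
  have := @vel_refl R k y north _ t0 (@smooth3_refl R k y north (H 0%N) s3).
  rewrite h (_ : (fun t => _) = H 0%N); last by apply/funext => t; rewrite rr.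
  by move=> ->; rewrite /refl_lin /ip /=; congr (_, _, _); ring.
- by rewrite (arc_length_refl hk sy sN yN).
exists (refl k y north P), n0; split => //; first exact: (refl_surface hk sy sN yN).
have -> : trace g = refl k y north @` trace (fun t => refl k y north (g t)).
  rewrite /trace image_comp; apply: eq_imagel => t _ /=; by rewrite rr.
rewrite tr; apply/seteqP; split => [_ [x [sx xP] <-]|x [sx xP]].
  by split; [exact: (refl_surface hk sy sN yN)|rewrite (refl_sqd hk sy sN yN)].
exists (refl k y north x); last exact: rr.
by split; [exact: (refl_surface hk sy sN yN)|rewrite -(refl_sqd hk sy sN yN) rr].
Qed.

End equality.

(** * Distance and circles *)

Section distance.
Context {R : realType}.
Local Notation pt := (R * R * R)%type.
Implicit Types (k : R) (g : R -> pt) (x P : pt).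
Notation north := (@north R).

Lemma asinh0 : asinh (0 : R) = 0.
Proof. by rewrite /asinh add0r expr0n/= add0r sqrtr1 ln1. Qed.

Lemma is_derive_asinh (t : R) : has_deriv t (@asinh R) (Num.sqrt (1 + t ^+ 2))^-1.
Proof.
have s0 : 0 < t ^+ 2 + 1 by rewrite ltr_pwDr// sqr_ge0.
have D1 : has_deriv t (fun s : R => s ^+ 2 + 1) (2 * t).
  by derive_ring.
have D2 := der_comp (l := fun s : R => s ^+ 2 + 1) (is_derive_sqrt s0) D1.
have D3 : has_deriv t (fun s : R => s + Num.sqrt (s ^+ 2 + 1)) (1 + (2 * Num.sqrt (t ^+ 2 + 1))^-1 * (2 * t)).
  exact: is_deriveD.
set S := Num.sqrt (t ^+ 2 + 1) in D3.
have S0 : 0 < S by rewrite sqrtr_gt0.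
have S2 : S ^+ 2 = t ^+ 2 + 1 by rewrite sqr_sqrtr// ltW.
have tS : 0 < t + S by nra.
have D4 := der_comp (l := fun s : R => s + Num.sqrt (s ^+ 2 + 1)) (is_derive1_ln tS) D3.
apply: (der_ext D4) => //; rewrite [1 + t ^+ 2]addrC -/S.
by field; rewrite !lt0r_neq0.
Qed.

Lemma AS0 k : k != 1 -> AS k (0 : R) = 0.
Proof. by move=> /negbTE k1; rewrite /AS k1; case: ifP => // _; rewrite asinh0. Qed.

Lemma is_derive_AS k (t : R) : curvature k -> k != 1 ->
  has_deriv t (AS k) (Num.sqrt (1 - k * t ^+ 2))^-1.
Proof.
move=> hk k1; have [k0|k0] := eqVneq k 0.
  rewrite k0 mul0r subr0 sqrtr1 invr1 (_ : AS 0 = id); first exact: is_derive_id.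
  by apply/funext => s; rewrite /AS eq_sym oner_eq0 eqxx.
have kN : k = -1 by move: hk k1 k0; rewrite !inE => /or3P[] /eqP ->; rewrite ?eqxx.
rewrite kN mulN1r opprK (_ : AS (-1) = @asinh R); first exact: is_derive_asinh.
by apply/funext => s; rewrite /AS -kN (negbTE k1) (negbTE k0).
Qed.

Lemma radial_speed k x (v : pt) : curvature k -> k != 1 -> surface k x -> tangent k x v ->
  (x.1.1 * v.1.1 + x.1.2 * v.1.2) ^+ 2 <= (x.1.1 ^+ 2 + x.1.2 ^+ 2) * (1 - k * (x.1.1 ^+ 2 + x.1.2 ^+ 2)) * ip k v v.
Proof.
case: x v => [[x1 x2] x3] [[v1 v2] v3] hk k1 [/= e _]; rewrite /tangent /ip /= => tg.
have cs : (x1 * v1 + x2 * v2) ^+ 2 <= (x1 ^+ 2 + x2 ^+ 2) * (v1 ^+ 2 + v2 ^+ 2).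
  rewrite -subr_ge0 (_ : _ - _ = (x1 * v2 - x2 * v1) ^+ 2); first exact: sqr_ge0.
  by ring.
have zE : 1 - k * (x1 ^+ 2 + x2 ^+ 2) = x3 ^+ 2 by rewrite -e; ring.
have zv : x3 * v3 = - k * (x1 * v1 + x2 * v2) by lra.
rewrite zE (_ : (x1 ^+ 2 + x2 ^+ 2) * x3 ^+ 2 * _ = x3 ^+ 2 * ((x1 ^+ 2 + x2 ^+ 2) * (v1 ^+ 2 + v2 ^+ 2)) + k * (x1 ^+ 2 + x2 ^+ 2) * (x3 * v3) ^+ 2); last by ring.
rewrite zv.
have := ler_wpM2l (sqr_ge0 x3) cs; set s := x1 * v1 + x2 * v2; set M := x1 ^+ 2 + x2 ^+ 2 in e zE *.
have : x3 ^+ 2 * s ^+ 2 + k * M * (- k * s) ^+ 2 = s ^+ 2.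
  rewrite -zE; have kk := curvature_cube hk.
  rewrite (_ : _ + _ = s ^+ 2 + (k ^+ 3 - k) * M * s ^+ 2); last by ring.
  by rewrite kk subrr !mul0r addr0.
lra.
Qed.

Lemma sphere_speed x (v : pt) : surface 1 x -> tangent 1 x v -> v.2 ^+ 2 <= (1 - x.2 ^+ 2) * ip 1 v v.
Proof.
case: x v => [[x1 x2] x3] [[v1 v2] v3] [/= e _]; rewrite /tangent /ip /= => tg.
have cs : (x1 * v1 + x2 * v2) ^+ 2 <= (x1 ^+ 2 + x2 ^+ 2) * (v1 ^+ 2 + v2 ^+ 2).
  rewrite -subr_ge0 (_ : _ - _ = (x1 * v2 - x2 * v1) ^+ 2); first exact: sqr_ge0.
  by ring.
have zv : x1 * v1 + x2 * v2 = - (x3 * v3) by lra.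
have ME : x1 ^+ 2 + x2 ^+ 2 = 1 - x3 ^+ 2 by lra.
by move: cs; rewrite zv ME sqrrN; lra.
Qed.

Definition radial k x : R := if k == 1 then acos x.2 else AS k (Num.sqrt (x.1.1 ^+ 2 + x.1.2 ^+ 2)).

Section lower.
Variables (k : R) (g : R -> pt) (m : nat) (a b : nat -> R) (H : nat -> R -> pt).
Hypotheses (hk : curvature k) (cp : curve_pieces k g m a b H) (g0 : g 0 = north).
Variable L : R.
Hypothesis gL : arc_length k g = L%:E.

Let tang i t : (i < m)%N -> a i <= t <= b i -> surface k (H i t) /\ tangent k (H i t) (vel (H i) t).
Proof.
move=> im tab; have [[[_ lab] _ _] sH gH] := cp; split; first by have [<-] := gH i t im tab.
by apply: (vel_tangent (lab i im) (sH i im)) => // s sab; have [<- hs] := gH i s im sab.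
Qed.

Lemma length_bound (phi : pt -> R) :
  (forall i t, (i < m)%N -> a i <= t <= b i ->
     exists2 d, has_deriv t (fun s => phi (H i s)) d & d ^+ 2 <= spd k (H i) t ^+ 2) ->
  phi (g 1) - phi north <= L.
Proof.
move=> dphi; have [sigma [s0 sL bound]] := arc_function cp.
move: gL; rewrite sL => -[<-]; rewrite -[sigma 1]subr0 -s0 -g0; apply: bound => // i t im tab.
have [d D dle] := dphi i t im tab; exists d => // _.
rewrite leNgt; apply/negP => h; move: dle; rewrite leNgt => /negP; apply.
by rewrite ltrXn2r// ?nnegrE ?sqrtr_ge0// (le_trans _ (ltW h))// sqrtr_ge0.
Qed.

Lemma length_ge0 : 0 <= L.
Proof.
have := @length_bound (fun=> 0); rewrite subrr; apply => i t _ _.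
by exists 0; [exact: is_derive_cst|rewrite expr0n/= sqr_ge0].
Qed.

Lemma radial_lower_flat : k != 1 -> radial k (g 1) <= L.
Proof.
move=> k1; rewrite /radial (negbTE k1).
have k0 := curvature_le0 hk k1.
pose M (x : pt) := x.1.1 ^+ 2 + x.1.2 ^+ 2.
have M0 x : 0 <= M x by rewrite addr_ge0 ?sqr_ge0.
(* The square root is not differentiable on the axis, where the curve starts; adding [d] under the
   root smooths it without raising its rate above the speed, and [d] tends to 0 afterwards. *)
have key d : 0 < d -> AS k (Num.sqrt (M (g 1) + d)) - AS k (Num.sqrt d) <= L.
  move=> d0; have := @length_bound (fun x => AS k (Num.sqrt (M x + d))).
  have -> : M north = 0 by rewrite /M /= expr0n/= addr0.
  rewrite add0r; apply => i t im tab.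
  have [sx tx] := tang im tab; have [_ sH _] := cp; have [s1 s2 _] := sH i im.
  have D1 := smooth_is_derive t s1; have D2 := smooth_is_derive t s2.
  set v1 := derive1 _ t in D1; set v2 := derive1 _ t in D2.
  set x := H i t in sx tx.
  have Md : 0 < M x + d by rewrite ltr_wpDl.
  have DM : has_deriv t (fun s => M (H i s) + d) (2 * (x.1.1 * v1 + x.1.2 * v2)).
    by rewrite /M; apply: is_derive_eq; rewrite /GRing.scale/= -/x; ring.
  have DS := der_comp (l := fun s => M (H i s) + d) (is_derive_sqrt Md) DM.
  have DA := der_comp (l := fun s => Num.sqrt (M (H i s) + d)) (is_derive_AS _ hk k1) DS.
  have q0 : 0 < 1 - k * (M x + d) by rewrite subr_gt0 (@le_lt_trans _ _ 0)// mulr_le0_ge0// ltW.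
  pose A := Num.sqrt (1 - k * (M x + d)); pose Sx := Num.sqrt (M x + d).
  have A0 : 0 < A by rewrite sqrtr_gt0.
  have S0 : 0 < Sx by rewrite sqrtr_gt0.
  have A2 : A ^+ 2 = 1 - k * (M x + d) by rewrite sqr_sqrtr// ltW.
  have S2 : Sx ^+ 2 = M x + d by rewrite sqr_sqrtr// ltW.
  exists ((x.1.1 * v1 + x.1.2 * v2) / (A * Sx)).
    apply: (der_ext DA) => //; rewrite -/x -/Sx S2 -/A; field; rewrite !lt0r_neq0//.
  rewrite expr_div_n exprMn A2 S2 /spd sqr_sqrtr; last exact: (tangent_ge0 hk sx tx).
  rewrite ler_pdivrMr ?mulr_gt0//; apply: le_trans (radial_speed hk k1 sx tx) _.
  rewrite -/(M x) [X in _ <= X]mulrC; apply: ler_wpM2r; first exact: (tangent_ge0 hk sx tx).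
  rewrite mulrC; apply: ler_pM => //; [|by rewrite lerD2l lerN2 ler_wnM2l// lerDl ltW|by rewrite lerDl ltW].
  by rewrite subr_ge0 (@le_trans _ _ 0)// mulr_le0_ge0.
rewrite leNgt; apply/negP => hL.
pose f (d : R) := AS k (Num.sqrt (M (g 1) + d)) - AS k (Num.sqrt d).
have cA : continuous (AS k) by move=> t; exact: is_derive_continuous (is_derive_AS t hk k1).
have cS : continuous (fun d : R => AS k (Num.sqrt (M (g 1) + d))).
  apply: (cont_at (f := AS k)) => //; apply: (cont_at (f := Num.sqrt)); first exact: sqrt_continuous.
  by move=> t; apply: cvgD; [exact: cvg_cst|exact: cvg_id].
have cS' : continuous (fun d : R => AS k (Num.sqrt d)).
  by apply: (cont_at (f := AS k)) => //; exact: sqrt_continuous.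
have cf : continuous f by rewrite /f; ccont.
have f0 : L < f 0 by rewrite /f addr0 sqrtr0 AS0// subr0.
have : \forall d \near (0 : R), L < f d by have /cvgr_gt := cf 0; apply.
move=> /nbhs_ballP[e /= e0 he].
have e2 : 0 < e / 2 by rewrite divr_gt0.
have := he (e / 2); rewrite /ball/= sub0r normrN gtr0_norm// => /(_ (ltac:(lra))).
by rewrite ltNge key.
Qed.

Lemma radial_lower_sphere : k = 1 -> radial k (g 1) <= L.
Proof.
move=> k1; rewrite /radial k1 eqxx.
have zb x : surface 1 x -> -1 <= x.2 <= 1.
  by move=> [e _]; have := sqr_ge0 x.1.1; have := sqr_ge0 x.1.2; move=> ? ?; apply/andP; split; nra.
have sg1 : surface 1 (g 1) by rewrite -{1}k1; apply: (surface_curve cp); rewrite lexx ler01.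
(* Shrinking the argument keeps it off the ends of [-1, 1], where acos is not differentiable. *)
have key d : 0 < d < 1 -> acos ((1 - d) * (g 1).2) - acos (1 - d) <= L.
  move=> /andP[d0 d1]; have := @length_bound (fun x => acos ((1 - d) * x.2)).
  rewrite /= mulr1; apply => i t im tab.
  have [sx tx] := tang im tab; have [_ sH _] := cp; have [_ _ s3] := sH i im.
  rewrite k1 in sx tx; have /andP[z1 z2] := zb _ sx.
  have D3 := smooth_is_derive t s3; set v3 := derive1 _ t in D3.
  have Df : has_deriv t (fun s => (1 - d) * (H i s).2) ((1 - d) * v3).
    by derive_ring.
  have fi : -1 < (1 - d) * (H i t).2 < 1 by apply/andP; split; nra.
  have Da := is_derive_acos_comp (f := fun s => (1 - d) * (H i s).2) fi Df.
  exists (- ((1 - d) * v3) / Num.sqrt (1 - ((1 - d) * (H i t).2) ^+ 2)); first exact: Da.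
  have q0 : 0 < 1 - ((1 - d) * (H i t).2) ^+ 2 by move: fi => /andP[? ?]; nra.
  have sp := sphere_speed sx tx.
  have ip0 : 0 <= ip 1 (vel (H i) t) (vel (H i) t) by rewrite -k1; apply: (tangent_ge0 hk (x := H i t)); rewrite k1.
  rewrite expr_div_n sqr_sqrtr ?(ltW q0)// /spd k1 sqr_sqrtr// ler_pdivrMr// sqrrN exprMn mulrC.
  apply: (@le_trans _ _ ((1 - (H i t).2 ^+ 2) * ip 1 (vel (H i) t) (vel (H i) t) * (1 - d) ^+ 2)).
    by apply: ler_wpM2r => //; exact: sqr_ge0.
  rewrite mulrAC mulrC; apply: ler_wpM2l => //.
  rewrite exprMn; nra.
have zi := zb _ sg1; set z := (g 1).2 in key zi *.
have aK : cos (acos z) = z by apply: acosK; rewrite in_itv.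
rewrite leNgt; apply/negP => hL; have L0 := length_ge0.
set th := acos z in hL aK.
have thpi : th <= pi by exact: acos_lepi.
(* Each of the two acos values will be within [e] of its limit, which gives th - 2 e <= L, while th
   - L is 3 e. *)
pose e := (th - L) / 3.
have e0 : 0 < e by rewrite /e divr_gt0// subr_gt0.
have i0 : (0 : R) \in `[0, pi] by rewrite in_itv/= lexx pi_ge0.
have ie : e \in `[0, pi] by rewrite in_itv/= ltW//= /e; lra.
have it : th \in `[0, pi] by rewrite in_itv/= thpi andbT; lra.
have ite : th - e \in `[0, pi] by rewrite in_itv/= /e; lra.
have ce : cos e < 1 by rewrite -cos0 ltr_cos.
have cte : z < cos (th - e) by rewrite -aK ltr_cos//; lra.
pose d := Num.min (Num.min (1 - cos e) (cos (th - e) - z)) 1 / 2.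
have dm : 0 < Num.min (Num.min (1 - cos e) (cos (th - e) - z)) 1.
  by rewrite !lt_min ltr01 !subr_gt0 ce cte.
have d0 : 0 < d by rewrite /d divr_gt0.
have [d1 d2 d3] : [/\ d < 1, d <= 1 - cos e & d <= cos (th - e) - z].
  have h1 : Num.min (Num.min (1 - cos e) (cos (th - e) - z)) 1 <= 1 by rewrite ge_min lexx orbT.
  have h2 : Num.min (Num.min (1 - cos e) (cos (th - e) - z)) 1 <= 1 - cos e by rewrite !ge_min lexx.
  have h3 : Num.min (Num.min (1 - cos e) (cos (th - e) - z)) 1 <= cos (th - e) - z by rewrite !ge_min lexx orbT.
  by rewrite /d; split; lra.
have d01 : 0 < d < 1 by rewrite d0.
have := key d d01.
case/andP: zi => zi1 zi2.
have I1 : -1 <= 1 - d <= 1 by lra.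
have I2 : -1 <= (1 - d) * z <= 1 by apply/andP; split; nra.
have a1 : acos (1 - d) \in `[0, pi] by rewrite in_itv/= acos_ge0// acos_lepi.
have a2 : acos ((1 - d) * z) \in `[0, pi] by rewrite in_itv/= acos_ge0// acos_lepi.
have h1 : acos (1 - d) <= e by rewrite leNgt -ltr_cos// acosK ?in_itv//= -leNgt; lra.
have h2 : th - e <= acos ((1 - d) * z) by rewrite leNgt -ltr_cos// acosK ?in_itv//= -leNgt; nra.
rewrite /e in h1 h2; lra.
Qed.

End lower.

Lemma dist_north_ge k x : curvature k -> ((radial k x)%:E <= dist k north x)%E.
Proof.
move=> hk; apply: le_ereal_inf_tmp => _ [g [pg g0 g1] <-].
have [m [a [b [H cp]]]] := piecewise_smoothP pg.
have gL := arc_length_pieces cp; rewrite gL lee_fin -g1.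
by have [k1|k1] := eqVneq k 1; [exact: (radial_lower_sphere hk cp g0 gL k1)|exact: (radial_lower_flat hk cp g0 gL k1)].
Qed.

Lemma piecewise_smooth_single k (h : R -> pt) : smooth3 h -> (forall t, surface k (h t)) -> piecewise_smooth k h.
Proof.
move=> [s1 s2 s3] sh; split => //; exists [:: 1]; first by split; rewrite /= ?ltr01.
by case => // _; exists h; split.
Qed.

Lemma arc_length_const k (h : R -> pt) (c : R) : (forall t, spd k h t = c) -> arc_length k h = c%:E.
Proof.
move=> hc; rewrite /arc_length (eq_integral (cst c%:E)); last by move=> t _; rewrite speedE hc.
by rewrite integral_cst//= lebesgue_measure_itv/= lte_fin ltr01 oppr0 adde0 mule1.
Qed.

(** [S] and [C] stand for sine and cosine of th t, for th t and 1, or for their hyperbolic versions.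
    The curve leaves [north] towards the horizontal part of [x]. If that part is 0 there is no
    direction to take; the condition on [S 1] then forces x = north and rules out the antipode. *)
Lemma dist_geodesic k x (th : R) (S C : R -> R) : 0 <= th -> smooth S -> smooth C ->
  (forall t, has_deriv t S (th * C t)) -> (forall t, has_deriv t C (- k * th * S t)) ->
  S 0 = 0 -> C 0 = 1 -> (forall t, C t ^+ 2 + k * S t ^+ 2 = 1) -> (k <> 1 -> forall t, 0 < C t) ->
  S 1 = Num.sqrt (x.1.1 ^+ 2 + x.1.2 ^+ 2) -> C 1 = x.2 -> (S 1 = 0 -> th = 0) -> k ^+ 3 = k ->
  (dist k north x <= th%:E)%E.
Proof.
move=> th0 sS sC dS dC S0 C0 CS Cp S1 C1 Sth kk.
set rho := Num.sqrt _ in S1.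
have rho2 : rho ^+ 2 = x.1.1 ^+ 2 + x.1.2 ^+ 2 by rewrite sqr_sqrtr// addr_ge0 ?sqr_ge0.
pose e1 := x.1.1 / rho; pose e2 := x.1.2 / rho.
pose h t : pt := (e1 * S t, e2 * S t, C t).
have [rz|rnz] := eqVneq rho 0.
  have [x1 x2] : x.1.1 = 0 /\ x.1.2 = 0.
    by move: rho2; rewrite rz expr0n/= => /esym/eqP; rewrite paddr_eq0 ?sqr_ge0// !sqrf_eq0 => /andP[/eqP ? /eqP ?].
  have thz : th = 0 by apply: Sth; rewrite S1.
  have xE : north = x.
    have cC : C 1 = 1.
      rewrite -[RHS]C0; apply/esym; apply: (zero_derive_eq (f := C) ler01) => t _.
      by have := dC t; rewrite thz mulr0 mul0r.
    by apply: pt_eq; rewrite /= ?x1 ?x2// -C1 cC.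
  rewrite thz; apply: ereal_inf_lbound; exists (fun=> north).
    split => //; apply: piecewise_smooth_single; last by move=> _; exact: surface_north.
    by split; exact: smooth_cst.
  apply: arc_length_const => t.
  have -> : spd k (fun=> north) t = Num.sqrt (ip k (0, 0, 0) (0, 0, 0)) by rewrite /spd /vel !derive1E !derive_cst.
  by rewrite /ip /= !mulr0 !addr0 sqrtr0.
have e12 : e1 ^+ 2 + e2 ^+ 2 = 1 by rewrite /e1 /e2 !expr_div_n -mulrDl -rho2 mulfV// expf_neq0.
have sh : smooth3 h.
  have sl c : smooth (fun t => c * S t).
    have -> : (fun t => c * S t) = lincomb3 0 c 0 0 S S S by apply/funext => t; rewrite /lincomb3; ring.
    exact: smooth_lincomb3.
  by split; [exact: sl|exact: sl|exact: sC].
apply: ereal_inf_lbound; exists h.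
  split.
  - apply: piecewise_smooth_single => // t; split => /=; last by move=> k1; exact: Cp.
    by rewrite -[RHS](CS t) -[in RHS](mul1r (S t ^+ 2)) -e12; ring.
  - by rewrite /h S0 C0 !mulr0.
  - by apply: pt_eq; rewrite /h /= ?S1 ?C1// /e1 /e2 divfK.
apply: arc_length_const => t.
have dl c : derive1 (fun t => c * S t) t = c * (th * C t).
  rewrite derive1E; have D : has_deriv t (fun t => c * S t) (c * (th * C t)).
    by have := dS t => D; derive_ring.
  by have [_ ->] := D.
have dc : derive1 C t = - k * th * S t by rewrite derive1E; have [_ ->] := dC t.
rewrite /spd /vel /ip /h /= !dl dc.
rewrite (_ : _ + _ = th ^+ 2); first by rewrite sqrtr_sqr ger0_norm.
transitivity (th ^+ 2 * ((e1 ^+ 2 + e2 ^+ 2) * C t ^+ 2 + k ^+ 3 * S t ^+ 2)); first by ring.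
by rewrite e12 mul1r kk CS mulr1.
Qed.

Lemma dist_north_le k x : curvature k -> surface k x -> (k = 1 -> x.2 != -1) ->
  (dist k north x <= (radial k x)%:E)%E.
Proof.
move=> hk sx xS; set rho := Num.sqrt (x.1.1 ^+ 2 + x.1.2 ^+ 2).
have rho2 : rho ^+ 2 = x.1.1 ^+ 2 + x.1.2 ^+ 2 by rewrite sqr_sqrtr// addr_ge0 ?sqr_ge0.
have rho0 : 0 <= rho by rewrite sqrtr_ge0.
have kk := curvature_cube hk.
have := hk; rewrite !inE => /or3P[] /eqP kE.
- have th0 : 0 <= asinh rho.
    have s1 : 1 <= Num.sqrt (rho ^+ 2 + 1) by rewrite -[X in X <= _]sqrtr1 ler_wsqrtr// lerDr sqr_ge0.
    by rewrite /asinh ln_ge0//; lra.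
  have -> : radial k x = asinh rho.
    have k1 : (k == 1) = false by apply/negbTE/eqP => h; lra.
    have k0 : (k == 0) = false by apply/negbTE/eqP => h; lra.
    by rewrite /radial /AS k1 k0.
  have sr : sinh (asinh rho) = rho := asinhK rho.
  set th := asinh rho in th0 sr *.
  have z0 : 0 < x.2 by case: sx => _; apply; rewrite kE; lra.
  have x2 : x.2 ^+ 2 = 1 + rho ^+ 2 by case: sx => + _; rewrite kE rho2; lra.
  have eN t : expR (- th * t) = (expR (th * t))^-1 by rewrite mulNr expRN.
  have ep t : 0 < expR (th * t) by exact: expR_gt0.
  have csq t : (2^-1 * expR (th * t) + 2^-1 * expR (- th * t)) ^+ 2 + k * (2^-1 * expR (th * t) + - 2^-1 * expR (- th * t)) ^+ 2 = 1.
    by rewrite eN kE; field; exact: lt0r_neq0.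
  apply: (@dist_geodesic k x th (fun t => 2^-1 * expR (th * t) + - 2^-1 * expR (- th * t)) (fun t => 2^-1 * expR (th * t) + 2^-1 * expR (- th * t))) => //.
  + exact: smooth_expR.
  + exact: smooth_expR.
  + move=> t; have d1 := expR_derive th t; have d2 := expR_derive (- th) t.
    derive_ring.
  + move=> t; have d1 := expR_derive th t; have d2 := expR_derive (- th) t.
    apply: is_derive_eq; rewrite kE /GRing.scale/=; ring.
  + by rewrite !mulr0 expR0; ring.
  + by rewrite !mulr0 expR0; field.
  + by move=> _ t; rewrite addr_gt0// mulr_gt0// ?expR_gt0// invr_gt0.
  + by rewrite -/rho -sr /sinh !mulr1; ring.
  + have c0 : 0 < 2^-1 * expR (th * 1) + 2^-1 * expR (- th * 1) by rewrite addr_gt0// mulr_gt0// ?expR_gt0// invr_gt0.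
    have := csq 1; rewrite (_ : 2^-1 * expR (th * 1) + - 2^-1 * expR (- th * 1) = rho); last by rewrite -sr /sinh !mulr1; ring.
    by rewrite kE; nra.
  + by move=> e; rewrite /th (_ : rho = 0) ?asinh0// -sr /sinh -e !mulr1; ring.
- have -> : radial k x = rho by rewrite /radial kE eq_sym oner_eq0 /AS eq_sym oner_eq0 eqxx.
  apply: (@dist_geodesic k x rho (fun t => rho * t) (fun=> 1)) => //.
  + have -> : (fun t => rho * t) = lincomb3 0 rho 0 0 id id id by apply/funext => t; rewrite /lincomb3; ring.
    by apply: smooth_lincomb3; exact: smooth_id.
  + exact: smooth_cst.
  + by move=> t; rewrite kE oppr0 !mul0r; exact: is_derive_cst.
  + by rewrite mulr0.
  + by move=> t; rewrite kE mul0r addr0 expr1n.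
  + by rewrite mulr1.
  + by rewrite (surface0_height (x := x))// -kE.
  + by rewrite mulr1.
have [e _] := sx; have x2 : x.2 ^+ 2 = 1 - rho ^+ 2 by move: e; rewrite kE rho2; lra.
have zi : -1 <= x.2 <= 1 by have := sqr_ge0 rho => ?; apply/andP; split; nra.
have -> : radial k x = acos x.2 by rewrite /radial kE eqxx.
have s1 : sin (acos x.2) = rho by rewrite sin_acos// x2 opprB addrCA subrr addr0 sqrtr_sqr ger0_norm.
have c1 : cos (acos x.2) = x.2 by apply: acosK; rewrite in_itv.
set th := acos x.2 in s1 c1 *.
apply: (@dist_geodesic k x th (fun t => 0 * cos (th * t) + 1 * sin (th * t)) (fun t => 1 * cos (th * t) + 0 * sin (th * t))) => //.
- exact: acos_ge0.
- exact: smooth_trig.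
- exact: smooth_trig.
- move=> t; have [d1 d2] := trig_derive th t; derive_ring.
- move=> t; have [d1 d2] := trig_derive th t; apply: is_derive_eq; rewrite kE /GRing.scale/=; ring.
- by rewrite mulr0 sin0 mul0r mulr0 addr0.
- by rewrite mulr0 cos0 mul0r mulr1 addr0.
- by move=> t; rewrite kE !mul0r addr0 add0r !mul1r cos2Dsin2.
- by rewrite mul0r add0r mul1r mulr1.
- by rewrite mul0r addr0 mul1r mulr1.
- rewrite mul0r add0r mul1r mulr1 s1 => r0.
  have : x.2 ^+ 2 = 1 by rewrite x2 r0 expr0n subr0.
  move/eqP; rewrite sqrf_eq1 (negbTE (xS kE)) orbF => /eqP z1.
  by rewrite /th z1 acos1.
Qed.

Definition radial_sqd k (n : R) : R := if k == 1 then acos (1 - n / 2) else AS k (Num.sqrt (n - k * n ^+ 2 / 4)).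

Lemma radialE k x : curvature k -> surface k x -> radial k x = radial_sqd k (sqd k x north).
Proof.
move=> hk sx; have [zE ME] := north_coords hk sx; rewrite /radial /radial_sqd ME.
by case: eqP => [k1|//]; rewrite zE k1 mul1r.
Qed.

Lemma dist_sqd k P x : curvature k -> surface k P -> surface k x ->
  ((radial_sqd k (sqd k P x))%:E <= dist k P x)%E /\
  ((k = 1 -> sqd k P x < 4) -> (dist k P x <= (radial_sqd k (sqd k P x))%:E)%E).
Proof.
move=> hk sP sx.
have base y : surface k y -> ((radial_sqd k (sqd k y north))%:E <= dist k north y)%E /\
    ((k = 1 -> sqd k y north < 4) -> (dist k north y <= (radial_sqd k (sqd k y north))%:E)%E).
  move=> sy; rewrite -radialE//; split; first exact: dist_north_ge.
  move=> y4; apply: dist_north_le => // k1; have [-> _] := north_coords hk sy.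
  by have := y4 k1; rewrite k1 => h; apply/eqP => e; lra.
rewrite sqdC; have [PN|PN] := pselect (P = north); first by rewrite PN; exact: base.
have sN := surface_north k.
rewrite -(dist_refl hk sP sN PN) (refl_p hk sP sN PN).
rewrite -(refl_sqd hk sP sN PN x P) (refl_p hk sP sN PN); apply: base.
exact: (refl_surface hk sP sN PN).
Qed.

Definition circle_radius k (n : R) : R := Num.sqrt (n - k * n ^+ 2 / 4).

Lemma radial_sqd_AS k n : curvature k -> 0 <= n -> (k = 1 -> n <= 2) -> radial_sqd k n = AS k (circle_radius k n).
Proof.
move=> hk n0 n2; rewrite /radial_sqd /AS /circle_radius; case: eqP => // k1.
have {}n2 := n2 k1; have I1 : -1 <= 1 - n / 2 <= 1 by lra.
have := sin_acos I1; rewrite (_ : 1 - (1 - n / 2) ^+ 2 = n - k * n ^+ 2 / 4); last by rewrite k1; field.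
move=> <-; rewrite sinK// in_itv/=; have a0 := acos_ge0 I1; have p0 := pi_gt0 R.
apply/andP; split; first by lra.
have i1 : acos (1 - n / 2) \in `[0, pi] by rewrite in_itv/= a0 acos_lepi.
have i2 : pi / 2 \in `[0, pi :> R] by rewrite in_itv/=; lra.
by rewrite leNgt -ltr_cos// acosK ?in_itv//= cos_pihalf -leNgt; lra.
Qed.

Lemma asinh_inj : injective (@asinh R). Proof. exact: can_inj (@asinhK R). Qed.

Lemma chord_sq_gt0 k (n : R) : curvature k -> 0 < n -> (k = 1 -> n <= 2) -> 0 < n - k * n ^+ 2 / 4.
Proof.
by move=> + n0 n2; rewrite !inE => /or3P[] /eqP kE; rewrite kE; [nra|lra|have := n2 kE; nra].
Qed.

Lemma radial_sqd_inj k (n l : R) : curvature k -> 0 < n -> (k = 1 -> n <= 2) -> 0 <= l -> (k = 1 -> l <= 4) ->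
  radial_sqd k l = radial_sqd k n -> l = n.
Proof.
move=> hk n0 n2 l0 l4; rewrite /radial_sqd; case: eqP => k1.
  have {}l4 := l4 k1; have {}n2 := n2 k1 => /(congr1 cos); rewrite !acosK ?in_itv/=; [lra| |].
    by lra.
  by lra.
have k0 := curvature_le0 hk (introN eqP k1).
have h (r : R) : 0 <= r -> 0 <= r - k * r ^+ 2 / 4 by move=> r0; have := sqr_ge0 r; nra.
have n1 := ltW n0.
have sq : Num.sqrt (l - k * l ^+ 2 / 4) = Num.sqrt (n - k * n ^+ 2 / 4) -> l = n.
  move=> /(congr1 (fun r => r ^+ 2)); rewrite !sqr_sqrtr ?h// => e.
  apply/eqP; rewrite -subr_eq0; apply/eqP.
  have /eqP : (l - n) * (1 - k * (l + n) / 4) = 0 by move: e => /eqP; rewrite -subr_eq0 => /eqP <-; field.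
  by rewrite mulf_eq0 => /orP[/eqP //|/eqP e2]; exfalso; nra.
by rewrite /AS; case: eqP => // _; case: eqP => _ => [|/asinh_inj]; exact: sq.
Qed.

Lemma sqd_bounds k P x : curvature k -> surface k P -> surface k x -> 0 <= sqd k P x /\ (k = 1 -> sqd k P x <= 4).
Proof.
move=> hk sP sx; have [h _] := sqd_surface hk sP sx; split => // k1.
have [e1 _] := sP; have [e2 _] := sx; rewrite k1 in e1 e2 *.
move: P x e1 e2 {sP sx h} => [[p1 p2] p3] [[x1 x2] x3] /= e1 e2.
rewrite /sqd /ip /=; have := sqr_ge0 (p1 + x1); have := sqr_ge0 (p2 + x2); have := sqr_ge0 (p3 + x3); nra.
Qed.

Lemma circle_distE k P n : curvature k -> surface k P -> 0 < n -> (k = 1 -> n <= 2) ->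
  [set x | surface k x /\ sqd k P x = n] = [set x | surface k x /\ dist k P x = (AS k (circle_radius k n))%:E].
Proof.
move=> hk sP n0 n2; rewrite -(radial_sqd_AS hk (ltW n0) n2); apply/seteqP; split => x /= [sx e]; split => //.
  have [lo hi] := dist_sqd hk sP sx; rewrite e in lo hi; apply/eqP; rewrite eq_le lo andbT; apply: hi => k1.
  by have := n2 k1; lra.
have [lo hi] := dist_sqd hk sP sx; have [l0 l4] := sqd_bounds hk sP sx.
have le : radial_sqd k (sqd k P x) <= radial_sqd k n by rewrite -lee_fin -e.
(* At the antipode the lower bound for the distance is already pi, larger than the radius of any
   circle with n <= 2. *)
have lt4 : k = 1 -> sqd k P x < 4.
  move=> k1; have {}l4 := l4 k1; have {}n2 := n2 k1; rewrite lt_neqAle l4 andbT; apply/eqP => e4.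
  move: le; rewrite e4 /radial_sqd k1 eqxx (_ : 1 - 4 / 2 = -1); last by field.
  by rewrite acosN1 leNgt acos_ltpi//; lra.
apply: (radial_sqd_inj hk n0 n2 l0 l4).
have h := hi lt4; rewrite e !lee_fin in lo h; by apply/eqP; rewrite eq_le lo h.
Qed.

Lemma AS_circle_radius k n : curvature k -> 0 < n -> (k = 1 -> n <= 2) ->
  0 < AS k (circle_radius k n) /\ (k = 1 -> AS k (circle_radius k n) < pi).
Proof.
move=> hk n0 n2; have r0 : 0 < circle_radius k n by rewrite sqrtr_gt0 chord_sq_gt0.
rewrite -(radial_sqd_AS hk (ltW n0) n2) /radial_sqd; split => [|k1].
  case: eqP => [k1|k1]; first by have := n2 k1 => ?; rewrite acos_gt0//; lra.
  rewrite /AS; case: eqP => // _; case: eqP => // _; rewrite -/(circle_radius k n) /asinh ln_gt0//.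
  have : 1 <= Num.sqrt (circle_radius k n ^+ 2 + 1) by rewrite -[X in X <= _]sqrtr1 ler_wsqrtr// lerDr sqr_ge0.
  lra.
by rewrite k1 eqxx; have := n2 k1 => ?; rewrite acos_ltpi//; lra.
Qed.

(** * An explicit circle and its length *)

Section explicit_circle.
Variables (k n : R).
Hypotheses (hk : curvature k) (n0 : 0 < n) (n2 : k = 1 -> n <= 2).
Let rho := circle_radius k n.
Let rho0 : 0 < rho. Proof. by rewrite sqrtr_gt0 chord_sq_gt0. Qed.
Let rho2 : rho ^+ 2 = n - k * n ^+ 2 / 4. Proof. by rewrite sqr_sqrtr// ltW// chord_sq_gt0. Qed.

Definition circ (t : R) : pt := (rho * cos (2 * pi * t), rho * sin (2 * pi * t), 1 - k * n / 2).

Lemma circ_surface t : surface k (circ t).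
Proof.
split => /=.
  transitivity ((1 - k * n / 2) ^+ 2 + k * rho ^+ 2 * (cos (2 * pi * t) ^+ 2 + sin (2 * pi * t) ^+ 2)); first by ring.
  by rewrite cos2Dsin2 mulr1 rho2; field.
move=> k1; have k0 := curvature_le0 hk (introN eqP k1).
by have := mulr_le0_ge0 k0 (ltW n0); lra.
Qed.

Lemma circ_smooth : smooth3 circ.
Proof.
split; last exact: smooth_cst.
- have -> : (fun t => (circ t).1.1) = fun t => rho * cos (2 * pi * t) + 0 * sin (2 * pi * t).
    by apply/funext => t; rewrite /circ mul0r addr0.
  exact: smooth_trig.
- have -> : (fun t => (circ t).1.2) = fun t => 0 * cos (2 * pi * t) + rho * sin (2 * pi * t).
    by apply/funext => t; rewrite /circ mul0r add0r.
  exact: smooth_trig.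
Qed.

Lemma cos_sin_inj (s t : R) : 0 <= s < 1 -> 0 <= t < 1 -> cos (2 * pi * s) = cos (2 * pi * t) ->
  sin (2 * pi * s) = sin (2 * pi * t) -> s = t.
Proof.
have p0 := pi_gt0 R.
suff wl (x y : R) : 0 <= x -> x <= y -> y < 1 -> cos (2 * pi * x) = cos (2 * pi * y) ->
    sin (2 * pi * x) = sin (2 * pi * y) -> x = y.
  move=> /andP[s0 s1] /andP[t0 t1] ec es; have [st|ts] := leP s t; first exact: wl.
  by apply/esym; apply: wl => //; exact: ltW.
move=> {s t} x0 xy y1 ec es.
have c1 : cos (2 * pi * (y - x)) = 1.
  by rewrite mulrBr cosB ec es -!expr2 cos2Dsin2.
have i0 : (0 : R) \in `[0, pi] by rewrite in_itv/= lexx ltW.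
have [h|h] := leP (2 * pi * (y - x)) pi.
  have i1 : 2 * pi * (y - x) \in `[0, pi] by rewrite in_itv/= h andbT mulr_ge0 ?subr_ge0// mulr_ge0// ltW.
  have : ~~ (0 < 2 * pi * (y - x)) by rewrite -ltr_cos// c1 cos0 ltxx.
  by rewrite -leNgt pmulr_rle0 ?mulr_gt0//; lra.
have i1 : 2 * pi - 2 * pi * (y - x) \in `[0, pi].
  by rewrite in_itv/=; apply/andP; split; nra.
have c2 : cos (2 * pi - 2 * pi * (y - x)) = 1.
  have -> : 2 * pi - 2 * pi * (y - x) = - (2 * pi * (y - x)) + pi *+ 2 by rewrite mulr2n; ring.
  by rewrite cosD2pi cosN.
have : ~~ (0 < 2 * pi - 2 * pi * (y - x)) by rewrite -ltr_cos// c2 cos0 ltxx.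
by rewrite -leNgt; nra.
Qed.

Lemma circ_simple : simple_closed_curve k circ.
Proof.
split.
- exact: piecewise_smooth_single circ_smooth circ_surface.
- by rewrite /circ mulr0 mulr1 cos0 sin0 [2 * pi]mulr_natl cos2pi sin2pi.
- move=> s t; rewrite !in_itv/= => si ti [/(mulfI (lt0r_neq0 rho0)) ec /(mulfI (lt0r_neq0 rho0)) es].
  exact: cos_sin_inj.
Qed.

Lemma circ_length : arc_length k circ = (2 * pi * rho)%:E.
Proof.
have p0 := pi_gt0 R.
apply: arc_length_const => t; have [dc ds] := trig_derive (2 * pi) t.
have d1 : derive1 (fun t => (circ t).1.1) t = rho * (- (2 * pi) * sin (2 * pi * t)).
  have D : has_deriv t (fun t => (circ t).1.1) (rho * (- (2 * pi) * sin (2 * pi * t))).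
    by derive_ring.
  by rewrite derive1E; have [_ ->] := D.
have d2 : derive1 (fun t => (circ t).1.2) t = rho * (2 * pi * cos (2 * pi * t)).
  have D : has_deriv t (fun t => (circ t).1.2) (rho * (2 * pi * cos (2 * pi * t))).
    by derive_ring.
  by rewrite derive1E; have [_ ->] := D.
have d3 : derive1 (fun t => (circ t).2) t = 0 by rewrite derive1E derive_cst.
rewrite /spd /vel /ip /= d1 d2 d3 !mulr0 addr0.
rewrite (_ : _ + _ = (2 * pi * rho) ^+ 2 * (cos (2 * pi * t) ^+ 2 + sin (2 * pi * t) ^+ 2)); last by ring.
by rewrite cos2Dsin2 mulr1 sqrtr_sqr ger0_norm// mulr_ge0 ?ltW// mulr_gt0.
Qed.

Lemma circ_trace : trace circ = [set x | surface k x /\ sqd k north x = n].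
Proof.
have kk := curvature_cube hk.
apply/seteqP; split => [_ [t _ <-]|x [sx xn]].
  split; first exact: circ_surface.
  rewrite /sqd /ip /=.
  rewrite (_ : _ + _ = rho ^+ 2 * (cos (2 * pi * t) ^+ 2 + sin (2 * pi * t) ^+ 2) + k ^+ 3 * n ^+ 2 / 4); last by field.
  by rewrite cos2Dsin2 mulr1 rho2 kk; field.
have [zE ME] := north_coords hk sx; rewrite sqdC xn in zE ME; rewrite -rho2 in ME.
have cc : continuous (fun t : R => cos (2 * pi * t)).
  by move=> t; exact: is_derive_continuous (trig_derive (2 * pi) t).1.
have cs : continuous (fun t : R => sin (2 * pi * t)).
  by move=> t; exact: is_derive_continuous (trig_derive (2 * pi) t).2.
(* The topological lemma on loops supplies the angle of a given unit vector. *)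
have [|||||t t01 [e1 e2]] := @circle_loop_onto R _ _ cc cs _ _ _ _ (x.1.1 / rho) (x.1.2 / rho).
- by move=> t _; exact: cos2Dsin2.
- by rewrite mulr0 mulr1 cos0 [2 * pi]mulr_natl cos2pi.
- by rewrite mulr0 mulr1 sin0 [2 * pi]mulr_natl sin2pi.
- move=> s t s0 st t1 [ec es]; have : s = t.
    by apply: cos_sin_inj => //; rewrite ?s0 ?t1 ?(lt_trans st)// ?(le_trans s0 (ltW st)).
  by move=> e; move: st; rewrite e ltxx.
- by rewrite !expr_div_n -mulrDl ME mulfV// expf_neq0// lt0r_neq0.
exists t; first by rewrite /= in_itv.
apply: pt_eq; rewrite /= ?e1 ?e2 ?zE//; by rewrite mulrC divfK// lt0r_neq0.
Qed.

Lemma circle_curve P : surface k P -> exists2 g, simple_closed_curve k g &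
  trace g = [set x | surface k x /\ sqd k P x = n] /\ arc_length k g = (2 * pi * rho)%:E.
Proof.
move=> sP; have [PN|PN] := pselect (P = north).
  by exists circ; [exact: circ_simple|rewrite PN circ_trace circ_length].
have sN := surface_north k; have rr := refl_inv hk sP sN PN.
have [pc cl ci] := circ_simple.
exists (fun t => refl k P north (circ t)).
  split; [exact: (piecewise_smooth_refl hk sP sN PN)|by rewrite cl|].
  by move=> s t si ti /(congr1 (refl k P north)); rewrite !rr; exact: ci.
split; last by rewrite (arc_length_refl hk sP sN PN)// circ_length.
have -> : trace (fun t => refl k P north (circ t)) = refl k P north @` trace circ by rewrite /trace image_comp.
rewrite circ_trace; apply/seteqP; split => [_ [x [sx xn] <-]|x [sx xn]].
  split; first exact: (refl_surface hk sP sN PN).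
  by rewrite -{1}(refl_q hk sP sN PN) (refl_sqd hk sP sN PN).
exists (refl k P north x); last exact: rr.
split; first exact: (refl_surface hk sP sN PN).
by have := refl_sqd hk sP sN PN P x; rewrite (refl_p hk sP sN PN) => ->.
Qed.

End explicit_circle.

End distance.

(** * Area of a disc *)

Section caps.
Context {R : realType}.
Notation TR := (measurableTypeR R).
Local Notation pt := (R * R * R)%type.
Notation north := (@north R).

Let disc (r : R) : set (R * R) := [set z | z.1 ^+ 2 + z.2 ^+ 2 < r].

Lemma measurable_disc (r : R) : measurable (disc r : set (TR * TR)).
Proof.
rewrite (_ : disc r = setT `&` (fun q : TR * TR => q.1 ^+ 2 + q.2 ^+ 2 : TR) @^-1` `]-oo, r[%classic).
  exact: measurable_sum_sq.
by apply/seteqP; split => z /=; rewrite /disc/= in_itv/=; [|case].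
Qed.

(** On the line of slope m the variable s = (1 + m^2) x^2 runs from 0 to r on either half line,
    which gives (Phi r - Phi 0) / (1 + m^2); the integral over m contributes pi. *)
Lemma integral_disc (phi Phi : R -> R) (r : R) : 0 < r -> continuous phi -> (forall s, 0 <= phi s) ->
  (forall s : R, 0 <= s -> has_deriv s Phi (phi s)) -> Phi 0 <= Phi r ->
  (\int[lam2]_(z in disc r) (phi (z.1 ^+ 2 + z.2 ^+ 2))%:E = (pi * (Phi r - Phi 0))%:E)%E.
Proof.
rewrite -subr_ge0 => r0 cphi phi0 dPhi P01.
have mD := measurable_disc r.
have mphi : measurable_fun setT (phi : TR -> TR) by exact: continuous_measurable_fun.
pose G (z : TR * TR) : TR := \1_(disc r) z * phi (z.1 ^+ 2 + z.2 ^+ 2).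
have mG : measurable_fun setT G.
  by apply: measurable_funM => //; have := measurableT_comp mphi (@measurable_sum_sq R).
have G0 z : 0 <= G z by rewrite mulr_ge0.
transitivity (\int[lam2]_z (G z)%:E)%E.
  rewrite integral_mkcond; apply: eq_integral => z _; rewrite patchE /G indicE.
  by case: ifP => _; rewrite ?mul1r ?mul0r.
rewrite ge0_integral_slope; last 2 first.
- exact/measurable_EFinP.
- by move=> z; rewrite lee_fin.
transitivity (\int[lam]_m ((Phi r - Phi 0)%:E * ((1 + m ^+ 2)^-1)%:E))%E; last first.
  rewrite ge0_integralZl//; last 2 first.
  - apply/measurable_EFinP; apply: continuous_measurable_fun; apply: contV => [|m]; first by ccont.
    by rewrite lt0r_neq0// ltr_pwDl// sqr_ge0.
  - by move=> m _; rewrite lee_fin invr_ge0 addr_ge0 ?sqr_ge0.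
  by rewrite integral_oneDsqr -EFinM mulrC.
apply: eq_integral => m _; pose q := 1 + m ^+ 2.
have q0 : 0 < q by rewrite /q ltr_pwDl// sqr_ge0.
pose rho := Num.sqrt (r / q).
have rho0 : 0 < rho by rewrite sqrtr_gt0 divr_gt0.
have rho2 : q * rho ^+ 2 = r by rewrite sqr_sqrtr ?divr_ge0 ?ltW// mulrC divfK// lt0r_neq0.
have sE (x : R) : x ^+ 2 + (m * x) ^+ 2 = q * x ^+ 2 by rewrite /q; ring.
have GE (x : R) : 0 < x -> G (x, m * x) = \1_(`]-oo, rho[) x * phi (q * x ^+ 2) /\ G (- x, m * - x) = G (x, m * x).
  have dE (z : R * R) : \1_(disc r) z = ((z.1 ^+ 2 + z.2 ^+ 2 < r)%R)%:R :> R.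
    rewrite indicE (_ : (z \in disc r) = (z.1 ^+ 2 + z.2 ^+ 2 < r))//.
    by apply/idP/idP; rewrite inE.
  move=> x0; rewrite /G !dE /= !sE sqrrN; split => //; rewrite indicE mem_setE in_itv/=.
  by rewrite (_ : (q * x ^+ 2 < r) = (x < rho))// -{1}rho2 ltr_pM2l// ltr_pXn2r// nnegrE ltW.
rewrite ge0_integral_halves; last 2 first.
- have mm : measurable_fun setT (fun x : TR => (x, m * x) : TR * TR).
    by apply/measurable_fun_pair => //=; exact: measurable_funM.
  apply: emeasurable_funM; apply/measurable_EFinP; last exact: (measurableT_comp mG mm).
  by apply: continuous_measurable_fun; apply: cont_norm => x; exact: cvg_id.
- by move=> x; rewrite -EFinM lee_fin mulr_ge0.
transitivity (\int[lam]_(x in `]0%R, rho[) (2 * x * phi (q * x ^+ 2))%:E)%E.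
  rewrite integral_mkcond [RHS]integral_mkcond; apply: eq_integral => x _.
  rewrite !patchE !mem_setE !in_itv/= andbT; case: ifPn => //= x0.
  have [-> ->] := GE x x0; rewrite normrN -!EFinM -EFinD gtr0_norm// indicE mem_setE in_itv/=.
  case: ifPn => _; first by rewrite mul1r; congr _%:E; ring.
  by rewrite mul0r mulr0 addr0.
have cl : continuous (fun x : R => 2 * x * phi (q * x ^+ 2)).
  apply: contM; first by move=> x; apply: cvgM; [exact: cvg_cst|exact: cvg_id].
  by apply: (cont_at cphi); ccont.
have dl (x : R) : has_deriv x (fun x : R => Phi (q * x ^+ 2) / q) (2 * x * phi (q * x ^+ 2)).
  have D1 : has_deriv x (fun x : R => q * x ^+ 2) (q * (2 * x)).
    by derive_ring.
  have D2 := der_comp (l := fun x : R => q * x ^+ 2) (dPhi _ (mulr_ge0 (ltW q0) (sqr_ge0 x))) D1.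
  by apply: is_derive_eq; rewrite /GRing.scale/=; field; rewrite lt0r_neq0.
rewrite -(@integral_itv_bndoo R 0 rho _ true false); last first.
  by apply/measurable_EFinP/measurable_funTS; apply: continuous_measurable_fun; exact: cl.
have := FTC_Rintegral (ltW rho0) dl cl.
rewrite rho2 expr0n/= mulr0 -mulrBl -EFinM => <-; rewrite /Rintegral fineK//.
by apply: integrable_fin_num => //; apply: cont_integrable_itv; exact: cl.
Qed.

(** The primitive 2 s / (1 + sqrt (1 - k s)) involves no division by k, so it covers k = 0 and k =
    -1 together. *)
Lemma integral_dens_vertical k (hk : curvature k) (k1 : k != 1) r : 0 < r ->
  (\int[lam2]_(z in disc r) (dens (vertical_chart hk k1) z)%:E = (pi * (2 * r / (1 + Num.sqrt (1 - k * r))))%:E)%E.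
Proof.
move=> r0; have k0 := curvature_le0 hk k1.
have den (s : R) : 0 <= s -> 0 < 1 - k * s by move=> s0; have := mulr_le0_ge0 k0 s0; lra.
pose phi (s : R) := (Num.sqrt (1 - k * `|s|))^-1; pose Phi (s : R) := 2 * s / (1 + Num.sqrt (1 - k * s)).
have h1 s : 0 < 1 + Num.sqrt (1 - k * s) by rewrite ltr_pwDl// sqrtr_ge0.
have -> : 2 * r / (1 + Num.sqrt (1 - k * r)) = Phi r - Phi 0 by rewrite /Phi mulr0 mul0r subr0.
transitivity (\int[lam2]_(z in disc r) (phi (z.1 ^+ 2 + z.2 ^+ 2))%:E)%E; last apply: (@integral_disc phi Phi r r0).
- apply: eq_integral => z _; rewrite /phi /= /height ger0_norm// addr_ge0 ?sqr_ge0//.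
- apply: contV => [|s]; last by rewrite lt0r_neq0// sqrtr_gt0 den.
  apply: (cont_at (f := Num.sqrt)); first exact: sqrt_continuous.
  apply: contB; first by move=> s; exact: cvg_cst.
  apply: contM; first by move=> s; exact: cvg_cst.
  by apply: cont_norm => s; exact: cvg_id.
- by move=> s; rewrite invr_ge0 sqrtr_ge0.
- move=> s s0; rewrite /phi ger0_norm//.
  have D1 : has_deriv s (fun s => 1 - k * s) (- k) by derive_ring.
  have D2 := der_comp (l := fun s => 1 - k * s) (is_derive_sqrt (den s s0)) D1.
  set h := Num.sqrt (1 - k * s) in D2 *.
  have hp : 0 < h by rewrite sqrtr_gt0 den.
  have h2 : k * s = 1 - h ^+ 2 by rewrite sqr_sqrtr ?ltW ?den//; ring.
  have D3 : has_deriv s (fun s => 1 + Num.sqrt (1 - k * s)) ((2 * h)^-1 * - k).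
    by apply: (der_ext (is_deriveD (is_derive_cst (1 : R) s 1) D2)) => //; rewrite add0r.
  have D4 := derivative_inv (f := fun s => 1 + Num.sqrt (1 - k * s)) (lt0r_neq0 (h1 s)) D3.
  apply: is_derive_eq; rewrite -/h /GRing.scale/=.
  transitivity ((2 * h * (1 + h) + k * s) / (h * (1 + h) ^+ 2)).
    by field; rewrite !lt0r_neq0//= -/h ltr_pwDl// ltW.
  by rewrite h2; field; rewrite !lt0r_neq0//= -/h ltr_pwDl// ltW.
- by rewrite /Phi mulr0 mul0r divr_ge0 ?mulr_ge0 ?ltW.
Qed.

Lemma integral_dens_stereo r : 0 < r ->
  (\int[lam2]_(z in disc r) (dens (stereo_chart (R := R)) z)%:E = (pi * (4 * r / (1 + r)))%:E)%E.
Proof.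
move=> r0; pose phi (s : R) := 4 * (1 + `|s|)^-1 ^+ 2; pose Phi (s : R) := 4 - 4 / (1 + s).
have -> : 4 * r / (1 + r) = Phi r - Phi 0 by rewrite /Phi; field; rewrite lt0r_neq0//; lra.
transitivity (\int[lam2]_(z in disc r) (phi (z.1 ^+ 2 + z.2 ^+ 2))%:E)%E; last apply: (@integral_disc phi Phi r r0).
- by apply: eq_integral => z _; rewrite /phi /= ger0_norm// addr_ge0 ?sqr_ge0//.
- apply: contM; first by move=> s; exact: cvg_cst.
  have ci : continuous (fun s : R => (1 + `|s|)^-1).
    apply: contV => [|s]; last by rewrite lt0r_neq0// ltr_pwDl.
    apply: contD; first by move=> s; exact: cvg_cst.
    by apply: cont_norm => s; exact: cvg_id.
  by ccont.
- by move=> s; rewrite mulr_ge0 ?sqr_ge0.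
- move=> s s0; have p : 0 < 1 + s by lra.
  have -> : phi s = 4 * (1 + s)^-1 ^+ 2 by rewrite /phi ger0_norm.
  have D1 : has_deriv s (fun s => 1 + s) 1.
    by apply: (der_ext (is_deriveD (is_derive_cst (1 : R) s 1) (is_derive_id s 1))) => //; rewrite add0r.
  have D2 := derivative_inv (f := fun s => 1 + s) (lt0r_neq0 p) D1.
  by apply: is_derive_eq; rewrite /GRing.scale/=; field; rewrite lt0r_neq0.
- by rewrite /Phi addr0 divr1 subrr subr_ge0 ler_pdivrMr; lra.
Qed.

Section component.
Variables (k n : R) (c : chart k).
Hypotheses (hk : curvature k) (n0 : 0 < n) (n2 : k = 1 -> n <= 2) (cc : chart_inverse c).
Let C : set pt := [set x | surface k x /\ sqd k north x = n].
Let D := connected_component (surface k `\` C) north.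
Let r := (n - k * n ^+ 2 / 4) / (1 + slant k * (1 - k * n / 2)) ^+ 2.

Lemma cap_disc z : sqd k north (emb c z) < n <-> disc r z.
Proof.
have sz := emb_surface c z; have [zE ME] := north_coords hk sz; have [v0 v4] := sqd_bounds hk sz (surface_north k).
have sl := emb_slant cc z; have ze := zt_emb cc z.
rewrite sqdC; move: (emb c z) zE ME v0 v4 sl ze {sz} => x; set v := sqd k x north => zE ME v0 v4 sl ze.
have zz : z.1 ^+ 2 + z.2 ^+ 2 = (v - k * v ^+ 2 / 4) / (1 + slant k * (1 - k * v / 2)) ^+ 2.
  by have e1 := congr1 fst ze; have e2 := congr1 snd ze; rewrite /zt /= in e1 e2; rewrite -e1 -e2 -zE -ME; field.
rewrite /disc /= zz /r /slant; have [k1|k1] := eqVneq k 1; last first.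
  have k0 := curvature_le0 hk k1.
  rewrite !mul0r !addr0 !expr1n !invr1 !mulr1 -subr_gt0 -[X in _ <-> is_true X]subr_gt0.
  rewrite (_ : _ - (v - _) = (n - v) * (1 - k * (n + v) / 4)); last by field.
  by rewrite pmulr_lgt0//; have := mulr_le0_ge0 k0 (addr_ge0 (ltW n0) v0); lra.
have v4' : 4 - v != 0 by move: sl; rewrite zE /slant k1 eqxx !mul1r => h; apply/eqP => e; move/eqP: h; apply; lra.
have {}v4 : 0 < 4 - v by rewrite lt_def v4' subr_ge0 v4.
have m2 := n2 k1; have n4 : 0 < 4 - n by lra.
have E (w : R) : 4 - w != 0 -> (w - k * w ^+ 2 / 4) / (1 + 1 * (1 - k * w / 2)) ^+ 2 = 4 / (4 - w) - 1.
  by move=> w4; rewrite k1; field; apply/eqP => e; move/eqP: w4; apply; lra.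
rewrite !E ?lt0r_neq0// ltrD2r ltr_pM2l// ltf_pV2 ?posrE//; split; lra.
Qed.

Lemma emb_origin : emb c (0, 0) = north.
Proof.
rewrite -(emb_zt cc (surface_north k)); first by rewrite /zt /= !mul0r.
by rewrite /slant /=; case: ifP => _; rewrite ?mul0r ?mulr1 ?addr0 ?oner_eq0// -natrD pnatr_eq0.
Qed.

(** A connected set containing [north] and off the circle cannot pass the value n of the squared
    chord; conversely, radial segments join the points of the disc to its centre. *)
Lemma cap_component : emb c @^-1` D = disc r.
Proof.
have sqd0 : sqd k north north = 0 by rewrite /sqd /ip /= !subrr !mulr0 !addr0.
apply/seteqP; split => z.
  rewrite -cap_disc => Dz; rewrite ltNge; apply/negP => nz.
  have cD : connected (sqd k north @` D).
    apply: connected_continuous_connected; first exact: component_connected.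
    apply: continuous_subspaceT.
    have [c11 c12 c2] := @continuous_coords R.
    by rewrite /sqd /ip /=; ccont.
  move/connected_intervalP: cD => iD.
  have : (sqd k north @` D) n.
    apply: (iD 0 (sqd k north (emb c z))).
    - exists north => //; apply: connected_component_refl; split; first exact: surface_north.
      by move=> []; rewrite sqd0 => _ e; move: n0; rewrite -e ltxx.
    - by exists (emb c z).
    - by rewrite (ltW n0).
  move=> [x Dx xn]; have [sx] := @connected_component_sub _ _ _ _ Dx; by apply.
move=> zr; rewrite /preimage/=; apply: (@component_connect R k c C north (seg (0, 0) z @` `[0, 1]) (0, 0) z).
- by apply: connected_continuous_connected; [exact: segment_connected|exact: continuous_subspaceT (@continuous_seg R (0, 0) z)].
- move=> _ [t /= t01 <-] [_ e]; suff : sqd k north (emb c (seg (0, 0) z t)) < n by rewrite e ltxx.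
  apply/cap_disc; move: zr; rewrite /disc/= /seg /= !subr0 !add0r; apply: le_lt_trans.
  move: t01; rewrite in_itv/= => /andP[t0 t1].
  rewrite !exprMn -mulrDr ler_piMl ?addr_ge0 ?sqr_ge0// expr_le1//.
- by exists 0; rewrite /= ?in_itv/= ?lexx ?ler01// /seg !mul0r !add0r.
- by exists 1; rewrite /= ?in_itv/= ?lexx ?ler01// /seg !mul1r !subr0 !add0r; case: (z).
- rewrite emb_origin; apply: connected_component_refl; split; first exact: surface_north.
  by move=> []; rewrite sqd0 => _ e; move: n0; rewrite -e ltxx.
Qed.

End component.

(** Archimedes' formula, valid for all three curvatures: the area of a cap is pi times the squared
    chord from its centre to its rim. *)
Lemma circle_encloses k n : curvature k -> 0 < n -> (k = 1 -> n <= 2) ->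
  encloses k [set x | surface k x /\ sqd k north x = n] (pi * n).
Proof.
move=> hk n0 n2; exists north.
  split; first exact: surface_north.
  by move=> []; rewrite /sqd /ip /= !subrr !mulr0 !addr0 => _ e; move: n0; rewrite -e ltxx.
set C := [set x | _]; set D := connected_component _ _.
have DS : D `<=` surface k by move=> x /(@connected_component_sub _ _ _ _)[].
have [k1|k1] := eqVneq k 1.
  split => // ; rewrite /D /C; move: hk n2 {C D DS}; rewrite k1 => h1 /(_ erefl) n2.
  have cE := cap_component h1 n0 (fun=> n2) (@stereo_inverse R).
  rewrite area_stereo; last by rewrite cE; exact: measurable_disc.
  transitivity (\int[lam2]_(z in disc (n / (4 - n))) (dens (stereo_chart (R := R)) z)%:E)%E; last first.
    by rewrite integral_dens_stereo ?divr_gt0//; [congr (_ * _)%:E; field; apply/andP; split; apply/eqP; lra|lra].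
  have rE : (n - 1 * n ^+ 2 / 4) / (1 + slant 1 * (1 - 1 * n / 2)) ^+ 2 = n / (4 - n).
    by rewrite /slant eqxx; field; apply/eqP; lra.
  rewrite -rE -cE [RHS]integral_mkcond; apply: eq_integral => z _.
  rewrite patchE indicE; case: ifPn => [/set_mem Dz|Dz]; first by rewrite mem_set// mul1r.
  by rewrite memNset ?mul0r// => h; move/negP: Dz; apply; rewrite inE.
have k0 := curvature_le0 hk k1.
have cE := cap_component hk n0 n2 (vertical_inverse hk k1).
have sl : slant k = 0 by rewrite /slant (negbTE k1).
have r0 := chord_sq_gt0 hk n0 n2; set s := n - _ in r0.
rewrite sl mul0r addr0 expr1n invr1 mulr1 -/s in cE.
split => [_|].
  exists (emb (vertical_chart hk k1) @` square (1 + s)); last first.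
    have cK : compact (emb (vertical_chart hk k1) @` square (1 + s)).
      by apply: continuous_compact; [exact: continuous_subspaceT (@continuous_emb R k _)|exact: compact_square].
    by split => //; apply: compact_closed => //; exact: norm_hausdorff.
  move=> x Dx; exists (zt k x); last by rewrite (emb_zt (vertical_inverse hk k1)) ?sl ?mul0r ?addr0 ?oner_eq0//; exact: DS.
  have : (emb (vertical_chart hk k1) @^-1` D) (zt k x).
    by rewrite /preimage/= (emb_zt (vertical_inverse hk k1)) ?sl ?mul0r ?addr0 ?oner_eq0//; exact: DS.
  rewrite cE; move: (zt k x) => w; rewrite /disc/= => h.
  have [h1 h2] : w.1 ^+ 2 < s /\ w.2 ^+ 2 < s by have := sqr_ge0 w.1; have := sqr_ge0 w.2; lra.
  by split; rewrite ler_norml; apply/andP; split; nra.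
rewrite (area_vertical hk k1 DS) cE integral_dens_vertical//.
have -> : Num.sqrt (1 - k * s) = 1 - k * n / 2.
  rewrite (_ : 1 - k * s = (1 - k * n / 2) ^+ 2); last by rewrite /s; field.
  by rewrite sqrtr_sqr ger0_norm//; have := mulr_le0_ge0 k0 (ltW n0); lra.
by congr (_ * _)%:E; rewrite /s; field; apply/eqP; have := mulr_le0_ge0 k0 (ltW n0); lra.
Qed.

End caps.

(** * Minimizers *)

Section minimizers.
Context {R : realType}.
Local Notation pt := (R * R * R)%type.
Notation north := (@north R).

Lemma arc_length_ge0 (k : R) (g : R -> pt) : (0 <= arc_length k g)%E.
Proof. by apply: integral_ge0 => t _; rewrite lee_fin sqrtr_ge0. Qed.

Lemma isoperimetric_curve (k B : R) (g : R -> pt) : curvature k -> piecewise_smooth k g ->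
  encloses k (trace g) B -> exists2 L : R, arc_length k g = L%:E & Num.sqrt (B * (4 * pi - k * B)) <= L.
Proof.
move=> hk pg eB; have [m [a [b [H cp]]]] := piecewise_smoothP pg.
have gL := arc_length_pieces cp; exists (pieces_length k m a b H); first exact: gL.
have [le _] := isoperimetric hk cp eB.
have L0 : 0 <= pieces_length k m a b H by rewrite -lee_fin -[X in (_ <= X)%E]gL; exact: arc_length_ge0.
by rewrite -[leRHS]ger0_norm// -sqrtr_sqr ler_wsqrtr.
Qed.

Section sums.
Variable k : R.
Hypothesis hk : curvature k.
Let h (a : R) := Num.sqrt (a * (4 * pi - k * a)).

Lemma area_deficit_gt0 (a : R) : 0 < a -> (k = 1 -> a <= 2 * pi) -> 0 < 4 * pi - k * a.
Proof.
by have := pi_gt0 R => p0 a0; move: hk; rewrite !inE => /or3P[] /eqP -> => [_|_|/(_ erefl)]; lra.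
Qed.

(** After squaring, the claim is h a h b + k a b > 0. For k = -1 it follows from h(a)^2 h(b)^2 - a^2
    b^2 = 4 pi a b (4 pi + a + b). *)
Lemma sqrt_area_add (a b : R) : 0 < a -> 0 < b -> (k = 1 -> a + b <= 2 * pi) -> h (a + b) < h a + h b.
Proof.
move=> a0 b0 ab; have p0 := pi_gt0 R.
have f0 := area_deficit_gt0.
have a1 : k = 1 -> a <= 2 * pi by move/ab; lra.
have b1 : k = 1 -> b <= 2 * pi by move/ab; lra.
have fa := f0 a a0 a1; have fb := f0 b b0 b1; have fab := f0 _ (addr_gt0 a0 b0) ab.
have ha : 0 < h a by rewrite sqrtr_gt0 mulr_gt0.
have hb : 0 < h b by rewrite sqrtr_gt0 mulr_gt0.
have ha2 : h a ^+ 2 = a * (4 * pi - k * a) by rewrite sqr_sqrtr// ltW// mulr_gt0.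
have hb2 : h b ^+ 2 = b * (4 * pi - k * b) by rewrite sqr_sqrtr// ltW// mulr_gt0.
rewrite -[ltRHS]ger0_norm ?addr_ge0 ?ltW// -sqrtr_sqr ltr_sqrt ?exprn_gt0 ?addr_gt0//.
rewrite sqrrD ha2 hb2 -subr_gt0.
rewrite (_ : _ - _ = 2 * (h a * h b + k * a * b)); last by rewrite -mulr_natl; ring.
rewrite pmulr_rgt0//; have hab := mulr_gt0 ha hb; have := mulr_gt0 a0 b0 => ab0.
move: (hk); rewrite !inE => /or3P[] /eqP kE; rewrite kE; [|lra|lra].
suff : a * b < h a * h b by lra.
rewrite -(@ltr_pXn2r _ 2)// ?nnegrE ?ltW// [in ltRHS]exprMn ha2 hb2 kE.
rewrite -subr_gt0 (_ : _ - _ = 4 * pi * (a * b) * (4 * pi + a + b)); last by ring.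
by rewrite !mulr_gt0// !addr_gt0// mulr_gt0.
Qed.

Lemma sqrt_area_sum n (a : 'I_n.+1 -> R) : (forall i, 0 < a i) -> (k = 1 -> \sum_i a i <= 2 * pi) ->
  h (\sum_i a i) <= \sum_i h (a i) /\ ((0 < n)%N -> h (\sum_i a i) < \sum_i h (a i)).
Proof.
elim: n a => [|n IH] a a0 a1; first by rewrite !big_ord1.
have s0 : 0 < \sum_(i < n.+1) a (lift ord0 i).
  by rewrite big_ord_recl ltr_wpDr// sumr_ge0// => i _; exact: ltW.
rewrite !(big_ord_recl n.+1).
have [|k1|le _] := IH (fun i => a (lift ord0 i)); first by move=> i; exact: a0.
  by have := a1 k1; rewrite (big_ord_recl n.+1); have := a0 ord0; lra.
have lt : h (a ord0 + \sum_(i < n.+1) a (lift ord0 i)) < h (a ord0) + \sum_(i < n.+1) h (a (lift ord0 i)).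
  apply: lt_le_trans (_ : h (a ord0) + h (\sum_(i < n.+1) a (lift ord0 i)) <= _); last by rewrite lerD2l.
  by apply: sqrt_area_add => // k1; have := a1 k1; rewrite big_ord_recl.
by split => // ; exact: ltW.
Qed.

End sums.

Section fixed_area.
Variables (k A : R).
Hypotheses (hk : curvature k) (A0 : 0 < A) (A1 : k = 1 -> A <= 2 * pi).
Let l := Num.sqrt (A * (4 * pi - k * A)).

Lemma perimeter_bound (C : multicurve k) : encloses_total A C ->
  (l%:E <= perimeter C)%E /\ ((1 < ncomp C)%N -> (l%:E < perimeter C)%E).
Proof.
rewrite /encloses_total /perimeter; case: C => [[//|n] /= n0 g gP _] [a [aP aA]].
have bound i : exists2 L, arc_length k (g i) = L%:E & Num.sqrt (a i * (4 * pi - k * a i)) <= L.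
  by have [pg _ _] := gP i; apply: isoperimetric_curve => //; have [] := aP i.
have [le lt] := @sqrt_area_sum k hk n a (fun i => (aP i).1) (fun k1 => eq_ind_r (fun s => s <= _) (A1 k1) aA).
pose L i := fine (arc_length k (g i)).
have LE i : arc_length k (g i) = (L i)%:E by rewrite /L; have [x -> _] := bound i.
have hL i : Num.sqrt (a i * (4 * pi - k * a i)) <= L i by rewrite /L; have [x -> ?] := bound i.
rewrite (eq_bigr (fun i => (L i)%:E)) ?sumEFin ?lee_fin ?lte_fin; last by move=> i _; exact: LE.
have sL : \sum_i Num.sqrt (a i * (4 * pi - k * a i)) <= \sum_i L i by exact: ler_sum.
rewrite aA in le lt; split; first exact: le_trans le sL.
by move=> n1; apply: lt_le_trans sL; exact: lt.
Qed.

Definition single (g : R -> pt) (gP : simple_closed_curve k g) : multicurve k.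
Proof.
apply: (@Multicurve R k 1 isT (fun=> g) (fun=> gP)) => i j; by rewrite !ord1 eqxx.
Defined.

(** By [circle_encloses], the squared chord of a circle that encloses area [A]. *)
Let n := A / pi.
Let n_gt0 : 0 < n. Proof. by rewrite divr_gt0// pi_gt0. Qed.
Let n_le2 : k = 1 -> n <= 2. Proof. by move/A1; rewrite ler_pdivrMr// pi_gt0. Qed.
Let nr : 2 * pi * circle_radius k n = l.
Proof.
have p0 := pi_gt0 R; rewrite -[2 * pi]ger0_norm ?mulr_ge0 ?ltW// -sqrtr_sqr -sqrtrM ?sqr_ge0//.
by rewrite /l /n; congr Num.sqrt; move: pi p0 => p p0; field; rewrite lt0r_neq0.
Qed.

Lemma minimizer_exists : exists C : multicurve k, [/\ encloses_total A C, perimeter C = l%:E & is_minimizer A C].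
Proof.
have eC : encloses_total A (single (circ_simple hk n_gt0 n_le2)).
  exists (fun=> A); split; last by rewrite big_ord1.
  move=> i; split => //=; rewrite (circ_trace hk n_gt0 n_le2).
  by rewrite (_ : A = pi * n); [exact: circle_encloses|rewrite /n mulrC divfK// lt0r_neq0// pi_gt0].
have pC : perimeter (single (circ_simple hk n_gt0 n_le2)) = l%:E.
  by rewrite /perimeter big_ord1 /= (circ_length hk n_gt0 n_le2) nr.
eexists; split; [exact: eC|exact: pC|split => // D eD; rewrite pC; exact: (perimeter_bound eD).1].
Qed.

Lemma minimizer_circle (C : multicurve k) : is_minimizer A C -> ncomp C = 1%N /\
  exists P n0, [/\ surface k P, 0 < n0, k = 1 -> n0 <= 2, circle_radius k n0 = l / (2 * pi) &
    carrier C = [set x | surface k x /\ sqd k P x = n0]].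
Proof.
have p0 := pi_gt0 R.
have f0 : 0 <= A * (4 * pi - k * A) by apply/ltW/mulr_gt0 => //; exact: area_deficit_gt0.
move=> [eC minC]; have [D [eD pD _]] := minimizer_exists.
have := minC D eD; rewrite pD => pC.
have [_ lt1] := perimeter_bound eC.
have C1 : ncomp C = 1%N.
  apply/eqP; rewrite eqn_leq ncomp_gt0 andbT leqNgt; apply/negP => /lt1.
  by rewrite ltNge pC.
split => //; move: eC pC {minC lt1}; rewrite /encloses_total /perimeter /carrier.
case: C C1 => [N /= N0 g gP dis] N1; subst N => -[a [aP aA]]; rewrite big_ord1 => gl.
have {}aA : a ord0 = A by rewrite -aA big_ord1.
have [_ eg] := aP ord0; rewrite aA in eg; have sg := gP ord0.
have -> : \bigcup_(i in [set: 'I_1]) trace (g i) = trace (g ord0).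
  by apply/seteqP; split => [x [i _]|x tx]; [rewrite ord1|exists ord0].
have [pg _ _] := sg; have [m [b [c [H cp]]]] := piecewise_smoothP pg.
have gL := arc_length_pieces cp; rewrite gL lee_fin in gl.
have [_ eq] := isoperimetric hk cp eg.
have L0 : 0 <= pieces_length k m b c H by rewrite -lee_fin -[X in (_ <= X)%E]gL; exact: arc_length_ge0.
have {}eq : conformal_pairs k m b c H.
  by apply: eq; rewrite -[leRHS]sqr_sqrtr// ler_sqr// nnegrE sqrtr_ge0.
have [P [n0 [sP n00 n02 tE len]]] := conformal_circle hk sg cp eq gL.
exists P, n0; split => //; rewrite -/(circle_radius k n0) in len.
(* The explicit circle with this trace encloses [A] as well, so its length is at least [l]; by
   [conformal_circle] it is at most the length of the minimizer, hence at most [l]. This determines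
   the radius. *)
have [g' [pg' _ _] [tE' gL']] := circle_curve hk n00 n02 sP.
have [L' + le'] := isoperimetric_curve hk pg' (eq_ind _ (fun T => encloses k T A) eg _ (etrans tE (esym tE'))).
rewrite gL' => -[E]; rewrite -E in le'.
have -> : l = 2 * pi * circle_radius k n0 by apply/eqP; rewrite eq_le le' (le_trans len).
by rewrite mulrAC mulfV ?mul1r// lt0r_neq0// mulr_gt0.
Qed.

End fixed_area.

Lemma congruent_circles (k : R) (P Q : pt) (r : \bar R) : curvature k -> surface k P -> surface k Q ->
  congruent k [set x | surface k x /\ dist k P x = r] [set x | surface k x /\ dist k Q x = r].
Proof.
move=> hk sP sQ; have [->|PQ] := pselect (P = Q).
  exists id; last by rewrite image_id.
  by split => //; split => // x sx; exists x.
have rp := refl_p hk sP sQ PQ; have rr := refl_inv hk sP sQ PQ.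
exists (refl k P Q); first exact: refl_isometry.
apply/seteqP; split => [_ [x [sx dx] <-]|x [sx dx]].
  by split; [exact: refl_surface|rewrite -{1}rp dist_refl].
exists (refl k P Q x); last exact: rr.
by split; [exact: refl_surface|rewrite -(dist_refl hk sP sQ PQ) rp rr].
Qed.

End minimizers.

Theorem corollary3 (R : realType) (k : R) (hk : k \in [:: -1; 0; 1])
    (A : R) (hA0 : 0 < A) (hA1 : k = 1 -> A <= 2 * pi) :
  [/\ exists C : multicurve k, is_minimizer A C,
      forall C D : multicurve k, is_minimizer A C -> is_minimizer A D ->
        congruent k (carrier C) (carrier D)
    & forall C : multicurve k, is_minimizer A C ->
        ncomp C = 1%N /\
        is_circle k (AS k (Num.sqrt (A * (4 * pi - k * A)) / (2 * pi)))
          (carrier C)].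
Proof.
split.
- by have [C [_ _ mC]] := minimizer_exists hk hA0 hA1; exists C.
- move=> C D /(minimizer_circle hk hA0 hA1)[_ [P [n [sP n0 n2 nr ->]]]].
  move=> /(minimizer_circle hk hA0 hA1)[_ [Q [n' [sQ n'0 n'2 n'r ->]]]].
  by rewrite !circle_distE// nr n'r; exact: congruent_circles.
- move=> C /(minimizer_circle hk hA0 hA1)[C1 [P [n [sP n0 n2 nr ->]]]]; split => //.
  have [r0 rpi] := AS_circle_radius hk n0 n2.
  rewrite -nr; split => //; exists P => //; exact: circle_distE.
Qed.
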